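(* Let $p\in(3,\infty)$, $L>0$, and let $k$ be a knot class. Let $\Gamma\in C_{L,k}(\mathbb{R}/L\mathbb{Z},\mathbb{R}^3)$ be parametrized by arclength with $$\mathscr{M}_p(\Gamma)=\inf_{C_{L,k}(\mathbb{R}/L\mathbb{Z},\mathbb{R}^3)}\mathscr{M}_p .$$ Then $\Gamma\in W^{2-\frac2p,p}(\mathbb{R}/L\mathbb{Z},\mathbb{R}^3)$, $\Gamma$ is a minimizer of $\mathscr{E}_p$ in $C_k(\mathbb{R}/L\mathbb{Z},\mathbb{R}^3)$, and $\Gamma$ is a stationary point of $\mathscr{E}_p$, i.e. $\delta\mathscr{E}_p(\Gamma,\Phi)=0$ for all $\Phi\in W^{2-\frac2p,p}(\mathbb{R}/L\mathbb{Z},\mathbb{R}^3)$.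
   Context: Functions on $\mathbb{R}/L\mathbb{Z}$ are $L$-periodic functions on $\mathbb{R}$. Two embeddings $f_0,f_1$ of the circle into $\mathbb{R}^3$ are ambient isotopic if there is a level-preserving embedding $H:\mathbb{R}^3\times[0,1]\to\mathbb{R}^3\times[0,1]$, $H(y,t)=(h_t(y),t)$, with $h_0=\mathrm{id}$ and $f_1=h_1\circ f_0$; a knot class $k$ is an ambient isotopy class, and it is assumed that $k$ contains a smooth representative. $\mathscr{L}(\gamma)$ denotes the length of a rectifiable curve $\gamma$, and $$C_{L,k}(\mathbb{R}/L\mathbb{Z},\mathbb{R}^3):=\{\gamma\in C^0(\mathbb{R}/L\mathbb{Z},\mathbb{R}^3):\mathscr{L}(\gamma)=L,\ \gamma\text{ ambient isotopic to }k\},$$ $$C_{k}(\mathbb{R}/L\mathbb{Z},\mathbb{R}^3):=\{\gamma\in C^0(\mathbb{R}/L\mathbb{Z},\mathbb{R}^3):\mathscr{L}(\gamma)<\infty,\ \gamma\text{ ambient isotopic to }k\}.$$ For a simple closed curve $\gamma$ put $$c_\gamma(s,t,\sigma):=\frac{2\,|(\gamma(t)-\gamma(s))\wedge(\gamma(\sigma)-\gamma(s))|}{|\gamma(t)-\gamma(s)|\,|\gamma(s)-\gamma(\sigma)|\,|\gamma(\sigma)-\gamma(t)|}$$ ($\wedge$ the cross product; defined for parameters with pairwise distinct images). For an absolutely continuous, simple, regular ($|\gamma'|\ge C>0$ a.e.) closed curve on $\mathbb{R}/L\mathbb{Z}$, $$\mathscr{M}_p(\gamma):=\int_0^{L}\int_0^{L}\int_0^{L}c_\gamma(s,t,\sigma)^p\,|\gamma'(s)|\,|\gamma'(t)|\,|\gamma'(\sigma)|\,d\sigma\,dt\,ds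 ,$$ which is invariant under reparametrization; for a general rectifiable simple closed curve, $\mathscr{M}_p(\gamma)$ means the value for its arclength parametrization. The scale-invariant energy is $\mathscr{E}_p(\gamma):=\mathscr{M}_p(\gamma)^{1/p}\mathscr{L}(\gamma)^{(p-3)/p}$. The first variation is $\delta\mathscr{E}_p(\gamma,\Phi):=\frac{d}{d\tau}\big|_{\tau=0}\mathscr{E}_p(\gamma+\tau\Phi)$. $W^{2-\frac2p,p}(\mathbb{R}/L\mathbb{Z},\mathbb{R}^3)$ consists of all $\gamma\in W^{1,p}(\mathbb{R}/L\mathbb{Z},\mathbb{R}^3)$ with $\int_0^{L}\int_{-L/2}^{L/2}\frac{|\gamma'(x+w)-\gamma'(x)|^p}{|w|^{p-1}}\,dw\,dx<\infty$. *)

(* Defs.v *)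
From HB Require Import structures.
From mathcomp Require Import all_boot all_order all_algebra.
From mathcomp Require Import all_classical all_reals all_analysis.

Set Implicit Arguments.
Unset Strict Implicit.
Unset Printing Implicit Defensive.

Import Order.TTheory GRing.Theory Num.Theory.
Import numFieldNormedType.Exports.

Local Open Scope classical_set_scope.
Local Open Scope ring_scope.

(* Curves on R/LZ are represented by L-periodic functions on R. *)
Notation curve R := (R -> 'rV[R]_3).

Section Euclidean.
Context {R : realType}.
Implicit Types u v : 'rV[R]_3.

(* The library norm on matrices is the sup norm, hence this definition. *)
Definition enorm v : R := Num.sqrt (\sum_(i < 3) v ord0 i ^+ 2).

Definition cross u v : 'rV[R]_3 :=
  let a (i : nat) := u ord0 (inord i) in
  let b (i : nat) := v ord0 (inord i) in
  \row_(j < 3) [:: a 1%N * b 2%N - a 2%N * b 1%N;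
                   a 2%N * b 0%N - a 0%N * b 2%N;
                   a 0%N * b 1%N - a 1%N * b 0%N]`_j.

End Euclidean.

Section Curves.
Context {R : realType}.
Implicit Types (L : R) (f g : curve R).

Definition simple_closed_curve L f :=
  [/\ continuous f, periodic f L & {in `[0, L[ &, injective f}].

Definition curve_length (a b : R) f : \bar R :=
  ereal_sup [set (\sum_(0 <= i < size s)
                    enorm (f (nth b (a :: s) i.+1) - f (nth b (a :: s) i)))%:E
            | s in itv_partition a b].

Definition closed_length L f : \bar R := curve_length 0 L f.

Definition by_arclength f :=
  forall a b : R, a <= b -> curve_length a b f = (b - a)%:E.

Definition abs_continuous (a b : R) f :=
  forall e : R, 0 < e -> exists2 d : R, 0 < d &
    forall (n : nat) (u v : 'I_n -> R),
      (forall i, a <= u i /\ u i <= v i /\ v i <= b) ->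
      trivIset setT (fun i => `]u i, v i[%classic) ->
      \sum_(i < n) (v i - u i) < d ->
      \sum_(i < n) enorm (f (v i) - f (u i)) < e.

Definition regular L f :=
  exists2 C : R, 0 < C &
    {ae (@lebesgue_measure R), forall x, x \in `[0, L] -> C <= enorm (derive1 f x)}.

(* On a simple rectifiable closed curve f, the arclength function
   t |-> length of f on [0, t] is an increasing bijection of [0, L] onto
   [0, length of f], so the set below is a singleton. *)
Definition arclength_param L f : curve R :=
  get [set g : curve R | periodic g (fine (closed_length L f)) /\
         forall t, t \in `[0, L] -> g (fine (curve_length 0 t f)) = f t].

End Curves.

Section KnotClasses.
Context {R : realType}.
Implicit Types (L : R) (f : curve R) (k : set (curve R)).

Definition embedding_on (T U : topologicalType) (A : set T) (H : T -> U) :=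
  {within A, continuous H} /\
  exists G : U -> T,
    {within H @` A, continuous G} /\ forall x, A x -> G (H x) = x.

Definition ambient_isotopic (f0 f1 : curve R) :=
  exists h : R -> 'rV[R]_3 -> 'rV[R]_3,
    [/\ @embedding_on ('rV[R]_3 * R)%type ('rV[R]_3 * R)%type
          (setT `*` `[0, 1]) (fun yt => (h yt.2 yt.1, yt.2)),
        h 0 = id & f1 = h 1 \o f0].

Definition knot_class L k :=
  exists2 f0 : curve R, simple_closed_curve L f0 &
    k = [set f : curve R | simple_closed_curve L f /\ ambient_isotopic f0 f].

(* Smooth as an embedding: a smooth injective map with vanishing derivative
   somewhere could still parametrize a wild knot. *)
Definition smooth_embedding L f :=
  [/\ simple_closed_curve L f,
      forall n x, derivable (derive1n n f) x 1 & forall x, derive1 f x != 0].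

Definition CLk L k : set (curve R) :=
  [set f : curve R | [/\ continuous f, periodic f L, closed_length L f = L%:E & k f]].

Definition Ck L k : set (curve R) :=
  [set f : curve R | [/\ continuous f, periodic f L, (closed_length L f < +oo)%E & k f]].

End KnotClasses.

Section Energy.
Context {R : realType}.
Implicit Types (p L : R) (f Phi : curve R).

Notation mu := (@lebesgue_measure R).

(* Vanishes by the convention x / 0 = 0 when two of the points coincide; for a
   simple closed curve this is a null set of parameters. *)
Definition menger_curvature f (s t sigma : R) : R :=
  2 * enorm (cross (f t - f s) (f sigma - f s)) /
  (enorm (f t - f s) * enorm (f s - f sigma) * enorm (f sigma - f t)).

Definition menger_integral p L f : \bar R :=
  (\int[mu]_(s in `[0%R, L]) \int[mu]_(t in `[0%R, L])
   \int[mu]_(sigma in `[0%R, L])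
     ((menger_curvature f s t sigma `^ p) *
      enorm (derive1 f s) * enorm (derive1 f t) * enorm (derive1 f sigma))%R%:E)%E.

(* The integral formula when f itself is absolutely continuous, simple and
   regular; the same integral for the arclength parametrization otherwise. *)
Definition menger_energy p L f : \bar R :=
  if `[< [/\ simple_closed_curve L f, abs_continuous 0 L f & regular L f] >]
  then menger_integral p L f
  else menger_integral p (fine (closed_length L f)) (arclength_param L f).

Definition scaled_energy p L f : \bar R :=
  (poweR (menger_energy p L f) p^-1 *
   poweR (closed_length L f) ((p - 3) / p))%E.

(* Finiteness near 0 is part of the notion, as [fine] sends +oo to 0. *)
Definition first_variation p L f Phi (v : R) :=
  let E tau := scaled_energy p L (fun x => f x + tau *: Phi x) in
  (\forall tau \near (0 : R), E tau \is a fin_num) /\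
  is_derive (0 : R) 1 (fun tau : R => fine (E tau)) v.

End Energy.

Section Sobolev.
Context {R : realType}.
Implicit Types (p L : R) (f g : curve R).

Notation mu := (@lebesgue_measure R).

Definition Lp_periodic p L f :=
  [/\ periodic f L,
      forall i, measurable_fun setT (fun x => f x ord0 i) &
      (\int[mu]_(x in `[0%R, L]) (enorm (f x) `^ p)%R%:E < +oo)%E].

Definition weak_derivative L f g :=
  forall phi : R -> R, periodic phi L ->
    (forall n x, derivable (derive1n n phi) x 1) ->
    forall i, \int[mu]_(x in `[0, L]) (f x ord0 i * derive1 phi x) =
              - \int[mu]_(x in `[0, L]) (g x ord0 i * phi x).

Definition W1p_with_derivative p L f g :=
  [/\ Lp_periodic p L f, Lp_periodic p L g & weak_derivative L f g].

(* The space W^(2 - 2/p, p)(R/LZ, R^3); g is the weak derivative f'. *)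
Definition sobolev_slobodeckij p L f :=
  exists2 g : curve R, W1p_with_derivative p L f g &
    (\int[mu]_(x in `[0%R, L]) \int[mu]_(w in `[(- (L / 2))%R, (L / 2)%R])
       ((enorm (g (x + w) - g x) `^ p) / (`|w| `^ (p - 1)))%R%:E < +oo)%E.

End Sobolev.

Section Variational.
Context {R : realType}.
Implicit Types (p L : R) (f Phi : curve R) (C : set (curve R)).

Definition minimizer (J : curve R -> \bar R) C f :=
  C f /\ forall g, C g -> (J f <= J g)%E.

(* Elements of the Sobolev space are classes modulo null sets; f + tau * Phi is
   the curve obtained from the continuous representative Phi of such a class. *)
Definition stationary p L f :=
  forall Phi, continuous Phi -> sobolev_slobodeckij p L Phi ->
    first_variation p L f Phi 0.

End Variational.

(* Main.v *)
(** Regularity.  Finite energy with [p > 3] forces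
    [|(w - x) ^ (w' - x)| <= C |w - x| |w' - x| r ^ kappa] for points of the
    curve within distance [r], with [kappa = (p - 3) / (p + 3)].  Hence chord
    directions converge and the curve is C^1 with Hölder tangent.  The unit chord
    directions e_u at [Gamma s] satisfy |e_u - e_v| <= c(s, s + u, s + v) |u - v|,
    and a Hardy inequality turns this into a bound of the seminorm by the energy.

    Stationarity.  A field [Phi] in the Sobolev-Slobodeckij class is C^1, by
    du Bois-Reymond and Morrey.  So [Gamma + tau Phi] stays embedded, and in the
    knot class: with Psi a Lipschitz extension of [Phi \o Gamma^-1], the isotopy is
    y |-> y + t tau Psi(y).  The second difference in [tau] of the energy density
    is at most [tau ^ 2] times an integrable kernel built from the seminorms of
    [Gamma] and [Phi], hence M(tau) + M(-tau) <= 2 M(0) + C tau ^ 2.  The length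
    obeys an analogous bound, and weighted AM-GM carries both over to the energy
    E.  As E(tau), E(-tau) >= E(0), we get |E(tau) - E(0)| <= K tau ^ 2: the
    derivative exists and vanishes, without a formula for it. *)

Require Import Defs.
From HB Require Import structures.
From mathcomp Require Import all_boot all_order all_algebra.
From mathcomp Require Import all_classical all_reals all_analysis.
From mathcomp Require Import measurable_realfun ring lra.

Set Implicit Arguments.
Unset Strict Implicit.
Unset Printing Implicit Defensive.

Import Order.TTheory GRing.Theory Num.Theory.
Import numFieldNormedType.Exports.

Local Open Scope classical_set_scope.
Local Open Scope ring_scope.

(** The exponent [kappa] comes from counting. A triple of diameter [d] with cross product [a] keeps
    curvature of order [a / d ^ 3] while its vertices move by a small multiple of [a / d], so the
    energy is at least a multiple of [(a / d ^ 3) ^ p * (a / d) ^ 3]. This bounds [a] by a multiple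
    of [d ^ (2 + kappa)], with [kappa > 0] because [p > 3]. The Hölder bound must precede the Hardy
    inequality, which absorbs an integral into itself and therefore needs a finite truncation of it.
    The density is singular where vertices merge. The base of a triple is therefore chosen opposite
    to the longest arc: the other two vertices lie on both sides of it, their parameter distance is
    the sum of the two offsets, and a single divided difference of chord quotients carries the whole
    singularity. Perturbed curves have neither unit speed nor length [L]; the homogeneity
    [M (c f) = c ^ (3 - p) M f] lets them compete. The AM-GM weights [1 / p] and [(p - 3) / p] leave
    [2 / p] for a constant term; the ratios in it require [M (Gamma) > 0], since no closed regular
    curve lies on a line. Finiteness of the minimum comes from the smooth representative. *)

Section EuclideanSpace.
Context {R : realType}.
Implicit Types (u v w : 'rV[R]_3) (a : R).

(** Coordinates are addressed by the literals 0, 1, 2, so that [coE] reduces vector identities to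
    [ring] on real numbers. *)
Definition co (i : nat) v : R := v ord0 (inord i).

Definition dot u v : R := \sum_(i < 3) u ord0 i * v ord0 i.

Lemma sum3E (F : 'I_3 -> R) :
  \sum_(i < 3) F i = F (inord 0) + F (inord 1) + F (inord 2).
Proof.
rewrite !big_ord_recl big_ord0 addr0 addrA.
by congr (F _ + F _ + F _); apply: val_inj => /=; rewrite ?inordK.
Qed.

Lemma dotE u v : dot u v = co 0 u * co 0 v + co 1 u * co 1 v + co 2 u * co 2 v.
Proof. exact: sum3E. Qed.

Lemma enormE v : enorm v = Num.sqrt (dot v v).
Proof. by congr Num.sqrt; apply: eq_bigr => i _; rewrite expr2. Qed.

Lemma eq_vec3 u v :
  co 0 u = co 0 v -> co 1 u = co 1 v -> co 2 u = co 2 v -> u = v.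
Proof.
move=> e0 e1 e2; apply/rowP => j.
case: j => -[|[|[|//]]] hj.
- by move: e0; rewrite /co; have -> // : inord 0 = Ordinal hj by apply: val_inj; rewrite /= inordK.
- by move: e1; rewrite /co; have -> // : inord 1 = Ordinal hj by apply: val_inj; rewrite /= inordK.
- by move: e2; rewrite /co; have -> // : inord 2 = Ordinal hj by apply: val_inj; rewrite /= inordK.
Qed.

Lemma coD i u v : co i (u + v) = co i u + co i v. Proof. by rewrite /co mxE. Qed.
Lemma coN i u : co i (- u) = - co i u. Proof. by rewrite /co mxE. Qed.
Lemma coB i u v : co i (u - v) = co i u - co i v. Proof. by rewrite coD coN. Qed.
Lemma coZ i a u : co i (a *: u) = a * co i u. Proof. by rewrite /co mxE. Qed.
Lemma co0 i : co i 0 = 0. Proof. by rewrite /co mxE. Qed.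

Lemma co_cross0 u v : co 0 (cross u v) = co 1 u * co 2 v - co 2 u * co 1 v.
Proof. by rewrite /co mxE inordK. Qed.
Lemma co_cross1 u v : co 1 (cross u v) = co 2 u * co 0 v - co 0 u * co 2 v.
Proof. by rewrite /co mxE inordK. Qed.
Lemma co_cross2 u v : co 2 (cross u v) = co 0 u * co 1 v - co 1 u * co 0 v.
Proof. by rewrite /co mxE inordK. Qed.

Definition coE := (dotE, co_cross0, co_cross1, co_cross2, coD, coN, coZ, co0).

Lemma dotDl u v w : dot (u + v) w = dot u w + dot v w. Proof. by rewrite !coE; ring. Qed.
Lemma dotNl u v : dot (- u) v = - dot u v. Proof. by rewrite !coE; ring. Qed.
Lemma dotZl a u v : dot (a *: u) v = a * dot u v. Proof. by rewrite !coE; ring. Qed.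
Lemma dotZr a u v : dot v (a *: u) = a * dot v u. Proof. by rewrite !coE; ring. Qed.
Lemma dot0l u : dot 0 u = 0. Proof. by rewrite !coE; ring. Qed.

Lemma dotvv_ge0 v : 0 <= dot v v.
Proof. by rewrite dotE -!expr2 !addr_ge0 ?sqr_ge0. Qed.

Lemma enorm_ge0 v : 0 <= enorm v. Proof. exact: sqrtr_ge0. Qed.

Lemma sqr_enorm v : enorm v ^+ 2 = dot v v.
Proof. by rewrite enormE sqr_sqrtr ?dotvv_ge0. Qed.

Lemma enorm0 : enorm 0 = 0 :> R.
Proof. by rewrite enormE dot0l sqrtr0. Qed.

Lemma enorm_eq0 v : (enorm v == 0) = (v == 0).
Proof.
apply/idP/eqP => [/eqP e|->]; last by rewrite enorm0.
have: dot v v = 0 by rewrite -sqr_enorm e expr0n.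
rewrite dotE => h; apply: eq_vec3; rewrite co0; nra.
Qed.

Lemma enorm_gt0 v : (0 < enorm v) = (v != 0).
Proof. by rewrite lt_neqAle eq_sym enorm_eq0 enorm_ge0 andbT. Qed.

Lemma enormZ a v : enorm (a *: v) = `|a| * enorm v.
Proof.
by rewrite !enormE dotZl dotZr mulrA -expr2 sqrtrM ?sqr_ge0// sqrtr_sqr.
Qed.

Lemma enormN v : enorm (- v) = enorm v.
Proof. by rewrite -scaleN1r enormZ normrN normr1 mul1r. Qed.

Lemma enormBC u v : enorm (u - v) = enorm (v - u).
Proof. by rewrite -enormN opprB. Qed.

Lemma lagrange u v : enorm (cross u v) ^+ 2 = enorm u ^+ 2 * enorm v ^+ 2 - dot u v ^+ 2.
Proof. by rewrite !sqr_enorm !coE; ring. Qed.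

Lemma enorm_cross_le u v : enorm (cross u v) <= enorm u * enorm v.
Proof.
rewrite -(@ler_pXn2r _ 2)// ?nnegrE ?mulr_ge0 ?enorm_ge0//.
by rewrite lagrange exprMn gerBl sqr_ge0.
Qed.

Lemma ler_norm_dot u v : `|dot u v| <= enorm u * enorm v.
Proof.
rewrite -(@ler_pXn2r _ 2)// ?nnegrE ?mulr_ge0 ?enorm_ge0//.
by rewrite real_normK ?num_real// exprMn -subr_ge0 -lagrange sqr_ge0.
Qed.

Lemma dot_le u v : dot u v <= enorm u * enorm v.
Proof. exact: le_trans (ler_norm _) (ler_norm_dot u v). Qed.

Lemma sqr_enormD u v :
  enorm (u + v) ^+ 2 = enorm u ^+ 2 + 2 * dot u v + enorm v ^+ 2.
Proof. by rewrite !sqr_enorm !coE; ring. Qed.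

Lemma sqr_enormB u v :
  enorm (u - v) ^+ 2 = enorm u ^+ 2 - 2 * dot u v + enorm v ^+ 2.
Proof. by rewrite !sqr_enorm !coE; ring. Qed.

Lemma ler_enormD u v : enorm (u + v) <= enorm u + enorm v.
Proof.
rewrite -(@ler_pXn2r _ 2)// ?nnegrE ?addr_ge0 ?enorm_ge0//.
rewrite sqr_enormD sqrrD; have := dot_le u v; lra.
Qed.

Lemma ler_enormB u v : enorm (u - v) <= enorm u + enorm v.
Proof. by rewrite -(enormN v) ler_enormD. Qed.

Lemma enorm_triangle u v w : enorm (u - w) <= enorm (u - v) + enorm (v - w).
Proof. by rewrite (le_trans _ (ler_enormD _ _))// addrA subrK. Qed.

Lemma lerB_enorm u v : enorm u - enorm v <= enorm (u - v).
Proof. by rewrite lerBlDr (le_trans _ (ler_enormD _ _))// subrK. Qed.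

Lemma ler_norm_co i v : (i < 3)%N -> `|co i v| <= enorm v.
Proof.
move=> i3; rewrite enormE -sqrtr_sqr ler_sqrt ?dotvv_ge0// dotE -!expr2.
have := sqr_ge0 (co 0 v); have := sqr_ge0 (co 1 v); have := sqr_ge0 (co 2 v).
by case: i i3 => [|[|[|]]]// _; lra.
Qed.

Lemma enorm_le_sum v : enorm v <= `|co 0 v| + `|co 1 v| + `|co 2 v|.
Proof.
rewrite -(@ler_pXn2r _ 2)// ?nnegrE ?addr_ge0 ?enorm_ge0//.
rewrite sqr_enorm dotE -!expr2 -!(real_normK (num_real (co _ v))).
have := normr_ge0 (co 0 v); have := normr_ge0 (co 1 v); have := normr_ge0 (co 2 v).
nra.
Qed.

(** The topology of ['rV[R]_3] is that of the sup norm; this bound and [enorm_le_normr] transfer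
    limits to [enorm]. *)
Lemma normr_le_enorm v : `|v| <= enorm v.
Proof.
rewrite [leLHS]/Num.Def.normr/= mx_normrE (bigmax_le _ (enorm_ge0 v))//= => -[i j] _ /=.
by rewrite (ord1 i) (_ : v ord0 j = co j v) ?ler_norm_co// /co inord_val.
Qed.

Lemma enorm_le_normr v : enorm v <= 3 * `|v|.
Proof.
have h i : `|co i v| <= `|v|.
  rewrite [leRHS]/Num.Def.normr/= mx_normrE.
  by apply/bigmax_geP; right => /=; exists (ord0, inord i).
have := h 0%N; have := h 1%N; have := h 2%N; have := enorm_le_sum v; lra.
Qed.

Lemma crossDl u v w : cross (u + v) w = cross u w + cross v w.
Proof. by apply: eq_vec3; rewrite !coE; ring. Qed.
Lemma crossNl u v : cross (- u) v = - cross u v.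
Proof. by apply: eq_vec3; rewrite !coE; ring. Qed.
Lemma crossNr u v : cross u (- v) = - cross u v.
Proof. by apply: eq_vec3; rewrite !coE; ring. Qed.
Lemma crossBl u v w : cross (u - v) w = cross u w - cross v w.
Proof. by rewrite crossDl crossNl. Qed.
Lemma crossZl a u v : cross (a *: u) v = a *: cross u v.
Proof. by apply: eq_vec3; rewrite !coE; ring. Qed.
Lemma crossZr a u v : cross u (a *: v) = a *: cross u v.
Proof. by apply: eq_vec3; rewrite !coE; ring. Qed.
Lemma crossC u v : cross u v = - cross v u.
Proof. by apply: eq_vec3; rewrite !coE; ring. Qed.
Lemma crossvv u : cross u u = 0.
Proof. by apply: eq_vec3; rewrite !coE; ring. Qed.
Lemma cross0l u : cross 0 u = 0.
Proof. by apply: eq_vec3; rewrite !coE; ring. Qed.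
Lemma cross0r u : cross u 0 = 0.
Proof. by apply: eq_vec3; rewrite !coE; ring. Qed.
Lemma enorm_crossC u v : enorm (cross u v) = enorm (cross v u).
Proof. by rewrite crossC enormN. Qed.

(* Subadditivity of the sine of the angle between lines, split along and across [v]:
   v.(u x w) v = (v x u) x (v x w) and v x (u x w) = (v.w) u - (v.u) w. *)
Lemma enorm_cross_triangle u v w :
  enorm (cross u w) * enorm v <=
  enorm (cross u v) * enorm w + enorm u * enorm (cross v w).
Proof.
have [->|v0] := eqVneq v 0.
  by rewrite enorm0 mulr0 addr_ge0// mulr_ge0// enorm_ge0.
set n := enorm v; have n0 : 0 < n by rewrite enorm_gt0.
set su := enorm (cross u v); set sw := enorm (cross v w).
rewrite -(@ler_pXn2r _ 2)// ?nnegrE ?addr_ge0 ?mulr_ge0 ?enorm_ge0//.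
pose k := dot (cross v u) (cross v w).
have k1 : `|k| <= su * sw by rewrite /su enorm_crossC ler_norm_dot.
have n20 : 0 < n ^+ 2 by rewrite exprn_gt0.
rewrite -(ler_pM2l n20).
have su2 : su ^+ 2 = enorm u ^+ 2 * n ^+ 2 - dot u v ^+ 2 by exact: lagrange.
have sw2 : sw ^+ 2 = n ^+ 2 * enorm w ^+ 2 - dot v w ^+ 2 by exact: lagrange.
pose a := dot u v; pose b := dot v w.
have E : n ^+ 2 * (enorm (cross u w) * n) ^+ 2 =
   n ^+ 2 * ((su * enorm w) ^+ 2 + (enorm u * sw) ^+ 2) - 2 * a * b * k
   - su ^+ 2 * sw ^+ 2 - k ^+ 2.
  by rewrite /k !exprMn /su /sw /n !sqr_enorm /a /b !coE; ring.
rewrite E sqrrD.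
have ha : `|a| <= enorm u * n by exact: ler_norm_dot.
have hb : `|b| <= n * enorm w by exact: ler_norm_dot.
have hab : `|a| * `|b| <= (enorm u * n) * (n * enorm w) by apply: ler_pM.
have : - (a * b * k) <= (`|a| * `|b|) * `|k|.
  by rewrite -!normrM -normrN ler_norm.
have : (`|a| * `|b|) * `|k| <= (enorm u * n * (n * enorm w)) * (su * sw).
  by apply: ler_pM; rewrite ?mulr_ge0.
have := sqr_ge0 (su * sw); have := sqr_ge0 k; rewrite exprMn.
set X := enorm u * n * (n * enorm w) * (su * sw).
have -> : n ^+ 2 * ((su * enorm w) ^+ 2 + su * enorm w * (enorm u * sw) *+ 2 + (enorm u * sw) ^+ 2) =
  n ^+ 2 * ((su * enorm w) ^+ 2 + (enorm u * sw) ^+ 2) + 2 * X by rewrite /X; ring.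
lra.
Qed.

End EuclideanSpace.

(** * Integrals of arbitrary nonnegative functions; affine substitutions *)

Section IntegralToolkit.
Local Open Scope ereal_scope.

(** The integral of a nonnegative function is a supremum over the simple functions below it, which
    makes monotonicity independent of measurability. Integrands built from [derive1] of a general
    curve are compared in this way. *)
Lemma ge0_le_integral_any d (T : measurableType d) (R : realType)
    (m : {measure set T -> \bar R}) (D : set T) (f g : T -> \bar R) :
  (forall x, D x -> 0 <= f x) -> (forall x, D x -> f x <= g x) ->
  \int[m]_(x in D) f x <= \int[m]_(x in D) g x.
Proof.
move=> f0 fg; have g0 x : D x -> 0 <= g x.
  by move=> Dx; rewrite (le_trans (f0 _ Dx)) ?fg.
rewrite !ge0_integralE//; apply: ge_ereal_sup => _ [h /= hf <-].
apply: ereal_sup_ubound; exists h => //= x.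
by rewrite (le_trans (hf x))// lee_restrict.
Qed.

Import HBNNSimple.

(** An upper bound is tested on simple minorants only; this carries identities from measurable
    functions over to arbitrary nonnegative ones. *)
Lemma ge0_integral_le_ub d (T : measurableType d) (R : realType)
    (m : {measure set T -> \bar R}) (f : T -> \bar R) (B : \bar R) :
  (forall x, 0 <= f x) ->
  (forall h : {nnsfun T >-> R}, (forall x, (h x)%:E <= f x) ->
     \int[m]_x (h x)%:E <= B) ->
  \int[m]_x f x <= B.
Proof.
move=> f0 H; rewrite ge0_integralTE//; apply: ge_ereal_sup => _ [h /= hf <-].
by rewrite -integralT_nnsfun; exact: H.
Qed.

(** Dividing a simple minorant of [a * g] by [a] gives a minorant of [g], hence one inequality; the
    other one is the same inequality for the factor [k^-1]. *)
Lemma ge0_integralZl_any d (T : measurableType d) (R : realType)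
    (m : {measure set T -> \bar R}) (D : set T) (f : T -> \bar R) (k : R) :
  (0 < k)%R -> (forall x, D x -> 0 <= f x) ->
  \int[m]_(x in D) (k%:E * f x) = k%:E * \int[m]_(x in D) f x.
Proof.
have Z (g : T -> \bar R) (a : R) : (0 < a)%R -> (forall x, 0 <= g x) ->
    \int[m]_x (a%:E * g x) <= a%:E * \int[m]_x g x.
  move=> a0 g0; apply: ge0_integral_le_ub => [x|h hg].
    by rewrite mule_ge0// lee_fin ltW.
  have E : \int[m]_x (h x)%:E = a%:E * \int[m]_x (a^-1 * h x)%:E.
    rewrite -ge0_integralZl//=.
    - by apply: eq_integral => x _; rewrite -EFinM mulrA divff ?gt_eqF// mul1r.
    - by apply/measurable_EFinP; exact: measurable_funM.
    - by move=> x _; rewrite lee_fin mulr_ge0// invr_ge0 ltW.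
    - by rewrite lee_fin ltW.
  rewrite E lee_pmul2l//.
  apply: ge0_le_integral_any => x _.
    by rewrite lee_fin mulr_ge0// invr_ge0 ltW.
  have := hg x; case: (g x) (g0 x) => [r|_ _|//]; last by rewrite leey.
  rewrite !lee_fin => r0 hr.
  by rewrite mulrC ler_pdivrMr// mulrC.
move=> k0 f0; rewrite [LHS]integral_mkcond [in RHS]integral_mkcond erestrict_scale.
have g0 x : 0 <= (f \_ D) x by apply: erestrict_ge0.
apply/eqP; rewrite eq_le; apply/andP; split; first exact: Z.
have := Z (fun x => k%:E * (f \_ D) x) k^-1%R.
rewrite invr_gt0 => /(_ k0) /(_ _)/wrap[x|].
  by rewrite mule_ge0// lee_fin ltW.
under eq_integral do rewrite muleA -EFinM mulVf ?gt_eqF// mul1e.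
rewrite -(@lee_pmul2l _ k%:E)//=.
by rewrite muleA -EFinM divff ?gt_eqF// mul1e.
Qed.

Section affine.
Context {R : realType}.
Notation mu := (@lebesgue_measure R).
Local Open Scope ring_scope.

Lemma measurable_affine (c d : R) : measurable_fun setT (fun x : R => c * x + d).
Proof. by apply: measurable_funD => //; exact: measurable_funM. Qed.

Definition affine_image (c d : R) : {measure set (measurableTypeR R) -> \bar R} :=
  @measure_function_pushforward__canonical__measure_function_Measure
    _ _ (measurableTypeR R) (measurableTypeR R) R mu _ (measurable_affine c d).

(** The image of [mu] under the affine map, multiplied by [|c|], agrees with [mu] on half-open
    intervals, and this determines the measure. *)
Lemma lebesgue_measure_affine (c d : R) (A : set R) : c != 0 -> measurable A ->
  mu ((fun x => c * x + d) @^-1` A) = (`|c|^-1%:E * mu A)%E.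
Proof.
move=> c0 mA; have nc0 : 0 < `|c| by rewrite normr_gt0.
pose m : {measure set (measurableTypeR R) -> \bar R} :=
  mscale (NngNum (normr_ge0 c)) (affine_image c d).
have E X : ocitv X -> mu X = m X.
  move=> -[[a b] /= ab <-]; rewrite /m /= /mscale/= /pushforward/=.
  rewrite lebesgue_measure_itv/=.
  have [c1|c1] := ltP 0 c.
  - rewrite (_ : _ @^-1` _ = `]((a - d) / c), ((b - d) / c)]%classic); last first.
      apply/seteqP; split => x /=; rewrite !in_itv/= ltr_pdivrMr// ler_pdivlMr// mulrC ltrBlDr lerBrDr//.
    rewrite lebesgue_measure_itv/= !lte_fin ltr_pM2r ?invr_gt0// ltrD2r.
    case: ifP => _; last by rewrite mule0.
    by rewrite -!EFinB -EFinM gtr0_norm//; congr EFin; field; rewrite gt_eqF.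
  (* A negative slope reverses the interval, whose closed end is now on the left; its length is
     computed in the same way. *)
  - have {c1}c1 : c < 0 by rewrite lt_neqAle c0.
    rewrite (_ : _ @^-1` _ = `[((b - d) / c), ((a - d) / c)[%classic); last first.
      apply/seteqP; split => x /=; rewrite !in_itv/= ltr_ndivlMr// ler_ndivrMr// mulrC ltrBlDr lerBrDr// andbC//.
    rewrite lebesgue_measure_itv/= !lte_fin ltr_nM2r ?invr_lt0// ltrD2r.
    case: ifP => _; last by rewrite mule0.
    by rewrite -!EFinB -EFinM ltr0_norm//; congr EFin; field; rewrite lt_eqF.
rewrite [in RHS](lebesgue_measure_unique E)//.
by rewrite /m /= /mscale/= /pushforward/= muleA -EFinM mulVf ?mul1e// gt_eqF.
Qed.

(** For measurable functions this is integration against an image measure. A simple minorant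
    composed with the inverse map gives one inequality for all functions, and the inverse
    substitution gives the other. *)
Lemma ge0_integral_affine (f : R -> \bar R) (c d : R) : c != 0 ->
  (forall x, 0 <= f x)%E ->
  (\int[mu]_x f (c * x + d)%R = `|c|^-1%:E * \int[mu]_x f x)%E.
Proof.
have M (g : R -> \bar R) (a b : R) : a != 0 -> measurable_fun setT g ->
    (forall x, 0 <= g x)%E ->
    (\int[mu]_x g (a * x + b)%R = `|a|^-1%:E * \int[mu]_x g x)%E.
  move=> a0 mg g0.
  have := @ge0_integral_pushforward _ _ (measurableTypeR R) (measurableTypeR R) R
    (fun x => a * x + b) (measurable_affine a b) mu setT g
    measurableT mg (fun y _ => g0 y).
  rewrite preimage_setT => <-.
  have na0 : 0 <= `|a|^-1 by rewrite invr_ge0.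
  rewrite -(@ge0_integral_mscale _ _ R mu setT measurableT (NngNum na0))//.
  apply: eq_measure_integral; first exact: measurable_affine.
  by move=> mphi A mA _; exact: lebesgue_measure_affine.
have Z (g : R -> \bar R) (a b : R) : a != 0 -> (forall x, 0 <= g x)%E ->
    (\int[mu]_x g (a * x + b)%R <= `|a|^-1%:E * \int[mu]_x g x)%E.
  move=> a0 g0; apply: ge0_integral_le_ub => // h hg.
  have na : 0 < `|a| by rewrite normr_gt0.
  have na0 : a^-1 != 0 by rewrite invr_eq0.
  have mh : measurable_fun setT (fun x => (h x)%:E) by apply/measurable_EFinP.
  have := M (fun x => (h x)%:E) a^-1 (- b / a) na0 mh.
  move/(_ (fun x => ltac:(by rewrite lee_fin))).
  rewrite normfV invrK => Eh.
  have -> : (\int[mu]_x (h x)%:E = `|a|^-1%:E * (`|a|%:E * \int[mu]_x (h x)%:E))%E.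
    by rewrite muleA -EFinM mulVf ?mul1e// gt_eqF.
  rewrite lee_pmul2l ?lte_fin ?invr_gt0//.
  rewrite -Eh; apply: ge0_le_integral_any => x _; first by rewrite lee_fin.
  rewrite (le_trans (hg _))// (_ : a * _ + b = x)//.
  by field.
move=> c0 f0; apply/eqP; rewrite eq_le Z//=.
have nc : 0 < `|c| by rewrite normr_gt0.
have c10 : c^-1 != 0 by rewrite invr_eq0.
have := Z (fun x => f (c * x + d)) c^-1 (- d / c) c10 (fun x => f0 _).
rewrite normfV invrK -(@lee_pmul2l _ `|c|^-1%:E) ?lte_fin ?invr_gt0//.
rewrite muleA -EFinM mulVf ?gt_eqF// mul1e.
have E x : c * (c^-1 * x + - d / c) + d = x by field.
by under eq_integral do rewrite E.
Qed.

End affine.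
End IntegralToolkit.

(** * Measurability and continuity of vector-valued maps *)

Section Measurability.
Context {R : realType}.
Notation mu := (@lebesgue_measure R).

Lemma measurable_fun_inv : measurable_fun setT (fun x : R => x^-1).
Proof.
have -> : (fun x : R => x^-1) = (fun x : R => if x == 0 then 0 else x^-1).
  by apply/funext => x; case: eqP => // ->; rewrite invr0.
apply: measurable_fun_if => //.
- by apply: measurable_fun_eqr.
- rewrite setTI; apply: open_continuous_measurable_fun.
    rewrite (_ : _ @^-1` _ = ~` [set 0]); last first.
      by apply/seteqP; split => x /=; [move=> /negbT/eqP|move=> /eqP/negbTE].
    exact/closed_openC/closed_eq.
  move=> x; rewrite inE /= => /negbT x0; exact: inv_continuous.
Qed.

Context d (T : measurableType d).
Implicit Types (f g : T -> 'rV[R]_3) (a b : T -> R).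

(** Stated on coordinates, so that only real-valued measurable functions occur. *)
Definition mvec f := forall i : nat, (i < 3)%N -> measurable_fun setT (fun z => co i (f z)).

Lemma mvec_comp (f : R -> 'rV[R]_3) a : (forall i : nat, (i < 3)%N -> measurable_fun setT (fun z => co i (f z))) ->
  measurable_fun setT a -> mvec (fun z => f (a z)).
Proof.
move=> mf ma i i3; exact: (measurableT_comp (mf i i3) ma).
Qed.

Lemma mvecD f g : mvec f -> mvec g -> mvec (fun z => f z + g z).
Proof.
move=> mf mg i i3; under eq_fun do rewrite coD.
by apply: measurable_funD; [exact: mf|exact: mg].
Qed.

Lemma mvecN f : mvec f -> mvec (fun z => - f z).
Proof.
move=> mf i i3; under eq_fun do rewrite coN.
by apply: measurableT_comp; [|exact: mf].
Qed.

Lemma mvecB f g : mvec f -> mvec g -> mvec (fun z => f z - g z).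
Proof. by move=> mf mg; apply: mvecD => //; exact: mvecN. Qed.

Lemma mvecZ a f : measurable_fun setT a -> mvec f -> mvec (fun z => a z *: f z).
Proof.
move=> ma mf i i3; under eq_fun do rewrite coZ.
by apply: measurable_funM => //; exact: mf.
Qed.

Lemma mvec_cross f g : mvec f -> mvec g -> mvec (fun z => cross (f z) (g z)).
Proof.
move=> mf mg [|[|[|//]]] _;
  [under eq_fun do rewrite co_cross0|under eq_fun do rewrite co_cross1|
   under eq_fun do rewrite co_cross2];
  by apply: measurable_funB; apply: measurable_funM; (exact: mf || exact: mg).
Qed.

Lemma measurable_dot f g : mvec f -> mvec g -> measurable_fun setT (fun z => dot (f z) (g z)).
Proof.
move=> mf mg; under eq_fun do rewrite dotE.
by apply: measurable_funD; [apply: measurable_funD|]; apply: measurable_funM;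
  (exact: mf || exact: mg).
Qed.

Lemma measurable_enorm f : mvec f -> measurable_fun setT (fun z => enorm (f z)).
Proof.
move=> mf; under eq_fun do rewrite enormE.
apply: (@measurableT_comp _ _ _ _ _ _ (@Num.sqrt R)); last exact: measurable_dot.
exact: (continuous_measurable_fun (@sqrt_continuous R)).
Qed.

Lemma measurable_funV a : measurable_fun setT a -> measurable_fun setT (fun z => (a z)^-1).
Proof. by move=> ma; exact: (measurableT_comp measurable_fun_inv ma). Qed.

Lemma measurable_fun_powR a (p : R) : measurable_fun setT a -> measurable_fun setT (fun z => a z `^ p).
Proof. by move=> ma; exact: (measurableT_comp (measurable_powR p) ma). Qed.

Lemma measurable_norm_fun a : measurable_fun setT a -> measurable_fun setT (fun z => `|a z|).
Proof. by move=> ma; exact: measurableT_comp. Qed.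

End Measurability.

Section VectorContinuity.
Context {R : realType}.
Implicit Types f g : R -> 'rV[R]_3.

Lemma continuous_co (i : nat) : continuous (fun v : 'rV[R]_3 => co i v).
Proof. exact: coord_continuous. Qed.

Lemma continuous_mvec f : continuous f -> mvec f.
Proof.
move=> cf i i3; apply: continuous_measurable_fun => x.
apply: continuous_comp; [exact: cf|exact: continuous_co].
Qed.

Lemma enorm_cvgP (T : Type) (F : set_system T) (FF : Filter F)
    (f : T -> 'rV[R]_3) (l : 'rV[R]_3) :
  f @ F --> l <-> (fun x => enorm (f x - l)) @ F --> (0 : R).
Proof.
split=> [/cvgrPdist_lt h|/cvgr0Pnorm_lt h].
  apply/cvgr0Pnorm_lt => e e0; near=> x.
  rewrite ger0_norm ?enorm_ge0// enormBC (le_lt_trans (enorm_le_normr _))//.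
  rewrite -ltr_pdivlMl//; near: x.
  by apply: h; rewrite mulr_gt0.
apply/cvgrPdist_lt => e e0; near=> x.
rewrite distrC (le_lt_trans (normr_le_enorm _))//.
rewrite -[X in X < _]ger0_norm ?enorm_ge0//; near: x; exact: h.
Unshelve. all: by end_near. Qed.

Lemma continuous_enorm : continuous (@enorm R).
Proof.
move=> v; apply/(@cvgrPdist_lt R R _ (nbhs v) (nbhs_filter v)) => e e0; near=> w.
rewrite (@le_lt_trans _ _ (enorm (v - w)))//.
  rewrite ler_norml lerB_enorm andbT lerNl opprB enormBC; exact: lerB_enorm.
rewrite (le_lt_trans (enorm_le_normr _))// -ltr_pdivlMl//.
near: w; apply: (@cvgr_dist_lt R 'rV[R]_3 _ (nbhs v) (nbhs_filter v) id v) => //.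
by rewrite mulr_gt0.
Unshelve. all: by end_near. Qed.

End VectorContinuity.

(** * Exchange of integrals, periodicity, integrals over intervals *)

Section Tonelli.
Context {R : realType}.
Notation mu := (@lebesgue_measure R).
Local Open Scope ereal_scope.

Lemma measurable_fun_section_integral d (T : measurableType d) (D : set R)
    (f : T * R -> \bar R) : measurable D ->
  measurable_fun setT f -> (forall z, 0 <= f z) ->
  measurable_fun setT (fun x => \int[mu]_(y in D) f (x, y)).
Proof.
move=> mD mf f0.
under eq_fun do rewrite integral_mkcond.
pose g := f \_ (setT `*` D).
have mg : measurable_fun setT g.
  apply/(measurable_restrictT _ _).1; first exact: measurableX.
  exact: measurable_funTS.
have g0 z : 0 <= g z by apply: erestrict_ge0.
have := @measurable_fun_fubini_tonelli_F _ _ T (measurableTypeR R) R mu g mg g0.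
congr (measurable_fun _ _); apply/funext => x; apply: eq_integral => y _.
rewrite /g /patch; congr (if _ then _ else _).
by rewrite in_setX in_setT.
Qed.

Lemma tonelli_swap (A B : set R) (f : R * R -> \bar R) :
  measurable A -> measurable B -> measurable_fun setT f -> (forall z, 0 <= f z) ->
  \int[mu]_(x in A) \int[mu]_(y in B) f (x, y) =
  \int[mu]_(y in B) \int[mu]_(x in A) f (x, y).
Proof.
move=> mA mB mf f0.
pose g := f \_ (A `*` B).
have mg : measurable_fun setT g.
  apply/(measurable_restrictT _ _).1; first exact: measurableX.
  exact: measurable_funTS.
have g0 z : 0 <= g z by apply: erestrict_ge0.
have := @fubini_tonelli _ _ (measurableTypeR R) (measurableTypeR R) R mu mu g mg g0.
rewrite /fubini_F /fubini_G.
have -> : (fun x : R => \int[mu]_y g (x, y)) = (fun x => \int[mu]_(y in B) f (x, y)) \_ A.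
  apply/funext => x; rewrite [RHS]/patch; case: ifPn => [xA|xA].
    rewrite [RHS]integral_mkcond; apply: eq_integral => y _; rewrite /g /patch.
    by rewrite in_setX xA.
  rewrite integral0_eq// => y _; rewrite /g /patch ifN// notin_setE/=.
  by move: xA; rewrite notin_setE => xA [].
have -> : (fun y : R => \int[mu]_x g (x, y)) = (fun y => \int[mu]_(x in A) f (x, y)) \_ B.
  apply/funext => y; rewrite [RHS]/patch; case: ifPn => [yB|yB].
    rewrite [RHS]integral_mkcond; apply: eq_integral => x _; rewrite /g /patch.
    by rewrite in_setX yB andbT.
  rewrite integral0_eq// => x _; rewrite /g /patch ifN// notin_setE/=.
  by move: yB; rewrite notin_setE => yB [].
by rewrite -!integral_mkcond.
Qed.

End Tonelli.

Section Periodicity.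
Context {R : realType}.

Lemma periodic_intP (U : Type) (f : R -> U) (L : R) (n : int) x :
  (forall y, f (y + L) = f y) -> f (x + n%:~R * L) = f x.
Proof.
move=> fL; have N (m : nat) y : f (y + m%:R * L) = f y.
  elim: m y => [|m IH] y; first by rewrite mul0r addr0.
  by rewrite mulrSr mulrDl mul1r addrA fL IH.
case: n => m; first exact: N.
by rewrite NegzE mulrNz mulNr -[in RHS](subrK (m.+1%:R * L) x) N.
Qed.

Lemma floor_reduce (L x : R) : 0 < L -> exists n : int, 0 <= x + n%:~R * L < L.
Proof.
move=> L0; exists (- Num.floor (x / L))%R.
have h1 := floor_le_tmp (x / L); have h2 := floorD1_gt (x / L).
rewrite mulrNz mulNr subr_ge0 -ler_pdivlMr// h1/= ltrBlDr -[X in _ < X + _]mul1r -mulrDl.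
by rewrite -ltr_pdivrMr// addrC -(intrD _ _ 1).
Qed.

End Periodicity.

Section IntervalIntegrals.
Context {R : realType}.
Notation mu := (@lebesgue_measure R).
Implicit Types (a b c d L p : R).

Lemma ge0_integral_preimage_affine (D : set R) (f : R -> \bar R) c d : c != 0 ->
  (forall x, 0 <= f x)%E ->
  (\int[mu]_(x in (fun x => c * x + d)%R @^-1` D) f (c * x + d)%R =
   `|c|^-1%:E * \int[mu]_(x in D) f x)%E.
Proof.
move=> c0 f0; rewrite integral_mkcond [in RHS]integral_mkcond.
rewrite -(ge0_integral_affine d c0); last by move=> x; apply: erestrict_ge0.
by apply: eq_integral => x _; rewrite /patch.
Qed.

Lemma ge0_integral_itv_shift (f : R -> \bar R) a b d : (forall x, 0 <= f x)%E ->
  (\int[mu]_(x in `[a, b]) f (x + d)%R = \int[mu]_(x in `[(a + d)%R, (b + d)%R]) f x)%E.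
Proof.
move=> f0; have := @ge0_integral_preimage_affine `[a + d, b + d]%classic f 1 d (oner_neq0 _) f0.
rewrite normr1 invr1 mul1e => <-.
under [RHS]eq_integral do rewrite mul1r.
congr integral; apply/seteqP; split => x /=; rewrite !in_itv/= mul1r !lerD2r//.
Qed.

Lemma ge0_integral_itv_opp (f : R -> \bar R) a b : (forall x, 0 <= f x)%E ->
  (\int[mu]_(x in `[a, b]) f (- x)%R = \int[mu]_(x in `[(- b)%R, (- a)%R]) f x)%E.
Proof.
move=> f0; have N1 : (-1 : R) != 0 by rewrite oppr_eq0 oner_neq0.
have := @ge0_integral_preimage_affine `[- b, - a]%classic f (-1) 0 N1 f0.
rewrite normrN1 invr1 mul1e => <-.
under [RHS]eq_integral do rewrite mulN1r addr0.
congr integral; apply/seteqP; split => x /=; rewrite !in_itv/= mulN1r addr0 !lerN2 andbC//.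
Qed.

Lemma ge0_integral_itv_scale (f : R -> \bar R) a b c : 0 < c -> (forall x, 0 <= f x)%E ->
  (\int[mu]_(x in `[a, b]) f (c * x)%R =
   c^-1%:E * \int[mu]_(x in `[(c * a)%R, (c * b)%R]) f x)%E.
Proof.
move=> c0 f0.
have := @ge0_integral_preimage_affine `[c * a, c * b]%classic f c 0 (lt0r_neq0 c0) f0.
rewrite gtr0_norm// => <-.
under [RHS]eq_integral do rewrite addr0.
congr integral; apply/seteqP; split => x /=; rewrite !in_itv/= addr0 !ler_pM2l//.
Qed.

Lemma ge0_integral_itv_cat (f : R -> \bar R) a b c : a <= b -> b <= c ->
  measurable_fun setT f -> (forall x, 0 <= f x)%E ->
  (\int[mu]_(x in `[a, c]) f x = \int[mu]_(x in `[a, b]) f x + \int[mu]_(x in `[b, c]) f x)%E.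
Proof.
move=> ab bc mf f0.
have mS (D : set R) : measurable_fun D f by exact: measurable_funTS.
rewrite (_ : `[a, c]%classic = `[a, b[%classic `|` `[b, c]%classic); last first.
  apply/seteqP; split => x /=; rewrite !in_itv/=.
    by case: (ltP x b) => xb /andP[ax xc]; [left; rewrite ax|right; rewrite xc].
  by move=> [/andP[-> /ltW xb]|/andP[bx ->]]; rewrite ?(le_trans xb)// ?(le_trans ab).
rewrite ge0_integral_setU//; [by congr (_ + _)%E; rewrite integral_itv_bndo_bndc|exact: mS|].
apply/disj_setPS => x //=; rewrite !in_itv/= => -[/andP[_ xb] /andP[bx _]].
by move: (lt_le_trans xb bx); rewrite ltxx.
Qed.

(** For a starting point in [[0, L]] the window is cut at [L] and its right part moved back by one
    period; a general starting point is reduced modulo [L]. *)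
Lemma ge0_integral_periodic (f : R -> \bar R) L a : 0 < L ->
  measurable_fun setT f -> (forall x, 0 <= f x)%E -> (forall x, f (x + L)%R = f x) ->
  (\int[mu]_(x in `[a, (a + L)%R]) f x = \int[mu]_(x in `[0%R, L]) f x)%E.
Proof.
move=> L0 mf f0 fL.
have P b : 0 <= b <= L ->
    (\int[mu]_(x in `[b, (b + L)%R]) f x = \int[mu]_(x in `[0%R, L]) f x)%E.
  move=> /andP[b0 bL].
  rewrite (@ge0_integral_itv_cat _ b L)//; last by rewrite lerDr.
  rewrite (@ge0_integral_itv_cat _ 0 b L)// addeC; congr (_ + _)%E.
  have := @ge0_integral_itv_shift f 0 b L f0.
  by rewrite add0r => <-; apply: eq_integral.
have [n /andP[n0 nL]] := floor_reduce a L0.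
have := @ge0_integral_itv_shift f a (a + L) (n%:~R * L) f0.
rewrite (addrAC a L) (P (a + n%:~R * L)); last by rewrite n0 ltW.
by move=> <-; apply: eq_integral => x _; rewrite periodic_intP.
Qed.

Lemma continuous_FTC2_is_derive (F f : R -> R) a b : a <= b -> continuous f ->
  (forall x : R, is_derive x (1 : R) F (f x)) ->
  (\int[mu]_(x in `[a, b]) (f x)%:E = (F b - F a)%:E)%E.
Proof.
move=> + cf dF; rewrite le_eqVlt => /orP[/eqP <-|ab].
  by rewrite set_itv1 integral_set1 subrr.
have cF : continuous F.
  by move=> x; apply: differentiable_continuous; apply/derivable1_diffP; have [] := dF x.
rewrite (@continuous_FTC2 _ _ F)//.
- exact: continuous_subspaceT.
- split => [x _||]; first by have [] := dF x.
  + exact/cvg_at_right_filter/cF.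
  + exact/cvg_at_left_filter/cF.
- by move=> x _; rewrite derive1E; have [] := dF x.
Qed.

(** Only the continuous [f] is integrated exactly; [h] enters by comparison with the positive part
    of [f], which is where [0 <= h] is used. *)
Lemma FTC_le_integral (F f : R -> R) (h : R -> \bar R) a b : a <= b -> continuous f ->
  (forall x : R, is_derive x (1 : R) F (f x)) -> (forall x, 0 <= h x)%E ->
  (forall x, (a <= x <= b)%R -> (f x)%:E <= h x)%E ->
  ((F b - F a)%:E <= \int[mu]_(x in `[a, b]) h x)%E.
Proof.
move=> ab cf dF h0 fh; rewrite -(continuous_FTC2_is_derive ab cf dF).
rewrite (@le_trans _ _ (\int[mu]_(x in `[a, b]) (Num.max (f x) 0)%:E)%E)//.
  rewrite integralE.
  have -> : (\int[mu]_(x in `[a, b]) ((fun x => (f x)%:E)^\+ x) =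
             \int[mu]_(x in `[a, b]) (Num.max (f x) 0)%:E)%E.
    by apply: eq_integral => x _; rewrite funeposE EFin_max.
  by rewrite -[leRHS]sube0 leeB// integral_ge0.
apply: ge0_le_integral_any => x /=; rewrite in_itv/= => xab.
  by rewrite lee_fin le_max lexx orbT.
by rewrite EFin_max ge_max fh// h0.
Qed.

Lemma integral_powR_itv a M e : 0 < a -> a <= M -> e + 1 != 0 ->
  (\int[mu]_(v in `[a, M]) (v `^ e)%:E = ((M `^ (e + 1) - a `^ (e + 1)) / (e + 1))%:E)%E.
Proof.
move=> a0 + e1; rewrite le_eqVlt => /orP[/eqP <-|aM].
  by rewrite set_itv1 integral_set1 subrr mul0r.
pose F x := x `^ (e + 1) / (e + 1).
have dF (x : R) : 0 < x -> is_derive x (1 : R) F (x `^ e).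
  move=> x0; have := is_derive1_powR (e + 1) x0; rewrite addrK => d.
  have -> : F = (e + 1)^-1 \*: (fun x => x `^ (e + 1)).
    by apply/funext => y; rewrite /F /= mulrC.
  by apply: is_derive_eq; rewrite scalerA mulVf// scale1r.
have cF (x : R) : 0 < x -> {for x, continuous F}.
  move=> x0; apply: differentiable_continuous; apply/derivable1_diffP.
  by have [] := dF x x0.
have cf (x : R) : 0 < x -> {for x, continuous (fun x => x `^ e)}.
  move=> x0; apply: differentiable_continuous; apply/derivable1_diffP.
  by have [] := is_derive1_powR e x0.
rewrite (@continuous_FTC2 _ _ F)//.
- by rewrite -EFinB /F mulrBl.
- apply: continuous_in_subspaceT => x; rewrite inE/= in_itv/= => /andP[ax _].
  exact/cf/(lt_le_trans a0).
- split => [x||].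
  + by rewrite in_itv/= => /andP[ax _]; have [] := dF x (lt_trans a0 ax).
  + exact/cvg_at_right_filter/cF.
  + exact/cvg_at_left_filter/cF/(lt_trans a0).
- by move=> x; rewrite in_itv/= => /andP[ax _]; rewrite derive1E; have [] := dF x (lt_trans a0 ax).
Qed.

Lemma integral_powRN a M p : 0 < a -> a <= M -> 1 < p ->
  (\int[mu]_(v in `[a, M]) (v `^ (- p))%:E <= (a `^ (1 - p) / (p - 1))%:E)%E.
Proof.
move=> a0 aM p1; rewrite integral_powR_itv//; last by rewrite addrC subr_eq0 lt_eqF.
rewrite lee_fin (addrC _ 1) -[1 - p]opprB invrN mulrN -mulNr ler_pM2r ?invr_gt0 ?subr_gt0//.
by rewrite !opprB lerBlDr lerDl powR_ge0.
Qed.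

End IntervalIntegrals.

(** * Length of curves and the arclength parametrization *)

Section CurveLength.
Context {R : realType}.
Implicit Types (f : curve R) (a b c L : R) (s : seq R).

(** Length of the polygon through [f x] and the values of [f] along [s]; the recursion replaces the
    indexed sum in [curve_length]. *)
Fixpoint plen f x s : R :=
  if s is y :: s' then enorm (f y - f x) + plen f y s' else 0.

Lemma plenE f b x s :
  \sum_(0 <= i < size s) enorm (f (nth b (x :: s) i.+1) - f (nth b (x :: s) i)) = plen f x s.
Proof.
elim: s x => [|y s IH] x; first by rewrite big_nil.
by rewrite /= big_nat_recl//= IH.
Qed.

Lemma curve_lengthE a b f :
  curve_length a b f = ereal_sup [set (plen f a s)%:E | s in itv_partition a b].
Proof.
rewrite /curve_length; congr ereal_sup; apply/seteqP; split => _ [s hs <-];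
  by exists s => //; rewrite plenE.
Qed.

Lemma plen_ge0 f x s : 0 <= plen f x s.
Proof. by elim: s x => //= y s IH x; rewrite addr_ge0 ?enorm_ge0. Qed.

Lemma plen_cat f x s t : plen f x (s ++ t) = plen f x s + plen f (last x s) t.
Proof. by elim: s x => [|y s IH] x /=; rewrite ?add0r// IH addrA. Qed.

Lemma plenZ (k : R) f x s : plen (fun y => k *: f y) x s = `|k| * plen f x s.
Proof.
by elim: s x => [|y s IH] x /=; rewrite ?mulr0// IH mulrDr -scalerBr enormZ.
Qed.

Lemma plen_le_length a b f s : itv_partition a b s -> ((plen f a s)%:E <= curve_length a b f)%E.
Proof. by move=> hs; rewrite curve_lengthE; apply: ereal_sup_ubound; exists s. Qed.

Lemma itv_partition_singl a b : a < b -> itv_partition a b [:: b].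
Proof. by move=> ab; split => //=; rewrite ab. Qed.

Lemma curve_length_ge0 a b f : a <= b -> (0 <= curve_length a b f)%E.
Proof.
rewrite le_eqVlt => /orP[/eqP <-|ab].
  have h : itv_partition a a [::] by split.
  exact: le_trans (plen_le_length f h).
by apply: le_trans (plen_le_length f (itv_partition_singl ab)); rewrite lee_fin plen_ge0.
Qed.

Lemma enorm_le_length a b f : a <= b -> ((enorm (f b - f a))%:E <= curve_length a b f)%E.
Proof.
rewrite le_eqVlt => /orP[/eqP <-|ab]; first by rewrite subrr enorm0 curve_length_ge0.
by rewrite (le_trans _ (plen_le_length f (itv_partition_singl ab)))//= addr0.
Qed.

Lemma curve_length_le a b f (G : R -> R) :
  (forall u v, a <= u -> u <= v -> v <= b -> enorm (f v - f u) <= G v - G u) ->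
  (curve_length a b f <= (G b - G a)%:E)%E.
Proof.
move=> fG; rewrite curve_lengthE; apply: ge_ereal_sup => _ [s [hp /eqP hl] <-].
rewrite lee_fin.
elim: s a fG hp hl => [|y s IH] a fG /=; first by move=> _ ->; rewrite subrr.
move=> /andP[ay hp] hl.
have yb : y <= b by apply: (@itv_partition_le _ _ _ _ s); split => //; exact/eqP.
have := fG a y (lexx _) (ltW ay) yb.
have := IH y (fun u v yu => fG u v (le_trans (ltW ay) yu)) hp hl.
by lra.
Qed.

Lemma curve_lengthZ (k : R) a b f : 0 < k ->
  curve_length a b (fun x => k *: f x) = (k%:E * curve_length a b f)%E.
Proof.
move=> k0; rewrite !curve_lengthE -ereal_sup_pZl//; congr ereal_sup.
apply/seteqP; split => [_ [s hs <-]|_ [_ [s hs <-] <-]].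
  by exists (plen f a s)%:E; [exists s|rewrite plenZ gtr0_norm].
by exists s => //; rewrite plenZ gtr0_norm.
Qed.

(** Inserting [b] into a partition does not decrease the polygonal length, and partitions of the two
    halves concatenate. *)
Lemma curve_lengthD a b c f : a <= b -> b <= c ->
  curve_length a c f = (curve_length a b f + curve_length b c f)%E.
Proof.
move=> ab bc; apply/eqP; rewrite eq_le; apply/andP; split.
  rewrite [leLHS]curve_lengthE; apply: ge_ereal_sup => _ [s [hp /eqP hl] <-].
  suff [s1 [s2 [h1 h2 h]]] : exists s1 s2, [/\ itv_partition a b s1, itv_partition b c s2 &
      plen f a s <= plen f a s1 + plen f b s2].
    rewrite (@le_trans _ _ (plen f a s1 + plen f b s2)%:E)//.
    by rewrite EFinD leeD// plen_le_length.
  elim: s a ab hp hl => [|y s IH] a ab /=.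
    move=> _ ac; have cb : a = b by apply/le_anti; rewrite ab ac bc.
    by subst; exists [::], [::]; split => //=; rewrite addr0.
  move=> /andP[ay hp] hl; have [yb|yb] := leP y b.
    have [s1 [s2 [[h11 h12] h2 h]]] := IH y yb hp hl.
    exists (y :: s1), s2; split => //; first by split => //=; rewrite ay.
    by rewrite /= -addrA lerD2l.
  move: ab; rewrite le_eqVlt => /orP[/eqP ab|ab].
    exists [::], (y :: s); subst b; split => //; last by rewrite /= add0r.
    by split => //=; [rewrite ay|exact/eqP].
  exists [:: b], (y :: s); split => //.
  - exact: itv_partition_singl.
  - by split => //=; [rewrite yb|exact/eqP].
  - by rewrite /= addr0 addrA lerD2r addrC enorm_triangle.
have fin1 := curve_length_ge0 f ab; have fin2 := curve_length_ge0 f bc.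
have H s t : itv_partition a b s -> itv_partition b c t ->
    ((plen f a s + plen f b t)%:E <= curve_length a c f)%E.
  move=> hs ht; rewrite (_ : _ + _ = plen f a (s ++ t)); last first.
    by rewrite plen_cat; case: hs => _ /eqP ->.
  exact/plen_le_length/(itv_partition_cat hs ht).
have [->|finc] := eqVneq (curve_length a c f) +oo%E; first exact: leey.
have {finc} : curve_length a c f \is a fin_num.
  by rewrite ge0_fin_numE ?curve_length_ge0 ?(le_trans ab)// ltey.
move=> /fineK; set C := fine _ => EC.
(* The supremum over the second half is taken while the first partition is fixed; finiteness of the
   total length [C] makes the subtraction legitimate. *)
have H1 s : itv_partition a b s -> (curve_length b c f <= (C - plen f a s)%:E)%E.
  move=> hs; rewrite curve_lengthE; apply: ge_ereal_sup => _ [t ht <-].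
  by have := H s t hs ht; rewrite -EC !lee_fin lerBrDl.
have [s0 hs0] : exists s, itv_partition a b s.
  move: ab; rewrite le_eqVlt => /orP[/eqP <-|ab]; first by exists [::]; split.
  by exists [:: b]; exact: itv_partition_singl.
have : curve_length b c f \is a fin_num.
  by rewrite ge0_fin_numE// (le_lt_trans (H1 _ hs0))// ltry.
move=> /fineK; set B := fine _ => EB.
rewrite -EC -EB -leeBrDr// curve_lengthE; apply: ge_ereal_sup => _ [s hs <-].
by have := H1 s hs; rewrite -EB -EFinB !lee_fin !lerBrDr addrC.
Qed.

Lemma by_arclength_lip f u v : by_arclength f -> enorm (f v - f u) <= `|v - u|.
Proof.
move=> arc; wlog uv : u v / u <= v.
  move=> H; have [|/ltW] := leP u v; first exact: H.
  by move=> vu; rewrite enormBC distrC H.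
by have := enorm_le_length f uv; rewrite arc// lee_fin ger0_norm// subr_ge0.
Qed.

(** The lower bound contained in arclength parametrization: a function whose increments control all
    chords must grow at least at unit rate. *)
Lemma by_arclength_le f a b (G : R -> R) : by_arclength f -> a <= b ->
  (forall u v, a <= u -> u <= v -> v <= b -> enorm (f v - f u) <= G v - G u) ->
  b - a <= G b - G a.
Proof. by move=> arc ab /curve_length_le; rewrite arc. Qed.

End CurveLength.

Section Arclength.
Context {R : realType}.
Variables (L : R) (f : curve R).
Hypotheses (L0 : 0 < L) (cf : continuous f) (lf : (curve_length 0 L f < +oo)%E).

Let lam t : R := fine (curve_length 0 t f).

Lemma curve_length_fin u v : 0 <= u -> u <= v -> v <= L -> curve_length u v f \is a fin_num.
Proof.
move=> u0 uv vL; have L00 := ltW L0.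
have h0 := curve_length_ge0 f uv; have h1 := curve_length_ge0 f u0.
have h2 := curve_length_ge0 f vL.
rewrite ge0_fin_numE// (le_lt_trans _ lf)//.
rewrite (curve_lengthD f u0 (le_trans uv vL)) (curve_lengthD f uv vL).
by rewrite addeCA leeDl// adde_ge0.
Qed.

Lemma arclength_sub u v : 0 <= u -> u <= v -> v <= L ->
  curve_length u v f = (lam v - lam u)%:E.
Proof.
move=> u0 uv vL; rewrite /lam (curve_lengthD f u0 uv) fineD ?curve_length_fin//.
- by rewrite addrAC subrr add0r fineK// curve_length_fin.
- exact: le_trans uv vL.
Qed.

Lemma arclength_mono u v : 0 <= u -> u <= v -> v <= L -> lam u <= lam v.
Proof.
move=> u0 uv vL; rewrite -subr_ge0 -lee_fin -arclength_sub//.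
exact: curve_length_ge0.
Qed.

Lemma plen_adherent u v e : 0 <= u -> u < v -> v <= L -> 0 < e ->
  exists2 s, itv_partition u v s & (curve_length u v f < (plen f u s + e)%:E)%E.
Proof.
move=> u0 uv vL e0; have fn := curve_length_fin u0 (ltW uv) vL.
move: (fn); rewrite curve_lengthE => /(ub_ereal_sup_adherent e0)[_ [s hs <-]].
rewrite -curve_lengthE => h; exists s => //.
by rewrite EFinD -lteBlDr.
Qed.

Lemma near_enorm (t e : R) : 0 < e -> \forall u \near t, enorm (f u - f t) < e.
Proof.
move=> e0; have ct : f x @[x --> t] --> f t := @cf t.
move/enorm_cvgP/cvgr0Pnorm_lt/(_ _ e0) : ct.
by apply: filterS => u; rewrite ger0_norm ?enorm_ge0.
Qed.

(** In a partition of [[t, L]] that is optimal up to [e / 2], the starting point is moved to a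
    nearby [u]. By continuity of [f] the polygon loses less than [e / 2], so the arc from [u] is
    almost as long as the arc from [t]. *)
Lemma arclength_right t e : 0 <= t -> t < L -> 0 < e ->
  exists u, [/\ t < u, u <= L & lam u < lam t + e].
Proof.
move=> t0 tL e0; have e20 : 0 < e / 2 by rewrite divr_gt0.
have [[|y s] [hp hl] hs] := plen_adherent t0 tL (lexx L) e20.
  by move: hl => /= /eqP tL'; rewrite tL' ltxx in tL.
move: (hp) => /= /andP[ty hps].
have yL : y <= L by apply: (@itv_partition_le _ _ _ _ s); split.
near t^'+ => u.
have tu : t < u by near: u; exact: nbhs_right_gt.
have uy : u < y by near: u; exact: nbhs_right_lt.
have fu : enorm (f u - f t) < e / 2.
  by near: u; apply: cvg_within; exact: near_enorm.
have uL := ltW (lt_le_trans uy yL).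
exists u; split => //.
have hpu : itv_partition u L (y :: s) by split => //=; rewrite uy.
have := plen_le_length f hpu; rewrite arclength_sub ?(le_trans t0 (ltW tu))//.
move: hs; rewrite arclength_sub ?(ltW tL)// lee_fin lte_fin /=.
have := enorm_triangle (f y) (f u) (f t); lra.
Unshelve. all: by end_near. Qed.

Lemma arclength_left t e : 0 < t -> t <= L -> 0 < e ->
  exists u, [/\ 0 <= u, u < t & lam t < lam u + e].
Proof.
move=> t0 tL e0; have e20 : 0 < e / 2 by rewrite divr_gt0.
have [s [hp hl] hs] := plen_adherent (lexx 0) t0 tL e20.
case/lastP: s hp hl hs => [|s y] hp hl hs.
  by move: hl => /= /eqP tL'; rewrite tL' ltxx in t0.
move: hl; rewrite last_rcons => /eqP yt; subst y.
move: hp; rewrite rcons_path => /andP[hps st]; set z := last 0 s in st.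
have z0 : 0 <= z by apply: (@itv_partition_le _ _ _ _ s); split.
near t^'- => u.
have ut : u < t by near: u; exact: nbhs_left_lt.
have zu : z < u by near: u; exact: nbhs_left_gt.
have fu : enorm (f u - f t) < e / 2.
  by near: u; apply: cvg_within; exact: near_enorm.
exists u; split => //; first exact: le_trans z0 (ltW zu).
have hpu : itv_partition 0 u (rcons s u).
  by split; [rewrite rcons_path hps|rewrite last_rcons].
have u0 := le_trans z0 (ltW zu).
have := plen_le_length f hpu; rewrite arclength_sub// ?(le_trans (ltW ut))//.
move: hs; rewrite arclength_sub ?(ltW t0)// lee_fin lte_fin /=.
rewrite -!cats1 !plen_cat /= -/z !addr0 (enormBC (f u) (f z)) (enormBC (f t) (f z)).
have := enorm_triangle (f z) (f u) (f t); lra.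
Unshelve. all: by end_near. Qed.

Lemma arclength0 : lam 0 = 0.
Proof.
have : (curve_length 0 0 f <= (0 - 0 : R)%:E)%E.
  apply: (@curve_length_le _ _ _ _ id) => u v u0 uv v0.
  have -> : u = v by lra.
  by rewrite !subrr enorm0.
have := curve_length_ge0 f (lexx 0); rewrite subrr => h1 h2.
by rewrite /lam (_ : curve_length 0 0 f = 0%E)//; apply/eqP; rewrite eq_le h1 h2.
Qed.

(** The value is attained at the supremum of the parameters with arclength at most [y]; one-sided
    continuity from the left and from the right gives the two inequalities. *)
Lemma arclength_surj y : 0 <= y <= lam L -> exists2 t, 0 <= t <= L & lam t = y.
Proof.
move=> /andP[y0 yl].
pose S := [set u | 0 <= u <= L /\ lam u <= y].
have S0 : S 0 by split; [rewrite lexx ltW|rewrite arclength0].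
have ubS : ubound S L by move=> u [/andP[]].
have supS : has_sup S by split; [exists 0|exists L].
pose t := sup S.
have t0 : 0 <= t by exact: ub_le_sup (proj2 supS) _ S0.
have tL : t <= L by apply: ge_sup => //; exists 0.
exists t; first by rewrite t0.
apply/eqP; rewrite eq_le; apply/andP; split; apply/ler_addgt0Pr => e e0.
- have [t00|t00] := eqVneq t 0; first by rewrite t00 arclength0 addr_ge0// ltW.
  have tp : 0 < t by rewrite lt_neqAle eq_sym t00.
  have [u [u0 ut hu]] := arclength_left tp tL e0.
  have [v [/andP[v0 vL] vy] uv] := sup_gt (proj1 supS) ut.
  have := arclength_mono u0 (ltW uv) vL; lra.
- have [t00|t00] := eqVneq t L; first by rewrite t00; lra.
  have tp : t < L by rewrite lt_neqAle t00.
  have [u [tu uL hu]] := arclength_right t0 tp e0.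
  have u0 := le_trans t0 (ltW tu).
  suff : y < lam u by lra.
  rewrite ltNge; apply/negP => uy.
  have : u <= t by apply: ub_le_sup; [exact: (proj2 supS)|split => //; rewrite u0].
  by rewrite leNgt tu.
Qed.

Lemma arclength_inj u v : 0 <= u <= L -> 0 <= v <= L -> lam u = lam v -> f u = f v.
Proof.
wlog uv : u v / u <= v.
  move=> H hu hv E; have [uv|/ltW vu] := leP u v; first exact: H.
  by apply/esym/H.
move=> /andP[u0 uL] /andP[v0 vL] E.
have := enorm_le_length f uv; rewrite arclength_sub// E subrr lee_fin => h.
apply/esym/eqP; rewrite -subr_eq0 -enorm_eq0 eq_le h enorm_ge0//.
Qed.

Hypotheses (pf : periodic f L) (l0 : 0 < lam L).

Let S := [set g : curve R | periodic g (fine (closed_length L f)) /\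
         forall t, t \in `[0, L] -> g (fine (curve_length 0 t f)) = f t].

(** Reduce the argument modulo the total length and choose a preimage under the arclength function;
    the choice is immaterial because parameters of equal arclength have the same image. *)
Lemma arclength_param_ex : exists g, S g.
Proof.
have /choice[tau htau] : forall y, exists t, 0 <= y <= lam L -> 0 <= t <= L /\ lam t = y.
  move=> y; have [yy|yy] := boolP (0 <= y <= lam L); last by exists 0.
  by have [t ht ty] := arclength_surj yy; exists t.
pose red x : R := x - (Num.floor (x / lam L))%:~R * lam L.
exists (fun x => f (tau (red x))); split.
  move=> x; congr (f (tau _)); rewrite /red -/(lam L) mulrDl divff ?gt_eqF//.
  by rewrite floorDrz// floor1 intrD mulrDl mul1r; ring.
move=> t; rewrite in_itv/= -/(lam t) => tI; have /andP[t0 tL] := tI.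
have lt0 : 0 <= lam t by rewrite -arclength0 arclength_mono.
have ltL : lam t <= lam L by rewrite arclength_mono.
(* The full length is reduced to 0 and not to itself, so the end point relies on [f L = f 0]. *)
move: ltL; rewrite le_eqVlt => /orP[/eqP E|tl].
  have -> : red (lam t) = 0.
    by rewrite /red E divff ?gt_eqF// -[1]/(1%:~R) floor1 mul1r subrr.
  have [|h1 h2] := htau 0; first by rewrite lexx ltW.
  have b0 : 0 <= (0 : R) <= L by rewrite lexx (ltW L0).
  have bL : 0 <= L <= L by rewrite lexx (ltW L0).
  rewrite (arclength_inj h1 b0); last by rewrite h2 arclength0.
  rewrite -(pf 0) add0r; exact: arclength_inj.
have -> : red (lam t) = lam t.
  rewrite /red (_ : Num.floor _ = 0) ?mul0r ?subr0//.
  by apply/floor_def; rewrite divr_ge0//= ?ltW// add0r ltr_pdivrMr// mul1r.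
have [|h1 h2] := htau (lam t); first by rewrite lt0 ltW.
exact: arclength_inj.
Qed.

Lemma arclength_paramP : S (arclength_param L f).
Proof. by rewrite /arclength_param; apply: getPex; exact: arclength_param_ex. Qed.

(** Modulo the period every parameter is the arclength of some [t] in [[0, L]], where both curves
    must take the value [f t]. This identifies the curve that [get] picks. *)
Lemma arclength_param_unique g : S g -> arclength_param L f = g.
Proof.
have [h1 h2] := arclength_paramP => -[g1 g2]; apply/funext => x.
have [n /andP[n0 nL]] := floor_reduce x l0.
rewrite -(periodic_intP n x h1) -(periodic_intP n x g1).
have [|t tI <-] := @arclength_surj (x + n%:~R * lam L); first by rewrite n0 ltW.
by rewrite h2 ?in_itv//= g2 ?in_itv.
Qed.

End Arclength.

(** * Densities of Lipschitz functions and the speed of arclength curves *)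

Section LipschitzCumulative.
Context {R : realType}.
Variables (phi : R -> R) (K : R).
Hypothesis lip : forall u v, `|phi v - phi u| <= K * `|v - u|.

(** Adding [K * x] makes a [K]-Lipschitz function nondecreasing, hence the distribution function of
    a Stieltjes measure. The Lipschitz bound is an argument so that the cumulative structure can be
    attached to the term. *)
Definition lip_cumul (_ : forall u v, `|phi v - phi u| <= K * `|v - u|) (x : R) : R :=
  K * x + phi x.

Let lip_nd : nondecreasing (lip_cumul lip).
Proof.
move=> u v uv; rewrite /lip_cumul.
have := lip u v; rewrite ler_norml => /andP[h _].
by rewrite ger0_norm ?subr_ge0// in h; lra.
Qed.

Lemma lip_continuous : continuous phi.
Proof.
move=> x; apply/(@cvgrPdist_lt R R _ (nbhs x) (nbhs_filter x)) => e e0.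
have K0 : 0 <= K.
  have := lip 0 1; rewrite subr0 normr1 mulr1; exact: le_trans.
have d0 : 0 < e / (K + 1) by rewrite divr_gt0// ltr_wpDl.
near=> y.
rewrite (le_lt_trans (lip _ _))// (@le_lt_trans _ _ ((K + 1) * `|x - y|))//.
  by rewrite ler_wpM2r// lerDl.
rewrite -ltr_pdivlMl ?ltr_wpDl// mulrC; near: y.
exact: (@cvgr_dist_lt R R _ (nbhs x) (nbhs_filter x) id x).
Unshelve. all: by end_near. Qed.

Let lip_rc : right_continuous (lip_cumul lip).
Proof.
apply: right_continuousW => x; apply: cvgD; last exact: lip_continuous.
by apply: cvgM; [exact: cvg_cst|exact: cvg_id].
Qed.

HB.instance Definition _ := isCumulative.Build R _ R (lip_cumul lip) lip_nd lip_rc.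

End LipschitzCumulative.

Section LipschitzDensity.
Context {R : realType}.
Notation mu := (@lebesgue_measure R).

Lemma lebesgue_stieltjes_itv (F : cumulative R R) (a b : R) : a <= b ->
  lebesgue_stieltjes_measure F `]a, b]%classic = (F b - F a)%:E.
Proof.
move=> ab; rewrite /lebesgue_stieltjes_measure /measure_extension measurable_mu_extE/=.
  by rewrite wlength_itv_bnd.
exact: is_ocitv.
Qed.

(** The measures of [K * x + phi x] and [K * x - phi x] add up to [2 * K] times Lebesgue measure. *)
Lemma lipschitz_measure_le (phi : R -> R) (K : R)
    (lip : forall u v, `|phi v - phi u| <= K * `|v - u|) (A : set R) :
  0 < K -> measurable A ->
  (lebesgue_stieltjes_measure (lip_cumul lip) A <= (2 * K)%:E * mu A)%E.
Proof.
move=> K0 mA.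
have lipN u v : `|- phi v - - phi u| <= K * `|v - u|.
  by rewrite -opprD normrN; exact: lip.
pose nu1 := lebesgue_stieltjes_measure (lip_cumul lip).
pose nu2 := lebesgue_stieltjes_measure (lip_cumul lipN).
have k0 : 0 <= (2 * K)^-1 by rewrite invr_ge0 mulr_ge0// ltW.
have E X : ocitv X -> mu X = mscale (NngNum k0) (measure_add nu1 nu2) X.
  move=> -[[a b] /= _ <-]; have [ba|ab] := leP b a.
    by rewrite set_itv_ge ?bnd_simp -?leNgt// !measure0.
  have ab' := ltW ab.
  transitivity ((2 * K)^-1%:E * (nu1 `]a, b]%classic + nu2 `]a, b]%classic))%E;
    last by rewrite -measure_addE.
  rewrite /nu1 /nu2 !lebesgue_stieltjes_itv// lebesgue_measure_itv/= lte_fin ab.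
  rewrite -!EFinD -EFinM /lip_cumul; congr EFin; field; exact: lt0r_neq0.
rewrite [mu A](lebesgue_measure_unique E)// /mscale/= muleA -EFinM divff; last first.
  by rewrite mulf_neq0// gt_eqF.
by rewrite mul1e [leRHS]measure_addE leeDl.
Qed.

Lemma integrable_cst_itv (k a b : R) :
  mu.-integrable `]a, b]%classic (EFin \o (fun=> k)).
Proof.
apply/integrableP; split; first exact/measurable_EFinP/measurable_cst.
rewrite (eq_integral (cst `|k|%:E))// integral_cst//= lebesgue_measure_itv/=.
by case: ifP => _; rewrite -?EFinB -?EFinM ?mule0 ltry.
Qed.

(** The Stieltjes measure of [K * x + phi x], restricted to []A, B]], is absolutely continuous; its
    Radon-Nikodym density minus [K] is a density of [phi]. *)
Lemma lipschitz_density (phi : R -> R) (K A B : R) : 0 < K -> A <= B ->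
  (forall u v, `|phi v - phi u| <= K * `|v - u|) ->
  exists g : R -> R, mu.-integrable setT (EFin \o g) /\
    (forall a b, A <= a -> a <= b -> b <= B ->
       phi b - phi a = \int[mu]_(x in `]a, b]) g x).
Proof.
move=> K0 AB lip.
pose nu0 := lebesgue_stieltjes_measure (lip_cumul lip).
pose D : set R := `]A, B]%classic.
have mD : measurable D by exact: measurable_itv.
have nuD : (nu0 D < +oo)%E by rewrite /nu0 /D lebesgue_stieltjes_itv// ltry.
pose nu : {finite_measure set (measurableTypeR R) -> \bar R} :=
  @mfrestr _ (measurableTypeR R) R D nu0 mD nuD.
have dom : nu `<< mu.
  apply/null_content_dominatesP => X mX X0.
  apply/eqP; rewrite eq_le measure_ge0 andbT /nu /mfrestr /mrestr/=.
  have mXD : measurable (X `&` D) by exact: measurableI.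
  rewrite (le_trans (lipschitz_measure_le lip K0 mXD))//.
  rewrite (_ : mu (X `&` D) = 0%E) ?mule0//.
  apply/eqP; rewrite eq_le measure_ge0 andbT -X0.
  by apply: le_measure; rewrite ?inE//; exact: subIsetl.
have [f [f0 ffin fint fE]] := radon_nikodym_sigma_finite dom.
have intD : mu.-integrable D (EFin \o (fun x => fine (f x) - K)).
  apply: (@eq_integrable _ _ _ mu D mD (f \- (fun=> K%:E))%E).
    by move=> x _ /=; rewrite EFinB fineK.
  apply: integrableB => //; first exact: integrableS fint.
  exact: integrable_cst_itv.
exists ((fun x => fine (f x) - K) \_ D); split.
  by rewrite -restrict_EFin -integrable_mkcond.
move=> a b Aa ab bB.
have sub : `]a, b]%classic `<=` D.
  by move=> x; rewrite /D/= !in_itv/= => /andP[ax xb]; rewrite (le_lt_trans Aa ax) (le_trans xb bB).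
have -> : \int[mu]_(x in `]a, b]) (((fun x => fine (f x) - K) \_ D) x) =
          \int[mu]_(x in `]a, b]) (fine (f x) - K).
  apply: eq_Rintegral => x xab; rewrite patchE ifT//; apply/mem_set/sub.
  by move: xab; rewrite inE.
have intf : mu.-integrable `]a, b]%classic (EFin \o (fine \o f)).
  apply: (@eq_integrable _ _ _ mu _ _ f) => //; last exact: integrableS fint.
  by move=> x _ /=; rewrite fineK.
rewrite RintegralB//; last exact: integrable_cst_itv.
rewrite Rintegral_cst//= lebesgue_measure_itv/=.
have -> : \int[mu]_(x in `]a, b]) fine (f x) = K * b + phi b - (K * a + phi a).
  rewrite /Rintegral (eq_integral f); last by move=> x _; rewrite fineK.
  transitivity (fine (nu0 (`]a, b]%classic `&` D))); first by rewrite -fE.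
  by rewrite (setIidl sub) /nu0 lebesgue_stieltjes_itv.
have -> : fine (if (a%:E < b%:E)%E then (b%:E - a%:E)%E else 0%E) = b - a.
  by move: ab; rewrite le_eqVlt lte_fin => /orP[/eqP ->|->]; rewrite ?ltxx ?subrr//.
ring.
Qed.

End LipschitzDensity.

Section DifferenceQuotients.
Context {R : realType}.

Lemma derivable1_cvg (V : normedModType R) (f : R -> V) (x : R) : derivable f x (1 : R) ->
  h^-1 *: (f (h + x) - f x) @[h --> 0^'] --> derive1 f x.
Proof.
rewrite derive1E => /cvg_ex[l hl]; have := hl.
have -> : 'D_1 f x = l by apply/cvg_lim.
apply: cvg_trans; apply: near_eq_cvg; near=> h.
by rewrite /= /GRing.scale /= mulr1.
Unshelve. all: by end_near. Qed.

Lemma derive1_ge_slope (H : R -> R) (x c r : R) : 0 < r -> derivable H x (1 : R) ->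
  (forall u v, x - r <= u -> u <= v -> v <= x + r -> c * (v - u) <= H v - H u) ->
  c <= derive1 H x.
Proof.
move=> r0 dH Hc; have := derivable1_cvg dH => dc.
rewrite -(cvg_lim _ dc)//; apply: limr_ge; first by apply/cvg_ex; eexists; exact: dc.
near=> h.
have h0' : h != 0 by near: h; exact: nbhs_dnbhs_neq.
have hr : `|h| < r by near: h; exact: dnbhs0_lt.
move: hr; rewrite ltr_norml => /andP[ha hb].
rewrite /GRing.scale/=.
case: (ltgtP h 0) h0' => // hs _.
  rewrite mulrC ler_ndivlMr//.
  have := Hc (h + x) x; rewrite (_ : x - (h + x) = - h); last by ring.
  move=> /(_ _ _ _)/wrap[]; [lra|lra|lra|].
  by rewrite mulrN; lra.
rewrite mulrC ler_pdivlMr//.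
have := Hc x (h + x); rewrite addrK; apply; lra.
Unshelve. all: by end_near. Qed.

End DifferenceQuotients.

Section VectorDerivative.
Context {R : realType}.
Implicit Types (f : curve R) (x : R).

Lemma derivable_vec f x :
  (forall i : nat, (i < 3)%N -> derivable (fun y => co i (f y)) x (1 : R)) ->
  derivable f x (1 : R).
Proof.
move=> d; apply/derivable_mxP => i j.
rewrite (_ : (fun y : R => f y i j) = (fun y => co j (f y))); first exact: d.
by apply/funext => y; rewrite /co inord_val (ord1 i) (ord1 ord0).
Qed.

Lemma derivable_co (i : nat) f x : derivable f x (1 : R) ->
  derivable (fun y => co i (f y)) x (1 : R).
Proof. by move=> /derivable_mxP; exact. Qed.

Lemma derive1_co (i : nat) f x : derivable f x (1 : R) ->
  co i (derive1 f x) = derive1 (fun y => co i (f y)) x.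
Proof. by move=> df; rewrite /co derive1E (derive_mx df) mxE derive1E. Qed.

End VectorDerivative.

Section ArclengthDerivative.
Context {R : realType}.
Notation mu := (@lebesgue_measure R).

Lemma FTC1_integrable (g : R -> R) (A : R) : mu.-integrable setT (EFin \o g) ->
  {ae mu, forall x : R, A < x ->
     derivable (fun y : R => \int[mu]_(t in `]A, y]) g t) x (1 : R) /\
     derive1 (fun y : R => \int[mu]_(t in `]A, y]) g t) x = g x}.
Proof.
move=> ig; apply: (@FTC1 R g (BRight A)) => [y|].
  by apply: integrableS ig.
exact: open_integrable_locally openT ig.
Qed.

Lemma integral_itv_sub (g : R -> R) (A a b : R) : mu.-integrable setT (EFin \o g) ->
  A <= a -> a <= b ->
  \int[mu]_(t in `]A, b]) g t - \int[mu]_(t in `]A, a]) g t = \int[mu]_(t in `]a, b]) g t.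
Proof.
move=> ig Aa ab; apply: Rintegral_itvB; rewrite ?bnd_simp//.
by apply: integrableS ig.
Qed.

Lemma integrable_itv (h : R -> R) (a b : R) : mu.-integrable setT (EFin \o h) ->
  mu.-integrable `]a, b]%classic (EFin \o h).
Proof. by apply: integrableS. Qed.

Lemma integrableZl_itv (h : R -> R) (k a b : R) : mu.-integrable setT (EFin \o h) ->
  mu.-integrable `]a, b]%classic (EFin \o (fun x => k * h x)).
Proof.
move=> ih; have mI : measurable (`]a, b]%classic : set (measurableTypeR R)) by [].
have := integrableZl mI k (integrable_itv a b ih).
by apply: eq_integrable => // x _; rewrite /= EFinM.
Qed.

Lemma derive1_primitive (phi g : R -> R) (A B x : R) : A < x -> x < B ->
  (forall a b, A <= a -> a <= b -> b <= B -> phi b - phi a = \int[mu]_(t in `]a, b]) g t) ->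
  derivable (fun y : R => \int[mu]_(t in `]A, y]) g t) x (1 : R) /\
    derive1 (fun y : R => \int[mu]_(t in `]A, y]) g t) x = g x ->
  derivable phi x (1 : R) /\ derive1 phi x = g x.
Proof.
move=> Ax xB E [dG <-].
have nE : \forall y \near x, \int[mu]_(t in `]A, y]) g t = phi y - phi A.
  have xI : x \in `]A, B[ by rewrite in_itv/= Ax.
  apply: filterS (near_in_itvoo xI) => y; rewrite in_itv/= => /andP[Ay yB].
  by rewrite E// ltW.
have dphiA : derivable (fun y => phi y - phi A) x (1 : R).
  exact: near_eq_derivable nE dG.
have idA : is_derive x (1 : R) (fun y => phi y - phi A)
    (derive1 (fun y : R => \int[mu]_(t in `]A, y]) g t) x).
  by apply: DeriveDef => //; rewrite derive1E (near_eq_derive (1 : R) nE).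
have idp := is_deriveD idA (is_derive_cst (phi A) x (1 : R)).
rewrite addr0 in idp.
have phiE : (fun y => phi y - phi A) + cst (phi A) = phi.
  by apply/funext => y; exact: subrK.
rewrite phiE in idp.
by split; [|rewrite [LHS]derive1E]; have [] := idp.
Qed.

(** The coordinates are 1-Lipschitz, with densities forming a vector [G]. Chords are at most the
    integral of [|G|], so arclength forces this integral over [[u, v]] to be at least [v - u];
    Lebesgue differentiation then gives [f' = G] and [|G| >= 1] almost everywhere. This bounds the
    speed weights in the energy from below before any regularity is known. *)
Lemma by_arclength_derive1 (f : curve R) (L : R) : 0 < L -> by_arclength f ->
  {ae mu, forall x, x \in `[0, L] -> 1 <= enorm (derive1 f x)}.
Proof.
move=> L0 arc.
have lipf i (i3 : (i < 3)%N) u v : `|co i (f v) - co i (f u)| <= 1 * `|v - u|.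
  rewrite -coB mul1r (le_trans (ler_norm_co _ i3))//; exact: by_arclength_lip.
(* The densities are taken on a larger interval so that the end points of [[0, L]] are interior. *)
have AB : (-1 : R) <= L + 1 by lra.
have dens i (i3 : (i < 3)%N) := lipschitz_density ltr01 AB (lipf i i3).
have [g0 [ig0 g0E]] := dens 0%N isT.
have [g1 [ig1 g1E]] := dens 1%N isT.
have [g2 [ig2 g2E]] := dens 2%N isT.
pose G x : 'rV[R]_3 := \row_(j < 3) [:: g0 x; g1 x; g2 x]`_j.
have G0 x : co 0 (G x) = g0 x by rewrite /co mxE inordK.
have G1 x : co 1 (G x) = g1 x by rewrite /co mxE inordK.
have G2 x : co 2 (G x) = g2 x by rewrite /co mxE inordK.
have mG : mvec G.
  by move=> [|[|[|//]]] _; [under eq_fun do rewrite G0|under eq_fun do rewrite G1|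
    under eq_fun do rewrite G2]; apply/measurable_EFinP;
    [exact: measurable_int ig0|exact: measurable_int ig1|exact: measurable_int ig2].
pose n x := enorm (G x).
have in_ : mu.-integrable setT (EFin \o n).
  have isum : mu.-integrable setT (EFin \o (fun x => `|g0 x| + `|g1 x| + `|g2 x|)).
    rewrite (_ : _ \o _ = (fun x => `|(EFin \o g0) x| + `|(EFin \o g1) x| + `|(EFin \o g2) x|)%E); last first.
      by apply/funext => x /=; rewrite !EFinD.
    by apply: integrableD => //; [apply: integrableD => //|]; exact: integrable_abse.
  apply: le_integrable isum => //; first by apply/measurable_EFinP; exact: measurable_enorm.
  move=> x _ /=; rewrite lee_fin ger0_norm ?enorm_ge0// ger0_norm ?addr_ge0//.
  by rewrite (le_trans (enorm_le_sum _))// G0 G1 G2.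
have step u v : -1 <= u -> u <= v -> v <= L + 1 ->
    enorm (f v - f u) <= \int[mu]_(t in `]u, v]) n t.
  move=> u1 uv v1; have [->|fuv] := eqVneq (f v - f u) 0.
    by rewrite enorm0; apply: Rintegral_ge0 => x _; exact: enorm_ge0.
  pose e := f v - f u.
  have isub h := @integrable_itv h u v.
  have iZ k h := @integrableZl_itv h k u v.
  (* Pairing with the chord [e] itself turns the three coordinate integrals into one, to which
     Cauchy-Schwarz applies under the integral sign. *)
  have E : dot e e = \int[mu]_(t in `]u, v]) (co 0 e * g0 t + co 1 e * g1 t + co 2 e * g2 t).
    rewrite RintegralD//; [|by apply: (integrableD _ (iZ _ _ ig0) (iZ _ _ ig1))|exact: iZ].
    rewrite RintegralD//; [|exact: iZ..].
    rewrite !RintegralZl//; [|exact: isub..].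
    by rewrite -g0E// -g1E// -g2E// -!coB -/e dotE.
  have le1 : dot e e <= \int[mu]_(t in `]u, v]) (enorm e * n t).
    rewrite E; apply: le_Rintegral => //.
    - by apply: (integrableD _ (integrableD _ (iZ _ _ ig0) (iZ _ _ ig1)) (iZ _ _ ig2)).
    - exact: iZ.
    - by move=> x _; rewrite -G0 -G1 -G2 -dotE dot_le.
  rewrite RintegralZl// in le1; last exact: isub.
  move: le1; rewrite -sqr_enorm expr2 ler_pM2l// enorm_gt0//.
pose H y := \int[mu]_(t in `](-1), y]) n t.
have Hinc u v : -1 <= u -> u <= v -> v <= L + 1 -> v - u <= H v - H u.
  move=> u1 uv v1; rewrite /H.
  apply: (by_arclength_le (G := H) arc) => // a b ua ab bv.
  by rewrite /H integral_itv_sub// ?step// ?(le_trans u1 ua)// (le_trans bv).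
have ae0 := FTC1_integrable (-1) ig0.
have ae1 := FTC1_integrable (-1) ig1.
have ae2 := FTC1_integrable (-1) ig2.
have aen := FTC1_integrable (-1) in_.
suff S (x : R) : (-1 < x -> derivable (fun y : R => \int[mu]_(t in `](-1), y]) g0 t) x (1 : R) /\
    derive1 (fun y : R => \int[mu]_(t in `](-1), y]) g0 t) x = g0 x) ->
  (-1 < x -> derivable (fun y : R => \int[mu]_(t in `](-1), y]) g1 t) x (1 : R) /\
    derive1 (fun y : R => \int[mu]_(t in `](-1), y]) g1 t) x = g1 x) ->
  (-1 < x -> derivable (fun y : R => \int[mu]_(t in `](-1), y]) g2 t) x (1 : R) /\
    derive1 (fun y : R => \int[mu]_(t in `](-1), y]) g2 t) x = g2 x) ->
  (-1 < x -> derivable (fun y : R => \int[mu]_(t in `](-1), y]) n t) x (1 : R) /\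
    derive1 (fun y : R => \int[mu]_(t in `](-1), y]) n t) x = n x) ->
    x \in `[0, L] -> 1 <= enorm (derive1 f x).
  have FF := ae_filter_ringOfSetsType mu.
  have ae01 := @filterI _ _ FF _ _ ae0 ae1; have ae2n := @filterI _ _ FF _ _ ae2 aen.
  by apply: (@filterS2 _ _ FF _ _ _ _ ae01 ae2n) => x [h0 h1] [h2 hn]; exact: S.
move=> h0 h1 h2 hn.
rewrite in_itv/= => /andP[x0 xL].
have x1 : -1 < x by exact: lt_le_trans x0.
have xL1 : x < L + 1 by rewrite (le_lt_trans xL)// ltrDl.
have [d0 e0] := derive1_primitive x1 xL1 g0E (h0 x1).
have [d1 e1] := derive1_primitive x1 xL1 g1E (h1 x1).
have [d2 e2] := derive1_primitive x1 xL1 g2E (h2 x1).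
have df : derivable f x 1.
  by apply: derivable_vec => -[|[|[|//]]] _; [exact: d0|exact: d1|exact: d2].
have fG : derive1 f x = G x.
  by apply: eq_vec3; rewrite derive1_co// ?G0 ?G1 ?G2.
rewrite fG -/(n x); have [dH <-] := hn x1.
pose r := Num.min (x + 1) (L + 1 - x).
have r0 : 0 < r by rewrite lt_min subr_gt0 xL1 -ltrBlDr sub0r x1.
have r1 : r <= x + 1 by rewrite ge_min lexx.
have r2 : r <= L + 1 - x by rewrite ge_min lexx orbT.
apply: (@derive1_ge_slope _ H x 1 r r0 dH) => u v xu uv vx; rewrite mul1r.
by apply: Hinc => //; move: xu vx r1 r2; clear; lra.
Qed.

End ArclengthDerivative.

(** * Finite energy makes triples of points flat *)

Section AlmostEverywhereLowerBound.
Context {R : realType}.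
Notation mu := (@lebesgue_measure R).

Lemma ae_mono (P Q : R -> Prop) : (forall x, P x -> Q x) ->
  {ae mu, forall x, P x} -> {ae mu, forall x, Q x}.
Proof. by move=> PQ; apply: (@filterS _ _ (ae_filter_ringOfSetsType mu)). Qed.

(** [F] is compared with [B] times the indicator of [[a, b]] minus an exceptional null set, which is
    a measurable function. *)
Lemma ae_integral_ge (F : R -> \bar R) (a b c d B : R) :
  c <= a -> a <= b -> b <= d -> 0 <= B -> (forall x, 0 <= F x)%E ->
  {ae mu, forall x, x \in `[a, b] -> (B%:E <= F x)%E} ->
  ((B * (b - a))%:E <= \int[mu]_(x in `[c, d]) F x)%E.
Proof.
move=> ca ab bd B0 F0 [N [mN N0 sN]].
have mI (u v : R) : measurable (`[u, v]%classic : set R) by [].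
have mIN : measurable (`[a, b]%classic `\` N) by exact: measurableD.
rewrite (@le_trans _ _ (\int[mu]_(x in `[c, d]) (B%:E * (\1_(`[a, b]%classic `\` N) x)%:E))%E)//.
  rewrite ge0_integralZl//; last first.
    by apply/measurable_EFinP; apply: measurable_funTS; exact: measurable_indic.
  rewrite integral_indic// setIidl; last first.
    move=> x [/=]; rewrite !in_itv/= => /andP[ax xb] _.
    by rewrite (le_trans ca ax) (le_trans xb bd).
  rewrite EFinM lee_wpmul2l//.
  have <- : mu `[a, b]%classic = (b - a)%:E.
    rewrite lebesgue_measure_itv/= lte_fin; case: ltP => // ba.
    have -> : a = b by apply/le_anti; rewrite ab ba.
    by rewrite subrr.
  rewrite (@le_trans _ _ (mu ((`[a, b]%classic `\` N) `|` N)))//.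
    apply: le_measure; rewrite ?inE//; first exact: measurableU.
    by move=> x abx; have [Nx|Nx] := pselect (N x); [right|left].
  have h := @measureU2 _ _ _ mu _ _ mIN mN.
    by apply: (le_trans h); rewrite [X in (_ + X <= _)%E](_ : _ = 0%E) ?adde0.
apply: ge0_le_integral_any => x _.
  by rewrite mule_ge0// lee_fin.
rewrite indicE; have [abN|abN] := boolP (x \in _); last by rewrite mule0.
have [abx Nx] := set_mem abN; rewrite mule1.
by apply: contrapT => nF; apply: Nx; apply: sN => /(_ _)/wrap[].
Qed.

End AlmostEverywhereLowerBound.

Section Perturbation.
Context {R : realType}.

Lemma menger_curvature_ge0 (g : curve R) s t sg : 0 <= menger_curvature g s t sg.
Proof. by rewrite /menger_curvature divr_ge0 ?mulr_ge0 ?enorm_ge0. Qed.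

Lemma cross_perturb (X Y X' Y' : 'rV[R]_3) (d e : R) : 0 <= e -> e <= d / 16 ->
  enorm X <= d -> enorm Y <= d -> enorm (X' - X) <= 2 * e -> enorm (Y' - Y) <= 2 * e ->
  enorm (cross X Y) - 8 * (e * d) <= enorm (cross X' Y').
Proof.
move=> e0 ed Xd Yd XX YY.
have nY' : enorm Y' <= 2 * d by have := lerB_enorm Y' Y; lra.
have -> : cross X' Y' = cross X Y + (cross (X' - X) Y' + cross X (Y' - Y)).
  by apply: eq_vec3; rewrite !coE; ring.
have := lerB_enorm (cross X Y) (- (cross (X' - X) Y' + cross X (Y' - Y))).
rewrite enormN opprK.
have := ler_enormD (cross (X' - X) Y') (cross X (Y' - Y)).
have : enorm (cross (X' - X) Y') <= 2 * e * (2 * d).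
  by rewrite (le_trans (enorm_cross_le _ _))// ler_pM ?enorm_ge0.
have : enorm (cross X (Y' - Y)) <= d * (2 * e).
  by rewrite (le_trans (enorm_cross_le _ _))// ler_pM ?enorm_ge0.
have : 0 <= e * d by rewrite mulr_ge0// (le_trans (enorm_ge0 X)).
set z := e * d; have -> : 2 * e * (2 * d) = 4 * z by rewrite /z; ring.
have -> : d * (2 * e) = 2 * z by rewrite /z; ring.
lra.
Qed.

Lemma menger_curvature_ge (f : curve R) (s t g a d : R) : 0 < a -> 0 < d ->
  a / 2 <= enorm (cross (f t - f s) (f g - f s)) ->
  enorm (f t - f s) <= 2 * d -> enorm (f g - f s) <= 2 * d -> enorm (f g - f t) <= 2 * d ->
  a / (8 * d ^+ 3) <= menger_curvature f s t g.
Proof.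
move=> a0 d0 cr nX nY nZ.
have crp : 0 < enorm (cross (f t - f s) (f g - f s)) by rewrite (lt_le_trans _ cr)// divr_gt0.
have X'0 : 0 < enorm (f t - f s).
  by rewrite enorm_gt0; apply: contraTneq crp => ->; rewrite cross0l enorm0 ltxx.
have Y'0 : 0 < enorm (f g - f s).
  by rewrite enorm_gt0; apply: contraTneq crp => ->; rewrite cross0r enorm0 ltxx.
have Z'0 : 0 < enorm (f g - f t).
  rewrite enorm_gt0; apply: contraTneq crp => /eqP; rewrite subr_eq0 => /eqP gt.
  by rewrite gt crossvv enorm0 ltxx.
rewrite /menger_curvature (enormBC (f s) (f g)) ler_pdivlMr ?mulr_gt0//.
rewrite (@le_trans _ _ (a / (8 * d ^+ 3) * (8 * d ^+ 3)))//.
  rewrite ler_wpM2l ?divr_ge0 ?(ltW a0) ?mulr_ge0 ?exprn_ge0 ?(ltW d0)//.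
  rewrite (_ : 8 * d ^+ 3 = 2 * d * (2 * d) * (2 * d)); last by ring.
  by rewrite !ler_pM// ?mulr_ge0 ?enorm_ge0.
rewrite divfK ?mulf_neq0 ?expf_neq0 ?gt_eqF//.
lra.
Qed.

(** Let [a] be the cross product, so [e = a / (16 * d)]. Moving the vertices by [e] costs at most
    [8 * (e * d) = a / 2] in the cross product and keeps the sides below [2 * d], so the curvature
    remains at least [2 * (a / 2) / (2 * d) ^ 3]. *)
Lemma menger_curvature_ge_perturb (f : curve R) (s t g s' t' g' e d : R) : 0 < e -> 0 < d ->
  e <= d / 16 -> 16 * (e * d) = enorm (cross (f t - f s) (f g - f s)) ->
  enorm (f s' - f s) <= e -> enorm (f t' - f t) <= e -> enorm (f g' - f g) <= e ->
  enorm (f t - f s) <= d -> enorm (f g - f s) <= d -> enorm (f g - f t) <= d ->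
  enorm (cross (f t - f s) (f g - f s)) / (8 * d ^+ 3) <= menger_curvature f s' t' g'.
Proof.
move=> e0 d0 ed ea fs ft fg h1 h2 h3.
have XX : enorm (f t' - f s' - (f t - f s)) <= 2 * e.
  rewrite (_ : _ - _ = (f t' - f t) - (f s' - f s)); last by apply: eq_vec3; rewrite !coE; ring.
  by have := ler_enormB (f t' - f t) (f s' - f s); lra.
have YY : enorm (f g' - f s' - (f g - f s)) <= 2 * e.
  rewrite (_ : _ - _ = (f g' - f g) - (f s' - f s)); last by apply: eq_vec3; rewrite !coE; ring.
  by have := ler_enormB (f g' - f g) (f s' - f s); lra.
have ZZ : enorm (f g' - f t' - (f g - f t)) <= 2 * e.
  rewrite (_ : _ - _ = (f g' - f g) - (f t' - f t)); last by apply: eq_vec3; rewrite !coE; ring.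
  by have := ler_enormB (f g' - f g) (f t' - f t); lra.
apply: menger_curvature_ge => //.
- by rewrite -ea !mulr_gt0.
- have := cross_perturb (ltW e0) ed h1 h2 XX YY; rewrite -ea; lra.
- have := lerB_enorm (f t' - f s') (f t - f s); lra.
- have := lerB_enorm (f g' - f s') (f g - f s); lra.
- have := lerB_enorm (f g' - f t') (f g - f t); lra.
Qed.

End Perturbation.

Section FlatTriples.
Context {R : realType}.
Notation mu := (@lebesgue_measure R).
Variables (p L : R) (f : curve R).
Hypotheses (hp : 3 < p) (L0 : 0 < L) (arc : by_arclength f).
Hypothesis fin : (menger_integral p L f < +oo)%E.

Let E := fine (menger_integral p L f).

Lemma menger_integrand_ge0 (g : curve R) s t sg :
  (0 <= ((menger_curvature g s t sg `^ p) *
      enorm (derive1 g s) * enorm (derive1 g t) * enorm (derive1 g sg))%R%:E)%E.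
Proof. by rewrite lee_fin !mulr_ge0 ?enorm_ge0 ?powR_ge0. Qed.

Lemma menger_integral_ge0 (g : curve R) : (0 <= menger_integral p L g)%E.
Proof. by do 3! (apply: integral_ge0 => ? _); exact: menger_integrand_ge0. Qed.

Lemma le_mul_weights (k c w1 w2 w3 : R) : 0 <= k -> k <= c -> 1 <= w1 -> 1 <= w2 -> 1 <= w3 ->
  k <= c * w1 * w2 * w3.
Proof.
move=> k0 kc h1 h2 h3; have c0 := le_trans k0 kc.
have cw1 : c <= c * w1 by rewrite ler_peMr.
have cw2 : c <= c * w1 * w2 by rewrite (le_trans cw1)// ler_peMr// (le_trans c0).
by rewrite (le_trans kc)// (le_trans cw2)// ler_peMr// (le_trans c0).
Qed.

(** By [by_arclength_derive1] the speed weights are at least 1 almost everywhere, so a cube on which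
    the curvature is at least [k] contributes [k ^ p] times its volume. *)
Lemma menger_integral_ge_box (a b c d k : R) : 0 <= a -> 0 <= b -> 0 <= c -> 0 <= d ->
  a + d <= L -> b + d <= L -> c + d <= L -> 0 <= k ->
  (forall s t sg, a <= s <= a + d -> b <= t <= b + d -> c <= sg <= c + d ->
     k <= menger_curvature f s t sg) ->
  ((k `^ p * d ^+ 3)%:E <= menger_integral p L f)%E.
Proof.
move=> a0 b0 c0 d0 aL bL cL k0 H.
have p0 : 0 <= p by rewrite (le_trans _ (ltW hp)).
have AE := by_arclength_derive1 L0 arc.
have kp0 : 0 <= k `^ p by exact: powR_ge0.
have -> : k `^ p * d ^+ 3 = k `^ p * (c + d - c) * (b + d - b) * (a + d - a) by ring.
have ad u : 0 <= u + d - u by rewrite addrC addKr.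
have adu u : u <= u + d by rewrite lerDl.
rewrite /menger_integral.
apply: (ae_integral_ge (c := 0) (d := L) a0 (adu a) aL).
- by rewrite !mulr_ge0.
- by move=> x; do 2! (apply: integral_ge0 => ? _); exact: menger_integrand_ge0.
apply: ae_mono AE => s Ws; rewrite in_itv/= => sI.
have {}Ws : 1 <= enorm (derive1 f s).
  by apply: Ws; rewrite in_itv/=; case/andP: sI => h1 h2; rewrite (le_trans a0 h1) (le_trans h2 aL).
have AE := by_arclength_derive1 L0 arc.
apply: (ae_integral_ge (c := 0) (d := L) b0 (adu b) bL).
- by rewrite !mulr_ge0.
- by move=> x; apply: integral_ge0 => ? _; exact: menger_integrand_ge0.
apply: ae_mono AE => t Wt; rewrite in_itv/= => tI.
have {}Wt : 1 <= enorm (derive1 f t).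
  by apply: Wt; rewrite in_itv/=; case/andP: tI => h1 h2; rewrite (le_trans b0 h1) (le_trans h2 bL).
have AE := by_arclength_derive1 L0 arc.
apply: (ae_integral_ge (c := 0) (d := L) c0 (adu c) cL kp0).
- by move=> x; exact: menger_integrand_ge0.
apply: ae_mono AE => sg Wg; rewrite in_itv/= => gI.
have {}Wg : 1 <= enorm (derive1 f sg).
  by apply: Wg; rewrite in_itv/=; case/andP: gI => h1 h2; rewrite (le_trans c0 h1) (le_trans h2 cL).
rewrite lee_fin; apply: le_mul_weights => //.
by apply: ge0_ler_powR; rewrite ?nnegrE ?menger_curvature_ge0// H.
Qed.

Lemma itv_near_point (s d : R) : 0 <= s <= L -> 0 <= d <= L / 2 ->
  exists a, [/\ 0 <= a, a + d <= L & forall x, a <= x <= a + d -> `|x - s| <= d].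
Proof.
move=> /andP[s0 sL] /andP[d0 dL]; have [sL2|sL2] := leP s (L / 2).
  exists s; split => //; first lra.
  by move=> x /andP[h1 h2]; rewrite ger0_norm; lra.
exists (s - d); split; [lra|lra|].
by move=> x /andP[h1 h2]; rewrite ler0_norm; lra.
Qed.

Let kap := (p - 3) / (p + 3).

(** A cube of side [e = a / (16 * d)] has curvature at least [k = a / (8 * d ^ 3)]. The energy
    bounds [k ^ p * e ^ 3], that is [a ^ (p + 3) <= C * d ^ (3 * p + 3)], and taking the root
    produces the exponent [(3 * p + 3) / (p + 3) = 2 + kap]. *)
Lemma flat_triple : exists2 C, 0 < C & forall s t sg d, 0 <= s <= L -> 0 <= t <= L -> 0 <= sg <= L ->
  0 < d -> enorm (f t - f s) <= d -> enorm (f sg - f s) <= d -> enorm (f sg - f t) <= d ->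
  enorm (cross (f t - f s) (f sg - f s)) <= C * d `^ (2 + kap).
Proof.
have E0 : 0 <= E by rewrite fine_ge0// menger_integral_ge0.
have p3 : 0 < p + 3 by rewrite ltr_wpDl// (le_trans _ (ltW hp)).
pose C := (16 ^+ 3 * 8 `^ p * (E + 1)) `^ (p + 3)^-1.
have C0 : 0 < C by rewrite powR_gt0// !mulr_gt0// ?powR_gt0 ?ltr_wpDl.
exists C => // s t sg d sI tI gI.
(* All chords have length at most [L], so a larger [d] may be replaced by [L]. *)
wlog dL : d / d <= L.
  move=> H d0 h1 h2 h3; have [|/ltW Ld] := leP d L; first by move=> dL; exact: H.
  have lipL u v : 0 <= u <= L -> 0 <= v <= L -> enorm (f u - f v) <= L.
    move=> /andP[u0 uL] /andP[v0 vL]; rewrite (le_trans (by_arclength_lip _ _ arc))//.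
    by rewrite ler_norml; apply/andP; split; move: u0 uL v0 vL; lra.
  rewrite (le_trans (H L (lexx L) L0 _ _ _)) ?lipL// ler_pM2l//.
  apply: ge0_ler_powR => //; rewrite ?nnegrE ?(ltW L0) ?(ltW d0)//.
  by rewrite addr_ge0// divr_ge0// ?(ltW p3)// subr_ge0 ltW.
move=> d0 h1 h2 h3.
set a := enorm (cross _ _).
have [a0|a0] := leP a 0; first by rewrite (le_trans a0)// mulr_ge0 ?powR_ge0// ltW.

pose e := a / (16 * d).
have e0 : 0 < e by rewrite divr_gt0// mulr_gt0.
have ad : a <= d ^+ 2.
  by rewrite (le_trans (enorm_cross_le _ _))// expr2 ler_pM ?enorm_ge0.
have ed : e <= d / 16.
  by rewrite /e ler_pdivrMr ?mulr_gt0// (_ : d / 16 * (16 * d) = d ^+ 2)//; field.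
have eL : 0 <= e <= L / 2.
  by rewrite ltW//=; move: ed dL d0; lra.
have [u1 [u10 u1L u1P]] := itv_near_point sI eL.
have [u2 [u20 u2L u2P]] := itv_near_point tI eL.
have [u3 [u30 u3L u3P]] := itv_near_point gI eL.
have ea : 16 * (e * d) = a by rewrite /e; field; exact: lt0r_neq0.
have key s' t' g' : u1 <= s' <= u1 + e -> u2 <= t' <= u2 + e -> u3 <= g' <= u3 + e ->
    a / (8 * d ^+ 3) <= menger_curvature f s' t' g'.
  move=> /u1P hs /u2P ht /u3P hg.
  have fs : enorm (f s' - f s) <= e by rewrite (le_trans (by_arclength_lip _ _ arc)).
  have ft : enorm (f t' - f t) <= e by rewrite (le_trans (by_arclength_lip _ _ arc)).
  have fg : enorm (f g' - f sg) <= e by rewrite (le_trans (by_arclength_lip _ _ arc)).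
  exact: (menger_curvature_ge_perturb e0 d0 ed ea fs ft fg h1 h2 h3).
have d30 : 0 < d ^+ 3 by rewrite exprn_gt0.
set k := a / (8 * d ^+ 3) in key.
have k0 : 0 < k by rewrite divr_gt0// mulr_gt0.
have := menger_integral_ge_box u10 u20 u30 (ltW e0) u1L u2L u3L (ltW k0) key.
have -> : menger_integral p L f = E%:E.
  by rewrite /E fineK// ge0_fin_numE// menger_integral_ge0.
rewrite lee_fin => kE.
have ak : a = k * (8 * d ^+ 3) by rewrite /k divfK// mulf_neq0// gt_eqF.
have aE : a `^ (p + 3) <= (16 ^+ 3 * 8 `^ p * (E + 1)) * d `^ (3 * p + 3).
  have -> : a `^ (p + 3) = a `^ p * a ^+ 3.
    by rewrite powRD ?(gt_eqF a0) ?implybT// powR_mulrn// ltW.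
  have -> : d `^ (3 * p + 3) = (d ^+ 3) `^ p * d ^+ 3.
    rewrite powRD ?(gt_eqF d0) ?implybT//.
    by rewrite -!(@powR_mulrn _ d 3) ?(ltW d0)// -powRrM.
  have E1 : a `^ p = k `^ p * (8 `^ p * (d ^+ 3) `^ p).
    transitivity ((k * (8 * d ^+ 3)) `^ p); first by congr (_ `^ p).
    have d38 : 0 <= 8 * d ^+ 3 by rewrite mulr_ge0// ltW.
    rewrite (@powRM _ k _ p (ltW k0) d38); congr (_ * _).
    by apply: powRM => //; exact: ltW.
  have E2 : a ^+ 3 = (16 * (e * d)) ^+ 3 by rewrite ea.
  rewrite E1 E2 (_ : k `^ p * (8 `^ p * (d ^+ 3) `^ p) * (16 * (e * d)) ^+ 3 =
     16 ^+ 3 * 8 `^ p * (k `^ p * e ^+ 3) * ((d ^+ 3) `^ p * d ^+ 3)); last by ring.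
  rewrite ler_wpM2r ?mulr_ge0 ?powR_ge0 ?(ltW d0)//.
  rewrite ler_wpM2l ?mulr_ge0 ?powR_ge0//.
  by rewrite (le_trans kE)// lerDl.
have p30 : p + 3 != 0 by rewrite gt_eqF.
have aa : (a `^ (p + 3)) `^ (p + 3)^-1 = a.
  by rewrite -powRrM mulfV// powRr1// ltW.
rewrite -[leLHS]aa.
have -> : C * d `^ (2 + kap) = ((16 ^+ 3 * 8 `^ p * (E + 1)) * d `^ (3 * p + 3)) `^ (p + 3)^-1.
  rewrite [in RHS](@powRM _ _ (d `^ (3 * p + 3))) ?powR_ge0//; last first.
    by rewrite !mulr_ge0 ?powR_ge0 ?addr_ge0.
  rewrite -/C -powRrM; congr (_ * _ `^ _); rewrite /kap.
  by field.
by apply: ge0_ler_powR; rewrite ?nnegrE ?powR_ge0 ?invr_ge0 ?(ltW p3)// (le_trans _ aE)// powR_ge0.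
Qed.

End FlatTriples.

(** * From flat triples to almost parallel chords *)

Section FlatCurves.
Context {R : realType}.
Implicit Types (f : curve R) (L C kap : R).

Definition flat_curve kap C f := forall s t g d, 0 < d ->
  enorm (f t - f s) <= d -> enorm (f g - f s) <= d -> enorm (f g - f t) <= d ->
  enorm (cross (f t - f s) (f g - f s)) <= C * d `^ (2 + kap).

Lemma flat_curve_periodic kap C L f : 0 < L -> periodic f L ->
  (forall s t g d, 0 <= s <= L -> 0 <= t <= L -> 0 <= g <= L -> 0 < d ->
    enorm (f t - f s) <= d -> enorm (f g - f s) <= d -> enorm (f g - f t) <= d ->
    enorm (cross (f t - f s) (f g - f s)) <= C * d `^ (2 + kap)) ->
  flat_curve kap C f.
Proof.
move=> L0 pf H s t g d d0.
have [m /andP[m0 mL]] := floor_reduce s L0.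
have [n /andP[n0 nL]] := floor_reduce t L0.
have [q /andP[q0 qL]] := floor_reduce g L0.
rewrite -(periodic_intP m s pf) -(periodic_intP n t pf) -(periodic_intP q g pf).
by apply: H => //; [rewrite m0 ltW|rewrite n0 ltW|rewrite q0 ltW].
Qed.

Lemma periodic_injective f L u v : 0 < L -> periodic f L -> {in `[0, L[ &, injective f} ->
  `|u - v| < L -> f u = f v -> u = v.
Proof.
move=> L0 pf inj uvL fuv.
have [m /andP[m0 mL]] := floor_reduce u L0.
have [n /andP[n0 nL]] := floor_reduce v L0.
have E : u + m%:~R * L = v + n%:~R * L.
  by apply: inj; rewrite ?in_itv/= ?m0 ?n0// (periodic_intP m u pf) (periodic_intP n v pf).
have E2 : u - v = (n - m)%:~R * L by rewrite intrB mulrBl; lra.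
move: uvL; rewrite E2 normrM (gtr0_norm L0) -ltr_pdivlMr// divff ?gt_eqF//.
rewrite -intr_norm (ltr_int R _ 1) => nm; apply/eqP; rewrite -subr_eq0 E2.
by case: (n - m) nm => [[|k]|k]//; rewrite mul0r.
Qed.

Lemma enorm_chord_continuous f s : continuous f -> continuous (fun u => enorm (f u - f s)).
Proof.
move=> cf x; apply: (@continuous_comp _ _ _ (fun u => f u - f s) (@enorm R)).
  by apply: cvgB; [exact: cf|exact: cvg_cst].
exact: continuous_enorm.
Qed.

Lemma chord_IVT f s t r : continuous f -> 0 <= r <= enorm (f t - f s) ->
  exists u, enorm (f u - f s) = r.
Proof.
move=> cf /andP[r0 rt].
have cfs := continuous_subspaceT (@enorm_chord_continuous f s cf).
have [st|/ltW ts] := leP s t.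
  have [|u _ <-] := @IVT R (fun u => enorm (f u - f s)) s t r st (cfs _).
    by rewrite subrr enorm0 min_l ?enorm_ge0// max_r ?enorm_ge0// r0.
  by exists u.
have [|u _ <-] := @IVT R (fun u => enorm (f u - f s)) t s r ts (cfs _).
  by rewrite subrr enorm0 min_r ?enorm_ge0// max_l ?enorm_ge0// r0.
by exists u.
Qed.

(** Flatness is used at scale [2 * b], with [a <= b] the two chord lengths. As [b <= 2 * a], the
    square [b * b] is at most [2 * a * b], which brings in the product of the chords. *)
Lemma flat_chords_comparable kap C f s t g : 0 < C -> 0 <= kap -> flat_curve kap C f ->
  enorm (f g - f s) <= 2 * enorm (f t - f s) -> enorm (f t - f s) <= enorm (f g - f s) ->
  enorm (cross (f t - f s) (f g - f s)) <=
  C * (2 * 2 `^ (2 + kap)) * enorm (f t - f s) * enorm (f g - f s) * enorm (f g - f s) `^ kap.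
Proof.
move=> C0 k0 fl; set a := enorm (f t - f s); set b := enorm (f g - f s) => b2 ab.
have [b0|b0] := leP b 0.
  rewrite (le_trans (enorm_cross_le _ _))// -/a -/b.
  have -> : b = 0 by apply/le_anti; rewrite b0 enorm_ge0.
  by rewrite !mulr0 mul0r.
have := fl s t g (2 * b); rewrite -/a -/b => /(_ _ _ _ _)/wrap[||||].
- by rewrite mulr_gt0.
- by rewrite (le_trans ab)// ler_peMl ?(ltW b0)// ler1n.
- by rewrite ler_peMl ?(ltW b0)// ler1n.
- rewrite (le_trans (enorm_triangle _ (f s) _))// (enormBC (f s)) -/a -/b.
  by rewrite mulr_natl mulr2n lerD.
move=> h; rewrite (le_trans h)// powRM ?(ltW b0)//.
rewrite (@powRD _ b) ?(gt_eqF b0) ?implybT// (_ : b `^ 2 = b * b); last first.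
  by rewrite -[X in b `^ X]/(2%:R) powR_mulrn ?(ltW b0)// expr2.
have -> : C * (2 * 2 `^ (2 + kap)) * a * b * b `^ kap =
   C * (2 `^ (2 + kap) * ((2 * a * b) * b `^ kap)) by ring.
by rewrite ler_wpM2l ?(ltW C0)// ler_wpM2l ?powR_ge0// ler_wpM2r ?powR_ge0// ler_wpM2r// ltW.
Qed.

Lemma powR_half_lt1 kap : 0 < kap -> (2^-1 : R) `^ kap < 1.
Proof.
move=> k0; have := @gt0_ltr_powR R kap k0 2^-1 1; rewrite powR1; apply; rewrite ?nnegrE//.
by rewrite invf_lt1// ltr1n.
Qed.

(* Chords of comparable length are almost parallel by flatness; the bounds sum geometrically
   along points of the curve at dyadic distances from the base point. *)
Lemma flat_chords_parallel kap C f : 0 < C -> 0 < kap -> continuous f -> flat_curve kap C f ->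
  exists2 K, 0 < K & forall s t g M, enorm (f t - f s) <= M -> enorm (f g - f s) <= M ->
    enorm (cross (f t - f s) (f g - f s)) <=
    K * enorm (f t - f s) * enorm (f g - f s) * M `^ kap.
Proof.
move=> C0 k0 cf fl.
pose C1 := C * (2 * 2 `^ (2 + kap)); pose q : R := 2^-1 `^ kap.
have q1 : q < 1 by exact: powR_half_lt1.
have q0 : 0 < q by rewrite powR_gt0// invr_gt0.
have C10 : 0 < C1 by rewrite !mulr_gt0// powR_gt0.
have {q1} q10 : 0 < 1 - q by rewrite subr_gt0.
(* [K] solves [K * q + C1 = K]: passing through a point at half the distance multiplies the old
   constant by [q] and adds [C1], so the induction reproduces [K]. *)
pose K := C1 / (1 - q).
have K0 : 0 < K by rewrite divr_gt0.
have KE : K * q + C1 = K.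
  by rewrite /K; field; rewrite gt_eqF.
have CK : C1 <= K by rewrite -KE lerDr mulr_ge0 ?ltW.
have step n s t g : enorm (f t - f s) <= enorm (f g - f s) ->
    enorm (f g - f s) <= 2 ^+ n.+1 * enorm (f t - f s) ->
    enorm (cross (f t - f s) (f g - f s)) <=
    K * enorm (f t - f s) * enorm (f g - f s) * enorm (f g - f s) `^ kap.
  elim: n s t g => [|n IH] s t g tg gt.
    rewrite (le_trans (flat_chords_comparable C0 (ltW k0) fl gt tg))//.
    by rewrite -/C1 !ler_wpM2r ?enorm_ge0 ?powR_ge0.
  have [g2|g2] := leP (enorm (f g - f s)) (2 * enorm (f t - f s)).
    by apply: IH => //; rewrite (le_trans g2)// ler_wpM2r ?enorm_ge0// ler_eXnr// ler1n.
  set a := enorm (f t - f s) in tg gt g2 *; set b := enorm (f g - f s) in tg gt g2 *.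
  have a0 : 0 <= a by exact: enorm_ge0.
  have b0 : 0 < b by rewrite (le_lt_trans _ g2)// mulr_ge0.
  have [|u ub] := @chord_IVT f s g (b / 2) cf.
    by rewrite divr_ge0 ?(ltW b0)//= ler_pdivrMr// ler_peMr ?(ltW b0)// ler1n.
  have h1 := IH s t u; rewrite ub -/a in h1.
  have h2 := @flat_chords_comparable kap C f s u g C0 (ltW k0) fl.
  rewrite ub -/b in h2.
  have {}h1 : enorm (cross (f t - f s) (f u - f s)) <= K * a * (b / 2) * (b / 2) `^ kap.
    apply: h1; first by rewrite ler_pdivlMr// mulrC ltW.
    by rewrite ler_pdivrMr// mulrAC -exprSr.
  have {}h2 : enorm (cross (f u - f s) (f g - f s)) <= C1 * (b / 2) * b * b `^ kap.
    apply: h2; first by rewrite mulrC divfK.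
    by rewrite ler_pdivrMr// ler_peMr ?(ltW b0)// ler1n.
  have := enorm_cross_triangle (f t - f s) (f u - f s) (f g - f s).
  rewrite ub -/a -/b => h3.
  rewrite -(@ler_pM2r _ (b / 2)) ?divr_gt0// (le_trans h3)//.
  rewrite powRM ?(ltW b0) ?invr_ge0// -/q in h1.
  rewrite (@le_trans _ _ ((K * a * (b / 2) * (b `^ kap * q)) * b + a * (C1 * (b / 2) * b * b `^ kap)))//.
    by apply: lerD; [rewrite ler_wpM2r ?(ltW b0)|rewrite ler_wpM2l].
  rewrite (_ : _ + _ = (K * q + C1) * a * b * b `^ kap * (b / 2)); last by ring.
  by rewrite KE.
have pow2 (x y : R) : 0 < x -> exists n, y <= 2 ^+ n.+1 * x.
  move=> x0; exists (Num.bound (y / x)).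
  rewrite -ler_pdivrMr// ltW//.
  exact: (upper_nthrootP (leqnSn (Num.bound (y / x)))).
have Kp x y : 0 <= K * enorm x * enorm y.
  by rewrite mulr_ge0 ?enorm_ge0// mulr_ge0 ?enorm_ge0// ltW.
have sym s t g M : enorm (f t - f s) <= enorm (f g - f s) -> enorm (f g - f s) <= M ->
    enorm (cross (f t - f s) (f g - f s)) <=
    K * enorm (f t - f s) * enorm (f g - f s) * M `^ kap.
  move=> tg gM; have [t0|t0] := leP (enorm (f t - f s)) 0.
    rewrite (le_trans (enorm_cross_le _ _))//.
    have -> : enorm (f t - f s) = 0 by apply/le_anti; rewrite t0 enorm_ge0.
    by rewrite mulr0 !mul0r.
  have [n hn] := pow2 _ (enorm (f g - f s)) t0.
  rewrite (le_trans (step _ _ _ _ tg hn))// ler_wpM2l ?Kp//.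
  by apply: ge0_ler_powR; rewrite ?nnegrE ?(ltW k0) ?enorm_ge0// (le_trans (enorm_ge0 _) gM).
exists K => // s t g M tM gM.
have [tg|/ltW gt] := leP (enorm (f t - f s)) (enorm (f g - f s)); first exact: sym.
by rewrite enorm_crossC (mulrAC K); exact: sym.
Qed.

End FlatCurves.

(** * Tangent lines and Hölder continuity of the tangent *)

Section Tangent.
Context {R : realType}.
Implicit Types (f : curve R) (L K kap al r : R).

Definition parallel_chords kap K f := forall s t g M, enorm (f t - f s) <= M ->
  enorm (f g - f s) <= M ->
  enorm (cross (f t - f s) (f g - f s)) <= K * enorm (f t - f s) * enorm (f g - f s) * M `^ kap.

(** The chord from [t] to [g] and the axis from [s] to [w] are both almost parallel to the chord
    from [t] to [w], which has length at least [3 * r]; [enorm_cross_triangle] adds the two errors.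
    Every chord involved has length at most [5 * r]. *)
Lemma parallel_to_axis kap K f s t g w r : 0 < K -> 0 <= kap -> parallel_chords kap K f ->
  0 < r -> enorm (f t - f s) <= r -> enorm (f g - f s) <= r -> enorm (f w - f s) = 4 * r ->
  enorm (cross (f g - f t) ((4 * r)^-1 *: (f w - f s))) <=
  2 * K * (5 * r) `^ kap * enorm (f g - f t).
Proof.
move=> K0 k0 pc r0 tr gr wr.
pose z := f g - f t; pose v := f w - f t; pose q := (5 * r) `^ kap.
have q0 : 0 <= q by exact: powR_ge0.
have vle : enorm v <= 5 * r.
  rewrite /v (le_trans (enorm_triangle _ (f s) _))// wr (enormBC (f s)).
  by rewrite (_ : 5 * r = 4 * r + r) ?lerD2l//; ring.
have vge : 3 * r <= enorm v.
  have := lerB_enorm (f w - f s) (f t - f s); rewrite wr.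
  have -> : f w - f s - (f t - f s) = v by apply: eq_vec3; rewrite !coE; ring.
  by lra.
have v0 : 0 < enorm v by rewrite (lt_le_trans _ vge)// mulr_gt0.
have zle : enorm z <= 5 * r.
  rewrite /z (le_trans (enorm_triangle _ (f s) _))// (enormBC (f s)); lra.
have h1 : enorm (cross z v) <= K * enorm z * enorm v * q by exact: pc.
have h2 : enorm (cross (f t - f w) (f s - f w)) <=
    K * enorm (f t - f w) * enorm (f s - f w) * q.
  apply: pc; first by rewrite enormBC.
  by rewrite enormBC wr ler_wpM2r ?(ltW r0)// ler_nat.
have r4 : 0 < 4 * r by rewrite mulr_gt0.
have e1 : enorm ((4 * r)^-1 *: (f w - f s)) = 1.
  by rewrite enormZ wr ger0_norm ?invr_ge0 ?(ltW r4)// mulVf// gt_eqF.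
have {}h2 : enorm (cross v ((4 * r)^-1 *: (f w - f s))) <= K * enorm v * q.
  rewrite crossZr enormZ ger0_norm ?invr_ge0 ?(ltW r4)// ler_pdivrMl//.
  move: h2; rewrite -(opprB (f w) (f t)) -(opprB (f w) (f s)) crossNl crossNr opprK.
  rewrite !enormN wr -/v; congr (_ <= _); ring.
have := enorm_cross_triangle z v ((4 * r)^-1 *: (f w - f s)).
rewrite e1 mulr1 => h3.
rewrite -(ler_pM2r v0) (le_trans h3)//.
rewrite (@le_trans _ _ (K * enorm z * enorm v * q + enorm z * (K * enorm v * q)))//.
  by apply: lerD => //; rewrite ler_wpM2l ?enorm_ge0.
by rewrite -/q -/z le_eqVlt; apply/orP; left; apply/eqP; ring.
Qed.

(** The squared component along [e] is [|z| ^ 2] minus the squared cross product, and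
    [(1 - eta) ^ 2 <= 1 - eta ^ 2]. *)
Lemma near_axis (z e : 'rV[R]_3) (eta : R) : 0 <= eta <= 1 -> enorm e = 1 ->
  enorm (cross z e) <= eta * enorm z -> (1 - eta) * enorm z <= `|dot z e|.
Proof.
move=> /andP[n0 n1] e1 h; have := lagrange z e; rewrite e1 expr1n mulr1 => E.
rewrite -(@ler_pXn2r _ 2)// ?nnegrE ?mulr_ge0 ?enorm_ge0 ?subr_ge0//.
rewrite real_normK ?num_real//.
have : enorm (cross z e) ^+ 2 <= (eta * enorm z) ^+ 2.
  by rewrite ler_pXn2r// nnegrE ?mulr_ge0 ?enorm_ge0.
rewrite E !exprMn => h2.
have : (1 - eta) ^+ 2 * enorm z ^+ 2 <= (1 - eta ^+ 2) * enorm z ^+ 2.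
  rewrite ler_wpM2r ?sqr_ge0//; nra.
by rewrite mulrBl mul1r; lra.
Qed.

(** Expanding the square bounds it by [2 h ^ 2 - 2 h (z . e) <= 2 eta h ^ 2]. The square root is
    what halves the Hölder exponent. *)
Lemma chord_near_direction (z e : 'rV[R]_3) (h eta : R) : enorm e = 1 -> 0 <= h ->
  enorm z <= h -> (1 - eta) * h <= dot z e ->
  enorm (z - h *: e) <= Num.sqrt (2 * eta) * h.
Proof.
move=> e1 h0 zh hd; have [h00|hn0] := eqVneq h 0.
  by move: zh; rewrite h00 mulr0 scale0r subr0.
have hp : 0 < h by rewrite lt_neqAle eq_sym hn0.
have eta0 : 0 <= eta.
  have := dot_le z e; rewrite e1 mulr1 => d1.
  have : (1 - eta) * h <= 1 * h by rewrite mul1r; lra.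
  by rewrite ler_pM2r// gerBl.
rewrite -(@ler_pXn2r _ 2)// ?nnegrE ?mulr_ge0 ?enorm_ge0 ?sqrtr_ge0//.
rewrite sqr_enormB dotZr enormZ e1 mulr1 ger0_norm// exprMn (sqr_sqrtr (mulr_ge0 (ler0n _ 2) eta0)).
have : enorm z ^+ 2 <= h ^+ 2 by rewrite ler_pXn2r// nnegrE ?enorm_ge0.
have : h * ((1 - eta) * h) <= h * dot z e by rewrite ler_wpM2l.
have -> : h * ((1 - eta) * h) = h ^+ 2 - eta * h ^+ 2 by ring.
lra.
Qed.

(** On each short interval a single vector [e] is the slope of all chords up to the error
    [K * r ^ al]. [P] requires norm 1 for the arclength curve and nothing for perturbation fields,
    which share the results on derivatives. *)
Definition axis_curve (P : 'rV[R]_3 -> Prop) al K r0 f := forall s r, 0 < r -> r <= r0 -> exists2 e, P e &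
  forall t g, s - r <= t -> t <= g -> g <= s + r ->
    enorm (f g - f t - (g - t) *: e) <= K * r `^ al * (g - t).

(** Projection to the axis through a point at distance [4 * r] loses at most the factor [1 - eta] on
    each chord, so it is injective and hence monotone on the interval. Its increments then control
    all chords, and [by_arclength_le] makes them at least [(1 - eta) * (g - t)]: every chord is
    almost as long as its parameter interval in the direction of the axis. *)
Lemma parallel_chords_axis kap K L f : 0 < L -> 0 < K -> 0 < kap -> continuous f ->
  periodic f L -> {in `[0, L[ &, injective f} -> by_arclength f -> parallel_chords kap K f ->
  exists K' r0, [/\ 0 < K', 0 < r0 & axis_curve (fun e => enorm e = 1) (kap / 2) K' r0 f].
Proof.
move=> L0 K0 k0 cf pf inj arc pc.
(* By the triangle inequality every point of the curve has distance at least [R0] from [f 0] or from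
   [f (L / 2)], so an axis point at distance [4 * r <= R0] exists everywhere. *)
pose R0 := enorm (f (L / 2) - f 0) / 2.
have R00 : 0 < R0.
  rewrite divr_gt0// enorm_gt0 subr_eq0; apply/eqP => E.
  have := periodic_injective L0 pf inj _ E; rewrite subr0 ger0_norm ?divr_ge0 ?(ltW L0)//.
  rewrite ltr_pdivrMr// ltr_pMr// ltr1n => /(_ isT) /eqP.
  by rewrite mulf_eq0 invr_eq0 gt_eqF//= pnatr_eq0.
have far s : exists u, R0 <= enorm (f u - f s).
  have [h|h] := leP R0 (enorm (f 0 - f s)); first by exists 0.
  exists (L / 2); have := enorm_triangle (f (L / 2)) (f s) (f 0).
  rewrite (enormBC (f s) (f 0)) (_ : enorm (f (L / 2) - f 0) = R0 + R0); first by lra.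
  by rewrite /R0 -splitr.
pose A := 2 * K * 5 `^ kap.
have A0 : 0 < A by rewrite !mulr_gt0// powR_gt0.
(* Chosen so that [eta = A * r ^ kap] is at most 1/2 for [r <= r1]. *)
pose r1 := (2 * A)^-1 `^ kap^-1.
have r10 : 0 < r1 by rewrite powR_gt0// invr_gt0 mulr_gt0.
pose r0 := Num.min r1 (Num.min (R0 / 4) (L / 4)).
have r00 : 0 < r0 by rewrite !lt_min r10/=; apply/andP; split; rewrite divr_gt0.
exists (Num.sqrt (2 * A)), r0; split => //; first by rewrite sqrtr_gt0 mulr_gt0.
move=> s r rp rr0.
have rr1 : r <= r1 by rewrite (le_trans rr0)// ge_min lexx.
have rR : 4 * r <= R0.
  by rewrite mulrC -ler_pdivlMr// (le_trans rr0)// ge_min ge_min lexx orbT.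
have rL : 4 * r <= L.
  by rewrite mulrC -ler_pdivlMr// (le_trans rr0)// ge_min ge_min lexx !orbT.
have [u hu] := far s.
have [|w wr] := @chord_IVT _ f s u (4 * r) cf.
  by rewrite mulr_ge0 ?(ltW rp)// (le_trans rR).
pose e := (4 * r)^-1 *: (f w - f s).
have r4 : 0 < 4 * r by rewrite mulr_gt0.
have e1 : enorm e = 1.
  by rewrite enormZ wr ger0_norm ?invr_ge0 ?(ltW r4)// mulVf// gt_eqF.
pose eta := A * r `^ kap.
have eta0 : 0 <= eta by rewrite mulr_ge0 ?powR_ge0// ltW.
have eta2 : eta <= 2^-1.
  have : r `^ kap <= (2 * A)^-1.
    have -> : (2 * A)^-1 = r1 `^ kap.
      by rewrite /r1 -powRrM mulVf ?gt_eqF// powRr1// invr_ge0 mulr_ge0 ?(ltW A0).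
    by apply: ge0_ler_powR; rewrite ?nnegrE ?(ltW k0) ?(ltW rp) ?(ltW r10).
  by move=> h; rewrite /eta -ler_pdivlMl// -invfM mulrC in h *.
have inI t : s - r <= t -> t <= s + r -> enorm (f t - f s) <= r.
  by move=> h1 h2; rewrite (le_trans (by_arclength_lip _ _ arc))// ler_distl h1 h2.
have ax t g : s - r <= t -> t <= s + r -> s - r <= g -> g <= s + r ->
    (1 - eta) * enorm (f g - f t) <= `|dot (f g) e - dot (f t) e|.
  move=> t1 t2 g1 g2.
  have -> : dot (f g) e - dot (f t) e = dot (f g - f t) e by rewrite dotDl dotNl.
  apply: near_axis => //; first by rewrite eta0 (le_trans eta2)// invf_le1// ler1n.
  have := parallel_to_axis K0 (ltW k0) pc rp (inI t t1 t2) (inI g g1 g2) wr.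
  rewrite powRM ?(ltW rp)//; congr (_ <= _).
  by rewrite /eta /A; ring.
have phiinj : {in `[s - r, s + r] &, injective (fun t => dot (f t) e)}.
  move=> t g; rewrite !in_itv/= => /andP[t1 t2] /andP[g1 g2] E.
  have := ax t g t1 t2 g1 g2; rewrite E subrr normr0 pmulr_rle0; last first.
    by rewrite subr_gt0 (le_lt_trans eta2)// invf_lt1// ltr1n.
  move=> fgt; apply/esym; apply: (periodic_injective L0 pf inj); last first.
    by apply/eqP; rewrite -subr_eq0 -enorm_eq0 eq_le fgt enorm_ge0.
  by rewrite ltr_norml; apply/andP; split; lra.
have cphi : {within `[s - r, s + r], continuous (fun t => dot (f t) e)}.
  apply: continuous_subspaceT => t.
  have -> : (fun t => dot (f t) e) =
      (fun t => co 0 (f t) * co 0 e + co 1 (f t) * co 1 e + co 2 (f t) * co 2 e).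
    by apply/funext => x; rewrite dotE.
  have cc i : {for t, continuous (fun t => co i (f t) * co i e)}.
    apply: cvgM; last exact: cvg_cst.
    by apply: (@continuous_comp _ _ _ f (@co R i)); [exact: cf|exact: continuous_co].
  by apply: cvgD; [apply: cvgD|]; exact: cc.
(* The curve may run along the axis in either sense; [sgn] makes the projection nondecreasing. *)
pose sgn : R := if dot (f (s - r)) e <= dot (f (s + r)) e then 1 else -1.
have sg1 : `|sgn| = 1 by rewrite /sgn; case: ifP; rewrite ?normrN normr1.
have mono t g : s - r <= t -> t <= g -> g <= s + r ->
    `|dot (f g) e - dot (f t) e| = sgn * (dot (f g) e - dot (f t) e).
  move=> t1 tg g2; rewrite /sgn; case: ifPn => hs.
    rewrite mul1r ger0_norm// subr_ge0.
    have := segment_continuous_inj_le hs cphi phiinj.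
    by move=> ->; rewrite ?in_itv/= ?t1 ?g2 ?(le_trans t1) ?(le_trans tg).
  rewrite mulN1r ler0_norm// subr_le0.
  have hs' : dot (f (s + r)) e <= dot (f (s - r)) e by rewrite ltW// ltNge.
  have := segment_continuous_inj_ge hs' cphi phiinj.
  by move=> ->; rewrite ?in_itv/= ?t1 ?g2 ?(le_trans t1) ?(le_trans tg).
exists (sgn *: e); first by rewrite enormZ sg1 e1 mulr1.
move=> t g t1 tg g2.
have eta10 : 0 < 1 - eta by rewrite subr_gt0 (le_lt_trans eta2)// invf_lt1// ltr1n.
have len : (1 - eta) * (g - t) <= dot (f g - f t) (sgn *: e).
  rewrite dotZr dotDl dotNl mulrC -ler_pdivlMr//.
  have -> : sgn * (dot (f g) e - dot (f t) e) / (1 - eta) =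
    (sgn / (1 - eta)) * dot (f g) e - (sgn / (1 - eta)) * dot (f t) e by ring.
  apply: (by_arclength_le (G := fun x => sgn / (1 - eta) * dot (f x) e) arc) => // a b ta ab bg.
  have a1 := le_trans t1 ta; have b2 := le_trans bg g2.
  rewrite -mulrBr mulrAC ler_pdivlMr// mulrC -mono// ax//; first exact: le_trans ab b2.
  exact: le_trans a1 ab.
have h0 : 0 <= g - t by rewrite subr_ge0.
have fl : enorm (f g - f t) <= g - t.
  by rewrite (le_trans (by_arclength_lip _ _ arc))// ger0_norm.
have se1 : enorm (sgn *: e) = 1 by rewrite enormZ sg1 e1 mulr1.
rewrite (le_trans (chord_near_direction se1 h0 fl len))//.
rewrite /eta mulrA sqrtrM ?mulr_ge0 ?(ltW A0) ?(ltW K0)//.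
by rewrite -(powR12_sqrt (powR_ge0 r kap)) -powRrM.
Qed.

End Tangent.

#[local] Opaque enorm cross dot co.

Section TangentVector.
Context {R : realType}.
Implicit Types (f : curve R) (L K kap al r : R).

Lemma quotient_bound (z e : 'rV[R]_3) (h B : R) : h != 0 ->
  enorm (z - h *: e) <= B * `|h| -> enorm (h^-1 *: z - e) <= B.
Proof.
move=> h0 hz; have -> : h^-1 *: z - e = h^-1 *: (z - h *: e).
  by rewrite scalerBr scalerA mulVf// scale1r.
by rewrite enormZ normfV ler_pdivrMl ?normr_gt0// mulrC.
Qed.

Lemma axis_quotient al K r0 f s r e : 0 < r -> 
  (forall t g, s - r <= t -> t <= g -> g <= s + r ->
    enorm (f g - f t - (g - t) *: e) <= K * r `^ al * (g - t)) ->
  forall t h, h != 0 -> s - r <= t <= s + r -> s - r <= h + t <= s + r ->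
    enorm (h^-1 *: (f (h + t) - f t) - e) <= K * r `^ al.
Proof.
move=> r00 He t h h0 /andP[t1 t2] /andP[h1 h2]; apply: quotient_bound => //.
have [hp|hn] := leP 0 h.
  have := He t (h + t) t1 _ h2; rewrite addrK (ger0_norm hp); apply.
  by rewrite lerDr.
have := He (h + t) t h1 _ t2; rewrite (ltr0_norm hn) opprD addrCA subrr addr0 => H.
rewrite -enormN (le_trans _ (H _))//; last by rewrite gerDr ltW.
by rewrite le_eqVlt; apply/orP; left; apply/eqP; congr enorm; apply: eq_vec3; rewrite !coE; ring.
Qed.

Lemma powR_small K al (eps : R) : 0 < al -> 0 < eps ->
  exists2 r, 0 < r & K * r `^ al <= eps.
Proof.
move=> al0 e0; have [K0|K0] := leP K 0.
  by exists 1 => //; rewrite powR1 mulr1 (le_trans K0)// ltW.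
exists ((eps / K) `^ al^-1); first by rewrite powR_gt0// divr_gt0.
rewrite -powRrM mulVf ?gt_eqF// powRr1 ?divr_ge0 ?(ltW e0) ?(ltW K0)//.
by rewrite mulrCA mulfV ?gt_eqF// mulr1.
Qed.

(** By [axis_quotient] all difference quotients at scale [r] lie within [K * r ^ al] of one vector,
    which is the Cauchy criterion. *)
Lemma axis_derivable P al K r0 f s : 0 < al -> 0 <= K -> 0 < r0 -> axis_curve P al K r0 f ->
  derivable f s (1 : R).
Proof.
move=> al0 K0 r00 ax.
suff : cvg (h^-1 *: (f (h + s) - f s) @[h --> 0^']).
  rewrite /derivable (_ : (fun h => _) = (fun h => h^-1 *: (f (h + s) - f s)))//.
  by apply/funext => h /=; rewrite /GRing.scale/= mulr1.
apply/cauchy_cvgP; apply: cauchy_exP => eps eps0.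
have [r' r'0 hr'] := @powR_small K al (eps / 2) al0 (divr_gt0 eps0 (ltr0n _ 2)).
pose r := Num.min r' r0.
have rp : 0 < r by rewrite lt_min r'0.
have [|e e1 He] := ax s r rp; first by rewrite ge_min lexx orbT.
exists e; rewrite /fmapE/= nbhs_filterE/=.
near=> h; rewrite /= -ball_normE/=.
have h0 : h != 0 by near: h; exact: nbhs_dnbhs_neq.
have hr : `|h| < r by near: h; apply: dnbhs0_lt.
rewrite distrC (le_lt_trans (normr_le_enorm _))//.
rewrite (le_lt_trans (axis_quotient r0 rp He h0 _ _))//.
- by rewrite gerDl oppr_le0 lerDl (ltW rp).
- by move: hr; rewrite ltr_norml => /andP[a b]; apply/andP; split; lra.
rewrite (@le_lt_trans _ _ (eps / 2))//; last by rewrite gtr_pMr// invf_lt1// ltr1n.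
rewrite (le_trans _ hr')// ler_wpM2l// ge0_ler_powR ?nnegrE ?(ltW al0) ?(ltW rp) ?(ltW r'0)//.
by rewrite ge_min lexx.
Unshelve. all: by end_near. Qed.

Lemma derive1_near_bound f s (e : 'rV[R]_3) B d : 0 < d -> derivable f s (1 : R) ->
  (forall h, h != 0 -> `|h| < d -> enorm (h^-1 *: (f (h + s) - f s) - e) <= B) ->
  enorm (derive1 f s - e) <= B.
Proof.
move=> d0 /derivable1_cvg cv hB.
have cv2 : enorm (h^-1 *: (f (h + s) - f s) - e) @[h --> 0^'] --> enorm (derive1 f s - e).
  apply: (@cvg_comp _ _ _ (fun h => h^-1 *: (f (h + s) - f s) - e) (@enorm R) _
    (nbhs (derive1 f s - e))); last exact: continuous_enorm.
  by apply: cvgB => //; exact: cvg_cst.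
apply: (cvgr_to_le cv2).
near=> h; apply: hB; first by near: h; exact: nbhs_dnbhs_neq.
by near: h; apply: dnbhs0_lt.
Unshelve. all: by end_near. Qed.

Lemma axis_derive1_near P al K r0 f s r : 0 < al -> 0 <= K -> axis_curve P al K r0 f -> 0 < r -> r <= r0 ->
  exists2 e, P e & forall t, `|t - s| < r ->
    enorm (derive1 f t - e) <= K * r `^ al /\
    enorm (f t - f s - (t - s) *: e) <= K * r `^ al * `|t - s|.
Proof.
move=> al0 K0 ax rp rr0; have r00 := lt_le_trans rp rr0.
have [e e1 He] := ax s r rp rr0; exists e => // t ht; split.
  apply: (@derive1_near_bound _ _ _ _ (r - `|t - s|)); first by rewrite subr_gt0.
    exact: (axis_derivable al0 K0 r00 ax).
  move=> h h0 hr; apply: (axis_quotient r0 rp He h0).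
    by rewrite -ler_distl ltW.
  rewrite -ler_distl (_ : h + t - s = h + (t - s)); last by ring.
  by rewrite (le_trans (ler_normD _ _))// -lerBrDr ltW.
have [->|ts] := eqVneq t s; first by rewrite !subrr scale0r subr0 enorm0 normr0 mulr0.
have ts0 : t - s != 0 by rewrite subr_eq0.
have := axis_quotient r0 rp He ts0 (t := s).
rewrite subrK gerDl oppr_le0 lerDl (ltW rp) -ler_distl (ltW ht) => /(_ isT isT) H.
rewrite -(scalerKV ts0 (f t - f s)) -scalerBr enormZ mulrC.
by rewrite ler_pM2r ?normr_gt0.
Qed.

Lemma axis_continuous_derive1 P al K r0 f : 0 < al -> 0 <= K -> 0 < r0 -> axis_curve P al K r0 f ->
  continuous (derive1 f).
Proof.
move=> al0 K0 r00 ax s; apply/enorm_cvgP/cvgr0Pnorm_lt => eps eps0.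
have [r' r'0 hr'] := @powR_small K al (eps / 4) al0 (divr_gt0 eps0 (ltr0n _ 4)).
pose r := Num.min r' r0.
have rp : 0 < r by rewrite lt_min r'0.
have rr : r <= r0 by rewrite ge_min lexx orbT.
have h1 : K * r `^ al <= eps / 4.
  rewrite (le_trans _ hr')// ler_wpM2l//.
  rewrite ge0_ler_powR ?nnegrE ?(ltW al0) ?(ltW rp) ?(ltW r'0)//.
  by rewrite ge_min lexx.
have h2 : K * r `^ al + K * r `^ al < eps by move: h1 eps0; move: (_ * _) => w; lra.
have [e _ He] := @axis_derive1_near P al K r0 f s r al0 K0 ax rp rr.
have [|hs _] := He s; first by rewrite subrr normr0.
near=> t; rewrite ger0_norm ?enorm_ge0//.
have [|ht _] := He t; first by near: t; exists r => //= t; rewrite distrC.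
apply: (le_lt_trans (enorm_triangle _ e _)); rewrite (enormBC e).
exact: (le_lt_trans (lerD ht hs)).
Unshelve. all: by end_near. Qed.

Definition holder_tangent al K f := [/\ forall s, derivable f s (1 : R),
  forall s, enorm (derive1 f s) = 1,
  forall s t, enorm (derive1 f t - derive1 f s) <= K * `|t - s| `^ al &
  forall s t, enorm (f t - f s - (t - s) *: derive1 f s) <= K * `|t - s| `^ al * `|t - s|].

(** Parameters closer than [r0 / 2] are compared through the axis at scale [2 * |t - s|]; for
    distant ones the trivial bounds for unit tangents suffice. *)
Lemma axis_holder_tangent al K r0 f : 0 < al -> 0 < K -> 0 < r0 -> by_arclength f ->
  axis_curve (fun e => enorm e = 1) al K r0 f -> exists2 K', 0 < K' & holder_tangent al K' f.
Proof.
move=> al0 K0 r00 arc ax.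
have der s : derivable f s (1 : R) by exact: (axis_derivable al0 (ltW K0) r00 ax).
have T1 s : enorm (derive1 f s) = 1.
  apply/eqP; rewrite -subr_eq0 -normr_le0; apply/ler_addgt0Pl => eps eps0; rewrite addr0.
  have [r' r'0 hr'] := @powR_small K al eps al0 eps0.
  pose r := Num.min r' r0.
  have rp : 0 < r by rewrite lt_min r'0.
  have [|e e1 He] := @axis_derive1_near _ al K r0 f s r al0 (ltW K0) ax rp.
    by rewrite ge_min lexx orbT.
  have [|h _] := He s; first by rewrite subrr normr0.
  have h1 : K * r `^ al <= eps.
    rewrite (le_trans _ hr')// ler_wpM2l ?(ltW K0)//.
    rewrite ge0_ler_powR ?nnegrE ?(ltW al0) ?(ltW rp) ?(ltW r'0)//.
    by rewrite ge_min lexx.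
  have := lerB_enorm (derive1 f s) e; have := lerB_enorm e (derive1 f s).
  rewrite (enormBC e) e1 ler_norml => h3 h4; apply/andP; split; lra.
pose K1 := 2 * K * 2 `^ al.
(* Makes [K2 * x ^ al] at least 2 as soon as [x >= r0 / 2]. *)
pose K2 := 2 * (r0 / 2) `^ (- al).
have K10 : 0 < K1 by rewrite !mulr_gt0// powR_gt0.
have K20 : 0 < K2 by rewrite mulr_gt0// powR_gt0// divr_gt0.
have E x : K1 * x = K * (2 `^ al * x) + K * (2 `^ al * x) by rewrite /K1; ring.
have K2P x : r0 / 2 <= x -> 2 <= K2 * x `^ al.
  move=> xr; rewrite /K2 powRN -mulrA -{1}(mulr1 2) ler_pM2l// ler_pdivlMl ?powR_gt0 ?divr_gt0// mulr1.
  have x0 : 0 <= x by rewrite (le_trans _ xr)// divr_ge0// ltW.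
  by rewrite ge0_ler_powR ?nnegrE ?(ltW al0)// ?divr_ge0 ?(ltW r00).
clearbody K1 K2.
have loc s t : t != s -> `|t - s| < r0 / 2 ->
    enorm (derive1 f t - derive1 f s) <= K1 * `|t - s| `^ al /\
    enorm (f t - f s - (t - s) *: derive1 f s) <= K1 * `|t - s| `^ al * `|t - s|.
  move=> ts tr; have ts0 : 0 < `|t - s| by rewrite normr_gt0 subr_eq0.
  have [||e e1 He] := @axis_derive1_near _ al K r0 f s (2 * `|t - s|) al0 (ltW K0) ax.
  - by rewrite mulr_gt0.
  - by rewrite mulrC -ler_pdivlMr// ltW.
  have [|h1 h2] := He t; first by rewrite ltr_pMl// ltr1n.
  have [|h3 _] := He s; first by rewrite subrr normr0 mulr_gt0.
  rewrite powRM// ?(ltW ts0)// in h1 h2 h3.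
  split.
    by apply: (le_trans (enorm_triangle _ e _)); rewrite E; apply: lerD; [exact: h1|rewrite enormBC; exact: h3].
  have -> : f t - f s - (t - s) *: derive1 f s =
      (f t - f s - (t - s) *: e) + (t - s) *: (e - derive1 f s).
    by apply: eq_vec3; rewrite !coE; ring.
  apply: (le_trans (ler_enormD _ _)); rewrite E mulrDl; apply: lerD => //.
  by rewrite enormZ mulrC ler_wpM2r// enormBC.
have glob s t : t != s -> r0 / 2 <= `|t - s| ->
    enorm (derive1 f t - derive1 f s) <= K2 * `|t - s| `^ al /\
    enorm (f t - f s - (t - s) *: derive1 f s) <= K2 * `|t - s| `^ al * `|t - s|.
  move=> ts tr.
  have h2 := K2P _ tr.
  split.
    by rewrite (le_trans (ler_enormB _ _))// !T1.
  rewrite (le_trans (ler_enormB _ _))// enormZ T1 mulr1.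
  rewrite (@le_trans _ _ (2 * `|t - s|))// ?ler_wpM2r//.
  by rewrite mulr_natl mulr2n lerD2r (by_arclength_lip _ _ arc).
exists (K1 + K2); first by rewrite addr_gt0.
have both s t : enorm (derive1 f t - derive1 f s) <= (K1 + K2) * `|t - s| `^ al /\
    enorm (f t - f s - (t - s) *: derive1 f s) <= (K1 + K2) * `|t - s| `^ al * `|t - s|.
  have [->|ts] := eqVneq t s.
    by rewrite !subrr scale0r subr0 enorm0 normr0 powR0 ?gt_eqF// !mulr0.
  have [tr|tr] := ltP `|t - s| (r0 / 2).
    have [h1 h2] := loc s t ts tr; split.
      by rewrite (le_trans h1)// ler_wpM2r ?powR_ge0// lerDl ltW.
    by rewrite (le_trans h2)// !ler_wpM2r ?powR_ge0// lerDl ltW.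
  have [h1 h2] := glob s t ts tr; split.
    by rewrite (le_trans h1)// ler_wpM2r ?powR_ge0// lerDr ltW.
  by rewrite (le_trans h2)// !ler_wpM2r ?powR_ge0// lerDr ltW.
by split => // s t; have [] := both s t.
Qed.

Lemma holder_tangent_continuous al K f : 0 < al -> holder_tangent al K f ->
  continuous (derive1 f).
Proof.
move=> al0 [_ _ H _] s; apply/enorm_cvgP; apply/cvgr0Pnorm_lt => eps eps0.
have [r r0 hr] := @powR_small K al (eps / 2) al0 (divr_gt0 eps0 (ltr0n _ 2)).
near=> t; rewrite ger0_norm ?enorm_ge0// (le_lt_trans (H _ _))//.
have tr : `|t - s| < r by near: t; exact: (@cvgr_distC_lt _ _ _ _ _ id s).
have [K0|K0] := leP K 0; first by rewrite (le_lt_trans _ eps0)// mulr_le0_ge0 ?powR_ge0.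
rewrite (@le_lt_trans _ _ (eps / 2))//; last by rewrite gtr_pMr// invf_lt1// ltr1n.
rewrite (le_trans _ hr)// ler_wpM2l ?(ltW K0)// ge0_ler_powR ?nnegrE ?(ltW al0) ?(ltW r0)//.
Unshelve. all: by end_near. Qed.

End TangentVector.

(** * A Hardy inequality by dilation and absorption *)

Section HardyInequality.
Context {R : realType}.
Notation mu := (@lebesgue_measure R).
Implicit Types (p al K d e : R).

Lemma measurable_EFin_fun (D : set R) (g : R -> R) : measurable_fun setT g ->
  measurable_fun D (fun x => (g x)%:E).
Proof. by move=> mg; apply/measurable_EFinP; exact: measurable_funTS. Qed.

(** Monotone convergence along the intervals [[d / n.+1, d]], which exhaust []0, d]]. *)
Lemma ge0_integral_itv_eps (F : R -> \bar R) d (B : \bar R) : 0 < d ->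
  measurable_fun setT F -> (forall x, 0 <= F x)%E ->
  (forall e, 0 < e -> e <= d -> (\int[mu]_(x in `[e, d]) F x <= B)%E) ->
  (\int[mu]_(x in `[0%R, d]) F x <= B)%E.
Proof.
move=> d0 mF F0 hB.
have mFD (D : set R) : measurable D -> measurable_fun D F.
  by move=> mD; apply: measurable_funS mF.
rewrite -(@integral_itv_obnd_cbnd _ 0 (BRight d) F); last exact: mFD.
have dn0 n : 0 < d / n.+1%:R :> R by rewrite divr_gt0.
pose A n := `[d / n.+1%:R, d]%classic.
have -> : `]0%R, d]%classic = \bigcup_n A n.
  apply/seteqP; split => x /=; rewrite in_itv/=.
    move=> /andP[x0 xd]; exists (Num.truncn (d / x)) => //.
    rewrite /A/= in_itv/= xd andbT ler_pdivrMr// mulrC -ler_pdivrMr// ltW//.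
    exact: truncnS_gt.
  by move=> [n _]; rewrite /A/= in_itv/= => /andP[a ->]; rewrite (lt_le_trans _ a).
have := @ge0_nondecreasing_set_cvg_integral _ (measurableTypeR R) R A F mu.
move=> /(_ _ _ _ _)/cvg_lim <-//; last first.
- by move=> i; apply: mFD; exact: measurable_itv.
- by move=> i; exact: measurable_itv.
- apply/nondecreasing_seqP => n; rewrite subsetEset /A => x /=; rewrite !in_itv/=.
  move=> /andP[a ->]; rewrite andbT (le_trans _ a)// ler_pM2l// lef_pV2 ?posrE//.
  by rewrite ler_nat.
apply: lime_le; last by apply: nearW => n; apply: hB => //; rewrite ler_pdivrMr// ler_pMr// ler1n.
apply: ereal_nondecreasing_is_cvgn.
apply: ge0_nondecreasing_set_nondecreasing_integral => //; last by move=> i; apply: mFD; exact: measurable_itv.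
apply/nondecreasing_seqP => n; rewrite subsetEset /A => x /=; rewrite !in_itv/=.
move=> /andP[a ->]; rewrite andbT (le_trans _ a)// ler_pM2l// lef_pV2 ?posrE//.
by rewrite ler_nat.
by move=> i; exact: measurable_itv.
Qed.

Lemma ge0_integral_powR_lt d e : 0 < d -> -1 < e -> 
  (\int[mu]_(x in `[0%R, d]) (x `^ e)%:E < +oo)%E.
Proof.
move=> d0 e1; have e10 : 0 < e + 1 by rewrite -ltrBlDr sub0r.
apply: (@le_lt_trans _ _ (d `^ (e + 1) / (e + 1))%:E); last exact: ltry.
apply: ge0_integral_itv_eps => //.
- by apply/measurable_EFinP; exact: measurable_fun_powR.
- by move=> x; rewrite lee_fin powR_ge0.
move=> a a0 ad; rewrite integral_powR_itv// ?gt_eqF// lee_fin ler_pM2r ?invr_gt0//.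
by rewrite gerBl powR_ge0.
Qed.

Lemma powR_addr_le p (a b : R) : 1 <= p -> 0 <= a -> 0 <= b ->
  (a + b) `^ p <= 2 `^ p * (a `^ p + b `^ p).
Proof.
move=> p1 a0 b0; have p0 : 0 <= p by rewrite (le_trans _ p1).
wlog ab : a b a0 b0 / a <= b.
  move=> h; have [ab|/ltW ab] := leP a b; first exact: h.
  by rewrite addrC (addrC (a `^ _)) h.
apply: (@le_trans _ _ ((2 * b) `^ p)).
  by rewrite ge0_ler_powR ?nnegrE ?addr_ge0 ?mulr_ge0// mulr_natl mulr2n lerD2r.
by rewrite powRM// ler_wpM2l ?powR_ge0// lerDr powR_ge0.
Qed.

Let ch (h : R -> 'rV[R]_3) w v := enorm (h w - h v).
(** The term [c * t * X], at most half of [X], is moved to the left side; this is legitimate because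
    [X] is finite. *)
Lemma absorb_half (X A Y : \bar R) (a c t : R) : (0 <= X)%E -> (X < +oo)%E -> (0 <= A)%E ->
  0 < a -> 0 <= c -> (X <= a%:E * A + c%:E * Y)%E -> (Y <= t%:E * X)%E -> c * t <= 2^-1 ->
  (X <= (a * 2)%:E * A)%E.
Proof.
case: X => [x| |]//; case: A => [A| |]//; last first.
  by move=> _ _ _ a0 _ _ _ _; rewrite gt0_muley ?leey// lte_fin mulr_gt0.
rewrite lee_fin => x0 _ _ a0 c0 hX hY ct.
have {hX hY} : (x%:E <= a%:E * A%:E + c%:E * (t%:E * x%:E))%E.
  by rewrite (le_trans hX)// leeD2l// lee_wpmul2l// lee_fin.
rewrite -!EFinM -EFinD !lee_fin => h.
have : c * t * x <= 2^-1 * x by rewrite ler_wpM2r.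
by move: h; rewrite mulrA; lra.
Qed.

(** A truncation of [w ^ (1 - p) = w ^ (- be) * w ^ (be + 1 - p)]. Capping the second factor by [N]
    makes the integral to be absorbed finite; the first factor is kept intact because it yields the
    gain [th ^ be] under dilation. *)
Definition hardy_weight be p N w : R := w `^ (- be) * Num.min (w `^ (be + 1 - p)) N.

Lemma powR_antimono (a b r : R) : 0 < a -> a <= b -> r <= 0 -> b `^ r <= a `^ r.
Proof.
move=> a0 ab r0; rewrite -(opprK r) !(powRN _ (- r)) lef_pV2 ?posrE ?powR_gt0 ?(lt_le_trans a0)//.
by rewrite ge0_ler_powR ?nnegrE ?oppr_ge0 ?(ltW a0) ?(le_trans (ltW a0)).
Qed.

Section Absorption.
Variables (p al K d N th : R) (h : R -> 'rV[R]_3) (h0 : 'rV[R]_3).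
Hypotheses (p3 : 3 < p) (al0 : 0 < al) (al1 : al <= 1) (d0 : 0 < d) (K0 : 0 <= K) (N0 : 0 <= N).
Hypotheses (th0 : 0 < th) (th1 : th <= 1) (thal : 2 `^ p * th `^ al <= 2^-1).
Hypothesis mh : mvec h.
Hypothesis hol : forall w, 0 < w -> w <= d -> enorm (h w - h0) <= K * w `^ al.

Let be := 1 + al.
Let H w := enorm (h w - h0).
Let X := (\int[mu]_(w in `[0%R, d]) (H w `^ p * hardy_weight be p N w)%:E)%E.

Lemma hardy_weight_ge0 w : 0 <= hardy_weight be p N w.
Proof. by rewrite mulr_ge0 ?powR_ge0// le_min powR_ge0. Qed.

Lemma hardy_weight_le w : 0 <= w -> hardy_weight be p N w <= w `^ (1 - p).
Proof.
rewrite le_eqVlt => /orP[/eqP<-|w0].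
  by rewrite /hardy_weight powR0 ?mul0r ?powR_ge0// oppr_eq0 gt_eqF// addr_gt0.
apply: (@le_trans _ _ (w `^ (- be) * w `^ (be + 1 - p))).
  by rewrite ler_wpM2l ?powR_ge0// ge_min lexx.
by rewrite -powRD; [rewrite (_ : - be + (be + 1 - p) = 1 - p)//; ring|rewrite (gt_eqF w0) implybT].
Qed.

(** The capped factor is nonincreasing in [w], as [be + 1 - p < 0], and the other factor is
    homogeneous of degree [- be]. *)
Lemma hardy_weight_scale w : 0 < w -> hardy_weight be p N w <= th `^ be * hardy_weight be p N (th * w).
Proof.
move=> w0; have tw0 : 0 < th * w by exact: mulr_gt0.
rewrite /hardy_weight mulrA powRM ?(ltW th0) ?(ltW w0)// mulrA -powRD; last by rewrite (gt_eqF th0) implybT.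
rewrite subrr powRr0 mul1r ler_wpM2l ?powR_ge0// le_min ge_min.
rewrite [X in X || _]powR_antimono//=; first by rewrite ge_min lexx orbT.
  by rewrite ger_pMl.
by rewrite /be; have := p3; have := al1; lra.
Qed.

Lemma measurable_hardy_integrand : measurable_fun setT (fun w => H w `^ p * hardy_weight be p N w).
Proof.
apply: measurable_funM.
  by apply: measurable_fun_powR; apply: measurable_enorm; apply: mvecB => // i _; exact: measurable_cst.
apply: measurable_funM; first by apply: measurable_fun_powR.
by apply: measurable_minr; [exact: measurable_fun_powR|exact: measurable_cst].
Qed.

(** The Hölder bound dominates the integrand by a multiple of [w ^ (al * p - be)], whose exponent
    exceeds -1 because [be = 1 + al] and [p > 1]. *)
Lemma hardy_finite : (X < +oo)%E.
Proof.
have p0 : 0 <= p by rewrite (le_trans _ (ltW p3)).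
apply: (@le_lt_trans _ _ (\int[mu]_(w in `[0%R, d]) ((K `^ p * N)%:E * (w `^ (al * p - be))%:E))%E).
  apply: ge0_le_integral_any => w /=; rewrite in_itv/= => /andP[w0 wd].
    by rewrite lee_fin mulr_ge0 ?powR_ge0 ?hardy_weight_ge0.
  rewrite -EFinM lee_fin; move: w0; rewrite le_eqVlt => /orP[/eqP<-|w0].
    by rewrite /hardy_weight (powR0 (x := - be)) ?mul0r ?mulr0 ?mulr_ge0 ?powR_ge0// oppr_eq0 gt_eqF// addr_gt0.
  apply: (@le_trans _ _ ((K * w `^ al) `^ p * (w `^ (- be) * N))).
    apply: ler_pM; rewrite ?powR_ge0 ?hardy_weight_ge0//.
      by rewrite ge0_ler_powR ?nnegrE ?enorm_ge0 ?mulr_ge0 ?powR_ge0 ?hol.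
    by rewrite ler_wpM2l ?powR_ge0// ge_min lexx orbT.
  rewrite powRM ?powR_ge0// -powRrM powRD; last by rewrite (gt_eqF w0) implybT.
  by rewrite le_eqVlt; apply/orP; left; apply/eqP; ring.
rewrite ge0_integralZl//; last 3 first.
- by apply: measurable_EFin_fun; exact: measurable_fun_powR.
- by move=> w _; rewrite lee_fin powR_ge0.
- by rewrite lee_fin mulr_ge0 ?powR_ge0.
rewrite lte_mul_pinfty// ?lee_fin ?mulr_ge0 ?powR_ge0//.
apply: ge0_integral_powR_lt => //; rewrite /be.
by have : al < al * p; [rewrite ltr_pMr//; have := p3; lra|lra].
Qed.

(** Split [h w - h0] at [h (th * w)]. Substitution in the second part returns the same integral with
    the factor [2 ^ p * th ^ be * th^-1 = 2 ^ p * th ^ al], at most 1/2, and it is absorbed. *)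
Lemma hardy_absorb :
  (X <= (2 `^ p * 2)%:E * \int[mu]_(w in `[0%R, d]) (ch h w (th * w) `^ p * w `^ (1 - p))%:E)%E.
Proof.
have p0 : 0 <= p by rewrite (le_trans _ (ltW p3)).
have p1 : 1 <= p by rewrite (le_trans _ (ltW p3))// ler1n.
have mA : measurable_fun setT (fun w => ch h w (th * w) `^ p * w `^ (1 - p)).
  apply: measurable_funM; last exact: measurable_fun_powR.
  apply: measurable_fun_powR; apply: measurable_enorm; apply: mvecB => //.
  by apply: (@mvec_comp _ _ _ h (fun w => th * w) mh); exact: measurable_funM.
pose A := (\int[mu]_(w in `[0%R, d]) (ch h w (th * w) `^ p * w `^ (1 - p))%:E)%E.
pose Y := (\int[mu]_(w in `[0%R, d]) (H (th * w) `^ p * hardy_weight be p N (th * w))%:E)%E.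
have hY : (Y <= (th^-1)%:E * X)%E.
  rewrite /Y (ge0_integral_itv_scale 0 d th0
    (f := fun w => (H w `^ p * hardy_weight be p N w)%:E)); last first.
    by move=> w; rewrite lee_fin mulr_ge0 ?powR_ge0 ?hardy_weight_ge0.
  apply: lee_wpmul2l; first by rewrite lee_fin invr_ge0 ltW.
  apply: ge0_subset_integral => //; first 2 last.
  - move=> w; rewrite mulr0 /= !in_itv/= => /andP[-> h1]; rewrite (le_trans h1)//.
    by rewrite ger_pMl.
  - by apply: measurable_EFin_fun; apply: measurable_hardy_integrand.
  - by move=> w _; rewrite lee_fin mulr_ge0 ?powR_ge0 ?hardy_weight_ge0.
have hX : (X <= (2 `^ p)%:E * A + (2 `^ p * th `^ be)%:E * Y)%E.
  rewrite -ge0_integralZl ?lee_fin ?powR_ge0//; last 2 first.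
  - by apply: measurable_EFin_fun; apply: mA.
  - by move=> w _; rewrite lee_fin mulr_ge0 ?powR_ge0.
  have mHt : measurable_fun setT (fun w => (H (th * w) `^ p * hardy_weight be p N (th * w))).
    apply: (measurableT_comp measurable_hardy_integrand); exact: measurable_funM.
  rewrite -ge0_integralZl ?lee_fin ?mulr_ge0 ?powR_ge0//; last 2 first.
  - by apply: measurable_EFin_fun; apply: mHt.
  - by move=> w _; rewrite lee_fin mulr_ge0 ?powR_ge0 ?hardy_weight_ge0.
  rewrite -ge0_integralD//=; last 4 first.
  - by move=> w _; rewrite lee_fin !mulr_ge0 ?powR_ge0.
  - by apply: measurable_EFin_fun; apply: measurable_funM (measurable_cst _) mA.
  - move=> w _; rewrite lee_fin; apply: mulr_ge0; apply: mulr_ge0;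
      by rewrite ?powR_ge0 ?hardy_weight_ge0.
  - by apply: measurable_EFin_fun; apply: measurable_funM (measurable_cst _) mHt.
  apply: ge0_le_integral_any => w /=; rewrite in_itv/= => /andP[w0 wd].
    by rewrite lee_fin mulr_ge0 ?powR_ge0 ?hardy_weight_ge0.
  rewrite lee_fin; move: w0; rewrite le_eqVlt => /orP[/eqP<-|w0].
    by rewrite /hardy_weight mulr0 !(powR0 (x := - be)) ?mul0r ?mulr0 ?addr0 ?mulr_ge0 ?powR_ge0// oppr_eq0 gt_eqF// addr_gt0.
  apply: (@le_trans _ _ (2 `^ p * (ch h w (th * w) `^ p + H (th * w) `^ p) * hardy_weight be p N w)).
    rewrite ler_wpM2r ?hardy_weight_ge0// (le_trans _ (powR_addr_le _ _ _))// ?enorm_ge0//.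
    by rewrite ge0_ler_powR ?nnegrE ?enorm_ge0 ?addr_ge0 ?enorm_ge0// enorm_triangle.
  rewrite mulrDr mulrDl; apply: lerD; rewrite -!mulrA; apply: ler_wpM2l; rewrite ?powR_ge0//.
    by apply: ler_wpM2l; rewrite ?powR_ge0// hardy_weight_le// ltW.
  rewrite [leRHS]mulrCA; apply: ler_wpM2l; first exact: powR_ge0.
  exact: hardy_weight_scale.
apply: (absorb_half _ hardy_finite _ _ _ hX hY).
- by apply: integral_ge0 => w _; rewrite lee_fin mulr_ge0 ?powR_ge0 ?hardy_weight_ge0.
- by apply: integral_ge0 => w _; rewrite lee_fin mulr_ge0 ?powR_ge0.
- by rewrite powR_gt0.
- by rewrite mulr_ge0 ?powR_ge0.
rewrite /be powRD; last by rewrite (gt_eqF th0) implybT.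
rewrite powRr1 ?(ltW th0)// (_ : _ * _ = 2 `^ p * th `^ al * (th / th)); last by ring.
by rewrite mulfV ?gt_eqF// mulr1.
Qed.

End Absorption.

(** For [N = e ^ (1 + al + 1 - p)] the weight is not truncated on [[e, d]], and the constant in
    [hardy_absorb] does not depend on [N]; hence [e] may tend to 0. *)
Lemma hardy_dilation p al K d th (h : R -> 'rV[R]_3) h0 : 3 < p -> 0 < al -> al <= 1 -> 0 < d ->
  0 <= K -> 0 < th -> th <= 1 -> 2 `^ p * th `^ al <= 2^-1 -> mvec h ->
  (forall w, 0 < w -> w <= d -> enorm (h w - h0) <= K * w `^ al) ->
  (\int[mu]_(w in `[0%R, d]) (enorm (h w - h0) `^ p * w `^ (1 - p))%:E <=
   (2 `^ p * 2)%:E * \int[mu]_(w in `[0%R, d]) (enorm (h w - h (th * w)) `^ p * w `^ (1 - p))%:E)%E.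
Proof.
move=> p3 al0 al1 d0 K0 th0 th1 thal mh hol.
apply: ge0_integral_itv_eps => //.
- apply/measurable_EFinP; apply: measurable_funM; last exact: measurable_fun_powR.
  by apply: measurable_fun_powR; apply: measurable_enorm; apply: mvecB => // i _; exact: measurable_cst.
- by move=> x; rewrite lee_fin mulr_ge0 ?powR_ge0.
move=> e e0 ed.
apply: (le_trans _ (@hardy_absorb p al K d (e `^ (1 + al + 1 - p)) th h h0 _ _ _ _ _ _ _ _ _ _ _)) => //;
  rewrite ?powR_ge0//.
apply: (@le_trans _ _ (\int[mu]_(w in `[e, d])
   (enorm (h w - h0) `^ p * hardy_weight (1 + al) p (e `^ (1 + al + 1 - p)) w)%:E)%E).
  apply: ge0_le_integral_any => w /=; rewrite in_itv/= => /andP[ew wd].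
    by rewrite lee_fin mulr_ge0 ?powR_ge0.
  have w0 := lt_le_trans e0 ew.
  rewrite lee_fin ler_wpM2l ?powR_ge0// /hardy_weight min_l; last first.
    by apply: powR_antimono => //; lra.
  rewrite -powRD; last by rewrite (gt_eqF w0) implybT.
  by rewrite (_ : - (1 + al) + (1 + al + 1 - p) = 1 - p)//; ring.
apply: ge0_subset_integral => //; last 2 first.
- by move=> w _; rewrite lee_fin mulr_ge0 ?powR_ge0 ?hardy_weight_ge0 ?powR_ge0.
- by move=> w /=; rewrite !in_itv/= => /andP[a ->]; rewrite (le_trans (ltW e0) a).
by apply: measurable_EFin_fun; apply: measurable_hardy_integrand _ _ _ _ mh.
Qed.

End HardyInequality.

(** * Chord directions, tangent and curvature energy *)

Section ChordDirections.
Context {R : realType}.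
Notation mu := (@lebesgue_measure R).
Implicit Types (f : curve R) (p al K d L : R).

Definition direction (v : 'rV[R]_3) := (enorm v)^-1 *: v.

Lemma enorm_direction (v : 'rV[R]_3) : v != 0 -> enorm (direction v) = 1.
Proof.
by move=> v0; rewrite enormZ ger0_norm ?invr_ge0 ?enorm_ge0// mulVf// gt_eqF// enorm_gt0.
Qed.

(** The intermediate vector [x^-1 *: z] costs [B] twice: for its distance to [T], and because the
    length of [z] differs from [x] by at most [B * x]. If [z = 0], where [direction z] is 0, the
    hypothesis forces [B >= 1]. *)
Lemma direction_near (z T : 'rV[R]_3) (B x : R) : enorm T = 1 -> 0 < x ->
  enorm (z - x *: T) <= B * x -> enorm (direction z - T) <= 2 * B.
Proof.
move=> T1 x0 hz; have [E|z0] := eqVneq z 0.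
  rewrite E /direction scaler0 sub0r enormN T1.
  move: hz; rewrite E sub0r enormN enormZ T1 mulr1 gtr0_norm// -{1}(mul1r x) ler_pM2r//; lra.
have ez : 0 < enorm z by rewrite enorm_gt0.
have h1 : enorm (x^-1 *: z - T) <= B.
  by apply: quotient_bound; rewrite ?gt_eqF// gtr0_norm.
have h2 : enorm (direction z - x^-1 *: z) <= B.
  have -> : direction z - x^-1 *: z = ((enorm z)^-1 - x^-1) *: z.
    by rewrite /direction scalerBl.
  rewrite enormZ -[X in _ * X](ger0_norm (enorm_ge0 z)) -normrM mulrBl mulVf ?gt_eqF//.
  have -> : 1 - x^-1 * enorm z = x^-1 * (x - enorm z).
    by rewrite mulrBr mulVf ?gt_eqF.
  rewrite normrM gtr0_norm ?invr_gt0// ler_pdivrMl// mulrC (le_trans _ hz)//.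
  rewrite ler_norml; have := lerB_enorm (x *: T) z; have := lerB_enorm z (x *: T).
  rewrite (enormBC (x *: T)) enormZ T1 mulr1 gtr0_norm// => a b; apply/andP; split; lra.
rewrite mulr_natl mulr2n (le_trans (enorm_triangle _ (x^-1 *: z) _))//; exact: lerD.
Qed.

(** For unit vectors at angle theta, the distance is [2 sin (theta / 2)] and the cross product has
    norm [sin theta]. Distance at most 1 means an angle of at most 60 degrees, where the inequality
    holds. *)
Lemma enormB_le_cross (a b : 'rV[R]_3) : enorm a = 1 -> enorm b = 1 -> enorm (a - b) <= 1 ->
  enorm (a - b) <= 2 * enorm (cross a b).
Proof.
move=> a1 b1 h; have := lagrange a b; have := sqr_enormB a b.
rewrite a1 b1 !expr1n mulr1 => E1 E2.
rewrite -(@ler_pXn2r _ 2)// ?nnegrE ?mulr_ge0 ?enorm_ge0// exprMn E2.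
have := enorm_ge0 (a - b); move: E1 h; set d := enorm (a - b); set t := dot a b => E1 h d0.
have {E1} -> : t = 1 - d ^+ 2 / 2 by lra.
have d2 : d ^+ 2 <= 1 by rewrite -(expr1n _ 2) ler_pXn2r// nnegrE.
have := sqr_ge0 d; nra.
Qed.

(** By the law of sines, the sine of the angle at [f s] is half the opposite side times the
    curvature. *)
Lemma direction_curvature f s t g : f t != f s -> f g != f s ->
  enorm (direction (f t - f s) - direction (f g - f s)) <= 1 ->
  enorm (direction (f t - f s) - direction (f g - f s)) <=
  enorm (f g - f t) * menger_curvature f s t g.
Proof.
move=> ts gs h1; have [E|gt] := eqVneq (f g) (f t).
  by rewrite E !subrr !enorm0 mul0r.
have X0 : f t - f s != 0 by rewrite subr_eq0.
have Y0 : f g - f s != 0 by rewrite subr_eq0.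
have h := enormB_le_cross (enorm_direction X0) (enorm_direction Y0) h1.
rewrite (le_trans h)// /menger_curvature /direction crossZl crossZr !enormZ.
rewrite !ger0_norm ?invr_ge0 ?enorm_ge0// (enormBC (f s) (f g)).
have x0 : 0 < enorm (f t - f s) by rewrite enorm_gt0.
have y0 : 0 < enorm (f g - f s) by rewrite enorm_gt0.
have z0 : 0 < enorm (f g - f t) by rewrite enorm_gt0 subr_eq0.
rewrite le_eqVlt; apply/orP; left; apply/eqP.
by field; rewrite !gt_eqF.
Qed.

(** Averaging the dilation inequality over [th] in [[la / 2, la]] and substituting [v = th * w]
    produces a double integral. There [v <= w], hence [|w - v| <= w], and [w ^ (- p)] may be
    replaced by [|w - v| ^ (- p)]. *)
Lemma hardy_double p al : 3 < p -> 0 < al -> al <= 1 -> exists2 C, 0 < C &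
  forall d K (h : R -> 'rV[R]_3) h0, 0 < d -> 0 <= K -> mvec h ->
  (forall w, 0 < w -> w <= d -> enorm (h w - h0) <= K * w `^ al) ->
  (\int[mu]_(w in `[0%R, d]) (enorm (h w - h0) `^ p * w `^ (1 - p))%:E <=
   C%:E * \int[mu]_(w in `]0%R, d]) \int[mu]_(v in `]0%R, d])
     (enorm (h w - h v) `^ p * `|w - v| `^ (- p))%:E)%E.
Proof.
move=> p3 al0 al1; have p0 : 0 < p by rewrite (lt_trans _ p3).
(* The largest dilation factor whose remainder can be absorbed: [2 ^ p * la ^ al = 1 / 2]. *)
pose la : R := (2^-1 / 2 `^ p) `^ al^-1.
have la0 : 0 < la by rewrite powR_gt0// divr_gt0// powR_gt0.
have laal : 2 `^ p * la `^ al = 2^-1.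
  rewrite /la -powRrM mulVf ?gt_eqF// powRr1 ?divr_ge0 ?powR_ge0//.
  by rewrite mulrC divfK// gt_eqF// powR_gt0.
have la1 : la <= 1.
  have E1 : 1 = 1 `^ al^-1 :> R by rewrite powR1.
  rewrite /la [leRHS]E1 ge0_ler_powR ?nnegrE ?divr_ge0 ?powR_ge0 ?invr_ge0 ?(ltW al0)//.
  rewrite ler_pdivrMr ?powR_gt0// mul1r (@le_trans _ _ 1)//; first by rewrite invf_le1// ler1n.
  by rewrite -[leLHS](powRr0 2) ler_powR ?ler1n// ltW.
exists (2 / la * (2 `^ p * 2)); first by rewrite !mulr_gt0 ?invr_gt0 ?powR_gt0.
move=> d K h h0 d0 K0 mh hol.
set X := (X in (X <= _)%E).
have X0 : (0 <= X)%E by apply: integral_ge0 => w _; rewrite lee_fin mulr_ge0 ?powR_ge0.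
have mw : measurable_fun setT (fun w : R => w `^ (1 - p)) by exact: measurable_fun_powR.
pose F (z : R * R) := (enorm (h z.2 - h (z.1 * z.2)) `^ p * z.2 `^ (1 - p))%:E.
have mF : measurable_fun setT F.
  apply/measurable_EFinP; apply: measurable_funM.
    apply: measurable_fun_powR; apply: measurable_enorm; apply: mvecB.
      by apply: (mvec_comp mh); exact: measurable_snd.
    apply: (mvec_comp mh); apply: measurable_funM; [exact: measurable_fst|exact: measurable_snd].
  by apply: measurable_fun_powR; exact: measurable_snd.
have F0 z : (0 <= F z)%E by rewrite lee_fin mulr_ge0 ?powR_ge0.
have FE th w : F (th, w) = (enorm (h w - h (th * w)) `^ p * w `^ (1 - p))%:E by [].
clearbody F.
have step th : la / 2 <= th <= la ->
    (X <= (2 `^ p * 2)%:E * \int[mu]_(w in `]0%R, d]) F (th, w))%E.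
  move=> /andP[t1 t2]; have th0 : 0 < th by rewrite (lt_le_trans _ t1)// divr_gt0.
  rewrite (integral_itv_obnd_cbnd (b := BRight d)); last first.
    apply: measurable_funTS; exact: (measurableT_comp mF (pair1_measurable th)).
  under eq_integral do rewrite FE.
  apply: (hardy_dilation p3 al0 al1 d0 K0 th0 _ _ mh hol); first exact: le_trans t2 la1.
  by rewrite -laal ler_wpM2l ?powR_ge0// ge0_ler_powR ?nnegrE ?(ltW al0) ?(ltW th0) ?(ltW la0).
have C20 : 0 < 2 `^ p * 2 :> R by rewrite mulr_gt0 ?powR_gt0.
set C2 := 2 `^ p * 2 in step C20 *; clearbody C2.
have avg : ((la / 2)%:E * X <= C2%:E *
    \int[mu]_(w in `]0%R, d]) \int[mu]_(v in `]0%R, d])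
     (enorm (h w - h v) `^ p * `|w - v| `^ (- p))%:E)%E.
  have -> : ((la / 2)%:E * X = \int[mu]_(th in `[(la / 2)%R, la]) X)%E.
    rewrite integral_cst//= lebesgue_measure_itv/= lte_fin ifT; last by rewrite ltr_pdivrMr// ltr_pMr// ltr1n.
    rewrite muleC -EFinB; congr (_ * _%:E)%E; by field.
  apply: (@le_trans _ _ (\int[mu]_(th in `[(la / 2)%R, la])
      (C2%:E * \int[mu]_(w in `]0%R, d]) F (th, w)))%E).
    by apply: ge0_le_integral_any => // th /=; rewrite in_itv/=; exact: step.
  rewrite (ge0_integralZl_any _ C20); last first.
    by move=> th _; apply: integral_ge0 => w _; exact: F0.
  apply: lee_wpmul2l; first by rewrite lee_fin ltW.
  rewrite (tonelli_swap _ _ mF F0)//.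
  apply: ge0_le_integral_any => w /=; rewrite in_itv/= => /andP[w0 wd].
    by apply: integral_ge0 => th _; exact: F0.
  have mG : measurable_fun setT (fun v => enorm (h w - h v) `^ p).
    by apply: measurable_fun_powR; apply: measurable_enorm; apply: mvecB => // i _; exact: measurable_cst.
  under eq_integral do rewrite FE [_ * w]mulrC.
  rewrite (ge0_integral_itv_scale _ _ w0 (f := fun v => (enorm (h w - h v) `^ p * w `^ (1 - p))%:E)); last first.
    by move=> v; rewrite lee_fin mulr_ge0 ?powR_ge0.
  rewrite -ge0_integralZl_any ?invr_gt0//; last first.
    by move=> v _; rewrite lee_fin mulr_ge0 ?powR_ge0.
  apply: (@le_trans _ _ (\int[mu]_(v in `[(w * (la / 2))%R, (w * la)%R])
     (enorm (h w - h v) `^ p * `|w - v| `^ (- p))%:E)%E).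
    apply: ge0_le_integral_any => v /=; rewrite in_itv/= => /andP[v1 v2].
      by rewrite -EFinM lee_fin !mulr_ge0 ?powR_ge0 ?invr_ge0// ltW.
    rewrite -EFinM lee_fin; have [->|vw] := eqVneq v w.
      by rewrite subrr enorm0 powR0 ?gt_eqF// !mul0r mulr0.
    rewrite mulrCA ler_wpM2l ?powR_ge0//.
    have -> : w^-1 * w `^ (1 - p) = w `^ (- p).
      rewrite -powR_inv1 ?(ltW w0)// -powRD; last by rewrite (gt_eqF w0) implybT.
      by rewrite (_ : -1 + (1 - p) = - p)//; ring.
    apply: powR_antimono; last by rewrite oppr_le0 ltW.
      by rewrite normr_gt0 subr_eq0 eq_sym.
    have v0 : 0 <= v by rewrite (le_trans _ v1)// mulr_ge0 ?divr_ge0 ?ltW.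
    have vlew : v <= w by rewrite (le_trans v2)// ger_pMr.
    by rewrite ger0_norm ?subr_ge0// gerBl.
  apply: ge0_subset_integral => //.
  - apply: measurable_EFin_fun; apply: measurable_funM => //; apply: measurable_fun_powR.
    by apply: measurable_norm_fun; exact: measurable_funB.
  - by move=> v _; rewrite lee_fin mulr_ge0 ?powR_ge0.
  - move=> v /=; rewrite !in_itv/= => /andP[v1 v2]; rewrite (lt_le_trans _ v1)/=.
      by rewrite (le_trans v2)// (le_trans _ wd)// ger_pMr.
    by rewrite mulr_gt0 ?divr_gt0.
have -> : X = ((2 / la)%:E * ((la / 2)%:E * X))%E.
  rewrite muleA -EFinM (_ : _ * _ = 1) ?mul1e//.
  by field; rewrite gt_eqF.
rewrite [(2 / la * C2)%:E]EFinM -[leRHS]muleA; apply: lee_wpmul2l; last exact: avg.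
by rewrite lee_fin divr_ge0// ltW.
Qed.

End ChordDirections.

Section SlantedIntegrals.
Context {R : realType}.
Notation mu := (@lebesgue_measure R).
Implicit Types (L d c : R).

Lemma ge0_integral_shift_periodic (F : R -> \bar R) L a : 0 < L ->
  measurable_fun setT F -> (forall x, 0 <= F x)%E -> (forall x, F (x + L) = F x) ->
  (\int[mu]_(x in `[0%R, L]) F (x + a)%R = \int[mu]_(x in `[0%R, L]) F x)%E.
Proof.
move=> L0 mF F0 pF.
by rewrite ge0_integral_itv_shift// add0r addrC ge0_integral_periodic.
Qed.

Lemma integral_window_signed_le (F : R -> \bar R) L s d c : 0 < L -> d <= L ->
  c = 1 \/ c = -1 ->
  measurable_fun setT F -> (forall x, 0 <= F x)%E -> (forall x, F (x + L) = F x) ->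
  (\int[mu]_(w in `]0%R, d]) F (s + c * w)%R <= \int[mu]_(x in `[0%R, L]) F x)%E.
Proof.
move=> L0 dL c1 mF F0 pF.
apply: (@le_trans _ _ (\int[mu]_(w in `[0%R, L]) F (s + c * w)%R)%E).
  apply: ge0_subset_integral => //; last first.
    by move=> w /=; rewrite !in_itv/= => /andP[/ltW -> h]; rewrite (le_trans h).
  apply: measurable_funTS; under eq_fun do rewrite addrC.
  exact: (measurableT_comp mF (measurable_affine c s)).
case: c1 => ->.
  under eq_integral do rewrite mul1r addrC.
  by rewrite (ge0_integral_shift_periodic s L0 mF F0 pF).
under eq_integral do rewrite mulN1r.
rewrite (ge0_integral_itv_opp 0 L (f := fun w => F (s + w))); last by [].
rewrite oppr0; under eq_integral do rewrite addrC.
rewrite ge0_integral_itv_shift// add0r.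
have := @ge0_integral_periodic _ F L (- L + s) L0 mF F0 pF.
rewrite (_ : - L + s + L = s); last by ring.
by move=> ->.
Qed.

(** For fixed [w] a periodic integrand does not see the shift by [c * w]; Tonelli puts the integral
    in [s] inside. It moves the base point from one end of a chord to the other. *)
Lemma slant_shift (F : R * R -> \bar R) L d c : 0 < L ->
  measurable_fun setT F -> (forall z, 0 <= F z)%E ->
  (forall s w, F (s + L, w) = F (s, w)) ->
  (\int[mu]_(s in `[0%R, L]) \int[mu]_(w in `[0%R, d]) F (s + c * w, w)%R =
   \int[mu]_(s in `[0%R, L]) \int[mu]_(w in `[0%R, d]) F (s, w))%E.
Proof.
move=> L0 mF F0 pF.
have mF' : measurable_fun setT (fun z : R * R => F (z.1 + c * z.2, z.2)).
  apply: (measurableT_comp mF); apply: measurable_fun_pair; last exact: measurable_snd.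
  apply: measurable_funD; first exact: measurable_fst.
  by apply: measurable_funM => //; exact: measurable_snd.
rewrite (tonelli_swap _ _ mF' _)// (tonelli_swap _ _ mF F0)//; apply: eq_integral => w /[!inE]/=; rewrite in_itv/= => /andP[w0 wd].
rewrite (ge0_integral_shift_periodic (F := fun s => F (s, w)) _ L0)//.
exact: (measurableT_comp mF (pair2_measurable w)).
Qed.

Lemma measurable_menger (disp : measure_display) (T : measurableType disp) (f : curve R) (a b c : T -> R) :
  continuous f -> measurable_fun setT a -> measurable_fun setT b -> measurable_fun setT c ->
  measurable_fun setT (fun z => menger_curvature f (a z) (b z) (c z)).
Proof.
move=> cf ma mb mc; have mf := continuous_mvec cf.
have mfa := mvec_comp mf ma; have mfb := mvec_comp mf mb; have mfc := mvec_comp mf mc.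
apply: measurable_funM.
  by apply: measurable_funM => //; apply: measurable_enorm; apply: mvec_cross; exact: mvecB.
apply: measurable_funV; apply: measurable_funM; first apply: measurable_funM.
all: by apply: measurable_enorm; exact: mvecB.
Qed.

Lemma menger_periodic (f : curve R) L : periodic f L ->
  [/\ forall s t g, menger_curvature f (s + L) t g = menger_curvature f s t g,
      forall s t g, menger_curvature f s (t + L) g = menger_curvature f s t g &
      forall s t g, menger_curvature f s t (g + L) = menger_curvature f s t g].
Proof. by move=> pf; split => s t g; rewrite /menger_curvature pf. Qed.

End SlantedIntegrals.

Section ChordHardy.
Context {R : realType}.
Notation mu := (@lebesgue_measure R).
Variables (p al K L : R) (f : curve R).
Hypotheses (p3 : 3 < p) (al0 : 0 < al) (al1 : al <= 1) (K0 : 0 < K) (L0 : 0 < L).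
Hypotheses (cf : continuous f) (pf : periodic f L) (arc : by_arclength f).
Hypothesis hol : holder_tangent al K f.

(** [c] is 1 or -1, for the chord forward or backward from [s]; the outer factor makes both
    approximate [derive1 f s]. *)
Definition chord_dir f (c s w : R) := c *: direction (f (s + c * w) - f s).

Lemma chord_dir_holder c s w : `|c| = 1 -> 0 < w ->
  enorm (chord_dir f c s w - derive1 f s) <= 2 * K * w `^ al.
Proof.
move=> c1 w0; have [_ T1 _ H] := hol.
have cc : c * c = 1 by rewrite -expr2 -real_normK ?num_real// c1 expr1n.
have -> : chord_dir f c s w - derive1 f s =
    c *: (direction (f (s + c * w) - f s) - c *: derive1 f s).
  by rewrite /chord_dir scalerBr [c *: (c *: derive1 f s)]scalerA cc scale1r.
rewrite enormZ c1 mul1r -mulrA; apply: (direction_near _ w0); first by rewrite enormZ c1 T1 mul1r.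
have := H s (s + c * w); rewrite (addrC s) addrK normrM c1 mul1r (gtr0_norm w0).
by rewrite scalerA (mulrC w).
Qed.

Lemma chord_dir_neq0 c s w : `|c| = 1 -> 0 < w -> 2 * K * w `^ al <= 2^-1 ->
  f (s + c * w) != f s.
Proof.
move=> c1 w0 hw; apply/eqP => E; have := chord_dir_holder s c1 w0.
rewrite /chord_dir E subrr /direction scaler0 scaler0 sub0r enormN.
have [_ -> _ _] := hol; move=> h; have := le_trans h hw.
by rewrite leNgt invf_lt1// ltr1n.
Qed.

(** The smallness conditions put both directions within 1/2 of the tangent, hence within 1 of each
    other, as [direction_curvature] requires. The side opposite to [f s] is at most [|w - v|]. *)
Lemma chord_dir_curvature c s w v : `|c| = 1 -> 0 < w -> 0 < v ->
  2 * K * w `^ al <= 2^-1 -> 2 * K * v `^ al <= 2^-1 ->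
  enorm (chord_dir f c s w - chord_dir f c s v) `^ p * `|w - v| `^ (- p) <=
  menger_curvature f s (s + c * w) (s + c * v) `^ p.
Proof.
move=> c1 w0 v0 hw hv.
have p0 : 0 < p by rewrite (lt_trans _ p3).
have [->|wv] := eqVneq w v.
  by rewrite subrr enorm0 powR0 ?gt_eqF// mul0r powR_ge0.
have wv0 : 0 < `|w - v| by rewrite normr_gt0 subr_eq0.
have d1 : enorm (chord_dir f c s w - chord_dir f c s v) <= 1.
  rewrite (le_trans (enorm_triangle _ (derive1 f s) _))// (splitr 1) lerD//.
    by rewrite (le_trans (chord_dir_holder _ _ _))// mul1r.
  by rewrite enormBC (le_trans (chord_dir_holder _ _ _))// mul1r.
move: d1; rewrite /chord_dir -scalerBr enormZ c1 mul1r => d1.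
have := direction_curvature (chord_dir_neq0 s c1 w0 hw) (chord_dir_neq0 s c1 v0 hv) d1.
set D := enorm _; set m := menger_curvature _ _ _ _ => h.
have D0 : 0 <= D by exact: enorm_ge0.
have m0 : 0 <= m by exact: menger_curvature_ge0.
have {}h : D <= `|w - v| * m.
  rewrite (le_trans h)// ler_wpM2r// (le_trans (by_arclength_lip _ _ arc))//.
  rewrite opprD addrACA subrr add0r -mulrBr normrM c1 mul1r distrC//.
rewrite powRN ler_pdivrMr ?powR_gt0// -powRM// ?(ltW wv0)// mulrC.
have wm0 : 0 <= `|w - v| * m by exact: mulr_ge0.
exact: (ge0_ler_powR (ltW p0) D0 wm0 h).
Qed.

Lemma chord_dir_measurable c s : mvec (chord_dir f c s).
Proof.
have mf := continuous_mvec cf.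
have mz : mvec (fun w => f (s + c * w) - f s).
  apply: mvecB; last by move=> i _; exact: measurable_cst.
  by apply: (mvec_comp mf); apply: measurable_funD => //; exact: measurable_funM.
apply: mvecZ => //; apply: mvecZ => //; apply: measurable_funV; exact: measurable_enorm.
Qed.

Lemma chord_dir_measurable2 c : mvec (fun z : R * R => chord_dir f c z.1 z.2).
Proof.
have mf := continuous_mvec cf.
have mz : mvec (fun z : R * R => f (z.1 + c * z.2) - f z.1).
  apply: mvecB; last by apply: (mvec_comp mf); exact: measurable_fst.
  apply: (mvec_comp mf); apply: measurable_funD; first exact: measurable_fst.
  by apply: measurable_funM => //; exact: measurable_snd.
apply: mvecZ => //; apply: mvecZ => //; apply: measurable_funV; exact: measurable_enorm.
Qed.

Lemma menger_window_le s d c : d <= L -> c = 1 \/ c = -1 ->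
  (\int[mu]_(w in `]0%R, d]) \int[mu]_(v in `]0%R, d])
     (menger_curvature f s (s + c * w) (s + c * v) `^ p)%:E <=
   \int[mu]_(t in `[0%R, L]) \int[mu]_(g in `[0%R, L]) (menger_curvature f s t g `^ p)%:E)%E.
Proof.
move=> dL c1.
pose F (z : R * R) := (menger_curvature f s z.1 z.2 `^ p)%:E.
have mF : measurable_fun setT F.
  apply/measurable_EFinP; apply: measurable_fun_powR.
  exact: (measurable_menger cf (measurable_cst s) measurable_fst measurable_snd).
have F0 z : (0 <= F z)%E by rewrite lee_fin powR_ge0.
have [_ pf1 pf2] := menger_periodic pf.
have pF1 t g : F (t + L, g) = F (t, g) by rewrite /F/= pf1.
have pF2 t g : F (t, g + L) = F (t, g) by rewrite /F/= pf2.
have FE t g : (menger_curvature f s t g `^ p)%:E = F (t, g) by [].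
under eq_integral do under eq_integral do rewrite FE.
under [leRHS]eq_integral do under eq_integral do rewrite FE.
clearbody F.
pose G t := (\int[mu]_(g in `[0%R, L]) F (t, g))%E.
have mG : measurable_fun setT G by exact: measurable_fun_section_integral.
have G0 t : (0 <= G t)%E by exact: integral_ge0.
have pG t : G (t + L) = G t by apply: eq_integral => g _; rewrite pF1.
have mF' t : measurable_fun setT (fun g => F (t, g)).
  exact: (measurableT_comp mF (pair1_measurable _)).
apply: (@le_trans _ _ (\int[mu]_(w in `]0%R, d]) G (s + c * w)%R)%E).
  apply: ge0_le_integral_any => w _; first by apply: integral_ge0.
  exact: (integral_window_signed_le _ L0 dL c1 (mF' (s + c * w)) _ (pF2 (s + c * w))).
exact: integral_window_signed_le.
Qed.

(** [hardy_double] replaces the tangent by a second chord, and the quotient of directions by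
    [|w - v|] is dominated by the curvature of the triple [s], [s + c * w], [s + c * v]. Unit speed
    turns the weights of the energy into 1. *)
Lemma chord_dir_energy : exists C d, [/\ 0 < C, 0 < d, d <= L / 2 & forall c, c = 1 \/ c = -1 ->
  (\int[mu]_(s in `[0%R, L]) \int[mu]_(w in `[0%R, d])
     (enorm (chord_dir f c s w - derive1 f s) `^ p * w `^ (1 - p))%:E <=
   C%:E * menger_integral p L f)%E].
Proof.
have p0 : 0 < p by rewrite (lt_trans _ p3).
have [C C0 hC] := hardy_double p3 al0 al1.
have half0 : 0 < 2^-1 :> R by rewrite invr_gt0.
have [r r0 hr] := powR_small (2 * K) al0 half0.
pose d := Num.min r (L / 2).
have d0 : 0 < d by rewrite lt_min r0 divr_gt0.
have dr : d <= r by rewrite ge_min lexx.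
have dL : d <= L / 2 by rewrite ge_min lexx orbT.
clearbody d.
have small w : 0 < w -> w <= d -> 2 * K * w `^ al <= 2^-1.
  move=> w0 wd; rewrite (le_trans _ hr)// ler_wpM2l ?mulr_ge0 ?(ltW K0)//.
  by rewrite ge0_ler_powR ?nnegrE ?(ltW al0) ?(ltW w0) ?(ltW r0)// (le_trans wd).
have dL' : d <= L by rewrite (le_trans dL)// ler_pdivrMr// ler_pMr// ler1n.
exists C, d; split => // c c1.
have c1' : `|c| = 1 by case: c1 => ->; rewrite ?normrN normr1.
have [_ T1 _ _] := hol.
rewrite /menger_integral -(ge0_integralZl_any _ C0); last first.
  move=> s _; apply: integral_ge0 => t _; apply: integral_ge0 => g _.
  by rewrite lee_fin !mulr_ge0 ?powR_ge0 ?enorm_ge0.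
apply: ge0_le_integral_any => s /=; rewrite in_itv/= => /andP[s0 sL].
  by apply: integral_ge0 => w _; rewrite lee_fin mulr_ge0 ?powR_ge0.
apply: (le_trans (hC d (2 * K) (chord_dir f c s) (derive1 f s) d0 _ _ _)).
- by rewrite mulr_ge0// ltW.
- exact: chord_dir_measurable.
- by move=> w w0 _; exact: chord_dir_holder.
apply: lee_wpmul2l; first by rewrite lee_fin ltW.
have -> : (\int[mu]_(t in `[0%R, L]) \int[mu]_(g in `[0%R, L])
   (menger_curvature f s t g `^ p * enorm (derive1 f s) * enorm (derive1 f t) *
      enorm (derive1 f g))%:E = \int[mu]_(t in `[0%R, L]) \int[mu]_(g in `[0%R, L])
     (menger_curvature f s t g `^ p)%:E)%E.
  by apply: eq_integral => t _; apply: eq_integral => g _; rewrite !T1 !mulr1.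
apply: le_trans (menger_window_le s dL' c1).
apply: ge0_le_integral_any => w /=; rewrite in_itv/= => /andP[w0 wd].
  by apply: integral_ge0 => v _; rewrite lee_fin mulr_ge0 ?powR_ge0.
apply: ge0_le_integral_any => v /=; rewrite in_itv/= => /andP[v0 vd].
  by rewrite lee_fin mulr_ge0 ?powR_ge0.
by rewrite lee_fin; apply: chord_dir_curvature => //; exact: small.
Qed.

End ChordHardy.

#[local] Transparent co.

Lemma ord_co (R : realType) (v : 'rV[R]_3) (i : 'I_3) : v ord0 i = co i v.
Proof. by rewrite /co inord_val. Qed.

#[local] Opaque co.

(** * Periodic C^1 curves and the seminorm of their derivative *)

Section PeriodicC1.
Context {R : realType}.
Notation mu := (@lebesgue_measure R).
Implicit Types (f g : curve R) (p d L : R).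

Lemma derivable_continuous (V : normedModType R) (f : R -> V) :
  (forall x, derivable f x (1 : R)) -> continuous f.
Proof. by move=> df x; apply: differentiable_continuous; apply/derivable1_diffP. Qed.

Lemma derive1_periodic (V : normedModType R) (f : R -> V) L : periodic f L -> periodic (derive1 f) L.
Proof.
move=> pf x; rewrite /derive1 (_ : (fun h => h^-1 *: (f (h + (x + L)) - f (x + L))) =
  (fun h => h^-1 *: (f (h + x) - f x)))//.
by apply/funext => h; rewrite addrA !pf.
Qed.

Lemma periodic_bounded f L : 0 < L -> continuous f -> periodic f L ->
  exists2 M, 0 < M & forall x, enorm (f x) <= M.
Proof.
move=> L0 cf pf.
have cn : {within `[0, L], continuous (fun x => enorm (f x))}.
  apply: continuous_subspaceT => x.
  by apply: (@continuous_comp _ _ _ f (@enorm R)); [exact: cf|exact: continuous_enorm].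
have [c _ hc] := EVT_max (ltW L0) cn.
exists (1 + enorm (f c)); first by rewrite ltr_wpDr ?enorm_ge0.
move=> x; have [n /andP[n0 nL]] := floor_reduce x L0.
rewrite -(periodic_intP n x pf) (le_trans (hc _ _)) ?lerDr//.
by rewrite in_itv/= n0 ltW.
Qed.

Lemma continuous_Lp_periodic p L f : 0 < p -> 0 < L -> continuous f -> periodic f L ->
  Lp_periodic p L f.
Proof.
move=> p0 L0 cf pf; split => //.
  by move=> i; under eq_fun do rewrite ord_co; exact: continuous_mvec cf i (ltn_ord i).
have [M M0 hM] := periodic_bounded L0 cf pf.
apply: (@le_lt_trans _ _ (\int[mu]_(x in `[0%R, L]) (M `^ p)%:E)%E).
  apply: ge0_le_integral_any => x _; rewrite lee_fin ?powR_ge0//.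
  by rewrite ge0_ler_powR ?nnegrE ?enorm_ge0 ?(ltW p0) ?(ltW M0).
rewrite integral_cst//= lebesgue_measure_itv/= lte_fin L0 -EFinB -EFinM ltry//.
Qed.

Lemma C1_weak_derivative L f : 0 < L -> periodic f L -> (forall x, derivable f x (1 : R)) ->
  continuous (derive1 f) -> weak_derivative L f (derive1 f).
Proof.
move=> L0 pf df cf phi pphi sphi i.
have dphi x : derivable phi x (1 : R) := sphi 0%N x.
have cphi := derivable_continuous dphi.
have cphi1 : continuous (derive1 phi) by apply: derivable_continuous; exact: sphi 1%N.
have cof x : derivable (fun y => co i (f y)) x (1 : R) by exact: derivable_co.
have cf' : continuous (fun x => co i (derive1 f x)).
  by move=> x; apply: (@continuous_comp _ _ _ (derive1 f) (@co R i)); [exact: cf|exact: continuous_co].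
have cf0 := derivable_continuous cof.
under eq_Rintegral do rewrite ord_co.
under [in RHS]eq_Rintegral do rewrite ord_co.
have lr (F : R -> R) : continuous F -> (forall x, derivable F x (1 : R)) -> derivable_oo_LRcontinuous F 0 L.
  move=> cF dF; split => [x _||]; first exact: dF.
  - exact/cvg_at_right_filter/cF.
  - exact/cvg_at_left_filter/cF.
have dE : {in `]0, L[, derive1 (fun x => co i (f x)) =1 (fun x => co i (derive1 f x))}.
  by move=> x _; rewrite derive1_co.
have -> := @Rintegration_by_parts R (fun x => co i (f x)) phi (fun x => co i (derive1 f x))
  (derive1 phi) 0 L L0 (continuous_subspaceT cf') (@lr (fun x => co i (f x)) cf0 cof) dE
  (continuous_subspaceT cphi1) (@lr phi cphi dphi) (fun _ _ => erefl).
have -> : f L = f 0 by rewrite -[L]add0r pf.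
have -> : phi L = phi 0 by rewrite -[L]add0r pphi.
by rewrite subrr sub0r.
Qed.

(* Half of the seminorm integral, cut off at [d]; see [slobodeckij_double]. *)
Definition slobodeckij p L d g : \bar R :=
  (\int[mu]_(s in `[0%R, L]) \int[mu]_(w in `[0%R, d])
     (enorm (g (s + w) - g s) `^ p * w `^ (1 - p))%:E)%E.

Lemma measurable_slobodeckij p g (c1 c2 : R) : continuous g -> measurable_fun setT
  (fun z : R * R => (enorm (g (z.1 + c1 * z.2) - g (z.1 + c2 * z.2)) `^ p * z.2 `^ (1 - p))%:E).
Proof.
move=> cg; apply/measurable_EFinP; apply: measurable_funM.
  apply: measurable_fun_powR; apply: measurable_enorm.
  apply: mvecB; apply: (mvec_comp (continuous_mvec cg)); apply: measurable_funD;
    try exact: measurable_fst;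
    by apply: measurable_funM => //; exact: measurable_snd.
by apply: measurable_fun_powR; exact: measurable_snd.
Qed.

(** The part with offset [- w] equals the part with offset [w] after moving the base point from [x]
    to [x - w], an instance of [slant_shift]. *)
Lemma slobodeckij_double p L d g : 0 < L -> 0 <= d -> continuous g -> periodic g L ->
  (\int[mu]_(x in `[0%R, L]) \int[mu]_(w in `[(- d)%R, d])
     ((enorm (g (x + w) - g x) `^ p) / (`|w| `^ (p - 1)))%R%:E =
   slobodeckij p L d g + slobodeckij p L d g)%E.
Proof.
move=> L0 d0 cg pg.
pose F (z : R * R) := (enorm (g (z.1 + 1 * z.2) - g (z.1 + 0 * z.2)) `^ p * z.2 `^ (1 - p))%:E.
have mF : measurable_fun setT F by exact: measurable_slobodeckij.
have F0 z : (0 <= F z)%E by rewrite lee_fin mulr_ge0 ?powR_ge0.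
have pF s w : F (s + L, w) = F (s, w).
  by rewrite /F/= !(addrAC _ L) !pg.
have FE x w : F (x, w) = (enorm (g (x + w) - g x) `^ p * w `^ (1 - p))%:E.
  by rewrite /F/= mul1r mul0r addr0.
clearbody F.
have SE : slobodeckij p L d g = (\int[mu]_(s in `[0%R, L]) \int[mu]_(w in `[0%R, d]) F (s, w))%E.
  by apply: eq_integral => s _; apply: eq_integral => w _; rewrite FE.
have sh := slant_shift d (-1) L0 mF F0 pF; 
pose G (z : R * R) := ((enorm (g (z.1 + z.2) - g z.1) `^ p) / (`|z.2| `^ (p - 1)))%R%:E.
have GE x w : G (x, w) = (enorm (g (x + w) - g x) `^ p * `|w| `^ (1 - p))%:E.
  by rewrite /G/= -powRN opprB.
have GD x w : G (x, w) = ((enorm (g (x + w) - g x) `^ p) / (`|w| `^ (p - 1)))%R%:E by [].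
have mG : measurable_fun setT G.
  apply/measurable_EFinP; apply: measurable_funM.
    apply: measurable_fun_powR; apply: measurable_enorm; apply: mvecB;
      apply: (mvec_comp (continuous_mvec cg)); last exact: measurable_fst.
    by apply: measurable_funD; [exact: measurable_fst|exact: measurable_snd].
  apply: measurable_funV; apply: measurable_fun_powR; apply: measurable_norm_fun.
  exact: measurable_snd.
have G0 z : (0 <= G z)%E by rewrite lee_fin divr_ge0 ?powR_ge0.
clearbody G.
have mGx x : measurable_fun setT (fun w => G (x, w)).
  exact: (measurableT_comp mG (pair1_measurable x)).
have E x : (\int[mu]_(w in `[(- d)%R, d]) G (x, w) =
    \int[mu]_(w in `[0%R, d]) F (x, w) + \int[mu]_(w in `[0%R, d]) F (x + -1 * w, w)%R)%E.
  have dN : - d <= 0 by rewrite oppr_le0.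
  rewrite (ge0_integral_itv_cat dN d0 (mGx x) (fun w => G0 (x, w))) addeC; congr (_ + _)%E.
    apply: eq_integral => w /[!inE]/=; rewrite in_itv/= => /andP[w0 _].
    by rewrite GE FE ger0_norm.
  rewrite -[X in `[_, X]]oppr0 -(ge0_integral_itv_opp _ _ (f := fun w => G (x, w)))//.
  apply: eq_integral => w /[!inE]/=; rewrite in_itv/= => /andP[w0 _].
  rewrite GE FE; have -> : x + -1 * w + w = x by ring.
  by rewrite mulN1r normrN (ger0_norm w0) (enormBC (g (x - w))).
transitivity (\int[mu]_(x in `[0%R, L]) (\int[mu]_(w in `[0%R, d]) F (x, w) +
    \int[mu]_(w in `[0%R, d]) F (x + -1 * w, w)%R))%E.
  by apply: eq_integral => x _; rewrite -E; apply: eq_integral => w _; rewrite GD.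
have mF' : measurable_fun setT (fun z : R * R => F (z.1 + -1 * z.2, z.2)).
  apply: (measurableT_comp mF); apply: measurable_fun_pair; last exact: measurable_snd.
  apply: measurable_funD; first exact: measurable_fst.
  by apply: measurable_funM => //; exact: measurable_snd.
have m1 := measurable_funTS (D := `[0, L]%classic)
  (measurable_fun_section_integral (measurable_itv `[0, d]) mF F0).
have m2 := measurable_funTS (D := `[0, L]%classic)
  (measurable_fun_section_integral (measurable_itv `[0, d]) mF' (fun z => F0 _)).
rewrite SE -{2}sh; apply: ge0_integralD; rewrite ?inE//.
- by move=> x _; apply: integral_ge0 => w _; exact: F0.
- by move=> x _; apply: integral_ge0 => w _; exact: F0.
Qed.

(** Only small [w] matter: for [w >= d] the integrand is bounded because [g] is. *)
Lemma slobodeckij_cut p L d D g : 0 < L -> 1 < p -> 0 < d -> d <= D -> continuous g -> periodic g L ->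
  (slobodeckij p L d g < +oo -> slobodeckij p L D g < +oo)%E.
Proof.
move=> L0 p1 d0 dD cg pg fin.
have p0 : 0 < p by rewrite (lt_trans _ p1).
have [M M0 hM] := periodic_bounded L0 cg pg.
pose F (z : R * R) := (enorm (g (z.1 + 1 * z.2) - g (z.1 + 0 * z.2)) `^ p * z.2 `^ (1 - p))%:E.
have mF : measurable_fun setT F by exact: measurable_slobodeckij.
have F0 z : (0 <= F z)%E by rewrite lee_fin mulr_ge0 ?powR_ge0.
have FE s w : (enorm (g (s + w) - g s) `^ p * w `^ (1 - p))%:E = F (s, w).
  by rewrite /F/= mul1r mul0r addr0.
have Fle s w : d <= w -> (F (s, w) <= ((2 * M) `^ p * d `^ (1 - p))%:E)%E.
  move=> dw; rewrite -FE lee_fin ler_pM ?powR_ge0//.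
    rewrite ge0_ler_powR ?nnegrE ?enorm_ge0 ?(ltW p0) ?mulr_ge0 ?(ltW M0)//.
    by rewrite (le_trans (ler_enormB _ _))// mulr_natl mulr2n lerD.
  by apply: powR_antimono => //; rewrite subr_le0 ltW.
have mFx s : measurable_fun setT (fun w => F (s, w)).
  exact: (measurableT_comp mF (pair1_measurable _)).
rewrite /slobodeckij in fin *.
under eq_integral do under eq_integral do rewrite FE.
have {}fin : (\int[mu]_(s in `[0%R, L]) \int[mu]_(w in `[0%R, d]) F (s, w) < +oo)%E.
  by apply: le_lt_trans fin; rewrite le_eqVlt; apply/orP; left; apply/eqP;
     apply: eq_integral => s _; apply: eq_integral => w _; rewrite FE.
under eq_integral do rewrite (ge0_integral_itv_cat (ltW d0) dD (mFx _) (fun w => F0 (_, w))).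
clear FE; clearbody F.
rewrite ge0_integralD//; last 4 first.
- by move=> x _; exact: integral_ge0.
- by apply: measurable_funTS; exact: measurable_fun_section_integral.
- by move=> x _; exact: integral_ge0.
- by apply: measurable_funTS; exact: measurable_fun_section_integral.
apply: lte_add_pinfty; first exact: fin.
apply: (@le_lt_trans _ _ (\int[mu]_(s in `[0%R, L]) \int[mu]_(w in `[d, D])
   ((2 * M) `^ p * d `^ (1 - p))%:E)%E).
  apply: ge0_le_integral_any => s _; first exact: integral_ge0.
  by apply: ge0_le_integral_any => w //=; rewrite in_itv/= => /andP[dw _]; exact: Fle.
under eq_integral do rewrite integral_cst//= lebesgue_measure_itv/=.
rewrite integral_cst//= lebesgue_measure_itv/= !lte_fin L0.
by case: ifP => _; rewrite ?mule0 ?mul0e ?ltry// -!EFinB -!EFinM ltry.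
Qed.

Lemma C1_sobolev p L f : 1 < p -> 0 < L -> periodic f L -> (forall x, derivable f x (1 : R)) ->
  continuous (derive1 f) -> (slobodeckij p L (L / 2) (derive1 f) < +oo)%E ->
  sobolev_slobodeckij p L f.
Proof.
move=> p1 L0 pf df cf fin; have p0 : 0 < p by rewrite (lt_trans _ p1).
exists (derive1 f).
  split; last exact: C1_weak_derivative.
    by apply: continuous_Lp_periodic => //; exact: derivable_continuous.
  by apply: continuous_Lp_periodic => //; exact: derive1_periodic.
rewrite slobodeckij_double//; last exact: derive1_periodic.
  by rewrite lte_add_pinfty.
by rewrite divr_ge0// ltW.
Qed.

End PeriodicC1.

(** * Regularity of curves of finite energy *)

Section FiniteEnergyRegularity.
Context {R : realType}.
Notation mu := (@lebesgue_measure R).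
Implicit Types (f : curve R) (p al K L : R).

Lemma directionN (v : 'rV[R]_3) : direction (- v) = - direction v.
Proof. by rewrite /direction enormN scalerN. Qed.

(** One chord, seen forward from [s] and backward from [s + w], has one direction; it is the
    intermediate vector between the tangents at its two ends. *)
Lemma chord_dir_flip f s w : chord_dir f (-1) (s + w) w = chord_dir f 1 s w.
Proof.
rewrite /chord_dir scale1r scaleN1r mulN1r addrK mul1r.
by rewrite -(opprB (f (s + w))) directionN opprK.
Qed.

(** The difference of the tangents at [s + w] and [s] is split at the direction of the chord that
    joins the two points. The part at [s] is the forward chord estimate; the part at [s + w] is the
    backward one after [slant_shift]. *)
Lemma slobodeckij_tangent p al K L f : 3 < p -> 0 < al -> al <= 1 -> 0 < K -> 0 < L ->
  continuous f -> periodic f L -> by_arclength f -> holder_tangent al K f ->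
  (menger_integral p L f < +oo -> slobodeckij p L (L / 2) (derive1 f) < +oo)%E.
Proof.
move=> p3 al0 al1 K0 L0 cf pf arc hol fin.
have p1 : 1 < p by rewrite (lt_trans _ p3)// ltr1n.
have cT := holder_tangent_continuous al0 hol.
have pT := derive1_periodic pf.
have [C [d [C0 d0 dL hC]]] := chord_dir_energy p3 al0 al1 K0 L0 cf pf arc hol.
have [B B0 hB] : exists2 B : \bar R, (B < +oo)%E & forall c, c = 1 \/ c = -1 ->
  (\int[mu]_(s in `[0%R, L]) \int[mu]_(w in `[0%R, d])
     (enorm (chord_dir f c s w - derive1 f s) `^ p * w `^ (1 - p))%:E <= B)%E.
  exists (C%:E * menger_integral p L f)%E; last exact: hC.
  by rewrite lte_mul_pinfty// lee_fin ltW.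
pose F c (z : R * R) := (enorm (chord_dir f c z.1 z.2 - derive1 f z.1) `^ p * z.2 `^ (1 - p))%:E.
have mF c : measurable_fun setT (F c).
  apply/measurable_EFinP; apply: measurable_funM.
    apply: measurable_fun_powR; apply: measurable_enorm; apply: mvecB.
      exact: chord_dir_measurable2.
    by apply: (mvec_comp (continuous_mvec cT)); exact: measurable_fst.
  by apply: measurable_fun_powR; exact: measurable_snd.
have F0 c z : (0 <= F c z)%E by rewrite lee_fin mulr_ge0 ?powR_ge0.
have pF c s w : F c (s + L, w) = F c (s, w).
  by rewrite /F/= /chord_dir pT addrAC !pf.
have FE c s w : F c (s, w) = (enorm (chord_dir f c s w - derive1 f s) `^ p * w `^ (1 - p))%:E by [].
clearbody F.
apply: (slobodeckij_cut L0 p1 d0 dL cT pT).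
have mF' : measurable_fun setT (fun z : R * R => F (-1) (z.1 + 1 * z.2, z.2)).
  apply: (measurableT_comp (mF _)); apply: measurable_fun_pair; last exact: measurable_snd.
  apply: measurable_funD; first exact: measurable_fst.
  by apply: measurable_funM => //; exact: measurable_snd.
have m1 := measurable_funTS (D := `[0, L]%classic)
  (measurable_fun_section_integral (measurable_itv `[0, d]) mF' (fun z => F0 _ _)).
have m2 := measurable_funTS (D := `[0, L]%classic)
  (measurable_fun_section_integral (measurable_itv `[0, d]) (mF 1) (F0 1)).
have i1 : (\int[mu]_(s in `[0%R, L]) \int[mu]_(w in `[0%R, d]) F (-1)%R (s + 1 * w, w)%R <= B)%E.
  rewrite (slant_shift d 1 L0 (mF _) (F0 _) (pF _)).
  rewrite (le_trans _ (hB (-1) _))//; last by right.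
  by rewrite le_eqVlt; apply/orP; left; apply/eqP;
     apply: eq_integral => s _; apply: eq_integral => w _; rewrite FE.
have i2 : (\int[mu]_(s in `[0%R, L]) \int[mu]_(w in `[0%R, d]) F 1%R (s, w) <= B)%E.
  rewrite (le_trans _ (hB 1 _))//; last by left.
  by rewrite le_eqVlt; apply/orP; left; apply/eqP;
     apply: eq_integral => s _; apply: eq_integral => w _; rewrite FE.
have t0 : 0 < 2 `^ p :> R by rewrite powR_gt0.
apply: (@le_lt_trans _ _ ((2 `^ p)%:E * (B + B))%E); last first.
  by apply: lte_mul_pinfty; rewrite ?lee_fin ?(ltW t0)//; exact: lte_add_pinfty.
apply: (@le_trans _ _ ((2 `^ p)%:E *
  (\int[mu]_(s in `[0%R, L]) (\int[mu]_(w in `[0%R, d]) F (-1)%R (s + 1 * w, w)%R +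
   \int[mu]_(w in `[0%R, d]) F 1%R (s, w))))%E); last first.
  apply: lee_wpmul2l; first by rewrite lee_fin ltW.
  rewrite (le_trans _ (leeD i1 i2))// le_eqVlt; apply/orP; left; apply/eqP.
  by apply: ge0_integralD; rewrite ?inE//; move=> x _; apply: integral_ge0 => w _; exact: F0.
rewrite -(ge0_integralZl_any _ t0); last first.
  by move=> s _; apply: adde_ge0; apply: integral_ge0 => w _; exact: F0.
apply: ge0_le_integral_any => s _.
  by apply: integral_ge0 => w _; rewrite lee_fin mulr_ge0 ?powR_ge0.
apply: (@le_trans _ _ ((2 `^ p)%:E * \int[mu]_(w in `[0%R, d])
    (F (-1)%R (s + 1 * w, w)%R + F 1%R (s, w)))%E); last first.
  apply: lee_wpmul2l; first by rewrite lee_fin ltW.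
  rewrite le_eqVlt; apply/orP; left; apply/eqP; apply: ge0_integralD; rewrite ?inE//.
  - by apply: measurable_funTS; exact: (measurableT_comp mF' (pair1_measurable s)).
  - by apply: measurable_funTS; exact: (measurableT_comp (mF 1) (pair1_measurable s)).
rewrite -(ge0_integralZl_any _ t0); last by move=> w _; exact: adde_ge0.
apply: ge0_le_integral_any => w /=; rewrite in_itv/= => /andP[w0 wd].
  by rewrite lee_fin mulr_ge0 ?powR_ge0.
rewrite !FE -EFinD -EFinM lee_fin -mulrDl mulrA ler_wpM2r ?powR_ge0//.
rewrite mul1r chord_dir_flip.
set a := derive1 f (s + w); set b := derive1 f s; set e := chord_dir _ _ _ _.
clearbody a b e.
apply: le_trans (powR_addr_le (ltW p1) (enorm_ge0 _) (enorm_ge0 _)).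
apply: ge0_ler_powR; rewrite ?nnegrE ?addr_ge0 ?enorm_ge0 ?(ltW (lt_trans _ p1))//.
by rewrite (enormBC e a); exact: enorm_triangle.
Qed.

Lemma finite_energy_holder p L f : 3 < p -> 0 < L -> continuous f -> periodic f L ->
  {in `[0, L[ &, injective f} -> by_arclength f -> (menger_integral p L f < +oo)%E ->
  exists2 K, 0 < K & holder_tangent ((p - 3) / (p + 3) / 2) K f.
Proof.
move=> p3 L0 cf pf inj arc fin.
have kap0 : 0 < (p - 3) / (p + 3) by rewrite divr_gt0 ?subr_gt0 ?addr_gt0// (lt_trans _ p3).
have [C C0 hC] := flat_triple p3 L0 arc fin.
have fl := flat_curve_periodic L0 pf hC.
have [K K0 hK] := flat_chords_parallel C0 kap0 cf fl.
have [K' [r0 [K'0 r00 ax]]] := parallel_chords_axis L0 K0 kap0 cf pf inj arc hK.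
by apply: (axis_holder_tangent _ K'0 r00 arc ax); rewrite divr_gt0.
Qed.

Lemma finite_energy_regularity p L f : 3 < p -> 0 < L -> continuous f -> periodic f L ->
  {in `[0, L[ &, injective f} -> by_arclength f -> (menger_integral p L f < +oo)%E ->
  [/\ forall s, derivable f s (1 : R), continuous (derive1 f), forall s, enorm (derive1 f s) = 1 &
      (slobodeckij p L (L / 2) (derive1 f) < +oo)%E].
Proof.
move=> p3 L0 cf pf inj arc fin.
have [K K0 hol] := finite_energy_holder p3 L0 cf pf inj arc fin.
have p30 : 0 < p + 3 by rewrite addr_gt0// (lt_trans _ p3).
have al0 : 0 < (p - 3) / (p + 3) / 2 by rewrite !divr_gt0// subr_gt0.
have al1 : (p - 3) / (p + 3) / 2 <= 1.
  by rewrite ler_pdivrMr// mul1r ler_pdivrMr//; lra.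
have [d T1 _ _] := hol; split; [exact: d|exact: (holder_tangent_continuous al0 hol)|exact: T1|].
exact: (slobodeckij_tangent p3 al0 al1 K0 L0 cf pf arc hol fin).
Qed.

End FiniteEnergyRegularity.

(** * Difference quotients compared with the derivative *)

Section QuotientDefect.
Context {R : realType}.
Notation mu := (@lebesgue_measure R).
Implicit Types (f : curve R) (p L : R).

Lemma dotBl (u v w : 'rV[R]_3) : dot (u - v) w = dot u w - dot v w.
Proof. by rewrite !coE; ring. Qed.

Lemma is_derive_co f (i : nat) (x : R) : derivable f x (1 : R) ->
  is_derive x (1 : R) (fun y => co i (f y)) (co i (derive1 f x)).
Proof. by move=> df; rewrite derive1_co// derive1E; apply/derivableP; exact: derivable_co. Qed.

Lemma is_derive_dot_affine f (e : 'rV[R]_3) (y c w : R) : (forall x, derivable f x (1 : R)) ->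
  is_derive w (1 : R) (fun w => dot (f (y + c * w)) e) (c * dot (derive1 f (y + c * w)) e).
Proof.
move=> df.
have da : is_derive w (1 : R) (fun w => y + c * w) c.
  by apply: is_derive_eq; rewrite /GRing.scale/= add0r mul1r mulr1.
have d i : is_derive w (1 : R) (fun w => co i (f (y + c * w)))
    (co i (derive1 f (y + c * w)) * c).
  exact: (@is_derive1_comp _ (fun z => co i (f z)) (fun w => y + c * w) w _ _ (is_derive_co i (df _)) da).
have -> : (fun w => dot (f (y + c * w)) e) =
    (fun w => co 0 e * co 0 (f (y + c * w)) + co 1 e * co 1 (f (y + c * w)) +
      co 2 e * co 2 (f (y + c * w))).
  by apply/funext => z; rewrite dotE; ring.
apply: is_derive_eq; rewrite dotE /GRing.scale/=; ring.
Qed.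

Definition quot_defect f (y x : R) := enorm (x^-1 *: (f (y + x) - f y) - derive1 f y).

Lemma powR_pred (k p : R) : 0 < k -> k `^ p = k `^ (p - 1) * k.
Proof.
move=> k0; rewrite -[X in _ * X](powRr1 (ltW k0)) -powRD ?subrK//.
by rewrite (gt_eqF k0) implybT.
Qed.

(** An affine minorant of [k ^ p] that vanishes at [m / 2] with slope [(m / 2) ^ (p - 1)]; it is
    easier to handle than the tangent at [m]. *)
Lemma powR_half_slope p (m k : R) : 1 <= p -> 0 <= m -> 0 <= k ->
  (m / 2) `^ (p - 1) * (k - m / 2) <= k `^ p.
Proof.
move=> p1 m0 k0; have [km|mk] := leP k (m / 2).
  by rewrite (le_trans _ (powR_ge0 _ _))// mulr_ge0_le0 ?powR_ge0// subr_le0.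
have kp : 0 < k by rewrite (le_lt_trans _ mk)// divr_ge0.
rewrite [leRHS]powR_pred//.
apply: ler_pM; rewrite ?powR_ge0 ?subr_ge0 ?(ltW mk)//; last by rewrite gerBl divr_ge0.
by rewrite ge0_ler_powR ?nnegrE ?subr_ge0 ?divr_ge0 ?(ltW mk).
Qed.

(** A substitute for Jensen's inequality. Along the unit direction [e] of the defect, the mean of
    [derive1 f (y + c * w) - derive1 f y] over [[0, x]] is exactly the size [m] of the defect.
    Integrating the minorant of [powR_half_slope] gives [(m / 2) ^ (p - 1) * (m - m / 2) * x]. *)
Lemma quot_defect_avg p f (y c x : R) : 1 <= p -> (forall s, derivable f s (1 : R)) ->
  continuous (derive1 f) -> c = 1 \/ c = -1 -> 0 < x ->
  ((quot_defect f y (c * x) `^ p * x)%:E <= (2 `^ p)%:E *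
    \int[mu]_(w in `[0%R, x]) (enorm (derive1 f (y + c * w) - derive1 f y) `^ p)%:E)%E.
Proof.
move=> p1 df cf c1 x0; have p0 : 0 < p by rewrite (lt_le_trans _ p1).
have cc : c * c = 1 by case: c1 => ->; rewrite ?mulN1r ?opprK ?mulr1.
set m := quot_defect f y (c * x).
have m0 : 0 <= m by exact: enorm_ge0.
have I0 : (0 <= \int[mu]_(w in `[0%R, x]) (enorm (derive1 f (y + c * w) - derive1 f y) `^ p)%:E)%E.
  by apply: integral_ge0 => w _; rewrite lee_fin powR_ge0.
have [mE|mn0] := eqVneq m 0.
  by rewrite mE powR0 ?gt_eqF// mul0r; apply: mule_ge0; rewrite ?lee_fin ?powR_ge0.
have mp : 0 < m by rewrite lt_neqAle eq_sym mn0.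
pose v := (c * x)^-1 *: (f (y + c * x) - f y) - derive1 f y.
pose e := m^-1 *: v.
have e1 : enorm e = 1 by rewrite enormZ gtr0_norm ?invr_gt0// mulVf.
have ve : dot v e = m.
  by rewrite /e dotZr -sqr_enorm -/m -[enorm v]/m expr2 mulrA mulVf ?mul1r.
pose A := (m / 2) `^ (p - 1).
(* A primitive of the minorant [F'], explicit because [derive1 f] integrates to differences of
   [f]. *)
pose F w := A * (c * dot (f (y + c * w)) e - c * dot (f y) e - w * (dot (derive1 f y) e + m / 2)).
pose F' w := A * (dot (derive1 f (y + c * w)) e - (dot (derive1 f y) e + m / 2)).
have dF (w : R) : is_derive w (1 : R) F (F' w).
  have d1 := @is_derive_dot_affine f e y c w df.
  rewrite /F; apply: is_derive_eq.
  by rewrite /F' /GRing.scale/= !mulr1 !mulr0 add0r subr0 mulrA cc mul1r.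
have cF' : continuous F'.
  move=> w; rewrite /F'; apply: cvgM; first exact: cvg_cst.
  apply: cvgB; last exact: cvg_cst.
  have -> : (fun w => dot (derive1 f (y + c * w)) e) =
    (fun w => co 0 (derive1 f (y + c * w)) * co 0 e + co 1 (derive1 f (y + c * w)) * co 1 e +
      co 2 (derive1 f (y + c * w)) * co 2 e).
    by apply/funext => z; rewrite dotE.
  have ca : {for w, continuous (fun w => y + c * w)}.
    by apply: cvgD; [exact: cvg_cst|apply: cvgM; [exact: cvg_cst|exact: cvg_id]].
  have cc' i : {for w, continuous (fun w => co i (derive1 f (y + c * w)) * co i e)}.
    apply: cvgM; last exact: cvg_cst.
    apply: (@continuous_comp _ _ _ (fun w => derive1 f (y + c * w)) (@co R i)); last exact: continuous_co.
    by apply: (@continuous_comp _ _ _ (fun w => y + c * w) (derive1 f)); last exact: cf.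
  by rewrite [X in _ --> X]dotE; apply: cvgD; [apply: cvgD|]; exact: cc'.
have := @FTC_le_integral _ F F'
  (fun w => (enorm (derive1 f (y + c * w) - derive1 f y) `^ p)%:E) 0 x (ltW x0) cF' dF.
move=> /(_ (fun w => _) _) H.
have {H} : (((m / 2) `^ p * x)%:E <=
    \int[mu]_(w in `[0%R, x]) (enorm (derive1 f (y + c * w) - derive1 f y) `^ p)%:E)%E.
  have -> : (m / 2) `^ p * x = F x - F 0.
    have -> : F 0 = 0 by rewrite /F mulr0 addr0 mul0r subr0 subrr mulr0.
    have E : c * dot (f (y + c * x)) e - c * dot (f y) e = x * (dot v e + dot (derive1 f y) e).
      have cV : c^-1 = c by case: c1 => ->; rewrite ?invrN invr1.
      rewrite -mulrBr -dotBl /v; set D := f (y + c * x) - f y.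
      by rewrite [in RHS]dotBl subrK dotZl invfM cV mulrA (mulrCA x c) mulfV ?gt_eqF// mulr1.
    have m2 : 0 < m / 2 by rewrite divr_gt0.
    rewrite subr0 /F E ve (powR_pred p m2) -/A.
    by field.
  apply: H => w; first by rewrite lee_fin powR_ge0.
  move=> _; rewrite lee_fin /F' opprD addrA -dotBl.
  apply: (le_trans _ (powR_half_slope p1 m0 (enorm_ge0 _))).
  rewrite ler_wpM2l ?powR_ge0// lerD2r (le_trans (dot_le _ _))// e1 mulr1//.
move=> H; apply: le_trans (lee_wpmul2l _ H); last by rewrite lee_fin powR_ge0.
rewrite -EFinM lee_fin mulrA -powRM ?divr_ge0// mulrCA mulfV// mulr1//.
Qed.

End QuotientDefect.

Section DefectIntegrals.
Context {R : realType}.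
Notation mu := (@lebesgue_measure R).
Implicit Types (f : curve R) (p L D : R).

Lemma measurable_quot_defect disp (T : measurableType disp) f (a b : T -> R) :
  continuous f -> continuous (derive1 f) ->
  measurable_fun setT a -> measurable_fun setT b ->
  measurable_fun setT (fun z => quot_defect f (a z) (b z)).
Proof.
move=> cf cf' ma mb; apply: measurable_enorm; apply: mvecB.
  apply: mvecZ; first exact: measurable_funV.
  apply: mvecB; apply: (mvec_comp (continuous_mvec cf)) => //.
  exact: measurable_funD.
exact: (mvec_comp (continuous_mvec cf')).
Qed.

(* Hardy's inequality for averages: exchange the order of integration on [0 <= w < x <= D]. *)
Lemma integral_average_le p D (k : R -> R) : 1 < p -> 0 < D -> measurable_fun setT k ->
  (forall w, 0 <= k w) -> k 0 = 0 ->
  (\int[mu]_(x in `]0%R, D]) ((x `^ (- p))%:E * \int[mu]_(w in `[0%R, x]) (k w)%:E) <=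
   ((p - 1)^-1)%:E * \int[mu]_(w in `[0%R, D]) (k w * w `^ (1 - p))%:E)%E.
Proof.
move=> p1 D0 mk k0 k00; have p10 : 0 < p - 1 by rewrite subr_gt0.
pose S : set (R * R) := [set z | z.2 < z.1].
have mS : measurable S.
  have -> : S = (fun z => z.1 - z.2) @^-1` `]0, +oo[%classic.
    by apply/seteqP; split => z; rewrite /S/= in_itv/= andbT subr_gt0.
  rewrite -[X in measurable X]setTI; apply: measurable_funB => //.
pose F (z : R * R) := (z.1 `^ (- p) * (k z.2 * \1_S z))%:E.
have mF : measurable_fun setT F.
  apply/measurable_EFinP; apply: measurable_funM.
    by apply: measurable_fun_powR; exact: measurable_fst.
  apply: measurable_funM; last exact: measurable_indic.
  by apply: (measurableT_comp mk); exact: measurable_snd.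
have i0 z : 0 <= \1_S z :> R by rewrite indicE ler0n.
have F0 z : (0 <= F z)%E by rewrite lee_fin !mulr_ge0 ?powR_ge0.
have F1 x w : w < x -> F (x, w) = (x `^ (- p) * k w)%:E.
  by move=> wx; rewrite /F/= indicE (_ : _ \in S) ?mulr1// inE.
have F2 x w : x <= w -> F (x, w) = 0%E.
  by move=> xw; rewrite /F/= indicE (_ : _ \in S = false) ?mulr0//; apply/negbTE; rewrite notin_setE /S/=; apply/negP; rewrite -leNgt.
clearbody F; clear i0.
apply: (@le_trans _ _ (\int[mu]_(x in `]0%R, D]) \int[mu]_(w in `[0%R, D]) F (x, w))%E).
  apply: ge0_le_integral_any => x /=; rewrite in_itv/= => /andP[x0 xD].
    by apply: mule_ge0; rewrite ?lee_fin ?powR_ge0//; apply: integral_ge0 => w _; rewrite lee_fin.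
  have xp : 0 < x `^ (- p) by rewrite powR_gt0.
  rewrite -(ge0_integralZl_any _ xp); last by move=> w _; rewrite lee_fin.
  rewrite -(@integral_itv_bndo_bndc _ (BLeft 0) x); last first.
    by apply: measurable_funTS; apply: measurable_funeM; exact/measurable_EFinP.
  have -> : (\int[mu]_(w in `[0%R, x[) ((x `^ (- p))%:E * (k w)%:E) =
      \int[mu]_(w in `[0%R, x[) F (x, w))%E.
    apply: eq_integral => w /[!inE]/=; rewrite in_itv/= => /andP[_ wx].
    by rewrite F1// EFinM.
  apply: ge0_subset_integral => //.
  - by apply: measurable_funTS; exact: (measurableT_comp mF (pair1_measurable x)).
  - by move=> w /=; rewrite !in_itv/= => /andP[-> /ltW wx]; rewrite (le_trans wx).
rewrite (tonelli_swap _ _ mF F0)//.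
have pV : 0 < (p - 1)^-1 by rewrite invr_gt0.
rewrite -(ge0_integralZl_any _ pV); last by move=> w _; rewrite lee_fin mulr_ge0 ?powR_ge0.
apply: ge0_le_integral_any => w /=; rewrite in_itv/= => /andP[w0 wD].
  by apply: integral_ge0 => x _; exact: F0.
move: w0; rewrite le_eqVlt => /orP[/eqP w0|w0].
  rewrite -w0 k00 mul0r mule0 integral0_eq// => x /=; rewrite in_itv/= => /andP[x0 _].
  by rewrite F1// k00 mulr0.
have mFw : measurable_fun setT (fun x => F (x, w)).
  exact: (measurableT_comp mF (pair2_measurable w)).
rewrite integral_itv_obnd_cbnd; last exact: measurable_funTS.
rewrite (ge0_integral_itv_cat (ltW w0) wD mFw)//.
rewrite integral0_eq ?add0e; last first.
  by move=> x /=; rewrite in_itv/= => /andP[_ xw]; rewrite F2.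
have [kw|kw] := eqVneq (k w) 0.
  rewrite kw mul0r mule0 integral0_eq// => x /=; rewrite in_itv/= => /andP[wx _].
  by move: wx; rewrite le_eqVlt => /orP[/eqP ->|wx]; [rewrite F2|rewrite F1// kw mulr0].
have kw0 : 0 < k w by rewrite lt_neqAle eq_sym kw k0.
apply: (@le_trans _ _ ((k w)%:E * \int[mu]_(x in `[w, D]) (x `^ (- p))%:E)%E).
  rewrite -(ge0_integralZl_any _ kw0); last by move=> x _; rewrite lee_fin powR_ge0.
  apply: ge0_le_integral_any => x /=; rewrite in_itv/= => /andP[wx _]; first exact: F0.
  move: wx; rewrite le_eqVlt => /orP[/eqP <-|wx]; last by rewrite F1// mulrC.
  by rewrite F2// -EFinM lee_fin mulr_ge0 ?powR_ge0// ltW.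
apply: (le_trans (lee_wpmul2l _ (integral_powRN w0 wD p1))); first by rewrite lee_fin.
by rewrite -!EFinM lee_fin le_eqVlt; apply/orP; left; apply/eqP; ring.
Qed.

(** The averaged bound is inserted into Hardy's inequality for averages, after writing [x ^ (1 - p)]
    as [x * x ^ (- p)]. *)
Lemma quot_defect_integral p f (y c D : R) : 1 < p -> (forall s, derivable f s (1 : R)) ->
  continuous (derive1 f) -> c = 1 \/ c = -1 -> 0 < D ->
  (\int[mu]_(x in `]0%R, D]) (quot_defect f y (c * x) `^ p * x `^ (1 - p))%:E <=
   (2 `^ p / (p - 1))%:E * \int[mu]_(w in `[0%R, D])
     (enorm (derive1 f (y + c * w) - derive1 f y) `^ p * w `^ (1 - p))%:E)%E.
Proof.
move=> p1 df cf c1 D0; have p0 : 0 < p by rewrite (lt_trans _ p1).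
have t0 : 0 < 2 `^ p :> R by rewrite powR_gt0.
pose k w := enorm (derive1 f (y + c * w) - derive1 f y) `^ p.
have mk : measurable_fun setT k.
  apply: measurable_fun_powR; apply: measurable_enorm; apply: mvecB.
    by apply: (mvec_comp (continuous_mvec cf)); apply: measurable_funD => //; exact: measurable_funM.
  by move=> i _; exact: measurable_cst.
have k0 w : 0 <= k w by exact: powR_ge0.
have k00 : k 0 = 0 by rewrite /k mulr0 addr0 subrr enorm0 powR0 ?gt_eqF.
rewrite EFinM -muleA; apply: (le_trans _ (lee_wpmul2l _ (integral_average_le p1 D0 mk k0 k00))); last first.
  by rewrite lee_fin ltW.
rewrite -(ge0_integralZl_any _ t0); last first.
  by move=> x _; apply: mule_ge0; rewrite ?lee_fin ?powR_ge0//; apply: integral_ge0 => w _; rewrite lee_fin.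
apply: ge0_le_integral_any => x /=; rewrite in_itv/= => /andP[x0 xD].
  by rewrite lee_fin mulr_ge0 ?powR_ge0.
have := quot_defect_avg y (ltW p1) df cf c1 x0.
move=> /(lee_wpmul2l (x := (x `^ (- p))%:E)).
rewrite lee_fin powR_ge0 => /(_ isT); rewrite muleCA; apply: le_trans.
rewrite -EFinM lee_fin mulrCA ler_wpM2l ?powR_ge0//.
by rewrite [leLHS]powR_pred// (_ : 1 - p - 1 = - p)//; ring.
Qed.

End DefectIntegrals.

(** * Triple integrals and the dominating kernel *)

Section TripleIntegrals.
Context {R : realType}.
Notation mu := (@lebesgue_measure R).
Variable L : R.
Implicit Types F G : R * R * R -> \bar R.

Definition integral3 F : \bar R :=
  (\int[mu]_(s in `[0%R, L]) \int[mu]_(t in `[0%R, L]) \int[mu]_(g in `[0%R, L]) F (s, t, g))%E.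

Lemma integral3_ge0 F : (forall z, 0 <= F z)%E -> (0 <= integral3 F)%E.
Proof. by move=> F0; do 3 (apply: integral_ge0 => ? _). Qed.

Lemma integral3_le F G : (forall z, 0 <= F z)%E ->
  (forall s t g, 0 <= s <= L -> 0 <= t <= L -> 0 <= g <= L -> (F (s, t, g) <= G (s, t, g))%E) ->
  (integral3 F <= integral3 G)%E.
Proof.
move=> F0 FG; apply: ge0_le_integral_any => s /=; rewrite in_itv/= => hs.
  by do 2 (apply: integral_ge0 => ? _).
apply: ge0_le_integral_any => t /=; rewrite in_itv/= => ht; first by apply: integral_ge0 => ? _.
by apply: ge0_le_integral_any => g //=; rewrite in_itv/= => hg; exact: FG.
Qed.

Lemma eq_integral3 F G :
  (forall s t g, 0 <= s <= L -> 0 <= t <= L -> 0 <= g <= L -> F (s, t, g) = G (s, t, g)) ->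
  integral3 F = integral3 G.
Proof.
move=> FG; apply: eq_integral => s /[!inE]/=; rewrite in_itv/= => hs.
apply: eq_integral => t /[!inE]/=; rewrite in_itv/= => ht.
by apply: eq_integral => g /[!inE]/=; rewrite in_itv/= => hg; exact: FG.
Qed.

Lemma measurable_section3 F (s : R) : measurable_fun setT F ->
  measurable_fun setT (fun z : R * R => F (s, z.1, z.2)).
Proof.
move=> mF; apply: (measurableT_comp mF); apply: measurable_fun_pair; last exact: measurable_snd.
by apply: measurable_fun_pair; [exact: measurable_cst|exact: measurable_fst].
Qed.

Lemma ge0_integralD_itv (a b : R) (F G : R -> \bar R) :
  measurable_fun setT F -> measurable_fun setT G ->
  (forall x, 0 <= F x)%E -> (forall x, 0 <= G x)%E ->
  (\int[mu]_(x in `[a, b]) (F x + G x) =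
   \int[mu]_(x in `[a, b]) F x + \int[mu]_(x in `[a, b]) G x)%E.
Proof.
by move=> mF mG F0 G0; rewrite ge0_integralD//; exact: measurable_funTS.
Qed.

Lemma measurable_integral3_inner F : measurable_fun setT F -> (forall z, 0 <= F z)%E ->
  measurable_fun setT (fun z : R * R => \int[mu]_(g in `[0%R, L]) F (z, g))%E.
Proof. by move=> mF F0; exact: measurable_fun_section_integral. Qed.

Lemma measurable_integral3_outer F : measurable_fun setT F -> (forall z, 0 <= F z)%E ->
  measurable_fun setT (fun s : R => \int[mu]_(t in `[0%R, L]) \int[mu]_(g in `[0%R, L]) F (s, t, g))%E.
Proof.
move=> mF F0; apply: (@measurable_fun_section_integral _ _ (measurableTypeR R) _
  (fun z : R * R => \int[mu]_(g in `[0%R, L]) F (z, g))%E) => //.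
- exact: measurable_integral3_inner.
- by move=> z; exact: integral_ge0.
Qed.

Lemma integral3D F G : measurable_fun setT F -> measurable_fun setT G ->
  (forall z, 0 <= F z)%E -> (forall z, 0 <= G z)%E ->
  integral3 (fun z => F z + G z)%E = (integral3 F + integral3 G)%E.
Proof.
move=> mF mG F0 G0.
rewrite /integral3 -(ge0_integralD_itv _ _ (measurable_integral3_outer mF F0)
  (measurable_integral3_outer mG G0)); first last.
- by move=> s; do 2 (apply: integral_ge0 => ? _).
- by move=> s; do 2 (apply: integral_ge0 => ? _).
apply: eq_integral => s _.
have ms (H : R * R * R -> \bar R) : measurable_fun setT H -> (forall z, 0 <= H z)%E ->
    measurable_fun setT (fun t : R => \int[mu]_(g in `[0%R, L]) H (s, t, g))%E.
  by move=> mH H0; exact: (measurableT_comp (measurable_integral3_inner mH H0) (pair1_measurable s)).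
rewrite -(ge0_integralD_itv _ _ (ms F mF F0) (ms G mG G0)); first last.
- by move=> t; apply: integral_ge0 => ? _.
- by move=> t; apply: integral_ge0 => ? _.
apply: eq_integral => t _.
have mt (H : R * R * R -> \bar R) : measurable_fun setT H -> measurable_fun setT (fun g : R => H (s, t, g)).
  by move=> mH; exact: (measurableT_comp mH (pair1_measurable (s, t))).
exact: (ge0_integralD_itv _ _ (mt F mF) (mt G mG)).
Qed.

Lemma integral3Z F (k : R) : 0 < k -> (forall z, 0 <= F z)%E ->
  integral3 (fun z => k%:E * F z)%E = (k%:E * integral3 F)%E.
Proof.
move=> k0 F0; rewrite /integral3 -(ge0_integralZl_any _ k0); last first.
  by move=> s _; do 2 (apply: integral_ge0 => ? _).
apply: eq_integral => s _; rewrite -(ge0_integralZl_any _ k0); last first.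
  by move=> t _; apply: integral_ge0 => ? _.
by apply: eq_integral => t _; rewrite -(ge0_integralZl_any _ k0).
Qed.

Lemma integral3_swap12 F : measurable_fun setT F -> (forall z, 0 <= F z)%E ->
  integral3 (fun z => F (z.1.2, z.1.1, z.2)) = integral3 F.
Proof.
move=> mF F0; rewrite /integral3.
have mG : measurable_fun setT (fun z : R * R => \int[mu]_(g in `[0%R, L]) F (z, g))%E.
  exact: measurable_fun_section_integral.
have G0 z : (0 <= \int[mu]_(g in `[0%R, L]) F (z, g))%E by exact: integral_ge0.
exact: (esym (tonelli_swap (measurable_itv `[0, L]) (measurable_itv `[0, L]) mG G0)).
Qed.

Lemma integral3_swap23 F : measurable_fun setT F -> (forall z, 0 <= F z)%E ->
  integral3 (fun z => F (z.1.1, z.2, z.1.2)) = integral3 F.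
Proof.
move=> mF F0; apply: eq_integral => s _ /=.
exact: (esym (tonelli_swap (measurable_itv `[0, L]) (measurable_itv `[0, L])
  (measurable_section3 s mF) (fun z => F0 _))).
Qed.

Lemma integral3_rot F : measurable_fun setT F -> (forall z, 0 <= F z)%E ->
  integral3 (fun z => F (z.2, z.1.1, z.1.2)) = integral3 F.
Proof.
move=> mF F0; have mF2 : measurable_fun setT (fun z : R * R * R => F (z.1.2, z.1.1, z.2)).
  apply: (measurableT_comp mF); apply: measurable_fun_pair; last exact: measurable_snd.
  apply: measurable_fun_pair; apply: (measurableT_comp _ measurable_fst).
    exact: measurable_snd.
  exact: measurable_fst.
exact: (etrans (integral3_swap23 mF2 (fun z => F0 _)) (integral3_swap12 mF F0)).
Qed.

End TripleIntegrals.

Section TripleKernel.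
Context {R : realType}.
Notation mu := (@lebesgue_measure R).
Implicit Types (f : curve R) (p L D : R).

Lemma ge0_integral_itv_sym (I : R -> \bar R) D : 0 <= D -> measurable_fun setT I ->
  (forall x, 0 <= I x)%E ->
  (\int[mu]_(x in `[(- D)%R, D]) I x =
   \int[mu]_(x in `]0%R, D]) I (- x)%R + \int[mu]_(x in `]0%R, D]) I x)%E.
Proof.
move=> D0 mI I0; have DN : - D <= 0 by rewrite oppr_le0.
rewrite (ge0_integral_itv_cat DN D0 mI I0) -[X in `[_, X]]oppr0 -(ge0_integral_itv_opp 0 D I0).
rewrite -(@integral_itv_obnd_cbnd _ 0 (BRight D) I); last exact: measurable_funTS.
rewrite -(@integral_itv_obnd_cbnd _ 0 (BRight D) (fun x => I (- x)))//.
by apply: measurable_funTS; exact: (measurableT_comp mI (@oppr_measurable _ setT)).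
Qed.

Lemma measurable_inv_norm p (a : R) : measurable_fun setT (fun z : R => (a + `|z|) `^ (- p)).
Proof.
apply: measurable_fun_powR; apply: measurable_funD; [exact: measurable_cst|exact: normr_measurable].
Qed.

Lemma integral_inv_norm_le p (a D : R) : 1 < p -> 0 < a -> 0 <= D ->
  (\int[mu]_(z in `[(- D)%R, D]) ((a + `|z|) `^ (- p))%:E <= (2 * (a `^ (1 - p) / (p - 1)))%:E)%E.
Proof.
move=> p1 a0 D0; pose F (z : R) := ((a + `|z|) `^ (- p))%:E.
have mF : measurable_fun setT F by apply/measurable_EFinP; exact: measurable_inv_norm.
have F0 z : (0 <= F z)%E by rewrite lee_fin powR_ge0.
have DN : - D <= 0 by rewrite oppr_le0.
have half : (\int[mu]_(z in `[0%R, D]) F z <= (a `^ (1 - p) / (p - 1))%:E)%E.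
  have -> : (\int[mu]_(z in `[0%R, D]) F z = \int[mu]_(z in `[0%R, D]) ((z + a) `^ (- p))%:E)%E.
    apply: eq_integral => z /[!inE]/=; rewrite in_itv/= => /andP[z0 _].
    by rewrite /F ger0_norm// addrC.
  rewrite (ge0_integral_itv_shift 0 D a (f := fun v => (v `^ (- p))%:E)); last first.
    by move=> v; rewrite lee_fin powR_ge0.
  by rewrite add0r; apply: integral_powRN => //; rewrite lerDr.
rewrite (ge0_integral_itv_cat DN D0 mF F0) -[X in `[_, X]]oppr0 -(ge0_integral_itv_opp 0 D F0).
have -> : (\int[mu]_(z in `[0%R, D]) F (- z)%R = \int[mu]_(z in `[0%R, D]) F z)%E.
  by apply: eq_integral => z _; rewrite /F normrN.
by rewrite mulr_natl mulr2n EFinD; exact: leeD.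
Qed.

Lemma slobodeckij_flip p L d (g : curve R) (c : R) : 0 < L -> continuous g -> periodic g L ->
  c = 1 \/ c = -1 ->
  (\int[mu]_(s in `[0%R, L]) \int[mu]_(w in `[0%R, d])
     (enorm (g (s + c * w) - g s) `^ p * w `^ (1 - p))%:E = slobodeckij p L d g)%E.
Proof.
move=> L0 cg pg [] ->.
  by apply: eq_integral => s _; apply: eq_integral => w _; rewrite mul1r.
pose F (z : R * R) := (enorm (g (z.1 + 1 * z.2) - g (z.1 + 0 * z.2)) `^ p * z.2 `^ (1 - p))%:E.
have mF : measurable_fun setT F by exact: measurable_slobodeckij.
have F0 z : (0 <= F z)%E by rewrite lee_fin mulr_ge0 ?powR_ge0.
have pF s w : F (s + L, w) = F (s, w).
  by rewrite /F/= !(addrAC _ L) !pg.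
have FE s w : F (s, w) = (enorm (g (s + w) - g s) `^ p * w `^ (1 - p))%:E.
  by rewrite /F/= mul1r mul0r addr0.
clearbody F.
transitivity (\int[mu]_(s in `[0%R, L]) \int[mu]_(w in `[0%R, d]) F (s + (-1) * w, w)%R)%E.
  apply: eq_integral => s _; apply: eq_integral => w _; rewrite FE.
  have -> : s + -1 * w + w = s by ring.
  by rewrite (enormBC (g s)).
rewrite (slant_shift d (-1) L0 mF F0 pF).
by apply: eq_integral => s _; apply: eq_integral => w _; rewrite FE.
Qed.

Lemma measurable_slobodeckij1 p (g : curve R) (c : R) : continuous g -> measurable_fun setT
  (fun z : R * R => (enorm (g (z.1 + c * z.2) - g z.1) `^ p * z.2 `^ (1 - p))%:E).
Proof.
move=> cg; have -> : (fun z : R * R => (enorm (g (z.1 + c * z.2) - g z.1) `^ p * z.2 `^ (1 - p))%:E) =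
    (fun z => (enorm (g (z.1 + c * z.2) - g (z.1 + 0 * z.2)) `^ p * z.2 `^ (1 - p))%:E).
  by apply/funext => z; rewrite mul0r addr0.
exact: measurable_slobodeckij.
Qed.

Lemma slobodeckij_mono p L d D (g : curve R) : continuous g -> d <= D ->
  (slobodeckij p L d g <= slobodeckij p L D g)%E.
Proof.
move=> cg dD; apply: ge0_le_integral_any => s _.
  by apply: integral_ge0 => w _; rewrite lee_fin mulr_ge0 ?powR_ge0.
apply: ge0_subset_integral => //.
- apply: measurable_EFin_fun; apply: measurable_funM; last exact: measurable_fun_powR.
  apply: measurable_fun_powR; apply: measurable_enorm; apply: mvecB.
    by apply: (mvec_comp (continuous_mvec cg)); exact: measurable_funD.
  by move=> i _; exact: measurable_cst.
- by move=> w _; rewrite lee_fin mulr_ge0 ?powR_ge0.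
- by move=> w /=; rewrite !in_itv/= => /andP[-> wD]; rewrite (le_trans wD).
Qed.

Lemma slobodeckij_finite_any p L D (g : curve R) : 0 < L -> 1 < p -> continuous g -> periodic g L ->
  0 < D -> (slobodeckij p L (L / 2) g < +oo)%E -> (slobodeckij p L D g < +oo)%E.
Proof.
move=> L0 p1 cg pg D0 fin; have L2 : 0 < L / 2 by rewrite divr_gt0.
have [h|/ltW h] := leP (L / 2) D; first exact: (slobodeckij_cut L0 p1 L2 h cg pg fin).
exact: (le_lt_trans (slobodeckij_mono p L cg h) fin).
Qed.

(** The triple is a base point with two offsets, of which only the first enters the defect.
    Integrating out the second one leaves the weight of [quot_defect_integral] on the first. *)
Definition defect_kernel p f (z : R * R * R) :=
  (quot_defect f z.1.1 z.1.2 `^ p * (`|z.1.2| + `|z.2|) `^ (- p))%:E.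

Lemma defect_kernel_ge0 p f z : (0 <= defect_kernel p f z)%E.
Proof. by rewrite lee_fin mulr_ge0 ?powR_ge0. Qed.

Lemma measurable_defect_kernel p f : continuous f -> continuous (derive1 f) ->
  measurable_fun setT (defect_kernel p f).
Proof.
move=> cf cf'; have m12 : measurable_fun setT (fun z : R * R * R => z.1.2).
  by apply: (measurableT_comp _ measurable_fst); exact: measurable_snd.
apply/measurable_EFinP; apply: measurable_funM; apply: measurable_fun_powR.
  apply: measurable_quot_defect => //.
  by apply: (measurableT_comp _ measurable_fst); exact: measurable_fst.
by apply: measurable_funD; apply: measurable_norm_fun => //; exact: measurable_snd.
Qed.

Lemma defect_kernel_inner p D f (y x : R) : 1 < p -> 0 <= D -> x != 0 ->
   (\int[mu]_(z in `[(- D)%R, D]) defect_kernel p f (y, x, z) <=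
     (2 / (p - 1))%:E * (quot_defect f y x `^ p * `|x| `^ (1 - p))%:E)%E.
Proof.
move=> p1 D0 x0; have x0' : 0 < `|x| by rewrite normr_gt0.
have q0 : (0 <= (quot_defect f y x `^ p)%:E)%E by rewrite lee_fin powR_ge0.
have m : measurable_fun `[(- D), D] (fun z : R => ((`|x| + `|z|) `^ (- p))%:E).
  by apply: measurable_EFin_fun; exact: measurable_inv_norm.
have g0 (z : R) : `[(- D), D]%classic z -> (0 <= ((`|x| + `|z|) `^ (- p))%:E)%E.
  by rewrite lee_fin powR_ge0.
have -> : (\int[mu]_(z in `[(- D)%R, D]) defect_kernel p f (y, x, z) = (quot_defect f y x `^ p)%:E *
    \int[mu]_(z in `[(- D)%R, D]) ((`|x| + `|z|) `^ (- p))%:E)%E.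
  exact: (ge0_integralZl mu (measurable_itv `[(- D), D]) m g0 q0).
apply: (le_trans (lee_wpmul2l q0 (integral_inv_norm_le p1 x0' D0))).
by rewrite -!EFinM lee_fin le_eqVlt; apply/orP; left; apply/eqP; ring.
Qed.

(** Integrate in the second offset, apply [quot_defect_integral] to both signs of the first, and
    recognize the seminorm in the base point. *)
Lemma defect_kernel_finite p L D f : 1 < p -> 0 < L -> 0 < D -> periodic f L ->
  (forall s, derivable f s (1 : R)) -> continuous (derive1 f) ->
  (slobodeckij p L (L / 2) (derive1 f) < +oo)%E ->
  (\int[mu]_(y in `[0%R, L]) \int[mu]_(x in `[(- D)%R, D]) \int[mu]_(z in `[(- D)%R, D])
     defect_kernel p f (y, x, z) < +oo)%E.
Proof.
move=> p1 L0 D0 pf df cf' fin; have cf := derivable_continuous df.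
have p10 : 0 < p - 1 by rewrite subr_gt0.
have pf' := derive1_periodic pf.
have finD := slobodeckij_finite_any L0 p1 cf' pf' D0 fin.
pose Q y c := (\int[mu]_(x in `]0%R, D]) (quot_defect f y (c * x) `^ p * x `^ (1 - p))%:E)%E.
pose S y c := (\int[mu]_(w in `[0%R, D])
     (enorm (derive1 f (y + c * w) - derive1 f y) `^ p * w `^ (1 - p))%:E)%E.
have QS y c : c = 1 \/ c = -1 -> (Q y c <= (2 `^ p / (p - 1))%:E * S y c)%E.
  by move=> c1; exact: quot_defect_integral.
pose A : R := 2 / (p - 1).
have A0 : 0 < A by rewrite divr_gt0.
have Q0 y c : (0 <= Q y c)%E by apply: integral_ge0 => x _; rewrite lee_fin mulr_ge0 ?powR_ge0.
have S0 y c : (0 <= S y c)%E by apply: integral_ge0 => x _; rewrite lee_fin mulr_ge0 ?powR_ge0.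
have mS c : measurable_fun `[0, L] (fun y => S y c).
  apply: measurable_funTS.
  apply: (measurable_fun_section_integral (measurable_itv `[0, D]) (measurable_slobodeckij1 p c cf')).
  by move=> z; rewrite lee_fin mulr_ge0 ?powR_ge0.
have SE c : c = 1 \/ c = -1 -> (\int[mu]_(y in `[0%R, L]) S y c)%E = slobodeckij p L D (derive1 f).
  by move=> c1; exact: slobodeckij_flip.
clearbody S.
have bound : (\int[mu]_(y in `[0%R, L]) (S y (-1)%R + S y 1%R) < +oo)%E.
  have -> := ge0_integralD mu (measurable_itv `[0, L]) (fun y _ => S0 y (-1)) (mS (-1))
    (fun y _ => S0 y 1) (mS 1).
  by apply: lte_add_pinfty; rewrite SE//; [right|left].
have D0' := ltW D0.
have mk := measurable_defect_kernel p cf cf'.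
have k0 := defect_kernel_ge0 p f.
have step2 y : (\int[mu]_(x in `[(- D)%R, D]) \int[mu]_(z in `[(- D)%R, D])
     defect_kernel p f (y, x, z) <= A%:E * (Q y (-1)%R + Q y 1%R))%E.
  pose I x := (\int[mu]_(z in `[(- D)%R, D]) defect_kernel p f (y, x, z))%E.
  have mI : measurable_fun setT I.
    exact: (measurable_fun_section_integral (measurable_itv `[(- D), D])
      (measurable_section3 y mk) (fun z => k0 _)).
  have I0 x : (0 <= I x)%E by exact: integral_ge0.
  rewrite (ge0_integral_itv_sym D0' mI I0).
  rewrite muleDr// ?ge0_adde_def ?inE//; apply: leeD; rewrite /Q -(ge0_integralZl_any _ A0);
    try (by move=> x _; rewrite lee_fin mulr_ge0 ?powR_ge0);
    apply: ge0_le_integral_any => x /=; rewrite in_itv/= => /andP[x0 _] //.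
    have := @defect_kernel_inner p D f y (- x) p1 D0'; rewrite oppr_eq0 normrN (gtr0_norm x0) mulN1r.
    by apply; rewrite gt_eqF.
  have := @defect_kernel_inner p D f y x p1 D0'; rewrite (gtr0_norm x0) mul1r.
  by apply; rewrite gt_eqF.
pose B : R := A * (2 `^ p / (p - 1)).
have B0 : 0 < B by rewrite mulr_gt0// divr_gt0// powR_gt0.
apply: (@le_lt_trans _ _ (B%:E * \int[mu]_(y in `[0%R, L]) (S y (-1)%R + S y 1%R))%E); last first.
  by apply: lte_mul_pinfty; rewrite ?lee_fin// ltW.
rewrite -(ge0_integralZl_any _ B0); last by move=> y _; exact: adde_ge0.
apply: ge0_le_integral_any => y _; first by do 2 (apply: integral_ge0 => ? _).
apply: (le_trans (step2 y)).
rewrite /B [(A * (2 `^ p / (p - 1)))%:E]EFinM -[leRHS]muleA; apply: lee_wpmul2l; first by rewrite lee_fin ltW.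
rewrite muleDr// ?ge0_adde_def ?inE//.
by apply: leeD; apply: QS; [right|left].
Qed.

End TripleKernel.

Section DominatingKernel.
Context {R : realType}.
Notation mu := (@lebesgue_measure R).
Implicit Types (f : curve R) (p L : R) (F G : R * R * R -> \bar R).

Definition finite3 L F :=
  [/\ measurable_fun setT F, forall z, (0 <= F z)%E & (integral3 L F < +oo)%E].

Lemma finite3D L F G : finite3 L F -> finite3 L G -> finite3 L (fun z => F z + G z)%E.
Proof.
move=> [mF F0 fF] [mG G0 fG]; split.
- exact: emeasurable_funD.
- by move=> z; exact: adde_ge0.
- apply: (eq_ind_r (fun x => (x < +oo)%E) _ (integral3D L mF mG F0 G0)).
  exact: (lte_add_pinfty fF fG).
Qed.

Lemma finite3_sum L (I : eqType) (s : seq I) (F : I -> R * R * R -> \bar R) :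
  {in s, forall i, finite3 L (F i)} -> finite3 L (fun z => \sum_(i <- s) F i z)%E.
Proof.
elim: s => [_|i s IH H].
  under eq_fun do rewrite big_nil; split => //.
  by rewrite /integral3 !integral0_eq// => s _; rewrite integral0_eq// => t _; rewrite integral0_eq.
rewrite (_ : (fun z => _) = (fun z => F i z + \sum_(j <- s) F j z)%E); last first.
  by apply/funext => z; rewrite big_cons.
apply: finite3D; first by apply: H; rewrite inE eqxx.
by apply: IH => j js; apply: H; rewrite inE js orbT.
Qed.

Lemma measurable_perm3 F (a b c : R * R * R -> R) : measurable_fun setT F ->
  measurable_fun setT a -> measurable_fun setT b -> measurable_fun setT c ->
  measurable_fun setT (fun z => F (a z, b z, c z)).
Proof.
move=> mF ma mb mc; apply: (measurableT_comp mF); apply: measurable_fun_pair => //.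
exact: measurable_fun_pair.
Qed.

Lemma measurable_fst3 : measurable_fun setT (fun z : R * R * R => z.1.1).
Proof. by apply: (measurableT_comp _ measurable_fst); exact: measurable_fst. Qed.

Lemma measurable_snd3 : measurable_fun setT (fun z : R * R * R => z.1.2).
Proof. by apply: (measurableT_comp _ measurable_fst); exact: measurable_snd. Qed.

Lemma finite3_swap12 L F : finite3 L F -> finite3 L (fun z => F (z.1.2, z.1.1, z.2)).
Proof.
move=> [mF F0 fF]; split; [|by move=> z; exact: F0|by rewrite (integral3_swap12 L mF F0)].
exact: (measurable_perm3 mF measurable_snd3 measurable_fst3 measurable_snd).
Qed.

Lemma finite3_swap23 L F : finite3 L F -> finite3 L (fun z => F (z.1.1, z.2, z.1.2)).
Proof.
move=> [mF F0 fF]; split; [|by move=> z; exact: F0|by rewrite (integral3_swap23 L mF F0)].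
exact: (measurable_perm3 mF measurable_fst3 measurable_snd measurable_snd3).
Qed.

Lemma finite3_rot L F : finite3 L F -> finite3 L (fun z => F (z.2, z.1.1, z.1.2)).
Proof.
move=> [mF F0 fF]; split; [|by move=> z; exact: F0|by rewrite (integral3_rot L mF F0)].
exact: (measurable_perm3 mF measurable_snd measurable_fst3 measurable_snd3).
Qed.

(** For parameters in [[0, L]] and a correction of at most one period, offsets stay within [2 * L];
    kernels in offset form can thus be evaluated at parameters. *)
Lemma integral_recentre_le (I : R -> \bar R) L (s a : R) : 0 <= s <= L -> `|a| <= L ->
  measurable_fun setT I -> (forall x, 0 <= I x)%E ->
  (\int[mu]_(t in `[0%R, L]) I (t - s + a)%R <= \int[mu]_(x in `[(- (2 * L))%R, (2 * L)%R]) I x)%E.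
Proof.
move=> /andP[s0 sL] /ler_normlP[a1 a2] mI I0.
have -> : (\int[mu]_(t in `[0%R, L]) I (t - s + a)%R =
    \int[mu]_(t in `[0%R, L]) I (t + (a - s))%R)%E.
  by apply: eq_integral => t _; congr (I _); ring.
rewrite ge0_integral_itv_shift//; apply: ge0_subset_integral => //; first exact: measurable_funTS.
by move=> x /=; rewrite !in_itv/= => /andP[h1 h2]; apply/andP; split; lra.
Qed.

Lemma finite3_recentre p L f (a b : R) : 1 < p -> 0 < L -> periodic f L ->
  (forall s, derivable f s (1 : R)) -> continuous (derive1 f) ->
  (slobodeckij p L (L / 2) (derive1 f) < +oo)%E -> `|a| <= L -> `|b| <= L ->
  finite3 L (fun z => defect_kernel p f (z.1.1, z.1.2 - z.1.1 + a, z.2 - z.1.1 + b)).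
Proof.
move=> p1 L0 pf df cf' fin aL bL; have cf := derivable_continuous df.
have mk := measurable_defect_kernel p cf cf'; have k0 := defect_kernel_ge0 p f.
split; [|by move=> z; exact: k0|].
  apply: measurable_perm3 => //; first exact: measurable_fst3.
    by apply: measurable_funD => //; apply: measurable_funB; [exact: measurable_snd3|exact: measurable_fst3].
  by apply: measurable_funD => //; apply: measurable_funB; [exact: measurable_snd|exact: measurable_fst3].
have L20 : 0 < 2 * L by rewrite mulr_gt0.
have := defect_kernel_finite p1 L0 L20 pf df cf' fin; apply: le_lt_trans.
set D := 2 * L in L20 *.
apply: ge0_le_integral_any => s /=; rewrite in_itv/= => sL; first by do 2 (apply: integral_ge0 => ? _).
have m2 := measurable_section3 s mk.
have mI : measurable_fun setT (fun x => \int[mu]_(z in `[(- D)%R, D]) defect_kernel p f (s, x, z))%E.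
  exact: (measurable_fun_section_integral (measurable_itv `[(- D), D]) m2 (fun z => k0 _)).
have I0 x : (0 <= \int[mu]_(z in `[(- D)%R, D]) defect_kernel p f (s, x, z))%E by exact: integral_ge0.
apply: le_trans (integral_recentre_le sL aL mI I0).
apply: ge0_le_integral_any => t _; first by apply: integral_ge0.
have mx x : measurable_fun setT (fun z => defect_kernel p f (s, x, z)).
  exact: (measurableT_comp mk (pair1_measurable (s, x))).
exact: (integral_recentre_le sL bL (mx (t - s + a)) (fun z => k0 _)).
Qed.

(** The corrections that turn the difference of two parameters in [[0, L]] into the signed length of
    an arc. *)
Definition shifts L : seq R := [:: - L; 0; L].

(** The kernel for the base vertex [z.1.1], summed over all representatives of the two offsets and
    over the offset that carries the defect. The sum replaces a measurable choice between the
    cases. *)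
Definition base_kernel p L f (z : R * R * R) : \bar R :=
  (\sum_(a <- shifts L) \sum_(b <- shifts L)
    (defect_kernel p f (z.1.1, z.1.2 - z.1.1 + a, z.2 - z.1.1 + b)%R +
     defect_kernel p f (z.1.1, z.2 - z.1.1 + b, z.1.2 - z.1.1 + a)%R))%E.

(** The sum over the three possible base vertices. *)
Definition dominating_kernel p L f (z : R * R * R) : \bar R :=
  (base_kernel p L f z + base_kernel p L f (z.1.2, z.1.1, z.2) +
   base_kernel p L f (z.2, z.1.1, z.1.2))%E.

Lemma dominating_kernel_finite p L f : 1 < p -> 0 < L -> periodic f L ->
  (forall s, derivable f s (1 : R)) -> continuous (derive1 f) ->
  (slobodeckij p L (L / 2) (derive1 f) < +oo)%E -> finite3 L (dominating_kernel p L f).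
Proof.
move=> p1 L0 pf df cf' fin.
have B : finite3 L (base_kernel p L f).
  have sh a : a \in shifts L -> `|a| <= L.
    by rewrite !inE => /or3P[] /eqP ->; rewrite ?normrN ?normr0 ?gtr0_norm// ltW.
  apply: finite3_sum => a /sh ha; apply: finite3_sum => b /sh hb.
  apply: finite3D; first exact: finite3_recentre.
  exact: (finite3_swap23 (finite3_recentre p1 L0 pf df cf' fin hb ha)).
apply: finite3D; last exact: (finite3_rot B).
exact: (finite3D B (finite3_swap12 B)).
Qed.

(** The other two vertices lie on both sides of the base, and the arc opposite to it has length at
    least [L / 3]. The latter keeps all parameter distances away from [L], where the curve closes
    and the bilipschitz bound fails. *)
Definition opposite_offsets L (x z : R) := x * z < 0 /\ `|x| + `|z| <= 2 * L / 3.

Definition middle_vertex L (y u v : R) := exists a b, [/\ a \in shifts L, b \in shifts L &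
  opposite_offsets L (u - y + a) (v - y + b)].

Lemma middle_vertexC L y u v : middle_vertex L y u v -> middle_vertex L y v u.
Proof.
by move=> [a [b [ha hb [h1 h2]]]]; exists b, a; split => //; split; [rewrite mulrC|rewrite addrC].
Qed.

(* The base vertex lies opposite to the longest of the three arcs cut out by the triple. *)
Lemma middle_vertex_sorted L t1 t2 t3 : 0 < L -> t1 < t2 -> t2 < t3 -> t3 < t1 + L ->
  [\/ middle_vertex L t1 t2 t3, middle_vertex L t2 t1 t3 | middle_vertex L t3 t1 t2].
Proof.
move=> L0 h12 h23 h31.
have mN : - L \in shifts L by rewrite !inE eqxx.
have m0 : 0 \in shifts L by rewrite !inE eqxx orbT.
have mL : L \in shifts L by rewrite !inE eqxx !orbT.
have opp (x z : R) : 0 < x -> z < 0 -> x - z <= 2 * L / 3 -> opposite_offsets L x z.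
  by move=> x0 z0 h; split; [rewrite pmulr_rlt0|rewrite gtr0_norm// ltr0_norm].
have [w|w] := leP (L / 3) (t3 - t2).
  by apply: Or31; exists 0, (- L); split => //; apply: opp; lra.
have [u|u] := leP (L / 3) (t2 - t1).
  by apply: Or33; exists L, 0; split => //; apply: opp; lra.
apply: Or32; apply: middle_vertexC; exists 0, 0; split => //; apply: opp; lra.
Qed.

(** The parameters are sorted; the distances 0 and [L] are excluded because they describe coinciding
    points. *)
Lemma middle_vertex_cases L s t g : 0 < L -> 0 <= s <= L -> 0 <= t <= L -> 0 <= g <= L ->
  s != t -> t != g -> s != g -> `|s - t| != L -> `|t - g| != L -> `|s - g| != L ->
  [\/ middle_vertex L s t g, middle_vertex L t s g | middle_vertex L g s t].
Proof.
move=> L0 /andP[s0 sL] /andP[t0 tL] /andP[g0 gL] st tg sg stL tgL sgL.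
have lt a b : 0 <= a -> b <= L -> a < b -> `|a - b| != L -> b < a + L.
  move=> a0 bL ab; rewrite distrC gtr0_norm ?subr_gt0// => h.
  by rewrite -ltrBlDl lt_neqAle h lerBlDl (le_trans bL)// lerDr.
have [tsL gtL gsL] : [/\ `|t - s| != L, `|g - t| != L & `|g - s| != L].
  by rewrite (distrC t s) (distrC g t) (distrC g s); split.
have C := @middle_vertexC L.
case: (ltgtP s t) st => // st _; case: (ltgtP t g) tg => // tg _; case: (ltgtP s g) sg => // sg _.
- exact: (middle_vertex_sorted L0 st tg (lt _ _ s0 gL sg sgL)).
- by have := lt_trans st tg; rewrite ltNge (ltW sg).
- case: (middle_vertex_sorted L0 sg tg (lt _ _ s0 tL st stL)) => h.
  + by apply: Or31; exact: C.
  + by apply: Or33.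
  + by apply: Or32.
- case: (middle_vertex_sorted L0 sg st (lt _ _ g0 tL tg gtL)) => h.
  + by apply: Or33.
  + by apply: Or31; exact: C.
  + by apply: Or32; exact: C.
- case: (middle_vertex_sorted L0 st sg (lt _ _ t0 gL tg tgL)) => h.
  + by apply: Or32.
  + by apply: Or31.
  + by apply: Or33; exact: C.
- case: (middle_vertex_sorted L0 tg sg (lt _ _ t0 sL st tsL)) => h.
  + by apply: Or32; exact: C.
  + by apply: Or33; exact: C.
  + by apply: Or31.
- by have := lt_trans tg st; rewrite ltNge (ltW sg).
- case: (middle_vertex_sorted L0 tg st (lt _ _ g0 sL sg gsL)) => h.
  + by apply: Or33; exact: C.
  + by apply: Or32; exact: C.
  + by apply: Or31; exact: C.
Qed.

End DominatingKernel.

(** * Bilipschitz bounds for regular embeddings *)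

Section EmbeddedC1.
Context {R : realType}.
Implicit Types (f : curve R) (L : R).

(** The scalar mean value theorem is applied to the component of the remainder [z] along [z]
    itself. *)
Lemma mean_value_le f (v : 'rV[R]_3) (a b e : R) : (forall x, derivable f x (1 : R)) -> a <= b ->
  (forall x, a <= x <= b -> enorm (derive1 f x - v) <= e) ->
  enorm (f b - f a - (b - a) *: v) <= e * (b - a).
Proof.
move=> df ab hv.
set z := f b - f a - (b - a) *: v.
have [->|z0] := eqVneq z 0.
  rewrite enorm0 mulr_ge0 ?subr_ge0//.
  by rewrite (le_trans _ (hv a _)) ?enorm_ge0// lexx ab.
have ez : 0 < enorm z by rewrite enorm_gt0.
pose phi x := dot (f (0 + 1 * x)) z - x * dot v z.
have dphi (x : R) : is_derive x (1 : R) phi (dot (derive1 f x - v) z).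
  have d1 := @is_derive_dot_affine R f z 0 1 x df.
  rewrite /phi; apply: is_derive_eq.
  by rewrite /GRing.scale/= mulr0 add0r mulr1 !mul1r add0r dotBl.
have cphi : {within `[a, b], continuous phi}.
  apply: continuous_subspaceT; apply: derivable_continuous => x.
  by have [] := dphi x.
have [c cab] := MVT_segment ab (fun x _ => dphi x) cphi.
rewrite /phi !mul1r !add0r => E.
have {E} E : enorm z ^+ 2 = dot (derive1 f c - v) z * (b - a).
  rewrite -E sqr_enorm {1}/z !dotBl dotZl; ring.
rewrite in_itv/= in cab.
rewrite -(ler_pM2r ez) -expr2 E mulrAC ler_wpM2r ?subr_ge0//.
by rewrite (le_trans (dot_le _ _))// ler_wpM2r ?enorm_ge0// hv.
Qed.

Lemma C1_lipschitz f M : (forall x, derivable f x (1 : R)) ->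
  (forall x, enorm (derive1 f x) <= M) -> forall u v, enorm (f u - f v) <= M * `|u - v|.
Proof.
move=> df hM u v; wlog uv : u v / v <= u.
  by move=> h; have [|/ltW] := leP v u; [exact: h|rewrite enormBC distrC; exact: h].
rewrite ger0_norm ?subr_ge0//.
have := @mean_value_le f 0 v u M df uv.
by rewrite scaler0 subr0; apply => x _; rewrite subr0.
Qed.

Definition regular_embedding L f := [/\ simple_closed_curve L f,
  forall x, derivable f x (1 : R), continuous (derive1 f) & forall x, derive1 f x != 0].

Lemma curve_near f (u e : R) : continuous f -> 0 < e ->
  exists2 d : R, 0 < d & forall v, `|v - u| < d -> enorm (f v - f u) < e.
Proof.
move=> cf e0; have /enorm_cvgP/cvgr0Pnorm_lt/(_ e e0) := cf u.
move=> /nbhs_ballP[d /= d0 hd]; exists d => // v vu.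
have := hd v; rewrite -ball_normE/= distrC => /(_ vu).
by rewrite ger0_norm ?enorm_ge0.
Qed.

Lemma nbhs_itv_prod (u x d : R) : 0 < d ->
  nbhs (u, x) [set z : R * R | `|z.1 - u| < d /\ `|z.2 - x| < d].
Proof.
move=> d0; exists ([set v | `|v - u| < d], [set y | `|y - x| < d]) => /=.
  by split; apply/nbhs_ballP; exists d => //= y; rewrite -ball_normE/= distrC.
by move=> [v y] /= [].
Qed.

(** Locally some constant works: at offset 0 because the derivative does not vanish, at other
    offsets by injectivity, since an offset of at most [2 * L / 3] does not close up the curve.
    Compactness of the set of base points and offsets makes the constant uniform. *)
Lemma regular_embedding_bilipschitz L f : 0 < L -> regular_embedding L f ->
  exists2 m : R, 0 < m & forall u v, `|u - v| <= 2 * L / 3 -> m * `|u - v| <= enorm (f u - f v).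
Proof.
move=> L0 [[cf pf inj] df cf' f'0].
pose K := `[0, L]%classic `*` `[0, (2 * L / 3)]%classic.
have cK : compact K by apply: compact_setX; exact: segment_compact.
(* Neighbourhoods of a pair with offset 0 contain negative offsets, and those of the constant 0
   contain negative constants; the alternative and the premise dispose of them. *)
pose P (m : R) (z : R * R) := 0 < m -> m * z.2 <= enorm (f (z.1 + z.2) - f z.1) \/ z.2 < 0.
have H : \forall m \near (0 : R), K `<=` P m.
  apply: (proj1 (compact_near_coveringP K) cK R (nbhs (0 : R)) P) => -[u x] [/=].
  rewrite !in_itv/= => /andP[u0 uL] /andP[x0 xL].
  suff [d [c [d0 c0 hc]]] : exists d c, [/\ 0 < d, 0 < c & forall v y, `|v - u| < d -> `|y - x| < d ->
      0 <= y -> c * y <= enorm (f (v + y) - f v)].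
    exists ([set z : R * R | `|z.1 - u| < d /\ `|z.2 - x| < d], [set m : R | m < c]) => /=.
      split; first exact: nbhs_itv_prod.
      change (nbhs (0 : R) [set m : R | m < c]); apply/nbhs_ballP; exists c => //= y.
      by rewrite -ball_normE/= sub0r normrN; exact: le_lt_trans (ler_norm _).
    move=> [[v y] m] /= [[h1 h2] mc] m0.
    have [y0|y0] := leP 0 y; last by right.
    by left; rewrite (le_trans _ (hc v y h1 h2 y0))// ler_wpM2r// ltW.
  move: x0; rewrite le_eqVlt => /orP[/eqP x0|x0].
    have T0 : 0 < enorm (derive1 f u) by rewrite enorm_gt0.
    have T2 : 0 < enorm (derive1 f u) / 2 by rewrite divr_gt0.
    have [d d0 hd] := curve_near u cf' T2.
    exists (d / 2), (enorm (derive1 f u) / 2); split => //; first by rewrite divr_gt0.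
    move=> v y; rewrite ltr_distl => /andP[h1 h1']; rewrite -x0 subr0 ltr_norml => /andP[h2 h2'] y0.
    have := @mean_value_le f (derive1 f u) v (v + y) (enorm (derive1 f u) / 2) df.
    rewrite lerDl (addrAC v y) subrr add0r => /(_ y0) mv.
    have h3 : enorm (f (v + y) - f v - y *: derive1 f u) <= enorm (derive1 f u) / 2 * y.
      apply: mv => w /andP[w1 w2]; apply/ltW/hd.
      by rewrite ltr_distl; apply/andP; split; lra.
    have := lerB_enorm (y *: derive1 f u) (f (v + y) - f v).
    rewrite (enormBC (y *: _)) enormZ ger0_norm//.
    move: h3; set A := enorm (derive1 f u); set B := enorm _; set C := enorm _.
    lra.
  have ne : f (u + x) != f u.
    apply/eqP => E; have := periodic_injective L0 pf inj _ E.
    rewrite addrAC subrr add0r ger0_norm ?(ltW x0)//.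
    have xL' : x < L by rewrite (le_lt_trans xL)//; lra.
    by move=> /(_ xL')/eqP; rewrite -subr_eq0 addrAC subrr add0r gt_eqF.
  pose e := enorm (f (u + x) - f u) / 3.
  have e0 : 0 < e by rewrite divr_gt0// enorm_gt0 subr_eq0.
  have [d1 d10 hd1] := curve_near u cf e0.
  have [d2 d20 hd2] := curve_near (u + x) cf e0.
  pose d := Num.min d1 (Num.min (d2 / 2) L).
  have d0 : 0 < d by rewrite !lt_min d10 divr_gt0.
  have dd1 : d <= d1 by rewrite ge_min lexx.
  have dd2 : d <= d2 / 2 by rewrite !ge_min lexx orbT.
  have ddL : d <= L by rewrite !ge_min lexx !orbT.
  exists d, (e / (2 * L)); split => //; first by rewrite divr_gt0// mulr_gt0.
  move=> v y h1 h2 y0.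
  have a1 := hd1 v (lt_le_trans h1 dd1).
  have a2 : enorm (f (v + y) - f (u + x)) < e.
    apply: hd2; rewrite opprD addrACA (le_lt_trans (ler_normD _ _))//; lra.
  have yL : y <= 2 * L.
    by move: h2; rewrite ltr_distl => /andP[_ h2]; lra.
  rewrite (@le_trans _ _ e)//.
    by rewrite mulrAC ler_pdivrMr ?mulr_gt0// ler_wpM2l// ltW.
  have := enorm_triangle (f (u + x)) (f (v + y)) (f u).
  have := enorm_triangle (f (v + y)) (f v) (f u).
  rewrite (enormBC (f (u + x)) (f (v + y))).
  have : enorm (f (u + x) - f u) = 3 * e by rewrite /e mulrC divfK.
  lra.
have [r /= r0 hr] : exists2 r : R, 0 < r & forall m, `|m| < r -> K `<=` P m.
  move: H => /nbhs_ballP[r /= r0 hr]; exists r => // m mr.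
  by apply: hr; rewrite -ball_normE/= sub0r normrN.
exists (r / 2); first by rewrite divr_gt0.
have r2 : `|r / 2| < r.
  by rewrite gtr0_norm ?divr_gt0// ltr_pdivrMr// ltr_pMr// ltr1n.
suff S u x : 0 <= x <= 2 * L / 3 -> r / 2 * x <= enorm (f (u + x) - f u).
  move=> u v; wlog uv : u v / v <= u.
    by move=> h; have [|/ltW] := leP v u; [exact: h|rewrite enormBC distrC; exact: h].
  rewrite ger0_norm ?subr_ge0// => h; have := S v (u - v); rewrite subr_ge0 uv h => /(_ isT).
  by rewrite addrCA subrr addr0.
move=> /andP[x0 xL]; have [n /andP[n0 nL]] := floor_reduce u L0.
have Kz : K (u + n%:~R * L, x) by split => /=; rewrite in_itv/= ?x0 ?xL ?n0 ?(ltW nL).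
have r20 : 0 < r / 2 by rewrite divr_gt0.
case: (hr (r / 2) r2 _ Kz r20) => /=; last by rewrite ltNge x0.
by rewrite addrAC !(periodic_intP n _ pf).
Qed.

End EmbeddedC1.

(** * Calculus of second differences *)

Section SecondDifferences.
Context {R : realType}.
Implicit Types (tau B r p m M A : R) (phi psi : R -> R).

(** Only the values at 0, [tau] and [- tau] enter. First differences are recorded too because
    products and powers mix them with the second one; all share the constant [B], later a multiple
    of an integrable kernel. *)
Definition second_diff tau B phi := [/\ `|phi 0| <= B, `|phi tau - phi 0| <= B * tau,
  `|phi (- tau) - phi 0| <= B * tau & `|phi tau + phi (- tau) - 2 * phi 0| <= B * tau ^+ 2].

Lemma second_diff_ge0 tau B phi : second_diff tau B phi -> 0 <= B.
Proof. by case=> h _ _ _; exact: le_trans (normr_ge0 _) h. Qed.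

Lemma sqr_le_norm (x y : R) : `|x| <= y -> x ^+ 2 <= y ^+ 2.
Proof.
move=> h; rewrite -(real_normK (num_real x)) ler_pXn2r// nnegrE//.
exact: le_trans (normr_ge0 _) h.
Qed.

Lemma normD_le3 (a b c A B C : R) : `|a| <= A -> `|b| <= B -> `|c| <= C -> `|a + b + c| <= A + B + C.
Proof.
by move=> h1 h2 h3; rewrite (le_trans (ler_normD _ _))// lerD// (le_trans (ler_normD _ _))// lerD.
Qed.

Lemma second_diff_le tau B B' phi : 0 <= tau -> B <= B' -> second_diff tau B phi -> second_diff tau B' phi.
Proof.
move=> t0 BB [h1 h2 h3 h4]; split.
- exact: le_trans BB.
- by rewrite (le_trans h2)// ler_wpM2r.
- by rewrite (le_trans h3)// ler_wpM2r.
- by rewrite (le_trans h4)// ler_wpM2r ?exprn_ge0.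
Qed.

Lemma norm_prodB (a b a0 b0 t A B : R) : 0 <= t <= 1 -> `|a0| <= A -> `|b0| <= B ->
  `|a - a0| <= A * t -> `|b - b0| <= B * t -> `|a * b - a0 * b0| <= 4 * A * B * t.
Proof.
move=> /andP[t0 t1] ha0 hb0 ha hb.
have A0 : 0 <= A := le_trans (normr_ge0 _) ha0; have B0 : 0 <= B := le_trans (normr_ge0 _) hb0.
have -> : a * b - a0 * b0 = (a - a0) * b0 + a0 * (b - b0) + (a - a0) * (b - b0) by ring.
have h1 : `|(a - a0) * b0| <= A * t * B by rewrite normrM ler_pM.
have h2 : `|a0 * (b - b0)| <= A * (B * t) by rewrite normrM ler_pM.
have h3 : `|(a - a0) * (b - b0)| <= A * t * (B * t) by rewrite normrM ler_pM.
rewrite (le_trans (normD_le3 h1 h2 h3))//.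
have AB : 0 <= A * B * t by rewrite !mulr_ge0.
have : A * B * t * t <= A * B * t by rewrite ler_piMr.
move: AB; have -> : A * t * (B * t) = A * B * t * t by ring.
have -> : A * t * B = A * B * t by ring.
have -> : A * (B * t) = A * B * t by ring.
have -> : 4 * A * B * t = 4 * (A * B * t) by ring.
lra.
Qed.

Lemma second_diffM tau B C phi psi : 0 <= tau <= 1 -> second_diff tau B phi -> second_diff tau C psi ->
  second_diff tau (4 * B * C) (fun x => phi x * psi x).
Proof.
move=> t01 h1 h2; have B0 := second_diff_ge0 h1; have C0 := second_diff_ge0 h2.
case: h1 => f0 fp fm fs; case: h2 => g0 gp gm gs; have /andP[t0 t1] := t01.
split; [|exact: norm_prodB|exact: norm_prodB|].
  rewrite normrM (le_trans (ler_pM _ _ f0 g0))// -mulrA -[leLHS]mul1r ler_wpM2r ?mulr_ge0//.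
  by rewrite ler1n.
have -> : phi tau * psi tau + phi (- tau) * psi (- tau) - 2 * (phi 0 * psi 0) =
    phi 0 * (psi tau + psi (- tau) - 2 * psi 0) + psi 0 * (phi tau + phi (- tau) - 2 * phi 0) +
    ((phi tau - phi 0) * (psi tau - psi 0) + (phi (- tau) - phi 0) * (psi (- tau) - psi 0)) by ring.
have e1 : `|phi 0 * (psi tau + psi (- tau) - 2 * psi 0)| <= B * (C * tau ^+ 2) by rewrite normrM ler_pM.
have e2 : `|psi 0 * (phi tau + phi (- tau) - 2 * phi 0)| <= C * (B * tau ^+ 2) by rewrite normrM ler_pM.
have e3 : `|(phi tau - phi 0) * (psi tau - psi 0) + (phi (- tau) - phi 0) * (psi (- tau) - psi 0)| <=
    B * tau * (C * tau) + B * tau * (C * tau).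
  by rewrite (le_trans (ler_normD _ _))// lerD// normrM ler_pM.
rewrite (le_trans (normD_le3 e1 e2 e3))// le_eqVlt; apply/orP; left; apply/eqP; ring.
Qed.

Lemma second_diffZ tau B (k : R) phi : 0 <= k -> second_diff tau B phi ->
  second_diff tau (k * B) (fun x => k * phi x).
Proof.
move=> k0 [h1 h2 h3 h4].
have E x : `|k * x| = k * `|x| by rewrite normrM ger0_norm.
split; rewrite -?mulrBr.
- by rewrite E ler_wpM2l.
- by rewrite E -mulrA ler_wpM2l.
- by rewrite E -mulrA ler_wpM2l.
- have -> : k * phi tau + k * phi (- tau) - 2 * (k * phi 0) =
    k * (phi tau + phi (- tau) - 2 * phi 0) by ring.
  by rewrite E -mulrA ler_wpM2l.
Qed.

Lemma second_diff_dot tau (U V : R) (u u' v v' : 'rV[R]_3) : 0 <= tau <= 1 ->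
  enorm u <= U -> enorm u' <= U -> enorm v <= V -> enorm v' <= V ->
  second_diff tau (4 * U * V) (fun t => dot (u + t *: u') (v + t *: v')).
Proof.
move=> t01 hu hu' hv hv'; have /andP[t0 t1] := t01.
have E t : dot (u + t *: u') (v + t *: v') =
    dot u v + (dot u v' + dot u' v) * t + dot u' v' * t ^+ 2.
  by rewrite !coE; ring.
have bd a b : enorm a <= U -> enorm b <= V -> `|dot a b| <= U * V.
  by move=> ha hb; rewrite (le_trans (ler_norm_dot _ _))// ler_pM ?enorm_ge0.
have UV : 0 <= U * V by exact: le_trans (normr_ge0 _) (bd _ _ hu hv).
have b1 : `|dot u v' + dot u' v| <= 2 * (U * V).
  by rewrite (le_trans (ler_normD _ _))// mulr_natl mulr2n lerD// bd.
have b2 := bd _ _ hu' hv'.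
have tt : tau ^+ 2 <= tau by rewrite expr2 ler_piMl.
have -> : 4 * U * V = 4 * (U * V) by ring.
have first s : `|s| = tau -> `|dot (u + s *: u') (v + s *: v') - dot (u + 0 *: u') (v + 0 *: v')| <=
    4 * (U * V) * tau.
  move=> hs; rewrite !E.
  have -> : dot u v + (dot u v' + dot u' v) * s + dot u' v' * s ^+ 2 -
      (dot u v + (dot u v' + dot u' v) * 0 + dot u' v' * 0 ^+ 2) =
      (dot u v' + dot u' v) * s + dot u' v' * s ^+ 2 by ring.
  rewrite (le_trans (ler_normD _ _))// [`|_ * s|]normrM [`|_ * s ^+ 2|]normrM normrX hs.
  have h1 : `|dot u v' + dot u' v| * tau <= 2 * (U * V) * tau by rewrite ler_wpM2r.
  have h2 : `|dot u' v'| * tau ^+ 2 <= U * V * tau by rewrite ler_pM ?exprn_ge0.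
  by rewrite (le_trans (lerD h1 h2))// -mulrDl ler_wpM2r//; lra.
split.
- rewrite scale0r addr0 scale0r addr0 (le_trans (bd _ _ hu hv))//; lra.
- by apply: first; rewrite ger0_norm.
- by apply: first; rewrite normrN ger0_norm.
- rewrite !E.
  have -> : dot u v + (dot u v' + dot u' v) * tau + dot u' v' * tau ^+ 2 +
    (dot u v + (dot u v' + dot u' v) * (- tau) + dot u' v' * (- tau) ^+ 2) -
    2 * (dot u v + (dot u v' + dot u' v) * 0 + dot u' v' * 0 ^+ 2) = 2 * dot u' v' * tau ^+ 2 by ring.
  rewrite normrM [`|2 * _|]normrM normrX (ger0_norm t0) ler_wpM2r ?exprn_ge0//.
  rewrite ger0_norm//; lra.
Qed.

Lemma powR_MVT r (u v : R) : 0 < u -> 0 < v -> exists2 w,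
  Num.min u v <= w <= Num.max u v & u `^ r - v `^ r = r * w `^ (r - 1) * (u - v).
Proof.
move=> u0 v0; wlog uv : u v u0 v0 / v <= u.
  move=> h; have /orP[|uv] := le_total v u; first exact: (h u v u0 v0).
  have [w hw E] := h v u v0 u0 uv; exists w; first by rewrite minC maxC.
  by rewrite -[LHS]opprB E -mulrN opprB.
have cont : {within `[v, u], continuous (fun x => x `^ r)}.
  apply: continuous_in_subspaceT => x; rewrite inE/= in_itv/= => /andP[vx _].
  apply: differentiable_continuous; apply/derivable1_diffP.
  by have [] := is_derive1_powR r (lt_le_trans v0 vx).
have [|w] := @MVT_segment R (fun x => x `^ r) (fun x => r * x `^ (r - 1)) v u uv _ cont.
  by move=> x; rewrite in_itv/= => /andP[vx _]; exact: is_derive1_powR (lt_trans v0 vx).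
by rewrite in_itv/= => hw E; exists w => //; rewrite min_r// max_l.
Qed.

Lemma powR_taylor r (u v S : R) : 0 < u -> 0 < v ->
  (forall w, Num.min u v <= w <= Num.max u v -> w `^ (r - 2) <= S) ->
  `|u `^ r - v `^ r - r * v `^ (r - 1) * (u - v)| <= `|r * (r - 1)| * S * (u - v) ^+ 2.
Proof.
move=> u0 v0 hS; have [w hw ->] := powR_MVT r u0 v0.
have w0 : 0 < w.
  by case/andP: hw => h _; rewrite (lt_le_trans _ h)// lt_min u0.
have [x hx E] := powR_MVT (r - 1) w0 v0.
have -> : r * w `^ (r - 1) * (u - v) - r * v `^ (r - 1) * (u - v) =
  r * (w `^ (r - 1) - v `^ (r - 1)) * (u - v) by ring.
have E2 : r - 1 - 1 = r - 2 by ring.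
rewrite E E2.
have wv : `|w - v| <= `|u - v|.
  have [uv|vu] := leP u v.
    move: hw; rewrite min_l// max_r// => /andP[h1 h2].
    by rewrite !ler0_norm ?subr_le0// lerN2 lerD2r.
  move: hw; rewrite min_r ?(ltW vu)// max_l ?(ltW vu)// => /andP[h1 h2].
  by rewrite !ger0_norm ?subr_ge0 ?(ltW vu)// lerD2r.
have xS : x `^ (r - 2) <= S.
  apply: hS; case/andP: hx => x1 x2; case/andP: hw => h1 h2; apply/andP; split.
    by rewrite (le_trans _ x1)// le_min h1 ge_min lexx orbT.
  by rewrite (le_trans x2)// ge_max h2 le_max lexx orbT.
have -> : r * ((r - 1) * x `^ (r - 2) * (w - v)) * (u - v) =
  (r * (r - 1)) * x `^ (r - 2) * ((w - v) * (u - v)) by ring.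
rewrite !normrM -!mulrA ler_wpM2l// ler_wpM2l// [`|_ `^ _|]ger0_norm ?powR_ge0//.
rewrite ler_pM ?powR_ge0 ?mulr_ge0//.
by rewrite -[leRHS]real_normK ?num_real// expr2 ler_wpM2r.
Qed.

Lemma powR_between r m M w : 0 < m -> m <= w <= M -> w `^ r <= m `^ r + M `^ r.
Proof.
move=> m0 /andP[mw wM]; have w0 := lt_le_trans m0 mw.
have [r0|/ltW r0] := leP 0 r.
  have : w `^ r <= M `^ r by rewrite ge0_ler_powR ?nnegrE ?(ltW w0) ?(ltW (lt_le_trans w0 wM)).
  by have := powR_ge0 m r; lra.
have : w `^ r <= m `^ r by exact: powR_antimono.
by have := powR_ge0 M r; lra.
Qed.

(** On [[m, M]] with [m > 0] every real power is smooth; [S0], [S1], [S2] bound the powers of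
    exponent [r], [r - 1], [r - 2] there, by the sum of the end values since the sign of the
    exponent is unknown. *)
Lemma second_diff_powR r m M B : 0 < m -> 0 <= B -> exists2 C, 0 <= C & forall tau phi, 0 <= tau <= 1 ->
  second_diff tau B phi -> m <= phi 0 <= M -> m <= phi tau <= M -> m <= phi (- tau) <= M ->
  second_diff tau C (fun x => phi x `^ r).
Proof.
move=> m0 B0.
pose S0 := m `^ r + M `^ r; pose S1 := m `^ (r - 1) + M `^ (r - 1); pose S2 := m `^ (r - 2) + M `^ (r - 2).
have S00 : 0 <= S0 by rewrite addr_ge0 ?powR_ge0.
have S10 : 0 <= S1 by rewrite addr_ge0 ?powR_ge0.
have S20 : 0 <= S2 by rewrite addr_ge0 ?powR_ge0.
have H0 w : m <= w <= M -> `|w `^ r| <= S0 by move=> h; rewrite ger0_norm ?powR_ge0// powR_between.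
have H1 w : m <= w <= M -> `|w `^ (r - 1)| <= S1 by move=> h; rewrite ger0_norm ?powR_ge0// powR_between.
have H2 w : m <= w <= M -> w `^ (r - 2) <= S2 by move=> h; rewrite powR_between.
clearbody S0 S1 S2.
pose K1 := `|r| * S1 * B; pose K2 := `|r * (r - 1)| * S2 * B ^+ 2.
have K10 : 0 <= K1 by rewrite !mulr_ge0.
have K20 : 0 <= K2 by rewrite !mulr_ge0 ?exprn_ge0.
exists (S0 + K1 + 2 * K2); first by rewrite !addr_ge0// mulr_ge0.
move=> tau phi /andP[t0 t1] [h1 h2 h3 h4] b0 bp bm.
have btw u v w : m <= u <= M -> m <= v <= M -> Num.min u v <= w <= Num.max u v -> m <= w <= M.
  move=> /andP[mu uM] /andP[mv vM] /andP[w1 w2]; apply/andP; split.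
    by rewrite (le_trans _ w1)// le_min mu.
  by rewrite (le_trans w2)// ge_max uM.
have pos u : m <= u <= M -> 0 < u by move=> /andP[h _]; exact: lt_le_trans h.
have first v : m <= v <= M -> `|v - phi 0| <= B * tau -> `|v `^ r - phi 0 `^ r| <= (S0 + K1 + 2 * K2) * tau.
  move=> hv hd; have [w hw ->] := powR_MVT r (pos _ hv) (pos _ b0).
  rewrite (@le_trans _ _ (K1 * tau))//; last by rewrite ler_wpM2r//; lra.
  rewrite !normrM /K1 -!mulrA ler_wpM2l// ler_pM//.
  by apply: H1; exact: btw hw.
have rem v : m <= v <= M -> `|v - phi 0| <= B * tau ->
    `|v `^ r - phi 0 `^ r - r * phi 0 `^ (r - 1) * (v - phi 0)| <= K2 * tau ^+ 2.
  move=> hv hd; have := @powR_taylor r v (phi 0) S2 (pos _ hv) (pos _ b0).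
  move=> /(_ (fun w hw => H2 w (btw _ _ _ hv b0 hw))) h; rewrite (le_trans h)//.
  have -> : K2 * tau ^+ 2 = `|r * (r - 1)| * S2 * (B * tau) ^+ 2 by rewrite /K2; ring.
  by rewrite ler_wpM2l ?mulr_ge0// sqr_le_norm.
split.
- by rewrite (le_trans (H0 _ b0))//; lra.
- exact: first.
- exact: first.
have -> : phi tau `^ r + phi (- tau) `^ r - 2 * phi 0 `^ r =
   r * phi 0 `^ (r - 1) * (phi tau + phi (- tau) - 2 * phi 0) +
   (phi tau `^ r - phi 0 `^ r - r * phi 0 `^ (r - 1) * (phi tau - phi 0)) +
   (phi (- tau) `^ r - phi 0 `^ r - r * phi 0 `^ (r - 1) * (phi (- tau) - phi 0)) by ring.
have e1 : `|r * phi 0 `^ (r - 1) * (phi tau + phi (- tau) - 2 * phi 0)| <= K1 * tau ^+ 2.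
  by rewrite !normrM /K1 -!mulrA ler_wpM2l// ler_pM// H1.
rewrite (le_trans (normD_le3 e1 (rem _ bp h2) (rem _ bm h3)))// -!mulrDl ler_wpM2r ?exprn_ge0//; lra.
Qed.

Lemma powR_sub2 p A : 0 <= A -> 2 < p -> A `^ (p - 2) * A ^+ 2 = A `^ p.
Proof.
move=> A0 p2; have p20 : 0 < p - 2 by rewrite subr_gt0.
have p0 : 0 < p by rewrite (lt_trans _ p2).
move: A0; rewrite le_eqVlt => /orP[/eqP<-|A0].
  by rewrite expr0n/= mulr0 powR0// gt_eqF.
by rewrite -powR_mulrn ?(ltW A0)// -powRD ?subrK// (gt_eqF A0) implybT.
Qed.

(** For [p > 2] the Taylor estimate persists when one of the points is 0; these cases are computed
    directly. *)
Lemma powR_taylor_ge0 p A (u v : R) : 2 < p -> 0 <= u <= A -> 0 <= v <= A ->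
  `|u `^ p - v `^ p - p * v `^ (p - 1) * (u - v)| <= p ^+ 2 * A `^ (p - 2) * (u - v) ^+ 2.
Proof.
move=> p2 /andP[u0 uA] /andP[v0 vA]; have p0 : 0 < p by rewrite (lt_trans _ p2).
have p20 : 0 <= p - 2 by rewrite subr_ge0 ltW.
have mono w : 0 <= w -> w <= A -> w `^ (p - 2) <= A `^ (p - 2).
  by move=> w0 wA; rewrite ge0_ler_powR ?nnegrE ?(le_trans w0 wA).
have p1p : 1 <= p ^+ 2 by rewrite -(expr1n _ 2) ler_pXn2r ?nnegrE ?(ltW p0)//; lra.
have App w : 0 <= w -> w <= A -> w `^ p <= A `^ (p - 2) * w ^+ 2.
  by move=> w0 wA; rewrite -(powR_sub2 w0 p2) ler_wpM2r ?exprn_ge0 ?mono.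
move: v0; rewrite le_eqVlt => /orP[/eqP v0|v0].
  rewrite -v0 (powR0 (x := p)) ?gt_eqF// (powR0 (x := p - 1)) ?gt_eqF ?subr_gt0//; last by rewrite (lt_trans _ p2)// ltr1n.
  rewrite mulr0 mul0r !subr0 ger0_norm ?powR_ge0// (le_trans (App _ u0 uA))//.
  by rewrite ler_wpM2r ?exprn_ge0// ler_peMl ?powR_ge0.
move: u0; rewrite le_eqVlt => /orP[/eqP u0|u0].
  rewrite -u0 powR0 ?gt_eqF// !sub0r sqrrN.
  have -> : - v `^ p - p * v `^ (p - 1) * - v = (p - 1) * v `^ p.
    by rewrite (powR_pred p v0); ring.
  rewrite ger0_norm ?mulr_ge0 ?powR_ge0 ?subr_ge0//; last by rewrite (le_trans _ (ltW p2))// ler1n.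
  have pp : p - 1 <= p ^+ 2.
    by rewrite expr2 (@le_trans _ _ p)// ?gerBl// ler_peMl ?(ltW p0)//; lra.
  rewrite -mulrA ler_pM ?powR_ge0 ?subr_ge0 ?App ?(ltW v0)//; lra.
have := @powR_taylor p u v (A `^ (p - 2)) u0 v0 _.
move=> /(_ _) h; rewrite (le_trans (h _))//.
  move=> w /andP[w1 w2]; apply: mono.
    by rewrite (le_trans _ w1)// le_min !ltW.
  by rewrite (le_trans w2)// ge_max uA.
rewrite ler_wpM2r ?sqr_ge0// ler_wpM2r ?powR_ge0//.
by rewrite ger0_norm ?mulr_ge0 ?(ltW p0)//; rewrite ?expr2 ?ler_wpM2l ?(ltW p0)//; lra.
Qed.

(** Meant for [phi] the norm of a vector polynomial in [tau]: not differentiable at its zeros, while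
    its square is a polynomial. The assumption is therefore on [phi ^ 2], and the linear Taylor term
    is expressed by it: [phi 0 ^ (p - 1) * (v - phi 0)] equals [phi 0 ^ (p - 2) * (v ^ 2 - phi 0 ^ 2
    - (v - phi 0) ^ 2) / 2]. *)
Lemma second_diff_norm_powR p k : 2 < p -> 0 <= k -> exists2 C, 0 <= C & forall tau A phi,
  0 <= tau <= 1 -> (forall x, 0 <= phi x) -> phi 0 <= A -> phi tau <= A -> phi (- tau) <= A ->
  `|phi tau - phi 0| <= A * tau -> `|phi (- tau) - phi 0| <= A * tau ->
  `|phi tau ^+ 2 + phi (- tau) ^+ 2 - 2 * phi 0 ^+ 2| <= k * A ^+ 2 * tau ^+ 2 ->
  second_diff tau (C * A `^ p) (fun x => phi x `^ p).
Proof.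
move=> p2 k0; have p0 : 0 < p by rewrite (lt_trans _ p2).
have p1 : 1 < p by rewrite (lt_trans _ p2)// ltr1n.
pose C := 1 + p * (k + 2) + 2 * p ^+ 2.
exists C; first by rewrite !addr_ge0 ?mulr_ge0 ?exprn_ge0 ?addr_ge0// ltW.
move=> tau A phi /andP[t0 t1] f0 b0 bp bm dp dm ds.
have A0 : 0 <= A by exact: le_trans b0.
have p20 : 0 <= p - 2 by rewrite subr_ge0 ltW.
have EA := powR_sub2 A0 p2.
have z0 : phi 0 `^ (p - 2) <= A `^ (p - 2) by rewrite ge0_ler_powR ?nnegrE.
have Ap0 := powR_ge0 A p; have A20 := powR_ge0 A (p - 2).
have Ed v : phi 0 `^ (p - 1) * (v - phi 0) =
    phi 0 `^ (p - 2) * ((v ^+ 2 - phi 0 ^+ 2) - (v - phi 0) ^+ 2) / 2.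
  have -> : phi 0 `^ (p - 1) = phi 0 `^ (p - 2) * phi 0.
    have := f0 0; rewrite le_eqVlt => /orP[/eqP<-|z].
      by rewrite mulr0 powR0// gt_eqF// subr_gt0.
    by rewrite powR_pred// (_ : p - 1 - 1 = p - 2)//; ring.
  by field.
have sq v : `|v - phi 0| <= A * tau -> (v - phi 0) ^+ 2 <= A ^+ 2 * tau ^+ 2.
  by rewrite -exprMn; exact: sqr_le_norm.
have rem v : 0 <= v <= A -> `|v - phi 0| <= A * tau ->
    `|v `^ p - phi 0 `^ p - p * phi 0 `^ (p - 1) * (v - phi 0)| <= p ^+ 2 * A `^ p * tau ^+ 2.
  move=> hv hd; have b0' : 0 <= phi 0 <= A by rewrite f0.
  rewrite (le_trans (powR_taylor_ge0 p2 hv b0'))// -EA.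
  have -> : p ^+ 2 * (A `^ (p - 2) * A ^+ 2) * tau ^+ 2 = p ^+ 2 * A `^ (p - 2) * (A ^+ 2 * tau ^+ 2) by ring.
  by rewrite ler_wpM2l ?sq// mulr_ge0 ?exprn_ge0 ?(ltW p0).
have first v : 0 <= v <= A -> `|v - phi 0| <= A * tau -> `|v `^ p - phi 0 `^ p| <= C * A `^ p * tau.
  move=> hv hd; have := rem v hv hd; set e := _ - _ - _ => he.
  have -> : v `^ p - phi 0 `^ p = e + p * phi 0 `^ (p - 1) * (v - phi 0) by rewrite /e subrK.
  have h1 : `|p * phi 0 `^ (p - 1) * (v - phi 0)| <= p * A `^ p * tau.
    rewrite !normrM (ger0_norm (ltW p0)) (ger0_norm (powR_ge0 _ _)) -!mulrA ler_wpM2l ?(ltW p0)//.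
    apply: (@le_trans _ _ (A `^ (p - 1) * (A * tau))).
      by rewrite ler_pM ?powR_ge0// ge0_ler_powR ?nnegrE// subr_ge0 ltW.
    rewrite mulrA; have := A0; rewrite le_eqVlt => /orP[/eqP<-|z].
      by rewrite mulr0 mul0r mulr_ge0 ?powR_ge0.
    by rewrite -powR_pred.
  have tt : tau ^+ 2 <= tau by rewrite expr2 ler_piMl.
  have h2 : p ^+ 2 * A `^ p * tau ^+ 2 <= p ^+ 2 * A `^ p * tau.
    by rewrite ler_wpM2l// mulr_ge0 ?exprn_ge0 ?(ltW p0).
  rewrite (le_trans (ler_normD _ _))// (le_trans (lerD (le_trans he h2) h1))//.
  rewrite -!mulrDl !ler_wpM2r// /C.
  have := mulr_ge0 (ltW p0) k0; have := exprn_ge0 2 (ltW p0); lra.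
split.
- rewrite ger0_norm ?powR_ge0// (@le_trans _ _ (A `^ p))//.
    by rewrite ge0_ler_powR ?nnegrE ?(ltW p0).
  rewrite ler_peMl// /C; have := mulr_ge0 (ltW p0) k0; have := exprn_ge0 2 (ltW p0); lra.
- by apply: first => //; rewrite f0.
- by apply: first => //; rewrite f0.
have -> : phi tau `^ p + phi (- tau) `^ p - 2 * phi 0 `^ p =
   p * (phi 0 `^ (p - 1) * (phi tau - phi 0) + phi 0 `^ (p - 1) * (phi (- tau) - phi 0)) +
   (phi tau `^ p - phi 0 `^ p - p * phi 0 `^ (p - 1) * (phi tau - phi 0)) +
   (phi (- tau) `^ p - phi 0 `^ p - p * phi 0 `^ (p - 1) * (phi (- tau) - phi 0)) by ring.
have r1 := rem (phi tau) _ dp; have r2 := rem (phi (- tau)) _ dm.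
rewrite !f0 bp bm /= in r1 r2; have {}r1 := r1 isT; have {}r2 := r2 isT.
have e1 : `|p * (phi 0 `^ (p - 1) * (phi tau - phi 0) + phi 0 `^ (p - 1) * (phi (- tau) - phi 0))| <=
    p * (k + 2) * A `^ p * tau ^+ 2.
  rewrite normrM (ger0_norm (ltW p0)) -!mulrA ler_wpM2l ?(ltW p0)// !Ed.
  set q := phi 0 `^ (p - 2) in z0 *; have q0 : 0 <= q by exact: powR_ge0.
  set a := phi tau in dp ds *; set b := phi (- tau) in dm ds *; set c := phi 0 in dp dm ds *.
  have -> : q * (a ^+ 2 - c ^+ 2 - (a - c) ^+ 2) / 2 + q * (b ^+ 2 - c ^+ 2 - (b - c) ^+ 2) / 2 =
     q / 2 * ((a ^+ 2 + b ^+ 2 - 2 * c ^+ 2) + (- (a - c) ^+ 2) + (- (b - c) ^+ 2)) by field.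
  have n1 : `|- (a - c) ^+ 2| <= A ^+ 2 * tau ^+ 2 by rewrite normrN ger0_norm ?sqr_ge0// sq.
  have n2 : `|- (b - c) ^+ 2| <= A ^+ 2 * tau ^+ 2 by rewrite normrN ger0_norm ?sqr_ge0// sq.
  rewrite normrM ger0_norm ?divr_ge0//.
  apply: (le_trans (ler_wpM2l _ (normD_le3 ds n1 n2))); first by rewrite divr_ge0.
  have -> : k * A ^+ 2 * tau ^+ 2 + A ^+ 2 * tau ^+ 2 + A ^+ 2 * tau ^+ 2 =
    (k + 2) * (A ^+ 2 * tau ^+ 2) by ring.
  rewrite -EA; have w0 : 0 <= (k + 2) * (A ^+ 2 * tau ^+ 2).
    by rewrite !mulr_ge0 ?exprn_ge0// addr_ge0.
  apply: (@le_trans _ _ (A `^ (p - 2) * ((k + 2) * (A ^+ 2 * tau ^+ 2)))).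
    by rewrite ler_wpM2r// (le_trans _ z0)// ler_pdivrMr ?ltr0n// ler_peMr ?ler1n.
  by rewrite le_eqVlt; apply/orP; left; apply/eqP; ring.
rewrite (le_trans (normD_le3 e1 r1 r2))// -!mulrDl ler_wpM2r ?exprn_ge0// ler_wpM2r// /C.
lra.
Qed.

End SecondDifferences.

(** * Pointwise bounds for the energy density of a perturbed curve *)

Section PointwiseDomination.
Context {R : realType}.
Implicit Types (f h Phi : curve R) (p L m M tau : R).

Definition perturb f Phi tau : curve R := fun x => f x + tau *: Phi x.

Definition energy_density p f (s t g : R) :=
  menger_curvature f s t g `^ p * enorm (derive1 f s) * enorm (derive1 f t) * enorm (derive1 f g).

Definition quotient f (y x : R) := x^-1 *: (f (y + x) - f y).

Lemma quotientK f y x : x != 0 -> f (y + x) - f y = x *: quotient f y x.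
Proof. by move=> x0; rewrite /quotient scalerA mulfV// scale1r. Qed.

Lemma quotient_perturb f Phi tau y x :
  quotient (perturb f Phi tau) y x = quotient f y x + tau *: quotient Phi y x.
Proof. by rewrite /quotient /perturb; apply: eq_vec3; rewrite !coE; ring. Qed.

Lemma is_derive_perturb f Phi tau x : derivable f x (1 : R) -> derivable Phi x (1 : R) ->
  is_derive x (1 : R) (perturb f Phi tau) (derive1 f x + tau *: derive1 Phi x).
Proof.
move=> /derivableP df /derivableP dP; rewrite !derive1E.
exact: (is_deriveD df (is_deriveZ tau dP)).
Qed.

Lemma derive1_perturb f Phi tau x : derivable f x (1 : R) -> derivable Phi x (1 : R) ->
  derive1 (perturb f Phi tau) x = derive1 f x + tau *: derive1 Phi x.
Proof. by move=> df dP; have [_ <-] := is_derive_perturb tau df dP; rewrite derive1E. Qed.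

Lemma derivable_perturb f Phi tau x : derivable f x (1 : R) -> derivable Phi x (1 : R) ->
  derivable (perturb f Phi tau) x (1 : R).
Proof. by move=> df dP; have [] := is_derive_perturb tau df dP. Qed.

(** A divided difference of the chord quotients at [y]; it is the one factor of the curvature that
    is not bounded as the offsets shrink. *)
Definition chord_gap f y x z := (`|x| + `|z|)^-1 *: (quotient f y x - quotient f y z).

(** Offsets of opposite sign satisfy [|x - z| = |x| + |z|]. Dividing the three sides by their
    parameter lengths leaves one factor [(|x| + |z|)^-1], which is given to the cross product, where
    the first quotient may be replaced by the difference of the two. *)
Lemma menger_quotients h y x z : x * z < 0 ->
  quotient h y x != 0 -> quotient h y z != 0 -> quotient h (y + z) (x - z) != 0 ->
  menger_curvature h y (y + x) (y + z) =
  2 * enorm (cross (chord_gap h y x z) (quotient h y z)) /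
    (enorm (quotient h y x) * enorm (quotient h y z) * enorm (quotient h (y + z) (x - z))).
Proof.
move=> xz a0 b0 d0.
have x0 : x != 0 by apply/eqP => E; move: xz; rewrite E mul0r ltxx.
have z0 : z != 0 by apply/eqP => E; move: xz; rewrite E mulr0 ltxx.
have nD : `|x - z| = `|x| + `|z|.
  have [xp|xn|xE] := ltgtP 0 x; last by rewrite -xE eqxx in x0.
    have zn : z < 0 by rewrite -(pmulr_rlt0 _ xp).
    by rewrite (gtr0_norm xp) (ltr0_norm zn) gtr0_norm// subr_gt0 (lt_trans zn).
  have zp : 0 < z by rewrite -(nmulr_rlt0 _ xn).
  by rewrite (ltr0_norm xn) (gtr0_norm zp) ltr0_norm ?subr_lt0 ?(lt_trans xn)// opprB addrC.
have xz0 : x - z != 0.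
  by rewrite -normr_gt0 nD addr_gt0// normr_gt0.
have E3 : h (y + z) - h (y + x) = - ((x - z) *: quotient h (y + z) (x - z)).
  rewrite -quotientK// opprB; congr (_ - h _); ring.
have Ed : h (y + x) - h (y + z) = (x - z) *: quotient h (y + z) (x - z).
  by rewrite -opprB E3 opprK.
rewrite /menger_curvature -(opprB (h (y + z))) enormN E3 enormN (quotientK h y x0) (quotientK h y z0).
rewrite /chord_gap; move: a0 b0 d0.
move: (quotient h y x) (quotient h y z) (quotient h (y + z) (x - z)) => a b d.
rewrite -!enorm_gt0 => ap bp dp.
rewrite !crossZl crossZr crossBl crossvv subr0 !enormZ nD.
have [xp zp] : 0 < `|x| /\ 0 < `|z| by rewrite !normr_gt0.
rewrite [`|(_ + _)^-1|]ger0_norm ?invr_ge0 ?addr_ge0//.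
move: ap bp dp xp zp; move: (enorm (cross _ _)) (enorm a) (enorm b) (enorm d) `|x| `|z|.
move=> N a1 b1 d1 u w ap bp dp up wp.
by field; rewrite !gt_eqF ?addr_gt0.
Qed.

Lemma powR_sqrK (w r : R) : 0 <= w -> (w ^+ 2) `^ r = w `^ (2 * r).
Proof. by move=> w0; rewrite -powR_mulrn// -powRrM. Qed.

(** Side lengths and speeds are written through [dot v v], which along a perturbation is a
    polynomial in [tau] bounded away from 0. Only the cross product may vanish, and it carries the
    exponent [p > 2]. *)
Lemma density_quotients p h y x z : x * z < 0 ->
  quotient h y x != 0 -> quotient h y z != 0 -> quotient h (y + z) (x - z) != 0 ->
  energy_density p h y (y + x) (y + z) =
  2 `^ p * enorm (cross (chord_gap h y x z) (quotient h y z)) `^ p *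
  (dot (quotient h y x) (quotient h y x) * dot (quotient h y z) (quotient h y z) *
   dot (quotient h (y + z) (x - z)) (quotient h (y + z) (x - z))) `^ (- (p / 2)) *
  (dot (derive1 h y) (derive1 h y) * dot (derive1 h (y + x)) (derive1 h (y + x)) *
   dot (derive1 h (y + z)) (derive1 h (y + z))) `^ (2^-1).
Proof.
move=> xz a0 b0 d0; rewrite /energy_density (menger_quotients xz a0 b0 d0).
move: a0 b0 d0; set c0 := cross _ _; clearbody c0; move: c0 (quotient h y x) (quotient h y z) (quotient h (y + z) (x - z)).
move: (derive1 h y) (derive1 h (y + x)) (derive1 h (y + z)) => u0 u1 u2 c va vb vd.
rewrite -!enorm_gt0 => ap bp dp; rewrite -!sqr_enorm.
have [N0 T00 T10 T20] : [/\ 0 <= enorm c, 0 <= enorm u0, 0 <= enorm u1 & 0 <= enorm u2] by split; exact: enorm_ge0.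
move: ap bp dp N0 T00 T10 T20.
move: (enorm c) (enorm u0) (enorm u1) (enorm u2) (enorm va) (enorm vb) (enorm vd) => N T0 T1 T2 a b d.
move=> ap bp dp N0 T00 T10 T20; rewrite -!exprMn.
have w0 : 0 < a * b * d by rewrite !mulr_gt0.
have T0' : 0 <= T0 * T1 * T2 by rewrite !mulr_ge0.
rewrite (powR_sqrK _ (ltW w0)) (powR_sqrK _ T0') mulfV// powRr1//.
rewrite powRM ?mulr_ge0 ?invr_ge0 ?(ltW w0)// powRM//.
have -> : (a * b * d)^-1 `^ p = (a * b * d) `^ (2 * - (p / 2)).
  by rewrite -powR_inv1 ?(ltW w0)// -powRrM; congr (_ `^ _); field.
ring.
Qed.

(** [m] bounds [f] from below, [M] bounds [f] and [Phi] from above. The lower chord bound is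
    confined to parameter distances at which the curve cannot close up. *)
Definition controlled L m M f Phi :=
  [/\ forall u v, `|u - v| <= 2 * L / 3 -> m * `|u - v| <= enorm (f u - f v),
      forall u v, enorm (f u - f v) <= M * `|u - v|,
      forall u v, enorm (Phi u - Phi v) <= M * `|u - v|,
      forall u, m <= enorm (derive1 f u) <= M & forall u, enorm (derive1 Phi u) <= M].

Lemma perturb_bounds m M tau (u v : 'rV[R]_3) (r : R) : 0 <= tau <= 1 -> tau * M <= m / 2 ->
  m <= enorm u -> enorm u <= M -> enorm v <= M -> `|r| <= tau ->
  m / 2 <= enorm (u + r *: v) <= 2 * M.
Proof.
move=> /andP[t0 t1] tM mu uM vM rt.
have hv : enorm (r *: v) <= m / 2.
  by rewrite enormZ (le_trans _ tM)// ler_pM ?enorm_ge0.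
have hv2 : enorm (r *: v) <= M.
  have M0 : 0 <= M := le_trans (enorm_ge0 _) vM.
  by rewrite enormZ -[leRHS]mul1r ler_pM ?enorm_ge0// (le_trans rt).
have := ler_enormD u (r *: v); have := lerB_enorm u (- (r *: v)); rewrite enormN opprK.
by move=> h1 h2; apply/andP; split; lra.
Qed.

Lemma second_diff_eq tau B (phi psi : R -> R) : phi 0 = psi 0 -> phi tau = psi tau ->
  phi (- tau) = psi (- tau) -> second_diff tau B psi -> second_diff tau B phi.
Proof. by rewrite /second_diff => -> -> ->. Qed.

(** By Lagrange's identity the squared norm is a polynomial in [r], so its second difference follows
    from [second_diffM]; for the norm itself only first differences are bounded. *)
Lemma second_diff_cross tau (rho M : R) (A0 A1 b0 b1 : 'rV[R]_3) : 0 <= tau <= 1 ->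
  0 <= rho -> enorm A0 <= rho -> enorm A1 <= rho -> enorm b0 <= M -> enorm b1 <= M ->
  let phi r := enorm (cross (A0 + r *: A1) (b0 + r *: b1)) in
  [/\ forall r, `|r| <= tau -> phi r <= 4 * rho * M,
      `|phi tau - phi 0| <= 4 * rho * M * tau, `|phi (- tau) - phi 0| <= 4 * rho * M * tau &
      `|phi tau ^+ 2 + phi (- tau) ^+ 2 - 2 * phi 0 ^+ 2| <= 8 * (4 * rho * M) ^+ 2 * tau ^+ 2].
Proof.
move=> t01 rho0 hA0 hA1 hb0 hb1 phi; have /andP[t0 t1] := t01.
have M0 : 0 <= M := le_trans (enorm_ge0 _) hb0.
have lin (u v : 'rV[R]_3) (B r : R) : enorm u <= B -> enorm v <= B -> `|r| <= tau -> enorm (u + r *: v) <= 2 * B.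
  move=> hu hv hr; have B0 : 0 <= B := le_trans (enorm_ge0 _) hu.
  rewrite (le_trans (ler_enormD _ _))// mulr_natl mulr2n lerD// enormZ -[leRHS]mul1r.
  by rewrite ler_pM ?enorm_ge0// (le_trans hr).
have size r : `|r| <= tau -> phi r <= 4 * rho * M.
  move=> hr; rewrite /phi (le_trans (enorm_cross_le _ _))//.
  rewrite (le_trans (ler_pM (enorm_ge0 _) (enorm_ge0 _) (lin _ _ _ _ hA0 hA1 hr) (lin _ _ _ _ hb0 hb1 hr)))//.
  by rewrite le_eqVlt; apply/orP; left; apply/eqP; ring.
have step r : `|r| = tau -> `|phi r - phi 0| <= 4 * rho * M * tau.
  move=> hr; have hr' : `|r| <= tau by rewrite hr.
  have E : cross (A0 + r *: A1) (b0 + r *: b1) - cross (A0 + 0 *: A1) (b0 + 0 *: b1) =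
      r *: (cross A1 (b0 + r *: b1) + cross A0 b1).
    by apply: eq_vec3; rewrite !coE; ring.
  have bd : enorm (cross (A0 + r *: A1) (b0 + r *: b1) - cross (A0 + 0 *: A1) (b0 + 0 *: b1)) <=
      4 * rho * M * tau.
    rewrite E enormZ hr mulrC ler_wpM2r// (le_trans (ler_enormD _ _))//.
    have h1 : enorm (cross A1 (b0 + r *: b1)) <= rho * (2 * M).
      by rewrite (le_trans (enorm_cross_le _ _))// ler_pM ?enorm_ge0// lin.
    have h2 : enorm (cross A0 b1) <= rho * M.
      by rewrite (le_trans (enorm_cross_le _ _))// ler_pM ?enorm_ge0.
    rewrite (le_trans (lerD h1 h2))//.
    by have := mulr_ge0 rho0 M0; lra.
  rewrite /phi; move: bd; set X := cross _ _; set Y := cross (A0 + 0 *: A1) _ => bd.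
  have := lerB_enorm X Y; have := lerB_enorm Y X; rewrite (enormBC Y) ler_norml => h1 h2.
  by apply/andP; split; lra.
split; [exact: size|by apply: step; rewrite ger0_norm|by apply: step; rewrite normrN ger0_norm|].
have E r : phi r ^+ 2 = dot (A0 + r *: A1) (A0 + r *: A1) * dot (b0 + r *: b1) (b0 + r *: b1) -
    dot (A0 + r *: A1) (b0 + r *: b1) * dot (A0 + r *: A1) (b0 + r *: b1).
  by rewrite /phi lagrange !sqr_enorm expr2.
have [_ _ _ s1] := second_diffM t01 (second_diff_dot t01 hA0 hA1 hA0 hA1) (second_diff_dot t01 hb0 hb1 hb0 hb1).
have [_ _ _ s2] := second_diffM t01 (second_diff_dot t01 hA0 hA1 hb0 hb1) (second_diff_dot t01 hA0 hA1 hb0 hb1).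
rewrite !E; move: s1 s2.
set p1 := dot _ _ * dot _ _; set p2 := dot _ _ * dot _ _; set p3 := dot _ _ * dot _ _.
move=> s1; set q1 := dot _ _ * dot _ _; set q2 := dot _ _ * dot _ _; set q3 := dot _ _ * dot _ _ => s2.
clearbody p1 p2 p3 q1 q2 q3.
have -> : p1 - q1 + (p2 - q2) - 2 * (p3 - q3) = (p1 + p2 - 2 * p3) - (q1 + q2 - 2 * q3) by ring.
rewrite (le_trans (ler_normB _ _))// (le_trans (lerD s1 s2))// -mulrDl ler_wpM2r ?exprn_ge0//.
by rewrite le_eqVlt; apply/orP; left; apply/eqP; ring.
Qed.

Definition gap_bound f Phi y x z :=
  (enorm (quotient f y x - quotient f y z) + enorm (quotient Phi y x - quotient Phi y z)) / (`|x| + `|z|).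

(** The density is [2 ^ p * NN ^ p * UU ^ (- (p / 2)) * VV ^ (1 / 2)], with [NN] the norm of the
    cross product, [UU] and [VV] products of squared quotients and of squared speeds. [NN]
    contributes the factor [gap_bound ^ p]; the condition [tau * M <= m / 2] keeps [UU] and [VV] in
    [[lo, hi]]. *)
Lemma density_second_diff p m M : 3 < p -> 0 < m -> m <= M -> exists2 K, 0 < K &
  forall L f Phi y x z tau, controlled L m M f Phi ->
  (forall s, derivable f s (1 : R)) -> (forall s, derivable Phi s (1 : R)) ->
  opposite_offsets L x z -> 0 <= tau <= 1 -> tau * M <= m / 2 ->
  second_diff tau (K * gap_bound f Phi y x z `^ p)
    (fun r => energy_density p (perturb f Phi r) y (y + x) (y + z)).
Proof.
move=> p3 m0 mM; have M0 : 0 < M := lt_le_trans m0 mM.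
have p2 : 2 < p by rewrite (lt_trans _ p3)// ltr_nat.
have [C1 C10 hN] := second_diff_norm_powR p2 (ler0n R 8).
pose lo := (m / 2) ^+ 2 * (m / 2) ^+ 2 * (m / 2) ^+ 2.
pose hi := (2 * M) ^+ 2 * (2 * M) ^+ 2 * (2 * M) ^+ 2.
pose B := 4 * (4 * (4 * M * M) * (4 * M * M)) * (4 * M * M).
have lo0 : 0 < lo by rewrite !mulr_gt0 ?exprn_gt0 ?divr_gt0.
have B0 : 0 <= B by rewrite !mulr_ge0 ?(ltW M0).
have [C2 C20 hU] := second_diff_powR (- (p / 2)) hi lo0 B0.
have [C3 C30 hV] := second_diff_powR (2^-1) hi lo0 B0.
pose K := 4 * (4 * (2 `^ p * (C1 * (4 * M) `^ p)) * C2) * C3.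
have K0 : 0 <= K by rewrite !mulr_ge0 ?powR_ge0.
exists (K + 1); first by rewrite ltr_wpDl.
move=> L f Phi y x z tau [bil lf lP df dP] derf derP [xz xzL] t01 tM.
have /andP[t0 t1] := t01.
have x0 : x != 0 by apply/eqP => E; move: xz; rewrite E mul0r ltxx.
have z0 : z != 0 by apply/eqP => E; move: xz; rewrite E mulr0 ltxx.
have xzn : `|x - z| <= `|x| + `|z| by exact: ler_normB.
have xz0 : x - z != 0.
  rewrite subr_eq0; apply/eqP => E; move: xz; rewrite E => /lt_geF.
  by rewrite -expr2 sqr_ge0.
have qlo u w : w != 0 -> `|w| <= 2 * L / 3 -> m <= enorm (quotient f u w).
  move=> w0 wL; rewrite /quotient enormZ normfV ler_pdivlMl ?normr_gt0// mulrC.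
  by have := bil (u + w) u; rewrite addrAC subrr add0r => /(_ wL).
have qhi g u w : (forall u v, enorm (g u - g v) <= M * `|u - v|) -> w != 0 -> enorm (quotient g u w) <= M.
  move=> lg w0; rewrite /quotient enormZ normfV ler_pdivrMl ?normr_gt0// mulrC.
  by have := lg (u + w) u; rewrite addrAC subrr add0r.
have xL : `|x| <= 2 * L / 3 by rewrite (le_trans _ xzL)// lerDl.
have zL : `|z| <= 2 * L / 3 by rewrite (le_trans _ xzL)// lerDr.
have dL : `|x - z| <= 2 * L / 3 by rewrite (le_trans xzn).
have rt0 : `|0 : R| <= tau by rewrite normr0.
have rtp : `|tau| <= tau by rewrite ger0_norm.
have rtm : `|- tau| <= tau by rewrite normrN ger0_norm.
have qb u w r : w != 0 -> `|w| <= 2 * L / 3 -> `|r| <= tau ->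
    m / 2 <= enorm (quotient f u w + r *: quotient Phi u w) <= 2 * M.
  by move=> w0 wL; apply: (perturb_bounds t01 tM); [exact: qlo|exact: qhi|exact: qhi].
have Tb u r : `|r| <= tau -> m / 2 <= enorm (derive1 f u + r *: derive1 Phi u) <= 2 * M.
  by move=> hr; have /andP[h1 h2] := df u; exact: (perturb_bounds t01 tM h1 h2 (dP u) hr).
have sq (v : 'rV[R]_3) : m / 2 <= enorm v <= 2 * M -> (m / 2) ^+ 2 <= dot v v <= (2 * M) ^+ 2.
  move=> /andP[h1 h2]; rewrite -sqr_enorm !ler_pXn2r ?nnegrE ?enorm_ge0 ?h1 ?h2 ?divr_ge0 ?(ltW m0)//.
  by rewrite mulr_ge0// ltW.
have m20 : 0 <= (m / 2) ^+ 2 by rewrite sqr_ge0.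
have prod3 (u v w : 'rV[R]_3) : m / 2 <= enorm u <= 2 * M -> m / 2 <= enorm v <= 2 * M ->
    m / 2 <= enorm w <= 2 * M -> lo <= dot u u * dot v v * dot w w <= hi.
  move=> /sq/andP[u1 u2] /sq/andP[v1 v2] /sq/andP[w1 w2].
  have u3 := le_trans m20 u1; have v3 := le_trans m20 v1; have w3 := le_trans m20 w1.
  have uv1 : (m / 2) ^+ 2 * (m / 2) ^+ 2 <= dot u u * dot v v by exact: ler_pM.
  have uv2 : dot u u * dot v v <= (2 * M) ^+ 2 * (2 * M) ^+ 2 by exact: ler_pM.
  have mm : 0 <= (m / 2) ^+ 2 * (m / 2) ^+ 2 by exact: mulr_ge0.
  apply/andP; split; first exact: (ler_pM mm m20 uv1 w1).
  exact: (ler_pM (mulr_ge0 u3 v3) w3 uv2 w2).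
have sdot (u v : 'rV[R]_3) : enorm u <= M -> enorm v <= M ->
    second_diff tau (4 * M * M) (fun r => dot (u + r *: v) (u + r *: v)).
  by move=> hu hv; exact: second_diff_dot.
set rho := gap_bound f Phi y x z.
have D0 : 0 < `|x| + `|z| by rewrite addr_gt0// normr_gt0.
have rho0 : 0 <= rho by rewrite divr_ge0 ?addr_ge0 ?enorm_ge0.
have gap g : enorm (quotient g y x - quotient g y z) <=
      enorm (quotient f y x - quotient f y z) + enorm (quotient Phi y x - quotient Phi y z) ->
    enorm (chord_gap g y x z) <= rho.
  move=> hg; rewrite /chord_gap enormZ ger0_norm ?invr_ge0 ?(ltW D0)// mulrC.
  by rewrite ler_pM2r ?invr_gt0.
have A0 : enorm (chord_gap f y x z) <= rho by apply: gap; rewrite lerDl enorm_ge0.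
have A1 : enorm (chord_gap Phi y x z) <= rho by apply: gap; rewrite lerDr enorm_ge0.
pose NN r := enorm (cross (chord_gap f y x z + r *: chord_gap Phi y x z) (quotient f y z + r *: quotient Phi y z)).
have [s1 s2 s3 s4] : [/\ forall r, `|r| <= tau -> NN r <= 4 * rho * M,
      `|NN tau - NN 0| <= 4 * rho * M * tau, `|NN (- tau) - NN 0| <= 4 * rho * M * tau &
      `|NN tau ^+ 2 + NN (- tau) ^+ 2 - 2 * NN 0 ^+ 2| <= 8 * (4 * rho * M) ^+ 2 * tau ^+ 2].
  exact: (second_diff_cross t01 rho0 A0 A1 (qhi f y z lf z0) (qhi Phi y z lP z0)).
have NN0 r : 0 <= NN r by exact: enorm_ge0.
have SN := hN tau (4 * rho * M) NN t01 NN0 (s1 0 rt0) (s1 tau rtp) (s1 _ rtm) s2 s3 s4.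
pose qq u w r := dot (quotient f u w + r *: quotient Phi u w) (quotient f u w + r *: quotient Phi u w).
pose TT u r := dot (derive1 f u + r *: derive1 Phi u) (derive1 f u + r *: derive1 Phi u).
have dfM u : enorm (derive1 f u) <= M by have /andP[] := df u.
have Sq u w : w != 0 -> second_diff tau (4 * M * M) (qq u w).
  by move=> w0; exact: (sdot _ _ (qhi f u w lf w0) (qhi Phi u w lP w0)).
have ST u : second_diff tau (4 * M * M) (TT u) by exact: (sdot _ _ (dfM u) (dP u)).
pose UU r := qq y x r * qq y z r * qq (y + z) (x - z) r.
pose VV r := TT y r * TT (y + x) r * TT (y + z) r.
have SU : second_diff tau B UU := second_diffM t01 (second_diffM t01 (Sq y x x0) (Sq y z z0)) (Sq (y + z) (x - z) xz0).
have SV : second_diff tau B VV := second_diffM t01 (second_diffM t01 (ST y) (ST (y + x))) (ST (y + z)).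
have bU r : `|r| <= tau -> lo <= UU r <= hi.
  by move=> hr; exact: (prod3 _ _ _ (qb y x r x0 xL hr) (qb y z r z0 zL hr) (qb (y + z) (x - z) r xz0 dL hr)).
have bV r : `|r| <= tau -> lo <= VV r <= hi.
  by move=> hr; exact: (prod3 _ _ _ (Tb y r hr) (Tb (y + x) r hr) (Tb (y + z) r hr)).
have SU' := hU tau UU t01 SU (bU 0 rt0) (bU tau rtp) (bU _ rtm).
have SV' := hV tau VV t01 SV (bV 0 rt0) (bV tau rtp) (bV _ rtm).
pose psi r := 2 `^ p * NN r `^ p * UU r `^ (- (p / 2)) * VV r `^ (2^-1).
have S : second_diff tau (4 * (4 * (2 `^ p * (C1 * (4 * rho * M) `^ p)) * C2) * C3) psi
  := second_diffM t01 (second_diffM t01 (second_diffZ (powR_ge0 2 p) SN) SU') SV'.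
have Epow : (4 * rho * M) `^ p = (4 * M) `^ p * rho `^ p.
  by rewrite mulrAC; apply: powRM => //; apply: mulr_ge0; [exact: ler0n|exact: ltW].
apply: (@second_diff_le R tau (K * rho `^ p)) => //; first by rewrite ler_wpM2r ?powR_ge0// lerDl.
have -> : K * rho `^ p = 4 * (4 * (2 `^ p * (C1 * (4 * rho * M) `^ p)) * C2) * C3.
  by rewrite Epow /K; ring.
pose ED r := energy_density p (perturb f Phi r) y (y + x) (y + z).
have eqd r : `|r| <= tau -> ED r = psi r.
  rewrite /ED /psi => hr; have nz v : m / 2 <= enorm v <= 2 * M -> v != 0.
    by move=> /andP[h _]; rewrite -enorm_gt0 (lt_le_trans _ h)// divr_gt0.
  rewrite density_quotients//; rewrite ?quotient_perturb; first last.
  - by apply: nz; exact: qb.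
  - by apply: nz; exact: qb.
  - by apply: nz; exact: qb.
  rewrite !(derive1_perturb r (derf _) (derP _)).
  have -> : chord_gap (perturb f Phi r) y x z = chord_gap f y x z + r *: chord_gap Phi y x z.
    by rewrite /chord_gap !quotient_perturb; apply: eq_vec3; rewrite !coE; ring.
  by [].
rewrite -/ED; clearbody ED psi.
exact: (second_diff_eq (eqd 0 rt0) (eqd tau rtp) (eqd _ rtm) S).
Qed.

End PointwiseDomination.

Section Domination.
Context {R : realType}.
Implicit Types (f h Phi : curve R) (p L m M tau : R).

Lemma quotient_gap_le f y x z :
  enorm (quotient f y x - quotient f y z) <= quot_defect f y x + quot_defect f y z.
Proof.
rewrite /quot_defect -/(quotient f y x) -/(quotient f y z) (enormBC (quotient f y z) (derive1 f y)).
exact: enorm_triangle.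
Qed.

Lemma defect_kernelE p f y x z :
  defect_kernel p f (y, x, z) = (quot_defect f y x `^ p * (`|x| + `|z|) `^ (- p))%:E.
Proof. by []. Qed.

(** The quotients at [x] and [z] are compared through the derivative at [y], for the curve and for
    the field; [4 ^ p] comes from splitting the power of the four defects. *)
Lemma gap_bound_powR p f Phi y x z : 1 <= p -> 0 < `|x| + `|z| ->
  ((gap_bound f Phi y x z `^ p)%:E <= (4 `^ p)%:E *
   (defect_kernel p f (y, x, z) + defect_kernel p f (y, z, x) +
    (defect_kernel p Phi (y, x, z) + defect_kernel p Phi (y, z, x))))%E.
Proof.
move=> p1 D0; have p0 : 0 <= p by exact: le_trans ler01 p1.
rewrite (defect_kernelE p f y x z) (defect_kernelE p f y z x).
rewrite (defect_kernelE p Phi y x z) (defect_kernelE p Phi y z x).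
rewrite (addrC `|z|) -!EFinD -[((4 `^ p)%:E * _)%E]EFinM lee_fin.
have factor (k a b c d w : R) : k * (a * w + b * w + (c * w + d * w)) = k * (a + b + (c + d)) * w by ring.
rewrite factor.
have q0 (g : curve R) u w : 0 <= quot_defect g u w by exact: enorm_ge0.
rewrite /gap_bound.
have -> : (`|x| + `|z|) `^ (- p) = ((`|x| + `|z|)^-1) `^ p.
  by rewrite -powR_inv1 ?(ltW D0)// -powRrM mulN1r.
rewrite powRM ?addr_ge0 ?enorm_ge0 ?invr_ge0//.
rewrite ler_wpM2r ?powR_ge0//.
have h1 := quotient_gap_le f y x z; have h2 := quotient_gap_le Phi y x z.
move: h1 h2 (q0 f y x) (q0 f y z) (q0 Phi y x) (q0 Phi y z).
move: (enorm_ge0 (quotient f y x - quotient f y z)) (enorm_ge0 (quotient Phi y x - quotient Phi y z)).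
move: (quot_defect f y x) (quot_defect f y z) (quot_defect Phi y x) (quot_defect Phi y z).
move: (enorm _) (enorm _) => u v a b c d u0 v0 uab vcd a0 b0 c0 d0.
have mono (s t : R) : 0 <= s -> s <= t -> s `^ p <= t `^ p.
  by move=> s0 st; apply: ge0_ler_powR => //; rewrite nnegrE// (le_trans s0).
have ab0 : 0 <= a + b := addr_ge0 a0 b0; have cd0 : 0 <= c + d := addr_ge0 c0 d0.
have s1 := mono (v + u) (a + b + (c + d)) (addr_ge0 u0 v0) (lerD uab vcd).
have s2 := powR_addr_le p1 ab0 cd0.
have s3 := powR_addr_le p1 a0 b0; have s4 := powR_addr_le p1 c0 d0.
rewrite (le_trans s1)// (le_trans s2)//.
have -> : 4 `^ p = 2 `^ p * 2 `^ p :> R by rewrite -powRM// -natrM.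
by rewrite -mulrA ler_wpM2l ?powR_ge0// mulrDr lerD.
Qed.

Lemma le_sum_mem (I : eqType) (s : seq I) (F : I -> \bar R) a : a \in s ->
  (forall i, 0 <= F i)%E -> (F a <= \sum_(i <- s) F i)%E.
Proof.
move=> ha F0; rewrite (big_rem a ha)/= leeDl//.
by elim: (rem a s) => [|i r IH]; rewrite ?big_nil// big_cons adde_ge0.
Qed.

Lemma base_kernel_ge p L f (s t g a b : R) : a \in shifts L -> b \in shifts L ->
  (defect_kernel p f (s, t - s + a, g - s + b)%R + defect_kernel p f (s, g - s + b, t - s + a)%R <=
   base_kernel p L f (s, t, g))%E.
Proof.
move=> ha hb; rewrite /base_kernel/=.
pose F a' b' := (defect_kernel p f (s, t - s + a', g - s + b')%R + defect_kernel p f (s, g - s + b', t - s + a')%R)%E.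
have F0 a' b' : (0 <= F a' b')%E by rewrite adde_ge0 ?defect_kernel_ge0.
have h1 : (F a b <= \sum_(b' <- shifts L) F a b')%E by exact: le_sum_mem.
apply: (le_trans h1); apply: (@le_sum_mem _ _ (fun a' => \sum_(b' <- shifts L) F a' b')%E _ ha) => i.
by elim: (shifts L) => [|j r IH]; rewrite ?big_nil// big_cons adde_ge0.
Qed.

Lemma base_kernel_ge0 p L f z : (0 <= base_kernel p L f z)%E.
Proof.
rewrite /base_kernel; elim: {1}(shifts L) => [|i r IH]; rewrite ?big_nil// big_cons adde_ge0//.
by elim: (shifts L) => [|j r' IH']; rewrite ?big_nil// big_cons !adde_ge0 ?defect_kernel_ge0.
Qed.

Lemma menger_curvatureC (h : curve R) s t g : menger_curvature h s t g = menger_curvature h s g t.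
Proof.
rewrite /menger_curvature enorm_crossC; congr (_ / _).
rewrite [enorm (h s - h g)]enormBC [enorm (h t - h s)]enormBC [enorm (h g - h t)]enormBC; ring.
Qed.

Lemma menger_curvature_swap (h : curve R) s t g : menger_curvature h s t g = menger_curvature h t s g.
Proof.
rewrite /menger_curvature.
have -> : cross (h s - h t) (h g - h t) = - cross (h t - h s) (h g - h s).
  by apply: eq_vec3; rewrite !coE; ring.
rewrite enormN; congr (_ / _).
rewrite (enormBC (h t) (h s)) (enormBC (h g) (h t)) (enormBC (h s) (h g)); ring.
Qed.

Lemma energy_densityC p h s t g : energy_density p h s t g = energy_density p h s g t.
Proof.
rewrite /energy_density (menger_curvatureC h s t g).
move: (menger_curvature h s g t `^ p) (enorm (derive1 h s)) (enorm (derive1 h t)) (enorm (derive1 h g)).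
by move=> *; ring.
Qed.

Lemma energy_density_swap p h s t g : energy_density p h s t g = energy_density p h t s g.
Proof.
rewrite /energy_density (menger_curvature_swap h s t g).
move: (menger_curvature h t s g `^ p) (enorm (derive1 h s)) (enorm (derive1 h t)) (enorm (derive1 h g)).
by move=> *; ring.
Qed.

Lemma shift_invariant (T : zmodType) (F : R -> T) L a u : periodic F L -> a \in shifts L -> F (u + a) = F u.
Proof.
move=> pF; rewrite !inE => /or3P[] /eqP ->; last exact: pF.
- by rewrite -[in RHS](subrK L u) pF.
- by rewrite addr0.
Qed.

Lemma energy_density_shift p L h s t g a b : periodic h L -> a \in shifts L -> b \in shifts L ->
  energy_density p h s (t + a) (g + b) = energy_density p h s t g.
Proof.
move=> ph ha hb; have ph' := derive1_periodic ph.
rewrite /energy_density /menger_curvature.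
by rewrite !(shift_invariant _ ph ha) !(shift_invariant _ ph hb) !(shift_invariant _ ph' ha) !(shift_invariant _ ph' hb).
Qed.

Lemma energy_density_degenerate p h s t g : p != 0 -> h s = h t -> energy_density p h s t g = 0.
Proof.
by move=> p0 E; rewrite /energy_density /menger_curvature E subrr enorm0 !mul0r invr0 mulr0 powR0// !mul0r.
Qed.

Lemma energy_density_ge0 p h s t g : 0 <= energy_density p h s t g.
Proof. by rewrite !mulr_ge0 ?powR_ge0 ?enorm_ge0. Qed.

Lemma perturb_periodic L f Phi r : periodic f L -> periodic Phi L -> periodic (perturb f Phi r) L.
Proof. by move=> pf pP x; rewrite /perturb pf pP. Qed.

Definition pair_kernel p L f Phi z := (dominating_kernel p L f z + dominating_kernel p L Phi z)%E.

(** Periodicity allows the vertices to be written as [y] plus offsets. A real [B] below the kernel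
    is produced because the kernel is typed in the extended reals and second differences are
    real. *)
Lemma middle_vertex_domination p m M : 3 < p -> 0 < m -> m <= M -> exists2 K, 0 < K &
  forall L f Phi tau y u v, controlled L m M f Phi -> periodic f L -> periodic Phi L ->
  (forall s, derivable f s (1 : R)) -> (forall s, derivable Phi s (1 : R)) ->
  0 <= tau <= 1 -> tau * M <= m / 2 -> middle_vertex L y u v ->
  exists2 B : R, (B%:E <= K%:E * (base_kernel p L f (y, u, v) + base_kernel p L Phi (y, u, v)))%E &
    second_diff tau B (fun r => energy_density p (perturb f Phi r) y u v).
Proof.
move=> p3 m0 mM; have [K K0 hK] := density_second_diff p3 m0 mM.
have p1 : 1 <= p by rewrite (le_trans _ (ltW p3))// ler1n.
exists (K * 4 `^ p); first by rewrite mulr_gt0 ?powR_gt0.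
move=> L f Phi tau y u v ctl pf pP df dP t01 tM [a [b [ha hb opp]]].
have := hK L f Phi y _ _ tau ctl df dP opp t01 tM.
set x := u - y + a in opp *; set z := v - y + b in opp * => S.
exists (K * gap_bound f Phi y x z `^ p).
  have D0 : 0 < `|x| + `|z|.
    have [/ltr0_neq0 xz _] := opp; rewrite ltr_wpDr ?normr_ge0// normr_gt0.
    by apply: contraNneq xz => ->; rewrite mul0r.
  rewrite [(K * 4 `^ p)%:E]EFinM [(K * _)%:E]EFinM -muleA lee_pmul2l//.
  apply: (le_trans (gap_bound_powR f Phi y p1 D0)).
  rewrite lee_pmul2l// ?lte_fin ?powR_gt0//.
  by apply: leeD; exact: base_kernel_ge.
have -> : (fun r => energy_density p (perturb f Phi r) y u v) =
    (fun r => energy_density p (perturb f Phi r) y (y + x) (y + z)).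
  apply/funext => r.
  have [-> ->] : y + x = u + a /\ y + z = v + b by split; rewrite /x /z; ring.
  exact: (esym (energy_density_shift p y u v (perturb_periodic r pf pP) ha hb)).
exact: S.
Qed.

(** The density is symmetric in its three parameters, so any vertex may serve as base, and the
    dominating kernel contains the terms of all three bases. *)
Lemma density_domination p m M : 3 < p -> 0 < m -> m <= M -> exists2 K, 0 < K &
  forall L f Phi tau, 0 < L -> controlled L m M f Phi -> periodic f L -> periodic Phi L ->
  (forall s, derivable f s (1 : R)) -> (forall s, derivable Phi s (1 : R)) ->
  0 <= tau <= 1 -> tau * M <= m / 2 ->
  forall s t g, 0 <= s <= L -> 0 <= t <= L -> 0 <= g <= L ->
  exists2 B : R, (B%:E <= K%:E * pair_kernel p L f Phi (s, t, g))%E &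
    second_diff tau B (fun r => energy_density p (perturb f Phi r) s t g).
Proof.
move=> p3 m0 mM; have [K K0 hK] := middle_vertex_domination p3 m0 mM.
exists K => // L f Phi tau L0 ctl pf pP df dP t01 tM s t g hs ht hg.
have b0 h z : (0 <= base_kernel p L h z)%E by exact: base_kernel_ge0.
have [p0 K0'] : p != 0 /\ (0 <= K%:E)%E by rewrite lee_fin ltW// gt_eqF// (lt_trans _ p3).
have main y u v : middle_vertex L y u v -> exists2 B : R,
    (B%:E <= K%:E * (base_kernel p L f (y, u, v) + base_kernel p L Phi (y, u, v)))%E &
    second_diff tau B (fun r => energy_density p (perturb f Phi r) y u v).
  exact: (hK L f Phi tau y u v ctl pf pP df dP t01 tM).
(* If two of the points coincide, the convention [x / 0 = 0] makes the density vanish for every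
   [r]. *)
have degenerate : (forall r, energy_density p (perturb f Phi r) s t g = 0) -> exists2 B : R,
    (B%:E <= K%:E * pair_kernel p L f Phi (s, t, g))%E &
    second_diff tau B (fun r => energy_density p (perturb f Phi r) s t g).
  move=> E; exists 0; first by rewrite mule_ge0// !adde_ge0.
  by rewrite /second_diff !E !(subrr, addr0, mulr0, mul0r, normr0, lexx).
have pp r := perturb_periodic r pf pP.
have coincide u v r : 0 <= u <= L -> 0 <= v <= L -> (u == v) || (`|u - v| == L) ->
    perturb f Phi r u = perturb f Phi r v.
  move=> /andP[u0 uL] /andP[v0 vL] /orP[/eqP -> //|/eqP h].
  have [vu|uv] := leP v u.
    move: h; rewrite ger0_norm ?subr_ge0// => h.
    by have -> : u = v + L by [lra]; rewrite pp.
  move: h; rewrite distrC gtr0_norm ?subr_gt0// => h.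
  by have -> : v = u + L by [lra]; rewrite pp.
have [dst|] := boolP ((s == t) || (`|s - t| == L)).
  by apply: degenerate => r; apply: energy_density_degenerate => //; exact: coincide.
rewrite negb_or => /andP[st stL].
have [dtg|] := boolP ((t == g) || (`|t - g| == L)).
  apply: degenerate => r; rewrite energy_density_swap energy_densityC.
  by apply: energy_density_degenerate => //; exact: coincide.
rewrite negb_or => /andP[tg tgL].
have [dsg|] := boolP ((s == g) || (`|s - g| == L)).
  apply: degenerate => r; rewrite energy_densityC.
  by apply: energy_density_degenerate => //; exact: coincide.
rewrite negb_or => /andP[sg sgL].
have le1 (x y z x' y' z' : \bar R) : (0 <= x -> 0 <= y -> 0 <= z -> 0 <= x' -> 0 <= y' -> 0 <= z' ->
    [/\ x + x' <= (x + y + z) + (x' + y' + z'), y + y' <= (x + y + z) + (x' + y' + z') &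
     z + z' <= (x + y + z) + (x' + y' + z')])%E.
  move=> x0 y0 z0 x'0 y'0 z'0; split; apply: leeD.
  - by rewrite -addeA leeDl ?adde_ge0.
  - by rewrite -addeA leeDl ?adde_ge0.
  - by rewrite (addeC x) -addeA leeDl ?adde_ge0.
  - by rewrite (addeC x') -addeA leeDl ?adde_ge0.
  - by rewrite leeDr ?adde_ge0.
  - by rewrite leeDr ?adde_ge0.
have [l1 l2 l3] := le1 _ _ _ _ _ _ (b0 f (s, t, g)) (b0 f (t, s, g)) (b0 f (g, s, t))
  (b0 Phi (s, t, g)) (b0 Phi (t, s, g)) (b0 Phi (g, s, t)).
case: (middle_vertex_cases L0 hs ht hg st tg sg stL tgL sgL) => /main[B hB S]; exists B.
- by apply: (le_trans hB); rewrite lee_pmul2l.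
- exact: S.
- by apply: (le_trans hB); rewrite lee_pmul2l.
- have -> : (fun r => energy_density p (perturb f Phi r) s t g) = (fun r => energy_density p (perturb f Phi r) t s g).
    by apply/funext => r; exact: energy_density_swap.
  exact: S.
- by apply: (le_trans hB); rewrite lee_pmul2l.
- have -> : (fun r => energy_density p (perturb f Phi r) s t g) = (fun r => energy_density p (perturb f Phi r) g s t).
    by apply/funext => r; exact: (etrans (energy_densityC _ _ _ _ _) (energy_density_swap _ _ _ _ _)).
  exact: S.
Qed.

End Domination.

(** * Second difference of the energy *)

Section EnergySecondDifference.
Context {R : realType}.
Implicit Types (f h Phi : curve R) (p L m M tau : R).

Definition C1_slobodeckij p L f := [/\ periodic f L, forall x, derivable f x (1 : R),
  continuous (derive1 f) & (slobodeckij p L (L / 2) (derive1 f) < +oo)%E].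

Lemma perturb0 f Phi : perturb f Phi 0 = f.
Proof. by apply/funext => x; rewrite /perturb scale0r addr0. Qed.

Lemma continuous_derive1_perturb f Phi r : (forall x, derivable f x (1 : R)) ->
  (forall x, derivable Phi x (1 : R)) -> continuous (derive1 f) -> continuous (derive1 Phi) ->
  continuous (derive1 (perturb f Phi r)).
Proof.
move=> df dP cf cP.
have -> : derive1 (perturb f Phi r) = (fun x => derive1 f x + r *: derive1 Phi x).
  by apply/funext => x; exact: derive1_perturb.
move=> x; apply: continuousD; first exact: cf.
by apply: continuousZl_tmp; exact: cP.
Qed.

Definition density_fun p f (z : R * R * R) : \bar R := (energy_density p f z.1.1 z.1.2 z.2)%:E.

Lemma menger_integralE p L f : menger_integral p L f = integral3 L (density_fun p f).
Proof. by []. Qed.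

Lemma density_fun_ge0 p f z : (0 <= density_fun p f z)%E.
Proof. by rewrite lee_fin energy_density_ge0. Qed.

Lemma measurable_density_fun p f : continuous f -> continuous (derive1 f) ->
  measurable_fun setT (density_fun p f).
Proof.
move=> cf cf'.
have m1 : measurable_fun setT (fun z : R * R * R => z.1.1).
  by apply: (measurableT_comp _ measurable_fst); exact: measurable_fst.
have m2 : measurable_fun setT (fun z : R * R * R => z.1.2).
  by apply: (measurableT_comp _ measurable_fst); exact: measurable_snd.
have m3 : measurable_fun setT (fun z : R * R * R => z.2) by exact: measurable_snd.
have md (a : R * R * R -> R) : measurable_fun setT a -> measurable_fun setT (fun z => enorm (derive1 f (a z))).
  by move=> ma; apply: measurable_enorm; exact: (mvec_comp (continuous_mvec cf') ma).
apply/measurable_EFinP; rewrite /energy_density.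
apply: measurable_funM; last exact: md.
apply: measurable_funM; last exact: md.
apply: measurable_funM; last exact: md.
by apply: measurable_fun_powR; exact: measurable_menger.
Qed.

Lemma enorm_periodic_min (g : curve R) L : 0 < L -> continuous g -> periodic g L ->
  (forall x, g x != 0) -> exists2 m, 0 < m & forall x, m <= enorm (g x).
Proof.
move=> L0 cg pg g0.
have cn : {within `[0, L], continuous (fun x => enorm (g x))}.
  apply: continuous_subspaceT => x.
  by apply: (@continuous_comp _ _ _ g (@enorm R)); [exact: cg|exact: continuous_enorm].
have [c _ hc] := EVT_min (ltW L0) cn.
exists (enorm (g c)); first by rewrite enorm_gt0.
move=> x; have [n /andP[n0 nL]] := floor_reduce x L0.
by rewrite -(periodic_intP n x pg) hc// in_itv/= n0 ltW.
Qed.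

Lemma controlled_exists L f Phi : 0 < L -> regular_embedding L f -> periodic Phi L ->
  (forall x, derivable Phi x (1 : R)) -> continuous (derive1 Phi) ->
  exists m M, [/\ 0 < m, m <= M & controlled L m M f Phi].
Proof.
move=> L0 ref pP dP cP'; have [m1 m10 bil] := regular_embedding_bilipschitz L0 ref.
have [[cf pf _] df cf' f'0] := ref.
have pf' := derive1_periodic pf; have pP' := derive1_periodic pP.
have [m2 m20 hm2] := enorm_periodic_min L0 cf' pf' f'0.
have [M1 M10 hM1] := periodic_bounded L0 cf' pf'.
have [M2 M20 hM2] := periodic_bounded L0 cP' pP'.
pose m := Num.min m1 m2; pose M := M1 + M2.
have [mm1 mm2] : m <= m1 /\ m <= m2 by rewrite /m !ge_min !lexx orbT.
have m0 : 0 < m by rewrite lt_min m10 m20.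
have M1M : M1 <= M by rewrite lerDl ltW.
have M2M : M2 <= M by rewrite lerDr ltW.
clearbody m M; exists m, M.
have b1 x : enorm (derive1 f x) <= M by exact: le_trans (hM1 x) M1M.
have b2 x : enorm (derive1 Phi x) <= M by exact: le_trans (hM2 x) M2M.
split; first exact: m0.
  exact: (le_trans mm2 (le_trans (hm2 0) (b1 0))).
split.
- by move=> u v uv; apply: (le_trans _ (bil u v uv)); rewrite ler_wpM2r.
- exact: C1_lipschitz.
- exact: C1_lipschitz.
- by move=> u; rewrite (b1 u) andbT; exact: (le_trans mm2 (hm2 u)).
- exact: b2.
Qed.

(** The pointwise estimate is integrated. Its part of order zero also shows that [f] has finite
    energy, which is how smooth curves are seen to have it. *)
Lemma menger_integral_second_diff p L f Phi : 3 < p -> 0 < L -> regular_embedding L f ->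
  C1_slobodeckij p L f -> C1_slobodeckij p L Phi ->
  exists2 C, 0 < C & exists2 t0, 0 < t0 & forall tau, 0 <= tau <= t0 ->
    (menger_integral p L f <= C%:E)%E /\
    (menger_integral p L (perturb f Phi tau) + menger_integral p L (perturb f Phi (- tau)) <=
     2%:E * menger_integral p L f + (C * tau ^+ 2)%:E)%E.
Proof.
move=> p3 L0 ref [pf df cf' ff] [pP dP cP' fP].
have p1 : 1 < p by rewrite (lt_trans _ p3)// ltr1n.
have [m [M [m0 mM ctl]]] := controlled_exists L0 ref pP dP cP'.
have M0 : 0 < M := lt_le_trans m0 mM.
have [K K0 hK] := density_domination p3 m0 mM.
have fin3 : finite3 L (pair_kernel p L f Phi).
  exact: (finite3D (dominating_kernel_finite p1 L0 pf df cf' ff) (dominating_kernel_finite p1 L0 pP dP cP' fP)).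
have [mG G0 fG] := fin3.
have [I hI] : exists I, integral3 L (pair_kernel p L f Phi) = I%:E.
  exists (fine (integral3 L (pair_kernel p L f Phi))).
  by rewrite fineK// ge0_fin_numE//; exact: integral3_ge0.
have I0 : 0 <= I by rewrite -lee_fin -hI; exact: integral3_ge0.
exists (K * I + 1); first by rewrite ltr_wpDl// mulr_ge0// ltW.
(* [tau <= 1] serves the calculus of second differences; [tau * M <= m / 2] keeps chord quotients
   and speeds above [m / 2]. *)
exists (Num.min 1 (m / 2 / M)); first by rewrite lt_min ltr01 !divr_gt0.
move=> tau /andP[t0]; rewrite le_min => /andP[t1 tM].
have t01 : 0 <= tau <= 1 by rewrite t0.
have {}tM : tau * M <= m / 2 by rewrite -ler_pdivlMr.
have H := hK L f Phi tau L0 ctl pf pP df dP t01 tM.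
have cper (r : R) : continuous (perturb f Phi r).
  by apply: derivable_continuous => x; exact: derivable_perturb.
have c1per (r : R) : continuous (derive1 (perturb f Phi r)) := continuous_derive1_perturb df dP cf' cP'.
have mD (r : R) : measurable_fun setT (density_fun p (perturb f Phi r)) := measurable_density_fun p (cper r) (c1per r).
have D0 (r : R) z : (0 <= density_fun p (perturb f Phi r) z)%E := density_fun_ge0 p _ z.
have [cf cf2] : continuous f /\ continuous (derive1 f) by split => //; exact: derivable_continuous.
have KG : (integral3 L (fun z => K%:E * pair_kernel p L f Phi z) = (K * I)%:E)%E.
  by rewrite (integral3Z L K0 G0) hI EFinM.
split.
  rewrite menger_integralE; apply: (@le_trans _ _ (K * I)%:E); last by rewrite lee_fin lerDl.
  rewrite -KG; apply: integral3_le; first exact: density_fun_ge0.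
  move=> s t g hs ht hg; have [B hB [S _ _ _]] := H s t g hs ht hg.
  apply: (le_trans _ hB); rewrite lee_fin; move: S; rewrite perturb0; apply: le_trans.
  exact: ler_norm.
rewrite !menger_integralE.
have sq0 : (0 <= (tau ^+ 2)%:E)%E by rewrite lee_fin sqr_ge0.
have two0 : (0 < 2 :> R) by [].
have [->|tn0] := eqVneq tau 0.
  rewrite oppr0 !perturb0 expr0n mulr0 adde0 (_ : 2%:E = 1%:E + 1%:E)%E; last by rewrite -EFinD.
  by rewrite ge0_muleDl ?lee_fin// !mul1e.
have tp : 0 < tau ^+ 2 by rewrite exprn_even_gt0.
have Kt0 : 0 < tau ^+ 2 * K by rewrite mulr_gt0.
have mG0 : measurable_fun setT (fun z => 2%:E * density_fun p f z)%E.
  by apply: measurable_funeM; exact: measurable_density_fun.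
have mKt : measurable_fun setT (fun z => (tau ^+ 2 * K)%:E * pair_kernel p L f Phi z)%E.
  exact: measurable_funeM.
rewrite -(integral3D L (mD tau) (mD (- tau)) (D0 tau) (D0 (- tau))).
rewrite -(integral3Z L two0 (density_fun_ge0 p f)).
apply: (@le_trans _ _ (integral3 L (fun z => 2%:E * density_fun p f z + (tau ^+ 2 * K)%:E * pair_kernel p L f Phi z)%E)).
  apply: integral3_le => [z|s t g hs ht hg]; first exact: adde_ge0 (D0 _ _) (D0 _ _).
  have [B hB [_ _ _ S]] := H s t g hs ht hg.
  move: S; rewrite perturb0 => S.
  apply: (@le_trans _ _ (2%:E * density_fun p f (s, t, g) + (tau ^+ 2)%:E * B%:E)%E); last first.
    by apply: leeD => //; rewrite [(tau ^+ 2 * K)%:E]EFinM -muleA lee_pmul2l.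
  rewrite /density_fun/= -EFinM -EFinD -!EFinM -EFinD lee_fin.
  move: S => /(le_trans (ler_norm _)); rewrite lerBlDl [_ * B]mulrC; exact.
rewrite integral3D//.
- by rewrite (integral3Z L Kt0 G0) hI leeD// -EFinM lee_fin -mulrA mulrC ler_wpM2r ?sqr_ge0// lerDl.
- by move=> z; apply: mule_ge0; [rewrite lee_fin|exact: density_fun_ge0].
- by move=> z; apply: mule_ge0; [rewrite lee_fin ltW|exact: G0].
Qed.

End EnergySecondDifference.

(** * Regular embeddings under small perturbations *)

Section RegularEmbeddings.
Context {R : realType}.
Notation mu := (@lebesgue_measure R).
Implicit Types (f h Phi : curve R) (p L m M tau : R).

Lemma primitive_ex (g : R -> R) (a : R) : continuous g ->
  exists G : R -> R, forall x, a < x -> is_derive x (1 : R) G (g x).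
Proof.
move=> cg; exists (fun x => \int[mu]_(t in `[a, x]) g t) => x ax.
have xu : x < x + 1 by rewrite ltrDl.
have ig : mu.-integrable `[a, x + 1] (EFin \o g).
  apply: continuous_compact_integrable; first exact: segment_compact.
  exact: continuous_subspaceT.
have [d e] := continuous_FTC1_closed xu ig ax (cg x).
by apply: (DeriveDef d); rewrite -derive1E; exact: e.
Qed.

(** With [z] the chord, the function [|z| G - f . z] is nondecreasing, and its increment is
    [|z| (G v - G u) - |z| ^ 2]. *)
Lemma enorm_le_primitive f (G k : R -> R) (a u v : R) : (forall x, derivable f x (1 : R)) ->
  (forall x, a < x -> is_derive x (1 : R) G (k x)) -> (forall x, enorm (derive1 f x) <= k x) ->
  a < u -> u <= v -> enorm (f v - f u) <= G v - G u.
Proof.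
move=> df dG fk au uv; set z := f v - f u.
pose F w := enorm z * G w - dot (f (0 + 1 * w)) z.
have dF w : a < w -> is_derive w (1 : R) F (enorm z * k w - 1 * dot (derive1 f (0 + 1 * w)) z).
  move=> aw; have d1 := dG w aw; have d2 := @is_derive_dot_affine _ f z 0 1 w df.
  by rewrite /F; apply: is_derive_eq.
have cF : {within `[u, v], continuous F}.
  apply: derivable_within_continuous => w; rewrite in_itv/= => /andP[uw _].
  by have [] := dF w (lt_le_trans au uw).
have [z0|z0] := eqVneq z 0.
  move: uv; rewrite le_eqVlt => /orP[/eqP <-|uv]; first by rewrite z0 enorm0 subrr.
  have cG : {within `[u, v], continuous G}.
    apply: derivable_within_continuous => w; rewrite in_itv/= => /andP[uw _].
    by have [] := dG w (lt_le_trans au uw).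
  have dG' w : w \in `]u, v[ -> is_derive w (1 : R) G (k w).
    by rewrite in_itv/= => /andP[uw _]; exact: dG (lt_trans au uw).
  have [c _ ->] := MVT uv dG' cG.
  by rewrite z0 enorm0 mulr_ge0 ?subr_ge0 ?(ltW uv)// (le_trans (enorm_ge0 _) (fk c)).
have ez : 0 < enorm z by rewrite enorm_gt0.
move: uv; rewrite le_eqVlt => /orP[/eqP uv|uv].
  by move: z0; rewrite /z uv subrr eqxx.
have dF' w : w \in `]u, v[ -> is_derive w (1 : R) F (enorm z * k w - 1 * dot (derive1 f (0 + 1 * w)) z).
  by rewrite in_itv/= => /andP[uw _]; exact: dF (lt_trans au uw).
have [c _ E] := MVT uv dF' cF.
have : 0 <= F v - F u.
  rewrite E; apply: mulr_ge0; last by rewrite subr_ge0 ltW.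
  rewrite !mul1r add0r subr_ge0.
  rewrite (le_trans (dot_le _ _))// [leLHS]mulrC; exact: (ler_wpM2l (enorm_ge0 z) (fk c)).
have -> : F v - F u = enorm z * (G v - G u) - enorm z ^+ 2.
  by rewrite sqr_enorm /F !mul1r !add0r {3}/z dotBl; ring.
by rewrite subr_ge0 expr2 ler_pM2l.
Qed.

Lemma curve_length_primitive f (G k : R -> R) (a u v : R) : (forall x, derivable f x (1 : R)) ->
  (forall x, a < x -> is_derive x (1 : R) G (k x)) -> (forall x, enorm (derive1 f x) <= k x) ->
  a < u -> (curve_length u v f <= (G v - G u)%:E)%E.
Proof.
move=> df dG fk au; apply: curve_length_le => s t us st tv.
exact: (enorm_le_primitive df dG fk (lt_le_trans au us) st).
Qed.

Lemma lipschitz_abs_continuous f M a b : 0 < M ->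
  (forall u v, enorm (f u - f v) <= M * `|u - v|) -> abs_continuous a b f.
Proof.
move=> M0 lf e e0; exists (e / M); first by rewrite divr_gt0.
move=> n u v uv _; rewrite ltr_pdivlMr// => h; apply: le_lt_trans h.
rewrite mulr_suml; apply: ler_sum => i _; rewrite mulrC (le_trans (lf _ _))//.
by rewrite ger0_norm// subr_ge0; have [_ []] := uv i.
Qed.

Lemma regular_embedding_energy p L f : 0 < L -> regular_embedding L f ->
  menger_energy p L f = menger_integral p L f.
Proof.
move=> L0 [scc df cf' f'0]; have [cf pf _] := scc; have pf' := derive1_periodic pf.
have [M M0 hM] := periodic_bounded L0 cf' pf'.
have [m m0 hm] := enorm_periodic_min L0 cf' pf' f'0.
have H : [/\ simple_closed_curve L f, abs_continuous 0 L f & regular L f].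
  split; [exact: scc|exact: (lipschitz_abs_continuous _ _ M0 (C1_lipschitz df hM))|].
  by exists m; [exact: m0|apply: aeW => x _; exact: hm].
by rewrite /menger_energy (asboolT H).
Qed.

(** Chords of [f] are at least [m * |u - v|] and those of [tau *: Phi] at most half of that, which
    gives injectivity for parameters at distance up to [2 * L / 3]; speeds are compared in the same
    way. *)
Lemma perturb_regular_embedding L f Phi : 0 < L -> regular_embedding L f -> periodic Phi L ->
  (forall x, derivable Phi x (1 : R)) -> continuous (derive1 Phi) ->
  exists2 t0, 0 < t0 & forall tau, `|tau| <= t0 -> regular_embedding L (perturb f Phi tau).
Proof.
move=> L0 ref pP dP cP'; have [m [M [m0 mM [bil _ lP df1 dP1]]]] := controlled_exists L0 ref pP dP cP'.
have [[cf pf inj] df cf' f'0] := ref.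
have M0 : 0 < M := lt_le_trans m0 mM.
exists (m / 2 / M); first by rewrite !divr_gt0.
move=> tau; rewrite (ler_pdivlMr _ _ M0) => tM.
have dp x : derivable (perturb f Phi tau) x (1 : R) by exact: derivable_perturb.
have pp : periodic (perturb f Phi tau) L by exact: perturb_periodic.
split.
- split; [exact: derivable_continuous|exact: pp|].
  have key u v : `|u - v| <= 2 * L / 3 -> perturb f Phi tau u = perturb f Phi tau v -> u = v.
    move=> uv E; apply/eqP; rewrite -subr_eq0 -normr_eq0; apply/eqP/le_anti; rewrite normr_ge0 andbT.
    have h1 := bil u v uv.
    have Ef : f u - f v = - (tau *: (Phi u - Phi v)).
      by move: E; rewrite /perturb => /eqP; rewrite -subr_eq0 opprD addrACA -scalerBr addr_eq0 => /eqP.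
    have h2 : enorm (f u - f v) <= m / 2 * `|u - v|.
      rewrite Ef enormN enormZ (le_trans (ler_wpM2l (normr_ge0 _) (lP u v)))// mulrA.
      by rewrite ler_wpM2r.
    have : m * `|u - v| <= m / 2 * `|u - v| := le_trans h1 h2.
    rewrite -subr_le0 -mulrBl pmulr_rle0//; lra.
  move=> u v; rewrite !in_itv/= => /andP[u0 uL] /andP[v0 vL] E.
  (* More distant parameters become close after a shift by one period; they would then differ by
     exactly [L], which is impossible in [[0, L[]. *)
  have [h|h] := leP `|u - v| (2 * L / 3); first exact: key.
  have [uv|vu] := leP u v.
    suff : u + L = v by lra.
    apply: key; last by rewrite pp.
    move: h; rewrite distrC ger0_norm ?subr_ge0// => h.
    by rewrite ger0_norm; lra.
  suff : u = v + L by lra.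
  apply: key; last by rewrite pp.
  move: h; rewrite gtr0_norm ?subr_gt0// => h.
  by rewrite ler0_norm; lra.
- exact: dp.
- exact: continuous_derive1_perturb.
- move=> x; rewrite (derive1_perturb _ (df x) (dP x)) -enorm_gt0.
  have /andP[h1 _] := df1 x; have h2 := lerB_enorm (derive1 f x) (- (tau *: derive1 Phi x)).
  move: h2; rewrite enormN opprK enormZ => h2.
  have h3 : `|tau| * enorm (derive1 Phi x) <= m / 2.
    by rewrite (le_trans _ tM)// ler_wpM2l.
  rewrite (lt_le_trans _ h2)// subr_gt0 (le_lt_trans h3)// (lt_le_trans _ h1)//.
  by rewrite gtr_pMr// invf_lt1// ltr1n.
Qed.

Lemma lipschitz_slobodeckij p L (g : curve R) M : 1 < p -> 0 < L -> 0 <= M ->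
  (forall u v, enorm (g u - g v) <= M * `|u - v|) -> (slobodeckij p L (L / 2) g < +oo)%E.
Proof.
move=> p1 L0 M0 lg; have p0 : 0 < p := lt_trans ltr01 p1.
apply: (@le_lt_trans _ _ (\int[mu]_(s in `[0%R, L]) \int[mu]_(w in `[0%R, (L / 2)%R]) (M `^ p * (L / 2))%:E)%E).
  apply: ge0_le_integral_any => s _; first by apply: integral_ge0 => w _; rewrite lee_fin mulr_ge0 ?powR_ge0.
  apply: ge0_le_integral_any => w /=; rewrite in_itv/= => /andP[w0 wL].
    by rewrite lee_fin mulr_ge0 ?powR_ge0.
  rewrite lee_fin; have [->|wn0] := eqVneq w 0.
    by rewrite addr0 subrr enorm0 powR0 ?gt_eqF// mul0r mulr_ge0 ?powR_ge0// divr_ge0// ltW.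
  have wp : 0 < w by rewrite lt_def wn0.
  have h : enorm (g (s + w) - g s) `^ p <= M `^ p * w `^ p.
    rewrite -powRM//; apply: ge0_ler_powR; rewrite ?nnegrE ?enorm_ge0 ?mulr_ge0 ?(ltW p0)//.
    by have := lg (s + w) s; rewrite addrAC subrr add0r ger0_norm.
  rewrite (le_trans (ler_wpM2r (powR_ge0 _ _) h))// -mulrA ler_wpM2l ?powR_ge0//.
  rewrite -powRD; last by rewrite (gt_eqF wp) implybT.
  by rewrite addrC subrK powRr1.
have fin (b c : R) : 0 <= b -> (\int[mu]_(w in `[0%R, b]) c%:E = (c * b)%:E)%E.
  move=> b0; rewrite integral_cst//= lebesgue_measure_itv/= lte_fin.
  by case: ltgtP b0 => // [b0 _|<- _]; rewrite ?subr0 ?mule0 ?mulr0// -EFinB subr0 -EFinM.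
under eq_integral => s _ do rewrite fin ?divr_ge0 ?(ltW L0)//.
by rewrite fin ?(ltW L0)// ltry.
Qed.

Lemma smooth_embedding_regular p L f : 1 < p -> 0 < L -> smooth_embedding L f ->
  regular_embedding L f /\ C1_slobodeckij p L f.
Proof.
move=> p1 L0 [scc df f'0]; have [cf pf _] := scc.
have d0 x : derivable f x (1 : R) := df 0%N x.
have d1 x : derivable (derive1 f) x (1 : R) := df 1%N x.
have d2 x : derivable (derive1 (derive1 f)) x (1 : R) := df 2%N x.
have cf' := derivable_continuous d1; have cf2 := derivable_continuous d2.
have pf' := derive1_periodic pf; have pf2 := derive1_periodic pf'.
have [M M0 hM] := periodic_bounded L0 cf2 pf2.
split; first exact: And4 scc d0 cf' f'0.
exact: And4 pf d0 cf' (lipschitz_slobodeckij p1 L0 (ltW M0) (C1_lipschitz d1 hM)).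
Qed.

End RegularEmbeddings.

(** * Smooth periodic test functions that approximate the identity *)

Section TestFunctions.
Context {R : realType}.
Notation mu := (@lebesgue_measure R).
Implicit Types (g k G : R -> R) (L a b : R).

Lemma derive_eq_itv (G1 G2 k : R -> R) (m : R) : 0 < m ->
  (forall x, - m < x -> is_derive x (1 : R) G1 (k x)) ->
  (forall x, - m < x -> is_derive x (1 : R) G2 (k x)) ->
  forall x, - m < x -> G1 x - G1 0 = G2 x - G2 0.
Proof.
move=> m0 d1 d2 x mx; pose G z := G1 z - G2 z.
have dG z : - m < z -> is_derive z (1 : R) G 0.
  by move=> mz; have := d1 z mz; have := d2 z mz => h2 h1; rewrite /G; apply: is_derive_eq; rewrite subrr.
have E u v : - m < u -> u <= v -> G v = G u.
  move=> mu uv.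
  have dG' z : z \in `]u, v[ -> is_derive z (1 : R) G 0.
    by rewrite in_itv/= => /andP[uz _]; exact: dG (lt_trans mu uz).
  have cG : {within `[u, v], continuous G}.
    apply: derivable_within_continuous => z; rewrite in_itv/= => /andP[uz _].
    by have [] := dG z (lt_le_trans mu uz).
  have [c _ h] := MVT_segment uv dG' cG.
  by apply/eqP; rewrite -subr_eq0 h mul0r.
have mN : - m < 0 by rewrite oppr_lt0.
have : G x = G 0 by have [h|/ltW h] := leP x 0; [rewrite (E x 0)|rewrite (E 0 x)].
rewrite /G => h; lra.
Qed.

(** Primitives on half-lines starting at [- n.+1], normalized to vanish at 0, agree on their common
    domain; at each point one that is defined around it is used. *)
Lemma global_primitive k : continuous k -> exists G : R -> R, forall x, is_derive x (1 : R) G (k x).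
Proof.
move=> ck.
have /choice[H hH] (n : nat) : exists G : R -> R, forall x : R, - n.+1%:R < x -> is_derive x (1 : R) G (k x).
  exact: primitive_ex.
pose N (x : R) := Num.truncn `|x|.
have hN x : `|x| < (N x).+1%:R by exact: truncnS_gt.
have hN2 (x : R) n : `|x| < n%:R -> - n%:R < x by rewrite ltr_norml => /andP[].
exists (fun x => H (N x) x - H (N x) 0) => x.
pose n := (N x).+1.
have nb : \forall y \near x, H n y - H n 0 = H (N y) y - H (N y) 0.
  apply/nbhs_ballP; exists 1 => //= y; rewrite -ball_normE/= => xy.
  have yn : `|y| < n.+1%:R.
    rewrite -natr1 (le_lt_trans _ (ltrD (hN x) xy))// distrC.
    by rewrite -[leLHS](_ : `|x + (y - x)| = _) ?ler_normD// addrC subrK.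
  have m0 : 0 < (minn n (N y)).+1%:R :> R by rewrite ltr0n.
  apply: (derive_eq_itv m0).
  - move=> z hz; apply: hH; apply: le_lt_trans hz.
    by rewrite lerN2 ler_nat ltnS geq_minl.
  - move=> z hz; apply: hH; apply: le_lt_trans hz.
    by rewrite lerN2 ler_nat ltnS geq_minr.
  - apply: hN2; rewrite /minn; case: ifP => _; [exact: yn|exact: hN].
have d : is_derive x (1 : R) (fun y => H n y - H n 0) (k x).
  have dH : is_derive x (1 : R) (H n) (k x).
    by apply: hH; apply: hN2; rewrite (lt_trans (hN x))// ltr_nat.
  by apply: is_derive_eq; rewrite subr0.
split.
  by apply: near_eq_derivable nb _; have [] := d.
by rewrite -(near_eq_derive (1 : R) nb); have [] := d.
Qed.

(** Trigonometric polynomials with shifted arguments, as syntax: differentiation is an operation on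
    terms, so smoothness of all orders follows by iteration. *)
Inductive trig := TrigC of R | TrigSin of R | TrigCos of R | TrigAdd of trig & trig | TrigMul of trig & trig.

Variable om : R.

Fixpoint trig_eval (t : trig) (x : R) : R := match t with
  | TrigC c => c
  | TrigSin a => sin (om * (x - a))
  | TrigCos a => cos (om * (x - a))
  | TrigAdd t1 t2 => trig_eval t1 x + trig_eval t2 x
  | TrigMul t1 t2 => trig_eval t1 x * trig_eval t2 x
  end.

Fixpoint trig_derive (t : trig) : trig := match t with
  | TrigC c => TrigC 0
  | TrigSin a => TrigMul (TrigC om) (TrigCos a)
  | TrigCos a => TrigMul (TrigC (- om)) (TrigSin a)
  | TrigAdd t1 t2 => TrigAdd (trig_derive t1) (trig_derive t2)
  | TrigMul t1 t2 => TrigAdd (TrigMul (trig_derive t1) t2) (TrigMul t1 (trig_derive t2))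
  end.

Lemma is_derive_trig t (x : R) : is_derive x (1 : R) (trig_eval t) (trig_eval (trig_derive t) x).
Proof.
have lin (a : R) : is_derive x (1 : R) (fun x => om * (x - a)) om.
  by apply: is_derive_eq; rewrite /GRing.scale/= subr0 mulr1.
elim: t => [c|a|a|t1 h1 t2 h2|t1 h1 t2 h2] /=.
- exact: is_derive_cst.
- have d := @is_derive1_comp _ sin (fun x => om * (x - a)) x _ _ (is_derive_sin (om * (x - a))) (lin a).
  by apply: (is_derive_eq d); rewrite mulrC.
- have d := @is_derive1_comp _ cos (fun x => om * (x - a)) x _ _ (is_derive_cos (om * (x - a))) (lin a).
  by apply: (is_derive_eq d); rewrite mulrC mulNr mulrN.
- exact: (is_deriveD h1 h2).
- by apply: is_derive_eq; rewrite /GRing.scale/=; ring.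
Qed.

Lemma derive1n_trig n t : derive1n n (trig_eval t) = trig_eval (iter n trig_derive t).
Proof.
elim: n => [|n IH]; first by rewrite derive1n0.
by rewrite derive1nS IH iterS; apply/funext => x; rewrite derive1E; have [_ ->] := is_derive_trig (iter n trig_derive t) x.
Qed.

Lemma smooth_primitive_trig (G : R -> R) t : (forall x, is_derive x (1 : R) G (trig_eval t x)) ->
  forall n x, derivable (derive1n n G) x (1 : R).
Proof.
move=> dG [|n] x; first by rewrite derive1n0; have [] := dG x.
have E : derive1 G = trig_eval t by apply/funext => y; rewrite derive1E; have [_ ->] := dG y.
by rewrite derive1Sn E derive1n_trig; have [] := is_derive_trig (iter n trig_derive t) x.
Qed.

End TestFunctions.

Section PeriodicKernel.
Context {R : realType}.
Notation mu := (@lebesgue_measure R).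
Variables (L : R) (L0 : 0 < L).
Implicit Types (F G : R -> R) (a b e x : R) (n : nat).

Let om : R := pi / L.

(* [k ^+ n], normalized over a period, concentrates at the multiples of [L]. *)
Definition peak x : R := 1 - sin (om * x) ^+ 2.

Lemma peak0 : peak 0 = 1.
Proof. by rewrite /peak mulr0 sin0 expr0n/= subr0. Qed.

Lemma peak_periodic x : peak (x + L) = peak x.
Proof.
rewrite /peak mulrDr (_ : om * L = pi); last by rewrite /om divfK ?gt_eqF.
by rewrite sinDpi sqrrN.
Qed.

Lemma peak_ge0 x : 0 <= peak x.
Proof. by rewrite subr_ge0 -(cos2Dsin2 (om * x)) lerDr sqr_ge0. Qed.

Lemma peak_lt1 x : 0 < x < L -> peak x < 1.
Proof.
move=> /andP[x0 xL]; have : 0 < sin (om * x).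
  apply: sin_gt0_pi; rewrite mulr_gt0 ?divr_gt0 ?pi_gt0//=.
  by rewrite /om mulrAC ltr_pdivrMr// ltr_pM2l ?pi_gt0.
by move=> s0; rewrite ltrBlDr ltrDl exprn_gt0.
Qed.

Definition peak_trig a n : trig :=
  iter n (TrigMul (TrigAdd (TrigC 1) (TrigMul (TrigC (-1)) (TrigMul (TrigSin a) (TrigSin a))))) (TrigC 1).

Lemma peak_trigE a n x : trig_eval om (peak_trig a n) x = peak (x - a) ^+ n.
Proof.
elim: n => [//|n IH]; rewrite exprS -IH /= /peak expr2; ring.
Qed.

Lemma is_derive_trig_continuous t : continuous (trig_eval om t).
Proof. by apply: derivable_continuous => x; have [] := is_derive_trig om t x. Qed.

Lemma continuous_peak : continuous peak.
Proof.
have -> : peak = trig_eval om (peak_trig 0 1).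
  by apply/funext => x; rewrite peak_trigE expr1 subr0.
exact: is_derive_trig_continuous.
Qed.

Lemma peak_near0 s : s < 1 -> exists2 e, 0 < e & forall x, 0 <= x <= e -> s <= peak x.
Proof.
move=> s1; have c0 : peak x @[x --> (0 : R)] --> peak 0 by exact: continuous_peak.
move: c0 => /cvgrPdist_lt/(_ (1 - s)); rewrite subr_gt0 => /(_ s1).
move=> /nbhs_ballP[e /= e0 he]; exists (e / 2) => [|x /andP[x0 xe]]; first by rewrite divr_gt0.
have := he x; rewrite -ball_normE/= sub0r normrN (ger0_norm x0) peak0 => h.
have {}h : `|1 - peak x| < 1 - s by apply: h; lra.
by move: h => /ltr_normlW; lra.
Qed.

Lemma peak_primitive_ex : exists H : nat -> R -> R, forall n x, is_derive x (1 : R) (H n) (peak x ^+ n).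
Proof.
suff /choice[H hH] : forall n, exists G : R -> R, forall x : R, is_derive x (1 : R) G (peak x ^+ n) by exists H.
move=> n; have [G hG] := global_primitive (@is_derive_trig_continuous (peak_trig 0 n)).
by exists G => x; have := hG x; rewrite peak_trigE subr0.
Qed.

Variable H : nat -> R -> R.
Hypothesis dH : forall n x, is_derive x (1 : R) (H n) (peak x ^+ n).

Definition peak_mass n := H n L - H n 0.

Lemma is_derive_shift n (c x : R) : is_derive x (1 : R) (fun x => H n (x + c)) (peak (x + c) ^+ n).
Proof.
have lin : is_derive x (1 : R) (fun x : R => x + c) 1.
  by apply: is_derive_eq; rewrite addr0.
have d := @is_derive1_comp _ (H n) (fun x => x + c) x _ _ (dH n (x + c)) lin.
by apply: (is_derive_eq d); rewrite mulr1.
Qed.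

Lemma primitive_period n x : H n (x + L) = H n x + peak_mass n.
Proof.
pose G x := H n (x + L) - H n x.
have dG y : is_derive y (1 : R) G 0.
  have h1 := is_derive_shift n L y; have h2 := dH n y.
  by rewrite /G; apply: is_derive_eq; rewrite peak_periodic subrr.
have := is_derive_0_is_cst x 0 dG; rewrite /G add0r /peak_mass => <-; ring.
Qed.

Lemma primitive_bounds n u v (lo hi : R) : u <= v -> (forall x, u <= x <= v -> lo <= peak x ^+ n <= hi) ->
  lo * (v - u) <= H n v - H n u <= hi * (v - u).
Proof.
move=> uv hb; have cH : {within `[u, v], continuous (H n)}.
  by apply: derivable_within_continuous => z _; have [] := dH n z.
have [c] := MVT_segment uv (fun z _ => dH n z) cH.
rewrite in_itv/= => /hb/andP[h1 h2] ->.
by apply/andP; split; rewrite ler_wpM2r ?subr_ge0.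
Qed.

Lemma primitive_mono n u v : u <= v -> H n u <= H n v.
Proof.
move=> uv; rewrite -subr_ge0.
have h x : u <= x <= v -> 0 <= peak x ^+ n <= peak x ^+ n by rewrite lexx exprn_ge0 ?peak_ge0.
have cH : {within `[u, v], continuous (H n)}.
  by apply: derivable_within_continuous => z _; have [] := dH n z.
have [c _ ->] := MVT_segment uv (fun z _ => dH n z) cH.
by rewrite mulr_ge0 ?subr_ge0 ?exprn_ge0 ?peak_ge0.
Qed.

(** [r < 1] is the maximum of the peak on [[d, L - d]]. For [s] strictly between [r] and 1 the peak
    exceeds [s] near 0, so the mass is at least a constant times [s ^ n] and the quotient decays
    like [(r / s) ^ n]. *)
Lemma peak_concentrates d : 0 < d -> d <= L / 2 -> exists r, [/\ 0 <= r,
  forall x, d <= x <= L - d -> peak x <= r & (fun n => r ^+ n / peak_mass n) @ \oo --> (0 : R)].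
Proof.
move=> d0 dL; have dLd : d <= L - d by lra.
have [c] := EVT_max dLd (continuous_subspaceT continuous_peak).
rewrite in_itv/= => /andP[c1 c2] hc; set r := peak c in hc.
have r0 : 0 <= r := peak_ge0 c.
have r1 : r < 1 by apply: peak_lt1; lra.
exists r; split => //; pose s := (1 + r) / 2.
have s0 : 0 < s by rewrite /s; lra.
have rs : r < s by rewrite /s; lra.
have s1 : s < 1 by rewrite /s; lra.
have [e e0 he] := peak_near0 s1.
pose e' := Num.min e L.
have e'0 : 0 < e' by rewrite lt_min e0 L0.
have [e'e e'L] : e' <= e /\ e' <= L by rewrite !ge_min !lexx orbT.
have mass n : e' * s ^+ n <= peak_mass n.
  have hb x : 0 <= x <= e' -> s ^+ n <= peak x ^+ n <= 1.
    move=> /andP[x0 xe]; apply/andP; split.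
      by rewrite lerXn2r ?nnegrE ?peak_ge0 ?(ltW s0)// he// x0 (le_trans xe).
    by rewrite exprn_ile1 ?peak_ge0// lerBlDr lerDl sqr_ge0.
  have /andP[h _] := primitive_bounds (ltW e'0) hb; rewrite subr0 mulrC in h.
  by rewrite (le_trans h)// lerD2r primitive_mono.
have up : (fun n => e'^-1 * (r / s) ^+ n) @ \oo --> (0 : R).
  apply: cvg_geometric; have h : 0 <= r / s := divr_ge0 r0 (ltW s0).
  by rewrite (ger0_norm h) (ltr_pdivrMr _ _ s0) mul1r.
apply: (@squeeze_cvgr _ _ _ _ (cst 0) (fun n => e'^-1 * (r / s) ^+ n)); [|exact: cvg_cst|exact: up].
apply: nearW => n; have sn : 0 < s ^+ n by rewrite exprn_gt0.
have m0 : 0 < peak_mass n by apply: lt_le_trans (mass n); rewrite mulr_gt0.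
rewrite divr_ge0 ?exprn_ge0 ?(ltW m0)//= expr_div_n mulrCA ler_wpM2l ?exprn_ge0//.
by rewrite -invfM lef_pV2 ?posrE// mulr_gt0.
Qed.

Lemma peak_mass_gt0 n : 0 < peak_mass n.
Proof.
have h1 : (2^-1 : R) < 1 by rewrite invf_lt1// ltr1n.
have [e e0 he] := peak_near0 h1; pose e' := Num.min e L.
have e'0 : 0 < e' by rewrite lt_min e0 L0.
have [e'e e'L] : e' <= e /\ e' <= L by rewrite !ge_min !lexx orbT.
have hb x : 0 <= x <= e' -> (2^-1) ^+ n <= peak x ^+ n <= 1.
  move=> /andP[x0 xe]; apply/andP; split; last first.
    by rewrite exprn_ile1 ?peak_ge0// lerBlDr lerDl sqr_ge0.
  by rewrite lerXn2r ?nnegrE ?peak_ge0 ?invr_ge0// he// x0 (le_trans xe).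
have /andP[h _] := primitive_bounds (ltW e'0) hb; rewrite subr0 in h.
apply: (@lt_le_trans _ _ (H n e' - H n 0)); last by rewrite lerD2r primitive_mono.
by apply: lt_le_trans h; rewrite mulr_gt0// exprn_gt0// invr_gt0.
Qed.

End PeriodicKernel.

(** * The fundamental theorem of calculus for weak derivatives *)

Section WeakDerivativePrimitive.
Context {R : realType}.
Notation mu := (@lebesgue_measure R).
Variables (L : R) (L0 : 0 < L).
Implicit Types (F G f g h : R -> R) (a b e x : R) (n : nat).

Lemma le_primitive F G f h (u v : R) : u <= v -> (forall x, is_derive x (1 : R) F (f x)) ->
  (forall x, is_derive x (1 : R) G (h x)) -> (forall x, u <= x <= v -> f x <= h x) ->
  F v - F u <= G v - G u.
Proof.
move=> uv dF dG fh; pose P x := G x - F x.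
have dP (x : R) : is_derive x (1 : R) P (h x - f x).
  by have h1 := dF x; have h2 := dG x; rewrite /P; apply: is_derive_eq.
have cP : {within `[u, v], continuous P}.
  by apply: derivable_within_continuous => z _; have [] := dP z.
have [c] := MVT_segment uv (fun z _ => dP z) cP.
rewrite in_itv/= => /fh; rewrite -subr_ge0 => h0 E.
have : 0 <= P v - P u by rewrite E mulr_ge0// subr_ge0.
rewrite /P; lra.
Qed.

Lemma Rintegral_primitive F f : continuous f -> (forall x, is_derive x (1 : R) F (f x)) ->
  \int[mu]_(x in `[0, L]) f x = F L - F 0.
Proof. by move=> cf dF; rewrite /Rintegral (continuous_FTC2_is_derive (ltW L0) cf dF). Qed.

Lemma Rintegral_le_primitive G f h : continuous f -> (forall x, is_derive x (1 : R) G (h x)) ->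
  (forall x, 0 <= x <= L -> f x <= h x) -> \int[mu]_(x in `[0, L]) f x <= G L - G 0.
Proof.
move=> cf dG fh; have [F dF] := global_primitive cf.
by rewrite (Rintegral_primitive cf dF); exact: (le_primitive (ltW L0) dF dG fh).
Qed.

Variable H : nat -> R -> R.
Hypothesis dH : forall n x, is_derive x (1 : R) (H n) (peak L x ^+ n).

Let I n := peak_mass L H n.
(** An approximate identity at [a]: peaks of integral 1 over a period. *)
Let K a n x := peak L (x - a) ^+ n / I n.

Let I0 n : 0 < I n. Proof. exact: peak_mass_gt0. Qed.

Let K0 a n x : 0 <= K a n x. Proof. by rewrite divr_ge0 ?exprn_ge0 ?peak_ge0 ?ltW. Qed.

Let dK a n x : is_derive x (1 : R) (fun x => H n (x - a) / I n) (K a n x).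
Proof.
have h := is_derive_shift dH n (- a) x.
by apply: is_derive_eq; rewrite /K /GRing.scale/= mulr0 add0r mulrC.
Qed.

Let cK a n : continuous (K a n).
Proof.
have -> : K a n = trig_eval (pi / L) (TrigMul (TrigC (I n)^-1) (peak_trig a n)).
  by apply/funext => x; rewrite /= peak_trigE mulrC.
exact: is_derive_trig_continuous.
Qed.

Let mass1 a n : H n (L - a) / I n - H n (0 - a) / I n = 1.
Proof.
by rewrite -mulrBl (addrC L) sub0r (primitive_period L0 dH) addrAC subrr add0r divff// gt_eqF.
Qed.

(** Within [d] of [a] continuity bounds [F] by [F a + e]. Elsewhere the kernel is at most
    [r ^ n / I n], while [F] exceeds [F a + e] by at most the oscillation [M]. The resulting bound
    is integrated through its primitive [G]. *)
Lemma kernel_average_upper F a e : continuous F -> 0 < a < L -> 0 < e ->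
  exists2 u : nat -> R, u @ \oo --> (0 : R) & forall n,
    \int[mu]_(x in `[0, L]) (F x * K a n x) <= F a + e + u n.
Proof.
move=> cF /andP[a0 aL] e0.
have [c _ hc] := EVT_max (ltW L0) (continuous_subspaceT cF).
have [c' c'I hc'] := EVT_min (ltW L0) (continuous_subspaceT cF).
pose M := F c - F c'.
have [d1 d10 hd1] : exists2 d, 0 < d & forall x, `|x - a| < d -> F x <= F a + e.
  have ca : F x @[x --> a] --> F a by exact: cF.
  move: ca => /cvgrPdist_lt/(_ e e0) /nbhs_ballP[d /= d0 hd]; exists d => // x xd.
  have := hd x; rewrite -ball_normE/= distrC => /(_ xd); rewrite distrC => /ltr_normlW; lra.
pose d := Num.min (Num.min d1 (L / 2)) (Num.min a (L - a)).
have L20 : 0 < L / 2 by rewrite divr_gt0.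
have d0 : 0 < d by rewrite !lt_min d10 L20 a0 subr_gt0 aL.
have [[dd1 dL] [da dLa]] : (d <= d1 /\ d <= L / 2) /\ (d <= a /\ d <= L - a).
  by rewrite /d !ge_min !lexx !orbT.
clearbody d.
have [r [r0 hr cr]] := peak_concentrates L0 dH d0 dL.
exists (fun n => M * L * (r ^+ n / I n)).
  by rewrite -[X in _ --> X](mulr0 (M * L)); apply: cvgM; [exact: cvg_cst|exact: cr].
move=> n.
have M0 : 0 <= M by rewrite subr_ge0 hc.
pose G x := (F a + e) * (H n (x - a) / I n) + M * (r ^+ n / I n) * x.
have dG x : is_derive x (1 : R) G ((F a + e) * K a n x + M * (r ^+ n / I n)).
  have h := dK a n x; rewrite /G; apply: is_derive_eq.
  by rewrite /GRing.scale/=; ring.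
have cFK : continuous (fun x => F x * K a n x) by move=> x; apply: cvgM; [exact: cF|exact: cK].
apply: (le_trans (Rintegral_le_primitive cFK dG _)); last first.
  rewrite /G; have := mass1 a n; set h1 := H n (L - a) / I n; set h0 := H n (0 - a) / I n => m1.
  have -> : (F a + e) * h1 + M * (r ^+ n / I n) * L - ((F a + e) * h0 + M * (r ^+ n / I n) * 0) =
     (F a + e) * (h1 - h0) + M * L * (r ^+ n / I n) by ring.
  by rewrite m1 mulr1.
move=> x /andP[x0 xL].
have rI : 0 <= r ^+ n / I n by rewrite divr_ge0 ?exprn_ge0 ?(ltW (I0 n)).
have [xa|xa] := ltP `|x - a| d.
  rewrite (le_trans (ler_wpM2r (K0 a n x) (hd1 x (lt_le_trans xa dd1))))// lerDl mulr_ge0//.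
have Kr : K a n x <= r ^+ n / I n.
  rewrite ler_wpM2r ?invr_ge0 ?(ltW (I0 n))// lerXn2r ?nnegrE ?peak_ge0//.
  have [ax|ax] := leP a x.
    by apply: hr; move: xa; rewrite ger0_norm ?subr_ge0// => ->; lra.
  rewrite -(peak_periodic L0); apply: hr; move: xa; rewrite ltr0_norm ?subr_lt0//; lra.
have Fx : F x - (F a + e) <= M.
  have h1 : F x <= F c by apply: hc; rewrite in_itv/= x0.
  have h2 : F c' <= F a by apply: hc'; rewrite in_itv/= !ltW.
  rewrite /M; lra.
rewrite -lerBlDl -mulrBl.
rewrite (le_trans (ler_wpM2r (K0 a n x) Fx))// ler_wpM2l//.
Qed.

Lemma integrable_continuous f (u v : R) : continuous f -> mu.-integrable `[u, v] (EFin \o f).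
Proof.
move=> cf; apply: continuous_compact_integrable; first exact: segment_compact.
exact: continuous_subspaceT.
Qed.

(** The missing lower bound is the upper bound for [- F]. *)
Lemma kernel_average F a : continuous F -> 0 < a < L ->
  (fun n => \int[mu]_(x in `[0, L]) (F x * K a n x)) @ \oo --> F a.
Proof.
move=> cF aL; apply/cvgrPdist_le => e e0.
have e2 : 0 < e / 2 by rewrite divr_gt0.
have cFN : continuous (fun x => - F x) by move=> x; apply: cvgN; exact: cF.
have [u cu hu] := kernel_average_upper cF aL e2.
have [v cv hv] := kernel_average_upper cFN aL e2.
have cFK n : continuous (fun x => F x * K a n x) by move=> x; apply: cvgM; [exact: cF|exact: cK].
have opp n : \int[mu]_(x in `[0, L]) (- F x * K a n x) = - \int[mu]_(x in `[0, L]) (F x * K a n x).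
  have [P dP] := global_primitive (cFK n).
  have dN (x : R) : is_derive x (1 : R) (fun x => - P x) (- F x * K a n x).
    by have h := dP x; apply: is_derive_eq; rewrite mulNr.
  have cN : continuous (fun x => - F x * K a n x) by move=> x; apply: cvgM; [exact: cFN|exact: cK].
  by rewrite (Rintegral_primitive (cFK n) dP) (Rintegral_primitive cN dN); ring.
near=> n.
have h1 := hu n; have := hv n; rewrite opp => h2.
have u1 : u n <= e / 2.
  apply: ltW; apply: (le_lt_trans (ler_norm _)); near: n.
  by move/cvgrPdist_lt : cu => /(_ _ e2); apply: filterS => n; rewrite sub0r normrN.
have v1 : v n <= e / 2.
  apply: ltW; apply: (le_lt_trans (ler_norm _)); near: n.
  by move/cvgrPdist_lt : cv => /(_ _ e2); apply: filterS => n; rewrite sub0r normrN.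
rewrite ler_norml; apply/andP; split; lra.
Unshelve. all: by end_near. Qed.

(** A smooth periodic approximation of the indicator of [[a, b]]; its derivative is the difference
    of the kernels at [a] and at [b]. *)
Definition step_test a b n x := H n (x - a) / I n - H n (x - b) / I n.

Lemma is_derive_step a b n x : is_derive x (1 : R) (step_test a b n) (K a n x - K b n x).
Proof. by have h1 := dK a n x; have h2 := dK b n x; rewrite /step_test; apply: is_derive_eq. Qed.

Lemma step_periodic a b n : periodic (step_test a b n) L.
Proof.
by move=> x; rewrite /step_test -!mulrBl (addrAC x L (- a)) (addrAC x L (- b)) !(primitive_period L0 dH); congr (_ / _); ring.
Qed.

Lemma step_smooth a b n m x : derivable (derive1n m (step_test a b n)) x (1 : R).
Proof.
apply: (@smooth_primitive_trig _ (pi / L) _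
  (TrigMul (TrigC (I n)^-1) (TrigAdd (peak_trig a n) (TrigMul (TrigC (-1)) (peak_trig b n))))).
move=> y; apply: (is_derive_eq (is_derive_step a b n y)).
by rewrite /= !peak_trigE /K; ring.
Qed.

Lemma step_bounds a b n x : a < b -> b - a < L -> 0 <= step_test a b n x <= 1.
Proof.
move=> ab baL; rewrite /step_test -mulrBl; apply/andP; split.
  rewrite divr_ge0 ?(ltW (I0 n))// subr_ge0 primitive_mono//; lra.
rewrite ler_pdivrMr// mul1r lerBlDl -(primitive_period L0 dH) primitive_mono//; lra.
Qed.

Lemma primitive_flat d n u v r : 0 <= r -> (forall x, d <= x <= L - d -> peak L x <= r) ->
  d <= u -> u <= v -> v <= L - d -> 0 < d -> `|H n v / I n - H n u / I n| <= L * (r ^+ n / I n).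
Proof.
move=> r0 hr du uv vL d0; rewrite -mulrBl normrM [`|(I n)^-1|]ger0_norm ?invr_ge0 ?(ltW (I0 n))// mulrA.
rewrite ler_wpM2r ?invr_ge0 ?(ltW (I0 n))//.
have hb x : u <= x <= v -> 0 <= peak L x ^+ n <= r ^+ n.
  move=> /andP[ux xv]; rewrite exprn_ge0 ?peak_ge0//= lerXn2r ?nnegrE ?peak_ge0//.
  by apply: hr; rewrite (le_trans du)// (le_trans xv).
have /andP[h1 h2] := primitive_bounds dH uv hb.
rewrite mul0r in h1; rewrite ger0_norm// (le_trans h2)// mulrC ler_wpM2r ?exprn_ge0//; lra.
Qed.

(** In each position of [x] relative to [a] and [b] the error is, up to periods, the increment of
    the normalized primitive over an interval that avoids the multiples of [L], where the primitive
    becomes flat. *)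
Lemma step_cvg a b x : 0 < a -> a < b -> b < L -> 0 <= x <= L -> x != a -> x != b ->
  (fun n => step_test a b n x) @ \oo --> (if a <= x <= b then 1 else 0 : R).
Proof.
move=> a0 ab bL /andP[x0 xL] xa xb.
have main (u v c : R) : 0 < u -> 0 < v -> u < L -> v < L ->
    (forall n, `|c - step_test a b n x| = `|H n v / I n - H n u / I n|) ->
    (fun n => step_test a b n x) @ \oo --> c.
  wlog uv : u v / u <= v.
    move=> h u0 v0 uL vL E; have [uv|/ltW vu] := leP u v; first exact: (h u v).
    by apply: (h v u vu) => // n; rewrite E distrC.
  move=> u0 v0 uL vL E; pose d := Num.min (Num.min u (L - v)) (L / 2).
  have d0 : 0 < d by rewrite !lt_min u0 subr_gt0 vL divr_gt0.
  have [[du dv] dL] : (d <= u /\ d <= L - v) /\ d <= L / 2 by rewrite /d !ge_min !lexx !orbT.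
  have [r [r0 hr cr]] := peak_concentrates L0 dH d0 dL.
  have {}cr : (fun n => L * (r ^+ n / I n)) @ \oo --> (0 : R).
    by rewrite -[X in _ --> X](mulr0 L); apply: cvgM; [exact: cvg_cst|exact: cr].
  apply/cvgrPdist_le => e e0; move/cvgrPdist_le : cr => /(_ e e0); apply: filterS => n.
  rewrite sub0r normrN => /(le_trans (ler_norm _)); apply: le_trans.
  rewrite E; apply: (primitive_flat n r0 hr du uv _ d0); lra.
have per n c : H n (c + L) / I n = H n c / I n + 1.
  by rewrite (primitive_period L0 dH) mulrDl divff// gt_eqF.
have [ax|xa'] := leP a x; last first.
  apply: (main (x - b + L) (x - a + L)); try lra.
  by move=> n; rewrite !per sub0r normrN /step_test; congr (`|_|); ring.
have {}ax : a < x by rewrite lt_neqAle eq_sym xa.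
have [xb'|bx] := leP x b; last first.
  apply: (main (x - b) (x - a)); try lra.
  by move=> n; rewrite sub0r normrN.
have {}xb' : x < b by rewrite lt_neqAle xb.
apply: (main (x - a) (x - b + L)); try lra.
by move=> n; rewrite per /step_test; congr (`|_|); ring.
Qed.

Lemma ae_neq a : {ae mu, forall x, x != a}.
Proof.
exists [set a]; split; [exact: measurable_set1|exact: lebesgue_measure_set1|].
by move=> x /= /negP; rewrite negbK => /eqP.
Qed.

(** Tested with [step_test], the side with [F] tends to [F a - F b] by concentration of the kernels,
    and the side with [g] to minus its integral over [[a, b]] by dominated convergence with majorant
    [|g|]. *)
Lemma weak_derivative_step F g a b : continuous F -> mu.-integrable `[0, L] (EFin \o g) ->
  (forall phi : R -> R, periodic phi L -> (forall n x, derivable (derive1n n phi) x (1 : R)) ->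
    \int[mu]_(x in `[0, L]) (F x * derive1 phi x) = - \int[mu]_(x in `[0, L]) (g x * phi x)) ->
  0 < a -> a < b -> b < L -> (\int[mu]_(x in `[a, b]) (g x)%:E = (F b - F a)%:E)%E.
Proof.
move=> cF ig weak a0 ab bL.
have aL : 0 < a < L by rewrite a0 (lt_trans ab).
have bL' : 0 < b < L by rewrite bL andbT (lt_trans a0).
have cstep n : continuous (step_test a b n).
  by apply: derivable_continuous => x; have [] := is_derive_step a b n x.
have mg : measurable_fun `[0, L] g by apply/measurable_EFinP; case/integrableP: ig.
have mI : measurable (`[0, L]%classic : set (measurableTypeR R)) by [].
have ms n : measurable_fun `[0, L] (fun x => (g x * step_test a b n x)%:E).
  apply/measurable_EFinP; apply: measurable_funM => //.
  by apply: measurable_funTS; exact: continuous_measurable_fun.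
have bd n x : (`|(g x * step_test a b n x)%:E| <= `|(g x)%:E|)%E.
  have /andP[h1 h2] : 0 <= step_test a b n x <= 1 by apply: step_bounds; lra.
  by rewrite lee_fin normrM (ger0_norm h1) ler_piMr.
have igs n : mu.-integrable `[0, L] (fun x => (g x * step_test a b n x)%:E).
  apply: (le_integrable mI (ms n) _ ig) => x _; exact: bd.
pose lim x := (g x * (if a <= x <= b then 1 else 0))%:E.
have limE x : lim x = ((EFin \o g) \_ `[a, b]) x.
  rewrite /lim patchE; case: ifPn => [h|h].
    by rewrite mem_set ?mulr1//= in_itv.
  by rewrite memNset ?mulr0//= in_itv/=; exact/negP.
have mlim : measurable_fun `[0, L] lim.
  rewrite (_ : lim = (EFin \o g) \_ `[a, b]); last by apply/funext.
  apply/(measurable_restrict _ _ _) => //.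
  by apply: (@measurable_funS _ _ _ _ `[0, L]%classic) => //; apply/measurable_EFinP.
have ig' : mu.-integrable `[0, L] (fun x => `|(g x)%:E|%E) by exact: integrable_abse.
have cv : \forall x \ae mu, `[0, L]%classic x ->
    (fun n => (g x * step_test a b n x)%:E) @ \oo --> lim x.
  apply: (@filterS2 _ _ (ae_filter_ringOfSetsType mu) _ _ _ _ (ae_neq a) (ae_neq b)) => x xa xb /=; rewrite in_itv/= => xL.
  apply: cvg_EFin; first exact: nearW.
  by apply: cvgM; [exact: cvg_cst|exact: step_cvg].
have dom : \forall x \ae mu, forall n, `[0, L]%classic x ->
    (`|(g x * step_test a b n x)%:E| <= `|(g x)%:E|)%E.
  by apply: aeW => x n _; exact: bd.
have [_ _ C1] := dominated_convergence mI ms mlim cv ig' dom.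
have C2 : (fun n => (\int[mu]_(x in `[0%R, L]) (g x * step_test a b n x)%:E)%E) @ \oo --> (F b - F a)%:E.
  have E n : (\int[mu]_(x in `[0%R, L]) (g x * step_test a b n x)%:E)%E =
      (\int[mu]_(x in `[0, L]) (F x * K b n x) - \int[mu]_(x in `[0, L]) (F x * K a n x))%:E.
    have fin : (\int[mu]_(x in `[0%R, L]) (g x * step_test a b n x)%:E)%E \is a fin_num.
      exact: integrable_fin_num.
    rewrite -(fineK fin); congr (_%:E).
    have := weak _ (@step_periodic a b n) (@step_smooth a b n).
    rewrite [X in - X](_ : _ = fine (\int[mu]_(x in `[0%R, L]) (g x * step_test a b n x)%:E)%E)// => W.
    rewrite -[LHS]opprK -W -[RHS]opprB; congr (- _).
    have cFK c : continuous (fun x => F x * K c n x) by move=> x; apply: cvgM; [exact: cF|exact: cK].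
    rewrite -(RintegralB mI (integrable_continuous 0 L (cFK a)) (integrable_continuous 0 L (cFK b))).
    apply: eq_Rintegral => x _; rewrite -mulrBr; congr (_ * _).
    by rewrite derive1E; have [_ ->] := is_derive_step a b n x.
  under eq_fun do rewrite E.
  apply: cvg_EFin; first exact: nearW.
  by apply: cvgB; exact: kernel_average.
have lims := cvg_unique (@ereal_hausdorff R) C1 C2.
rewrite -lims.
under [in RHS]eq_integral do rewrite limE.
rewrite -integral_mkcondr; congr (integral _ _ _); apply/seteqP; split => x /=.
  by rewrite !in_itv/= => /andP[ax xb]; rewrite ax xb; split => //; lra.
by case.
Qed.

End WeakDerivativePrimitive.

Section WeakDerivativeFTC.
Context {R : realType}.
Notation mu := (@lebesgue_measure R).
Implicit Types (F G h phi : R -> R) (L a b c : R).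

Lemma derive1_shift phi c : derive1 (fun x => phi (x + c)) = (fun x => derive1 phi (x + c)).
Proof.
apply/funext => x; rewrite /derive1 (_ : (fun h : R => h^-1 *: (phi (h + x + c) - phi (x + c))) =
  (fun h : R => h^-1 *: (phi (h + (x + c)) - phi (x + c))))//.
by apply/funext => h; rewrite addrA.
Qed.

Lemma derive1n_shift n phi c : derive1n n (fun x => phi (x + c)) = (fun x => derive1n n phi (x + c)).
Proof.
elim: n => [|n IH]; first by rewrite !derive1n0.
by rewrite !derive1nS IH derive1_shift.
Qed.

Lemma derivable_shift phi c x : derivable phi (x + c) (1 : R) -> derivable (fun y => phi (y + c)) x (1 : R).
Proof.
move=> d; have lin : is_derive x (1 : R) (fun y : R => y + c) 1.
  by apply: is_derive_eq; rewrite addr0.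
by have [] := @is_derive1_comp _ phi (fun y => y + c) x _ _ (derivableP d) lin.
Qed.

Lemma integral_itv_shift (k : R -> \bar R) a b d :
  (\int[mu]_(x in `[a, b]) k (x + d)%R = \int[mu]_(x in `[(a + d)%R, (b + d)%R]) k x)%E.
Proof.
rewrite [LHS]integralE [RHS]integralE; congr (_ - _)%E.
- transitivity (\int[mu]_(x in `[a, b]) (k^\+ (x + d)%R))%E; first by apply: eq_integral => x _; rewrite !funeposE.
  by apply: (ge0_integral_itv_shift a b d (f := (k^\+)%E)) => x; exact: funepos_ge0.
- transitivity (\int[mu]_(x in `[a, b]) (k^\- (x + d)%R))%E; first by apply: eq_integral => x _; rewrite !funenegE.
  by apply: (ge0_integral_itv_shift a b d (f := (k^\-)%E)) => x; exact: funeneg_ge0.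
Qed.

Lemma integral_periodic_shift h L c : 0 < L -> measurable_fun setT h -> periodic h L ->
  \int[mu]_(x in `[0, L]) h (x + c) = \int[mu]_(x in `[0, L]) h x.
Proof.
move=> L0 mh ph; rewrite /Rintegral; congr fine.
have key (k : R -> \bar R) : measurable_fun setT k -> (forall x, 0 <= k x)%E -> (forall x, k (x + L)%R = k x) ->
    (\int[mu]_(x in `[0%R, L]) k (x + c)%R = \int[mu]_(x in `[0%R, L]) k x)%E.
  move=> mk k0 pk; rewrite (ge0_integral_itv_shift 0 L c k0) add0r addrC.
  exact: ge0_integral_periodic.
have mE : measurable_fun setT (EFin \o h) by exact/measurable_EFinP.
rewrite [LHS]integralE [RHS]integralE; congr (_ - _)%E.
- transitivity (\int[mu]_(x in `[0%R, L]) ((EFin \o h)^\+ (x + c)%R))%E; first by apply: eq_integral => x _; rewrite !funeposE.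
  apply: (key (fun x => (EFin \o h)^\+ x)%E) => [|x|x]; [exact: measurable_funepos|exact: funepos_ge0|].
  by rewrite !funeposE /= ph.
- transitivity (\int[mu]_(x in `[0%R, L]) ((EFin \o h)^\- (x + c)%R))%E; first by apply: eq_integral => x _; rewrite !funenegE.
  apply: (key (fun x => (EFin \o h)^\- x)%E) => [|x|x]; [exact: measurable_funeneg|exact: funeneg_ge0|].
  by rewrite !funenegE /= ph.
Qed.

Lemma integrable_periodic G L a : 0 < L -> measurable_fun setT G -> periodic G L ->
  mu.-integrable `[0, L] (EFin \o G) -> mu.-integrable `[a, a + L] (EFin \o G).
Proof.
move=> L0 mG pG /integrableP[_ fin]; apply/integrableP; split.
  by apply: measurable_funTS; exact/measurable_EFinP.
rewrite (ge0_integral_periodic a L0)//; last by move=> x /=; rewrite pG.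
by apply: measurableT_comp => //; exact/measurable_EFinP.
Qed.

(** The step argument requires an interval strictly inside []0, L[]. Translation by [c] centres
    [[a, b]] in one period, and the weak formulation is invariant under translation. *)
Lemma weak_derivative_FTC L F G : 0 < L -> continuous F -> periodic F L -> periodic G L ->
  measurable_fun setT G -> mu.-integrable `[0, L] (EFin \o G) ->
  (forall phi : R -> R, periodic phi L -> (forall n x, derivable (derive1n n phi) x (1 : R)) ->
    \int[mu]_(x in `[0, L]) (F x * derive1 phi x) = - \int[mu]_(x in `[0, L]) (G x * phi x)) ->
  forall a b, a < b -> b - a < L -> (\int[mu]_(x in `[a, b]) (G x)%:E = (F b - F a)%:E)%E.
Proof.
move=> L0 cF pF pG mG iG weak a b ab baL.
have [H dH] := peak_primitive_ex L.
pose c := a - (L - (b - a)) / 2.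
pose Fc x := F (x + c); pose Gc x := G (x + c).
have cFc : continuous Fc.
  move=> x; apply: (@continuous_comp _ _ _ (fun x : R => x + c) F); last exact: cF.
  by apply: cvgD; [exact: cvg_id|exact: cvg_cst].
have mGc : measurable_fun setT Gc.
  by apply: measurableT_comp => //; apply: measurable_funD => //; exact: measurable_cst.
have iGc : mu.-integrable `[0, L] (EFin \o Gc).
  have /integrableP[_ fin] := iG; apply/integrableP; split.
    by apply: measurable_funTS; exact/measurable_EFinP.
  have := @ge0_integral_itv_shift _ (fun x => `|(G x)%:E|%E) 0 L c (fun=> abse_ge0 _) => E.
  have -> : (\int[mu]_(x in `[0%R, L]) `|(EFin \o Gc) x| = \int[mu]_(x in `[0%R, L]) `|(G (x + c))%:E|)%E by [].
  rewrite E add0r addrC (ge0_integral_periodic c L0)//; last by move=> x; rewrite pG.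
  by apply: measurableT_comp => //; exact/measurable_EFinP.
have weakc phi : periodic phi L -> (forall n x, derivable (derive1n n phi) x (1 : R)) ->
    \int[mu]_(x in `[0, L]) (Fc x * derive1 phi x) = - \int[mu]_(x in `[0, L]) (Gc x * phi x).
  move=> pphi sphi; pose psi x := phi (x - c).
  have ppsi : periodic psi L by move=> x; rewrite /psi addrAC pphi.
  have spsi n x : derivable (derive1n n psi) x (1 : R).
    by rewrite /psi derive1n_shift; apply: derivable_shift; exact: sphi.
  have dpsi : continuous psi by apply: derivable_continuous => x; exact: spsi 0%N x.
  have dpsi1 : continuous (derive1 psi) by apply: derivable_continuous => x; exact: spsi 1%N x.
  have W := weak psi ppsi spsi.
  rewrite -(@integral_periodic_shift (fun x => F x * derive1 psi x) L c L0) in W; first last.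
  - by move=> x; rewrite pF derive1_periodic.
  - by apply: measurable_funM; exact: continuous_measurable_fun.
  rewrite -(@integral_periodic_shift (fun x => G x * psi x) L c L0) in W; first last.
  - by move=> x; rewrite pG ppsi.
  - by apply: measurable_funM => //; exact: continuous_measurable_fun.
  have E1 x : F (x + c) * derive1 psi (x + c) = Fc x * derive1 phi x.
    by rewrite /psi derive1_shift addrK.
  have E2 x : G (x + c) * psi (x + c) = Gc x * phi x by rewrite /psi addrK.
  under eq_Rintegral do rewrite -E1.
  by under [in RHS]eq_Rintegral do rewrite -E2.
have E : (\int[mu]_(x in `[(a - c)%R, (b - c)%R]) (Gc x)%:E = (Fc (b - c) - Fc (a - c))%:E)%E.
  apply: (@weak_derivative_step _ L L0 H dH Fc Gc (a - c) (b - c) cFc iGc weakc); rewrite /c; lra.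
rewrite /Fc !subrK in E; rewrite -E.
by rewrite (integral_itv_shift (EFin \o G) (a - c) (b - c) c) !subrK.
Qed.

End WeakDerivativeFTC.

(** * A Morrey estimate for functions with finite seminorm *)

Section Morrey.
Context {R : realType}.
Notation mu := (@lebesgue_measure R).
Variables (p L S : R) (F G : R -> R).
Hypotheses (p3 : 3 < p) (L0 : 0 < L) (S0 : 0 <= S).
Hypothesis mG : measurable_fun setT G.
Hypothesis pG : periodic G L.
Hypothesis iG : mu.-integrable `[0, L] (EFin \o G).
Hypothesis FTC : forall a b, a < b -> b - a < L -> (\int[mu]_(x in `[a, b]) (G x)%:E = (F b - F a)%:E)%E.

Let q (z : R * R) : \bar R := ((`|G (z.1 + z.2) - G z.1| `^ p) / (`|z.2| `^ (p - 1)))%:E.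
Let J (x : R) : \bar R := (\int[mu]_(w in `[(- (L / 2))%R, (L / 2)%R]) q (x, w))%E.

Hypothesis hS : (\int[mu]_(x in `[0%R, L]) J x <= S%:E)%E.

Let q0 z : (0 <= q z)%E.
Proof. by rewrite lee_fin divr_ge0 ?powR_ge0. Qed.

Let mq : measurable_fun setT q.
Proof.
apply/measurable_EFinP; apply: measurable_funM.
  apply: measurable_fun_powR; apply: measurable_norm_fun; apply: measurable_funB.
    apply: measurableT_comp => //; apply: measurable_funD; [exact: measurable_fst|exact: measurable_snd].
  by apply: measurableT_comp => //; exact: measurable_fst.
apply: measurable_funV; apply: measurable_fun_powR; apply: measurable_norm_fun; exact: measurable_snd.
Qed.

Let J0 x : (0 <= J x)%E. Proof. by apply: integral_ge0 => w _; exact: q0. Qed.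

Let mJ : measurable_fun setT J. Proof. exact: measurable_fun_section_integral. Qed.

Let pJ x : J (x + L) = J x.
Proof. by apply: eq_integral => w _; rewrite /q/= (addrAC x L w) !pG. Qed.

Let iGab a b : b - a <= L -> mu.-integrable `[a, b] (EFin \o G).
Proof.
move=> ab; apply: integrableS (integrable_periodic a L0 mG pG iG) => //.
by move=> x /=; rewrite !in_itv/= => /andP[-> xb] /=; lra.
Qed.

Let kap := (p - 3) / p.
Let kap0 : 0 < kap. Proof. by rewrite divr_gt0 ?subr_gt0// (lt_trans _ p3). Qed.

(** Either [t <= lam], or [t = t ^ (1 - p) * t ^ p] with a decreasing first factor. It trades [t]
    for the integrable power and a constant [lam] that is free to be optimized. *)
Let young (lam t : R) : 0 < lam -> 0 <= t -> t <= lam + lam `^ (1 - p) * t `^ p.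
Proof.
move=> l0 t0; have [tl|lt] := leP t lam; first by rewrite (le_trans tl)// lerDl mulr_ge0 ?powR_ge0.
have tp : 0 < t := lt_trans l0 lt.
rewrite -[leLHS]add0r lerD ?(ltW l0)//.
have {1}-> : t = t `^ (1 - p) * t `^ p.
  by rewrite -powRD ?(gt_eqF tp) ?implybT// subrK powRr1// ltW.
rewrite ler_wpM2r ?powR_ge0//; apply: (powR_antimono l0 (ltW lt)).
by rewrite subr_le0 (le_trans _ (ltW p3))// ler1n.
Qed.

(** The deviation of [G] from its mean on [[a, b]], of length [D], is the mean of [G x - G y], to
    which [young] applies with [lam = D ^ kap]. The constant contributes [D ^ (kap + 1)] and the
    seminorm [D ^ (kap * (1 - p) + p - 2)]; these exponents agree for [kap = (p - 3) / p]. *)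
Lemma morrey_average a b u v : a <= u -> u <= v -> v <= b -> a < b -> b - a <= L / 2 ->
  `|F v - F u - (F b - F a) / (b - a) * (v - u)| <= (1 + S) * (b - a) `^ (kap + 1).
Proof.
move=> au uv vb ab baL; set D := b - a; set al := (F b - F a) / D.
have D0 : 0 < D by rewrite subr_gt0.
have L2 : L / 2 < L by rewrite ltr_pdivrMr// ltr_pMr// ltr1n.
have DL : D < L by rewrite (le_lt_trans baL).
have Ep : (\int[mu]_(x in `[a, b]) (G x)%:E = (al * D)%:E)%E.
  by rewrite FTC// /al divfK ?gt_eqF.
have muD : (\int[mu]_(x in `[a, b]) cst 1%:E x = D%:E :> \bar R)%E.
  by rewrite integral_cst//= lebesgue_measure_itv/= lte_fin ab mul1e -EFinB.
have mI (c d : R) : measurable (`[c, d]%classic : set (measurableTypeR R)) by [].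
have cint (k c d : R) : c <= d -> (\int[mu]_(x in `[c, d]) k%:E = (k * (d - c))%:E)%E.
  move=> cd; rewrite integral_cst//= lebesgue_measure_itv/= lte_fin.
  move: cd; rewrite le_eqVlt => /orP[/eqP ->|cd]; first by rewrite ltxx mule0 subrr mulr0.
  by rewrite cd -EFinB -EFinM.
have icst (k c d : R) : mu.-integrable `[c, d] (fun=> k%:E).
  apply: (@integrableS _ _ _ mu `[c, d]%classic) => //.
  by apply: (integrable_continuous c d (f := fun=> k)) => x; exact: cvg_cst.
have dev k c d : c <= d -> d - c < L -> (`|k * (d - c) - (F d - F c)|%:E <= \int[mu]_(x in `[c, d]) `|k - G x|%:E)%E.
  move=> cd dcL.
  have E0 : (k * (d - c) - (F d - F c))%:E = (\int[mu]_(x in `[c, d]) (k - G x)%:E)%E.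
    move: cd; rewrite le_eqVlt => /orP[/eqP ->|cd].
      by rewrite set_itv1 integral_set1 !subrr mulr0 subr0.
    rewrite (integralB_EFin (mI c d) (icst k c d) (iGab (ltW dcL))).
    by rewrite (cint k c d (ltW cd)) (FTC cd dcL) -EFinB.
  have -> : `|k * (d - c) - (F d - F c)|%:E = `|(k * (d - c) - (F d - F c))%:E|%E by [].
  rewrite E0; apply: (@le_abse_integral _ _ _ mu _ (fun x => (k - G x)%:E) (mI c d)).
  by apply: measurable_EFin_fun; exact: measurable_funB.
have lam0 : 0 < D `^ kap by exact: powR_gt0.
set lam := D `^ kap in lam0 *; pose mm := lam `^ (1 - p) * D `^ (p - 1).
have mm0 : 0 < mm by rewrite mulr_gt0 ?powR_gt0.
have inner x : a <= x <= b -> (`|G x - al|%:E <= (D^-1)%:E * ((lam * D)%:E + mm%:E * J x))%E.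
  move=> /andP[ax xb].
  have h1 := dev (G x) a b (ltW ab) DL.
  have -> : `|G x - al|%:E = ((D^-1)%:E * `|G x * (b - a) - (F b - F a)|%:E)%E.
    rewrite -EFinM; congr EFin; rewrite -[D^-1]ger0_norm ?invr_ge0 ?(ltW D0)// -normrM; congr (`|_|).
    by rewrite /al -/D; field; rewrite gt_eqF.
  rewrite lee_pmul2l ?lte_fin ?invr_gt0//; apply: (le_trans h1).
  have pw y : a <= y <= b -> `|G x - G y| <= lam + mm * (`|G (x + (y - x)) - G x| `^ p / `|y - x| `^ (p - 1)).
    move=> /andP[ay yb]; have -> : x + (y - x) = y by ring.
    rewrite (distrC (G y)); have [->|yx] := eqVneq y x.
      by rewrite !subrr normr0 powR0 ?gt_eqF ?(lt_trans _ p3)// mul0r mulr0 addr0 ltW.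
    have w0 : 0 < `|y - x| by rewrite normr_gt0 subr_eq0.
    have wD : `|y - x| <= D by rewrite ler_norml /D; apply/andP; split; lra.
    rewrite (le_trans (young lam0 (normr_ge0 _)))// lerD2l /mm -!mulrA ler_wpM2l ?powR_ge0//.
    rewrite mulrCA -[leLHS]mulr1 ler_wpM2l ?powR_ge0// ler_pdivlMr ?powR_gt0// mul1r.
    by rewrite ge0_ler_powR ?nnegrE ?(ltW D0)// subr_ge0 (le_trans _ (ltW p3))// ler1n.
  pose qs y : \bar R := q (x, y - x).
  have mqs : measurable_fun setT qs.
    apply: (measurableT_comp mq); apply: measurable_fun_pair; first exact: measurable_cst.
    by apply: measurable_funB.
  have qsE : (\int[mu]_(y in `[a, b]) qs y <= J x)%E.
    have -> : (\int[mu]_(y in `[a, b]) qs y = \int[mu]_(w in `[(a - x)%R, (b - x)%R]) q (x, w))%E.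
      rewrite -(integral_itv_shift (fun w => q (x, w)) a b (- x)).
      by [].
    apply: ge0_subset_integral => //.
    - by apply: measurable_funTS; exact: (measurableT_comp mq (pair1_measurable x)).
    - by move=> y /=; rewrite !in_itv/= => /andP[y1 y2]; apply/andP; split; move: baL; rewrite -/D /D; lra.
  apply: (@le_trans _ _ (\int[mu]_(y in `[a, b]) (lam%:E + mm%:E * qs y))%E).
    apply: ge0_le_integral_any => y /=; rewrite in_itv/= => hy; first by rewrite lee_fin.
    by rewrite /qs /q/= -EFinM -EFinD lee_fin; exact: pw.
  rewrite (ge0_integralD_itv a b (F := fun=> lam%:E)); first last.
  - by move=> y; apply: mule_ge0; [rewrite lee_fin ltW|exact: q0].
  - by move=> y; rewrite lee_fin ltW.
  - exact: measurable_funeM.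
  - exact: measurable_cst.
  rewrite (cint lam a b (ltW ab)) leeD2l// (ge0_integralZl_any _ mm0); last by move=> y _; exact: q0.
  by rewrite lee_pmul2l.
have h2 := dev al u v uv (le_lt_trans (lerB vb au) DL).
have h3 : (\int[mu]_(x in `[u, v]) `|al - G x|%:E <= \int[mu]_(x in `[a, b]) `|G x - al|%:E)%E.
  have -> : (\int[mu]_(x in `[u, v]) `|al - G x|%:E = \int[mu]_(x in `[u, v]) `|G x - al|%:E)%E.
    by apply: eq_integral => x _; rewrite distrC.
  apply: ge0_subset_integral => //.
  - by apply: measurable_EFin_fun; apply: measurable_norm_fun; exact: measurable_funB.
  - move=> x /=; rewrite !in_itv/= => /andP[ux xv].
    by rewrite (le_trans au ux) (le_trans xv vb).
have h4 : (\int[mu]_(x in `[a, b]) `|G x - al|%:E <= (D^-1)%:E * ((lam * D * D)%:E + mm%:E * S%:E))%E.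
  have iD : 0 < D^-1 by rewrite invr_gt0.
  apply: (@le_trans _ _ (\int[mu]_(x in `[a, b]) ((D^-1)%:E * ((lam * D)%:E + mm%:E * J x)))%E).
    by apply: ge0_le_integral_any => x /=; rewrite in_itv/= => hx; [rewrite lee_fin|exact: inner].
  rewrite (ge0_integralZl_any _ iD); last first.
    move=> x _; apply: adde_ge0; first by rewrite lee_fin mulr_ge0// ltW.
    by apply: mule_ge0; [rewrite lee_fin ltW|exact: J0].
  rewrite lee_pmul2l ?lte_fin//.
  rewrite (ge0_integralD_itv a b (F := fun=> (lam * D)%:E)); first last.
  - by move=> y; apply: mule_ge0; [rewrite lee_fin ltW|exact: J0].
  - by move=> y; rewrite lee_fin mulr_ge0 ?ltW.
  - exact: measurable_funeM.
  - exact: measurable_cst.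
  rewrite (cint (lam * D) a b (ltW ab)) leeD2l// (ge0_integralZl_any _ mm0); last by move=> y _; exact: J0.
  rewrite lee_pmul2l ?lte_fin//; apply: (le_trans _ hS); rewrite -(ge0_integral_periodic a L0 mJ J0 pJ).
  apply: ge0_subset_integral => //.
  - exact: measurable_funTS.
  - by move=> x /=; rewrite !in_itv/= => /andP[-> xb] /=; move: DL; rewrite /D; lra.
have h5 : `|al * (v - u) - (F v - F u)| <= D^-1 * (lam * D * D + mm * S).
  by rewrite -lee_fin; exact: (le_trans h2 (le_trans h3 h4)).
rewrite -normrN opprB; apply: (le_trans h5).
have E1 : D^-1 * (lam * D * D) = D `^ (kap + 1).
  rewrite powRD ?(gt_eqF D0) ?implybT// powRr1 ?(ltW D0)// -/lam; field; by rewrite gt_eqF.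
have E2 : D^-1 * mm = D `^ (kap + 1).
  rewrite /mm /lam -powRrM -(powR_inv1 (ltW D0)) -!powRD ?(gt_eqF D0) ?implybT//; congr (_ `^ _).
  by rewrite /kap; field; rewrite gt_eqF// (lt_trans _ p3).
by rewrite mulrDr E1 mulrA E2 mulrDl mul1r mulrC.
Qed.

(* Halving the larger interval until it is comparable with the smaller one. *)
Lemma morrey_affine : exists2 K, 0 <= K & forall a b u v, a <= u -> u <= v -> v <= b -> a < b ->
  b - a <= L / 2 -> `|F v - F u - (F b - F a) / (b - a) * (v - u)| <= K * (b - a) `^ kap * (v - u).
Proof.
pose C := 2 * (1 + S).
have C0 : 0 <= C by rewrite mulr_ge0// addr_ge0.
pose th : R := 2^-1 `^ kap.
have th1 : 0 < 1 - th by rewrite subr_gt0; exact: powR_half_lt1.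
(* The fixed point of one halving step, [K * th + C = K]. *)
pose K := C / (1 - th).
have CK : C <= K by rewrite ler_pdivlMr// ler_piMr// gerBl powR_ge0.
have K0 : 0 <= K := le_trans C0 CK.
have KE : K * th + C = K.
  by rewrite /K; field; rewrite gt_eqF.
exists K => //.
have base a b u v : a <= u -> u <= v -> v <= b -> a < b -> b - a <= L / 2 -> b - a <= 2 * (v - u) ->
    `|F v - F u - (F b - F a) / (b - a) * (v - u)| <= C * (b - a) `^ kap * (v - u).
  move=> au uv vb ab baL D2; apply: (le_trans (morrey_average au uv vb ab baL)).
  have D0 : 0 < b - a by rewrite subr_gt0.
  rewrite powRD ?(gt_eqF D0) ?implybT// powRr1 ?(ltW D0)//.
  have -> : C * (b - a) `^ kap * (v - u) = (1 + S) * ((b - a) `^ kap * (2 * (v - u))) by rewrite /C; ring.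
  by rewrite ler_wpM2l ?addr_ge0// ler_wpM2l ?powR_ge0.
have ind n : forall a b u v, a <= u -> u < v -> v <= b -> b - a <= L / 2 -> b - a <= 2 ^+ n.+1 * (v - u) ->
    `|F v - F u - (F b - F a) / (b - a) * (v - u)| <= K * (b - a) `^ kap * (v - u).
  elim: n => [|n IH] a b u v au uv vb baL Dn.
    have ab : a < b by rewrite (le_lt_trans au)// (lt_le_trans uv).
    apply: (le_trans (base a b u v au (ltW uv) vb ab baL Dn)).
    by rewrite ler_wpM2r ?subr_ge0 ?(ltW uv)// ler_wpM2r ?powR_ge0.
  have ab : a < b by rewrite (le_lt_trans au)// (lt_le_trans uv).
  have uv0 : 0 <= v - u by rewrite subr_ge0 ltW.
  have [D2|D2] := leP (b - a) (2 * (v - u)).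
    apply: (le_trans (base a b u v au (ltW uv) vb ab baL D2)).
    by rewrite ler_wpM2r// ler_wpM2r ?powR_ge0.
  (* An interval of half the length that still contains [[u, v]]: it starts at [u] or ends at
     [b]. *)
  have [a' [aa a'u va' a'b]] : exists a', [/\ a <= a', a' <= u, v <= a' + (b - a) / 2 & a' + (b - a) / 2 <= b].
    have [h|h] := leP u (b - (b - a) / 2).
      by exists u; split; lra.
    by exists (b - (b - a) / 2); split; lra.
  set b' := a' + (b - a) / 2 in va' a'b.
  have E' : b' - a' = (b - a) / 2 by rewrite /b'; ring.
  have D0 : 0 < b - a by rewrite subr_gt0.
  have ab' : a' < b' by rewrite -subr_gt0 E' divr_gt0.
  have h1 : `|F v - F u - (F b' - F a') / (b' - a') * (v - u)| <= K * (b' - a') `^ kap * (v - u).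
    apply: IH => //; rewrite E'.
      by rewrite (le_trans _ baL)// ler_pdivrMr// ler_peMr ?(ltW D0)// ler1n.
    by rewrite ler_pdivrMr// mulrC mulrA -exprS.
  have h2 : `|F b' - F a' - (F b - F a) / (b - a) * (b' - a')| <= C * (b - a) `^ kap * (b' - a').
    by apply: base => //; rewrite ?(ltW ab')// E'; lra.
  have E : F v - F u - (F b - F a) / (b - a) * (v - u) =
     (F v - F u - (F b' - F a') / (b' - a') * (v - u)) +
     (F b' - F a' - (F b - F a) / (b - a) * (b' - a')) * ((v - u) / (b' - a')).
    by field; rewrite !gt_eqF// subr_gt0.
  rewrite E (le_trans (ler_normD _ _))// normrM [`|(v - u) / _|]ger0_norm; last first.
    by rewrite divr_ge0// E' divr_ge0// ltW.
  have r0 : 0 <= (v - u) / (b' - a') by rewrite divr_ge0// E' divr_ge0// ltW.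
  apply: (le_trans (lerD h1 (ler_wpM2r r0 h2))).
  rewrite E' [((b - a) / 2) `^ kap]powRM ?(ltW D0) ?invr_ge0// -/th -{2}KE.
  rewrite le_eqVlt; apply/orP; left; apply/eqP; field; by rewrite gt_eqF.
move=> a b u v au + vb ab baL; rewrite le_eqVlt => /orP[/eqP ->|uv].
  by rewrite !subrr !mulr0 subr0 normr0.
pose n := Num.truncn ((b - a) / (v - u)).
apply: (ind n) => //; have uv0 : 0 < v - u by rewrite subr_gt0.
rewrite -ler_pdivrMr//; apply: (@le_trans _ _ (n.+1%:R)).
  by apply: ltW; exact: truncnS_gt.
by rewrite -natrX ler_nat ltnW// ltn_expl.
Qed.

End Morrey.

#[local] Transparent co.

(** * Fields in the Sobolev-Slobodeckij class are C^1 *)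

Section SobolevRegularity.
Context {R : realType}.
Notation mu := (@lebesgue_measure R).
Implicit Types (f g Phi : curve R) (p L c : R).

Lemma ae_translate (P : R -> Prop) c : {ae mu, forall x, P x} -> {ae mu, forall x, P (x + c)}.
Proof.
move=> [N [mN N0 sub]]; exists ((fun x => 1 * x + c) @^-1` N); split.
- by rewrite -[X in measurable X]setTI; exact: (measurable_affine 1 c).
- by apply: (etrans (lebesgue_measure_affine c (oner_neq0 _) mN)); rewrite N0 mule0.
- by move=> x /= hx; apply: sub; rewrite /= mul1r.
Qed.

(** On a short window the integral identity and Lebesgue differentiation identify the derivative;
    countably many windows cover the half-line beyond [- L]. Starting before 0, it contains all
    parameters [s] and [s + w] of the one-sided seminorm. *)
Lemma derive1_eq_ae (F G : R -> R) L : 0 < L -> continuous F -> measurable_fun setT G ->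
  (forall a, mu.-integrable `[a, a + L] (EFin \o G)) ->
  (forall a b, a < b -> b - a < L -> (\int[mu]_(x in `[a, b]) (G x)%:E = (F b - F a)%:E)%E) ->
  {ae mu, forall x, - L < x -> derive1 F x = G x}.
Proof.
move=> L0 cF mG iG FTC.
have loc c : {ae mu, forall x, c < x -> x < c + L / 2 -> derive1 F x = G x}.
  pose Gc := G \_ `[c, c + L / 2].
  have sub : `[c, c + L / 2] `<=` `[c, c + L].
    by move=> x /=; rewrite !in_itv/= => /andP[-> xc] /=; rewrite (le_trans xc)// lerD2l ler_pdivrMr// ler_peMr ?(ltW L0)// ler1n.
  have iGc : mu.-integrable setT (EFin \o Gc).
    have -> : EFin \o Gc = (EFin \o G) \_ `[c, c + L / 2].
      by apply/funext => x; rewrite /Gc /= !patchE; case: ifP.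
    apply/(integrable_mkcond _ _).1 => //.
    by apply: integrableS (iG c).
  apply: ae_mono (FTC1_integrable c iGc) => x H cx xc.
  have E a b : c <= a -> a <= b -> b <= c + L / 2 -> F b - F a = \int[mu]_(t in `]a, b]) Gc t.
    move=> ca; rewrite le_eqVlt => /orP[/eqP <- _|ab bc].
      by rewrite subrr set_itv_ge ?bnd_simp// Rintegral_set0.
    rewrite /Rintegral integral_itv_obnd_cbnd; last first.
      by apply: measurable_funTS; case/integrableP: iGc.
    have -> : (\int[mu]_(x in `[a, b]) (EFin \o Gc) x = \int[mu]_(x in `[a, b]) (G x)%:E)%E.
      apply: eq_integral => y; rewrite inE/= in_itv/= => /andP[ay yb].
      by rewrite /Gc /= patchE mem_set//= in_itv/= (le_trans ca ay) (le_trans yb bc).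
    rewrite FTC// (le_lt_trans (lerB bc ca))// addrAC subrr add0r.
    by rewrite ltr_pdivrMr// ltr_pMr// ltr1n.
  have [_ ->] := derive1_primitive cx xc E (H cx).
  by rewrite /Gc patchE mem_set//= in_itv/= !ltW.
(* Windows of length [L / 2] at steps of [L / 4], so that every point is interior to one of them. *)
have := ae_foralln (fun n : nat => loc (- L + n%:R * (L / 4))).
apply: ae_mono => x h xL.
pose n := Num.truncn ((x + L) / (L / 4)).
have L4 : 0 < L / 4 by rewrite divr_gt0.
have r0 : 0 < (x + L) / (L / 4) by rewrite divr_gt0//; lra.
have /andP[n1 n2] := truncn_itv (ltW r0).
rewrite ler_pdivlMr// in n1; rewrite ltr_pdivrMr// -natr1 in n2.
rewrite -/n in n1 n2; clearbody n; case: n n1 n2 => [|n] n1 n2.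
  by apply: (h 0%N); rewrite mul0r; move: n2; rewrite add0r mul1r; lra.
move: n1 n2; rewrite -natr1 !mulrDl !mul1r => n1 n2.
by apply: (h n); lra.
Qed.

Lemma powR_le1D p (t : R) : 1 <= p -> 0 <= t -> t <= 1 + t `^ p.
Proof.
move=> p1 t0; have [t1|/ltW t1] := leP t 1; first by rewrite (le_trans t1)// lerDl powR_ge0.
by rewrite (le_trans _ (_ : t `^ p <= _)) ?lerDr// -[leLHS]powRr1// ler_powR.
Qed.

(** The components of the weak derivative are densities of those of [Phi], so [morrey_affine]
    supplies mean slopes that make [Phi] an [axis_curve], and it is C^1 like the tangent argument
    shows. The derivative equals the weak one almost everywhere and inherits its seminorm. *)
Lemma sobolev_slobodeckij_C1 p L Phi : 3 < p -> 0 < L -> continuous Phi ->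
  sobolev_slobodeckij p L Phi -> C1_slobodeckij p L Phi.
Proof.
move=> p3 L0 cPhi [g [[pPhi _ _] [pg mg Lpg] weak] fin].
have p1 : 1 < p by rewrite (lt_trans _ p3)// ltr1n.
have p0 : 0 < p := lt_trans ltr01 p1.
have mvg : forall i : nat, (i < 3)%N -> measurable_fun setT (fun x => co i (g x)).
  by move=> i _; exact: (mg (inord i)).
have meg : measurable_fun setT (fun x => enorm (g x)) by exact: measurable_enorm.
have mI (c d : R) : measurable (`[c, d]%classic : set (measurableTypeR R)) by [].
have ig i : (i < 3)%N -> mu.-integrable `[0, L] (EFin \o (fun x => co i (g x))).
  move=> i3; apply/integrableP; split; first by apply: measurable_funTS; apply/measurable_EFinP; exact: mvg.
  apply: (@le_lt_trans _ _ (\int[mu]_(x in `[0%R, L]) (1%:E + (enorm (g x) `^ p)%:E))%E).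
    apply: ge0_le_integral_any => x _; first exact: abse_ge0.
    by rewrite -EFinD lee_fin (le_trans (ler_norm_co _ i3))// powR_le1D ?(ltW p1) ?enorm_ge0.
  rewrite (ge0_integralD_itv 0 L (F := fun=> 1%:E)); first last.
  - by move=> x; rewrite lee_fin powR_ge0.
  - by move=> x; rewrite lee_fin.
  - by apply/measurable_EFinP; exact: measurable_fun_powR.
  - exact: measurable_cst.
  by rewrite lte_add_pinfty// integral_cst//= lebesgue_measure_itv/= lte_fin L0 -EFinB mul1e ltry.
have pgi i : periodic (fun x => co i (g x)) L by move=> x; rewrite pg.
have cFi i : continuous (fun x => co i (Phi x)).
  by move=> x; apply: (@continuous_comp _ _ _ Phi (@co R i)); [exact: cPhi|exact: continuous_co].
have FTC i : (i < 3)%N -> forall a b : R, a < b -> b - a < L ->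
    (\int[mu]_(x in `[a, b]) (co i (g x))%:E = (co i (Phi b) - co i (Phi a))%:E)%E.
  move=> i3; apply: (weak_derivative_FTC L0 (cFi i) _ (pgi i) (mvg i i3) (ig i i3)).
    by move=> x; rewrite pPhi.
  by move=> phi pphi sphi; exact: (weak phi pphi sphi (inord i)).
set SS := (\int[mu]_(x in `[0%R, L]) \int[mu]_(w in `[(- (L / 2))%R, (L / 2)%R]) _)%E in fin.
have SS0 : (0 <= SS)%E.
  by apply: integral_ge0 => x _; apply: integral_ge0 => w _; rewrite lee_fin divr_ge0 ?powR_ge0.
have S0 : 0 <= fine SS by exact: fine_ge0.
have hS i : (i < 3)%N -> (\int[mu]_(x in `[0%R, L]) \int[mu]_(w in `[(- (L / 2))%R, (L / 2)%R])
    ((`|co i (g (x + w)%R) - co i (g x)| `^ p) / (`|w| `^ (p - 1)))%:E <= (fine SS)%:E)%E.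
  move=> i3; rewrite fineK; last by rewrite ge0_fin_numE.
  apply: ge0_le_integral_any => x _.
    by apply: integral_ge0 => w _; rewrite lee_fin divr_ge0 ?powR_ge0.
  apply: ge0_le_integral_any => w _; rewrite lee_fin; first by rewrite divr_ge0 ?powR_ge0.
  rewrite ler_wpM2r ?invr_ge0 ?powR_ge0// ge0_ler_powR ?nnegrE ?enorm_ge0 ?(ltW p0)//.
  by rewrite -coB ler_norm_co.
have mor i (i3 : (i < 3)%N) := morrey_affine p3 L0 S0 (mvg i i3) (pgi i) (ig i i3) (FTC i i3) (hS i i3).
have [K0 K00 h0] := mor 0%N isT; have [K1 K10 h1] := mor 1%N isT; have [K2 K20 h2] := mor 2%N isT.
pose kap := (p - 3) / p; pose K := (K0 + K1 + K2) * 2 `^ kap.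
have kap0 : 0 < kap by rewrite divr_gt0// subr_gt0.
have K_0 : 0 <= K by rewrite mulr_ge0 ?powR_ge0 ?addr_ge0.
have L4 : 0 < L / 4 by rewrite divr_gt0.
have ax : axis_curve (fun=> True) kap K (L / 4) Phi.
  move=> s r r0 rL; exists ((s + r - (s - r))^-1 *: (Phi (s + r) - Phi (s - r))) => // t v h3 h4 h5.
  have ab : s - r < s + r by lra.
  have baL : s + r - (s - r) <= L / 2 by lra.
  have g0 := h0 _ _ t v h3 h4 h5 ab baL; have g1 := h1 _ _ t v h3 h4 h5 ab baL.
  have g2 := h2 _ _ t v h3 h4 h5 ab baL.
  rewrite (le_trans (enorm_le_sum _))// !coB !coZ !coB.
  have E (y w z d : R) : y - w - (v - t) * (d^-1 * z) = y - w - z / d * (v - t) by ring.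
  rewrite !E (le_trans (lerD (lerD g0 g1) g2))//.
  have -> : (s + r - (s - r)) `^ kap = 2 `^ kap * r `^ kap.
    by rewrite -powRM ?(ltW r0)//; congr (_ `^ _); ring.
  by rewrite le_eqVlt; apply/orP; left; apply/eqP; rewrite /K; ring.
have dPhi x : derivable Phi x (1 : R) by exact: (axis_derivable kap0 K_0 L4 ax).
have cPhi' : continuous (derive1 Phi) by exact: (axis_continuous_derive1 kap0 K_0 L4 ax).
suff h : (slobodeckij p L (L / 2) (derive1 Phi) < +oo)%E by exact: And4 pPhi dPhi cPhi' h.
have aei i : (i < 3)%N -> {ae mu, forall x, - L < x -> co i (derive1 Phi x) = co i (g x)}.
  move=> i3; have := derive1_eq_ae L0 (cFi i) (mvg i i3)
    (fun a => integrable_periodic a L0 (mvg i i3) (pgi i) (ig i i3)) (FTC i i3).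
  by apply: ae_mono => x h xL; rewrite -h// derive1_co.
have ae : {ae mu, forall x, - L < x -> derive1 Phi x = g x}.
  have FF := ae_filter_ringOfSetsType mu.
  apply: (@filterS3 _ _ FF _ _ _ _ _ (aei 0%N isT) (aei 1%N isT) (aei 2%N isT)) => x e0 e1 e2 xL.
  by apply: eq_vec3; [exact: e0|exact: e1|exact: e2].
apply: le_lt_trans fin; rewrite /SS /slobodeckij.
set f := derive1 Phi in cPhi' ae *.
pose k1 (z : R * R) := (enorm (f (z.1 + z.2) - f z.1) `^ p * z.2 `^ (1 - p))%:E.
pose k2 (z : R * R) := (enorm (g (z.1 + z.2) - g z.1) `^ p / `|z.2| `^ (p - 1))%:E.
have msum : measurable_fun setT (fun z : R * R => z.1 + z.2).
  by apply: measurable_funD; [exact: measurable_fst|exact: measurable_snd].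
have mdiff (h : curve R) : (forall i : nat, (i < 3)%N -> measurable_fun setT (fun x => co i (h x))) ->
    measurable_fun setT (fun z : R * R => enorm (h (z.1 + z.2) - h z.1) `^ p).
  move=> mh; apply: measurable_fun_powR; apply: measurable_enorm.
  by apply: mvecB; apply: (mvec_comp mh); [exact: msum|exact: measurable_fst].
have mk1 : measurable_fun setT k1.
  apply/measurable_EFinP; apply: measurable_funM; first exact: (mdiff f (continuous_mvec cPhi')).
  by apply: measurable_fun_powR; exact: measurable_snd.
have mk2 : measurable_fun setT k2.
  apply/measurable_EFinP; apply: measurable_funM; first exact: (mdiff g mvg).
  by apply: measurable_funV; apply: measurable_fun_powR; apply: measurable_norm_fun; exact: measurable_snd.
have k10 z : (0 <= k1 z)%E by rewrite lee_fin mulr_ge0 ?powR_ge0.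
have k20 z : (0 <= k2 z)%E by rewrite lee_fin divr_ge0 ?powR_ge0.
have i10 (x : R) : (0 <= \int[mu]_(w in `[0%R, (L / 2)%R]) k1 (x, w))%E by apply: integral_ge0.
have i20 (x : R) : (0 <= \int[mu]_(w in `[(- (L / 2))%R, (L / 2)%R]) k2 (x, w))%E by apply: integral_ge0.
have m1 : measurable_fun setT (fun x : R => \int[mu]_(w in `[0%R, (L / 2)%R]) k1 (x, w))%E.
  by apply: measurable_fun_section_integral => //; exact: mI.
have m2 : measurable_fun setT (fun x : R => \int[mu]_(w in `[(- (L / 2))%R, (L / 2)%R]) k2 (x, w))%E.
  by apply: measurable_fun_section_integral => //; exact: mI.
have L2 : 0 < L / 2 by rewrite divr_gt0.
apply: (ae_ge0_le_integral (mI 0 L) (fun x _ => i10 x) (measurable_funTS m1) (fun x _ => i20 x) (measurable_funTS m2)).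
have ae' := ae; apply: ae_mono ae => s hs; rewrite /= in_itv/= => /andP[s0 sL].
have fgs : f s = g s by apply: hs; lra.
have msec (k : R * R -> \bar R) (D : set R) : measurable_fun setT k -> measurable_fun D (fun w => k (s, w)).
  by move=> mk; apply: measurable_funTS; exact: (measurableT_comp mk (pair1_measurable s)).
apply: (@le_trans _ _ (\int[mu]_(w in `[0%R, (L / 2)%R]) k2 (s, w))%E); last first.
  apply: ge0_subset_integral => //; first exact: msec.
  by move=> w /=; rewrite !in_itv/= => /andP[w0 ->]; rewrite andbT; lra.
apply: (ae_ge0_le_integral (mI 0 (L / 2)) (fun w _ => k10 (s, w)) (msec _ _ mk1) (fun w _ => k20 (s, w)) (msec _ _ mk2)).
apply: ae_mono (ae_translate s ae') => w hw; rewrite /= in_itv/= => /andP[w0 wL].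
rewrite /k1 /k2 /= fgs (addrC s) hw; last lra.
rewrite lee_fin (ger0_norm w0) -powRN opprB.
exact: lexx.
Qed.

End SobolevRegularity.

#[local] Opaque co.

(** * Behaviour of length and energy under scaling *)

Section Scaling.
Context {R : realType}.
Notation mu := (@lebesgue_measure R).
Implicit Types (f g : curve R) (p L c : R).

Lemma derivable_scale_affine f c b x : c != 0 -> b != 0 -> derivable f (b * x) (1 : R) ->
  is_derive x (1 : R) (fun s => c *: f (b * s)) (c *: (b *: derive1 f (b * x))).
Proof.
move=> c0 b0 /derivable1_diffP df.
have db : is_derive x (1 : R) (fun s : R => b * s) b.
  by apply: is_derive_eq; rewrite /GRing.scale/= mulr1.
have dbx : differentiable (fun s : R => b * s) x by apply/derivable1_diffP; have [] := db.
have dc : differentiable (f \o (fun s => b * s)) x by exact: differentiable_comp.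
have Eb : 'd (fun s : R => b * s) x 1 = b by rewrite -deriveE//; have [_ ->] := db.
have E : 'D_1 (f \o (fun s : R => b * s)) x = b *: derive1 f (b * x).
  by rewrite (deriveE _ dc) (diff_comp dbx df) [LHS]/comp Eb (diff1E df).
have d1 : is_derive x (1 : R) (f \o (fun s : R => b * s)) (b *: derive1 f (b * x)).
  by split; [apply/derivable1_diffP|].
exact: (is_deriveZ c d1).
Qed.

(* At a point of non-differentiability [derive1] is the junk value [point = 0],
   hence the rule holds without any assumption on [f]. *)
Lemma derive1_scale_affine f c b x : c != 0 -> b != 0 ->
  derive1 (fun s => c *: f (b * s)) x = c *: (b *: derive1 f (b * x)).
Proof.
move=> c0 b0; have junk g y : ~ derivable g y (1 : R) -> derive1 g y = 0.
  move=> nd; rewrite derive1E /derive dvgP//.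
  by apply/rowP => i; rewrite !mxE.
have [d|nd] := pselect (derivable f (b * x) (1 : R)).
  by rewrite derive1E; have [_ ->] := derivable_scale_affine c0 b0 d.
rewrite (junk f _ nd) !scaler0; apply: junk => d; apply: nd.
have d' : derivable (fun s => c *: f (b * s)) (b^-1 * (b * x)) (1 : R) by rewrite mulKf.
have [] := derivable_scale_affine (invr_neq0 c0) (invr_neq0 b0) d'.
move=> h _; move: h; rewrite (_ : (fun s => _) = f)//.
by apply/funext => s; rewrite scalerA mulVf// scale1r mulVKf.
Qed.

Lemma menger_scale_affine f (c b s t g : R) : 0 < c ->
  menger_curvature (fun x => c *: f (b * x)) s t g = c^-1 * menger_curvature f (b * s) (b * t) (b * g).
Proof.
move=> c0; rewrite /menger_curvature -!scalerBr crossZl crossZr !enormZ !(gtr0_norm c0).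
move: (enorm (cross (f (b * t) - f (b * s)) (f (b * g) - f (b * s)))) (enorm (f (b * t) - f (b * s)))
  (enorm (f (b * s) - f (b * g))) (enorm (f (b * g) - f (b * t))) => n a b1 d.
rewrite (_ : c * a * (c * b1) * (c * d) = c ^+ 3 * (a * b1 * d)); last ring.
rewrite invfM !mulrA; congr (_ * _); field; by rewrite gt_eqF.
Qed.

(** The curvature contributes [c ^ (- p)] and each of the three speeds [c * b]. *)
Lemma density_scale_affine p f (c b s t g : R) : 0 < c -> 0 < b ->
  energy_density p (fun x => c *: f (b * x)) s t g =
  c `^ (3 - p) * b ^+ 3 * energy_density p f (b * s) (b * t) (b * g).
Proof.
move=> c0 b0; pose h x := c *: f (b * x).
have M : menger_curvature h s t g = c^-1 * menger_curvature f (b * s) (b * t) (b * g) := menger_scale_affine f b s t g c0.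
have E x : enorm (derive1 h x) = c * (b * enorm (derive1 f (b * x))).
  by rewrite (derive1_scale_affine f x (lt0r_neq0 c0) (lt0r_neq0 b0)) !enormZ (gtr0_norm c0) (gtr0_norm b0).
rewrite -/h /energy_density M (E s) (E t) (E g).
move: (menger_curvature_ge0 f (b * s) (b * t) (b * g)) => {M E h}.
move: (menger_curvature f (b * s) (b * t) (b * g)) (enorm (derive1 f (b * s)))
  (enorm (derive1 f (b * t))) (enorm (derive1 f (b * g))) => m d1 d2 d3 m0.
have ci : 0 <= c^-1 by rewrite invr_ge0 ltW.
have -> : c `^ (3 - p) = c ^+ 3 * c^-1 `^ p.
  rewrite powRD; last by rewrite (gt_eqF c0) implybT.
  by rewrite powR_mulrn ?(ltW c0)// -(powR_inv1 (ltW c0)) -powRrM mulN1r.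
rewrite (powRM p ci m0); move: (m `^ p) (c^-1 `^ p) => x y; ring.
Qed.

Lemma menger_integral_scale p L f c : 0 < c ->
  menger_integral p L (fun x => c *: f x) = ((c `^ (3 - p))%:E * menger_integral p L f)%E.
Proof.
move=> c0; rewrite !menger_integralE -(integral3Z L (powR_gt0 _ c0) (density_fun_ge0 p f)).
apply: eq_integral3 => s t g _ _ _; rewrite /density_fun /= -EFinM; congr EFin.
have E : (fun x => c *: f x) = (fun x => c *: f (1 * x)) by apply/funext => x; rewrite mul1r.
by rewrite E (density_scale_affine p f s t g c0 ltr01) !mul1r expr1n mulr1.
Qed.

(** The rescaling that preserves arclength parametrization; the three factors [c^-1] from the inner
    dilation are used up by the substitutions. *)
Lemma menger_integral_dilation p L f c : 0 < c -> 0 < L ->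
  menger_integral p (c * L) (fun x => c *: f (c^-1 * x)) = ((c `^ (3 - p))%:E * menger_integral p L f)%E.
Proof.
move=> c0 L0; have ci0 : 0 < c^-1 by rewrite invr_gt0.
have key (F : R -> \bar R) : (forall x, 0 <= F x)%E ->
    (\int[mu]_(x in `[0%R, (c * L)%R]) (c^-1%:E * F (c^-1 * x)%R) = \int[mu]_(x in `[0%R, L]) F x)%E.
  move=> F0; rewrite (ge0_integralZl_any _ ci0); last by move=> x _; exact: F0.
  have := @ge0_integral_preimage_affine R `[0, L]%classic F c^-1 0 (lt0r_neq0 ci0) F0.
  rewrite (gtr0_norm ci0) invrK => E.
  have -> : (\int[mu]_(x in `[0%R, (c * L)%R]) F (c^-1 * x)%R = c%:E * \int[mu]_(x in `[0%R, L]) F x)%E.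
    rewrite -E (_ : `[0%R, (c * L)%R]%classic = (fun x => c^-1 * x + 0) @^-1` `[0, L]).
      by apply: eq_integral => x _; rewrite addr0.
    apply/seteqP; split => x /=; rewrite !in_itv/= addr0 (pmulr_rge0 _ ci0) (ler_pdivrMl _ _ c0) => xI; exact: xI.
  by rewrite muleA -EFinM mulVf ?gt_eqF// mul1e.
rewrite !menger_integralE -(integral3Z L (powR_gt0 _ c0) (density_fun_ge0 p f)).
pose D z := ((c `^ (3 - p))%:E * density_fun p f z)%E.
have D0 z : (0 <= D z)%E by apply: mule_ge0; [rewrite lee_fin powR_ge0|exact: density_fun_ge0].
have m0 (x : \bar R) : (0 <= x)%E -> (0 <= c^-1%:E * x)%E by move=> x0; apply: mule_ge0 => //; rewrite lee_fin ltW.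
have E (s t g : R) : density_fun p (fun x => c *: f (c^-1 * x)) (s, t, g) =
    (c^-1%:E * (c^-1%:E * (c^-1%:E * D (c^-1 * s, c^-1 * t, c^-1 * g)%R)))%E.
  rewrite /D /density_fun /= -!EFinM; congr EFin; rewrite (density_scale_affine p f s t g c0 ci0); ring.
rewrite /integral3.
under eq_integral => s _.
  under eq_integral => t _.
    under eq_integral => g _ do rewrite E.
    rewrite (ge0_integralZl_any _ ci0); last by move=> g _; exact: (m0 _ (m0 _ (D0 _))).
    rewrite (ge0_integralZl_any _ ci0); last by move=> g _; exact: (m0 _ (D0 _)).
    rewrite (key (fun u : R => D (c^-1 * s, c^-1 * t, u)%R) (fun u : R => D0 _)).
    over.
  rewrite (ge0_integralZl_any _ ci0); last first.
    by move=> t _; apply: (m0); apply: integral_ge0 => g _; exact: D0.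
  rewrite (key (fun t : R => \int[mu]_(u in `[0%R, L]) D (c^-1 * s, t, u)%R))%E; last by move=> t; apply: integral_ge0 => g _; exact: D0.
  over.
rewrite (key (fun s : R => \int[mu]_(t in `[0%R, L]) \int[mu]_(u in `[0%R, L]) D (s, t, u)))%E; first by [].
by move=> s; do 2 (apply: integral_ge0 => ? _); exact: D0.
Qed.

Lemma simple_closed_curve_scale L f c : c != 0 -> simple_closed_curve L f ->
  simple_closed_curve L (fun x => c *: f x).
Proof.
move=> c0 [cf pf inj]; split.
- by move=> x; apply: continuousZl_tmp; exact: cf.
- by move=> x; rewrite pf.
- by move=> u v uI vI /(scalerI c0); exact: inj.
Qed.

Lemma abs_continuous_scale a b f c : c != 0 -> abs_continuous a b f -> abs_continuous a b (fun x => c *: f x).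
Proof.
move=> c0 af e e0; have c0' : 0 < `|c| by rewrite normr_gt0.
have [d d0 hd] := af (e / `|c|) (divr_gt0 e0 c0'); exists d => // n u v uv tr sd.
have := hd n u v uv tr sd; rewrite ltr_pdivlMr// mulr_suml; apply: le_lt_trans.
by apply: ler_sum => i _; rewrite -scalerBr enormZ mulrC.
Qed.

Lemma regular_scale L f c : c != 0 -> regular L f -> regular L (fun x => c *: f x).
Proof.
move=> c0 [C C0 h]; have c0' : 0 < `|c| by rewrite normr_gt0.
exists (`|c| * C); first exact: mulr_gt0.
apply: ae_mono h => x h xL.
have := derive1_scale_affine f x c0 (oner_neq0 R); rewrite mul1r scale1r => E.
rewrite (_ : (fun x => c *: f x) = (fun s => c *: f (1 * s))); last by apply/funext => s; rewrite mul1r.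
by rewrite E enormZ ler_pM2l// h.
Qed.

(** The condition that selects the direct formula in [menger_energy]. It is invariant under scaling,
    so a curve and its multiples are evaluated by the same formula. *)
Definition energy_branch L f := [/\ simple_closed_curve L f, abs_continuous 0 L f & regular L f].

Lemma menger_energy_branch p L f : energy_branch L f -> menger_energy p L f = menger_integral p L f.
Proof. by move=> h; rewrite /menger_energy (asboolT h). Qed.

Lemma menger_energy_arclength p L f : ~ energy_branch L f ->
  menger_energy p L f = menger_integral p (fine (closed_length L f)) (arclength_param L f).
Proof. by move=> h; rewrite /menger_energy (asboolF h). Qed.

Lemma energy_branch_scale L f c : c != 0 -> energy_branch L f -> energy_branch L (fun x => c *: f x).
Proof.
by move=> c0 [h1 h2 h3]; split; [exact: simple_closed_curve_scale|exact: abs_continuous_scale|exact: regular_scale].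
Qed.

Lemma closed_length_gt0 L f : 0 < L -> simple_closed_curve L f -> (0 < closed_length L f)%E.
Proof.
move=> L0 [_ _ inj]; have L2 : 0 < L / 2 by rewrite divr_gt0.
have LL : L / 2 < L by rewrite ltr_pdivrMr// ltr_pMr// ltr1n.
rewrite /closed_length (curve_lengthD f (ltW L2) (ltW LL)).
apply: (@lt_le_trans _ _ (enorm (f (L / 2) - f 0))%:E).
  rewrite lte_fin enorm_gt0 subr_eq0; apply/eqP => E.
  have := inj _ _ _ _ E; rewrite !in_itv/= lexx L0 LL (ltW L2) => /(_ isT isT) h.
  by move: L2; rewrite h ltxx.
apply: (le_trans (enorm_le_length f (ltW L2))).
by rewrite leeDl// curve_length_ge0// ltW.
Qed.

Lemma arclength_param_scale L f c : 0 < c -> 0 < L -> simple_closed_curve L f ->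
  (closed_length L f < +oo)%E ->
  arclength_param L (fun x => c *: f x) = (fun s => c *: arclength_param L f (c^-1 * s)).
Proof.
move=> c0 L0 scc lf; have [cf pf _] := scc.
have [cf' pf' _] := simple_closed_curve_scale (lt0r_neq0 c0) scc.
have l0 := closed_length_gt0 L0 scc.
have l1 : 0 < fine (closed_length L f) by apply: fine_gt0; rewrite l0.
have lE : closed_length L (fun x => c *: f x) = (c%:E * closed_length L f)%E by exact: curve_lengthZ.
have lfin : closed_length L f \is a fin_num by rewrite ge0_fin_numE// ltW.
have lf' : (closed_length L (fun x => c *: f x) < +oo)%E.
  by rewrite lE -(fineK lfin) -EFinM ltry.
have l1' : 0 < fine (closed_length L (fun x => c *: f x)).
  by rewrite lE -(fineK lfin) -EFinM /= mulr_gt0.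
have [h1 h2] := arclength_paramP L0 cf lf pf l1.
apply: (arclength_param_unique L0 cf' lf' pf' l1'); split.
  move=> x; rewrite lE -[in x + _](fineK lfin) -EFinM /= mulrDr mulKf ?gt_eqF//.
  by rewrite h1.
move=> t tI; rewrite curve_lengthZ//.
have tI' := tI; rewrite in_itv/= in tI'; have /andP[t0 tL] := tI'.
have fint := curve_length_fin L0 lf (lexx 0) t0 tL.
by rewrite -(fineK fint) -EFinM /= mulKf ?gt_eqF// h2.
Qed.

Lemma menger_energy_scale p L f c : 0 < c -> 0 < L -> simple_closed_curve L f ->
  (closed_length L f < +oo)%E ->
  menger_energy p L (fun x => c *: f x) = ((c `^ (3 - p))%:E * menger_energy p L f)%E.
Proof.
move=> c0 L0 scc lf; have cn0 := lt0r_neq0 c0.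
pose cf x := c *: f x.
have [h|nh] := pselect (energy_branch L f).
  rewrite (menger_energy_branch p h) (menger_energy_branch p (energy_branch_scale cn0 h)).
  exact: menger_integral_scale.
have nh' : ~ energy_branch L cf.
  move=> h; apply: nh; have := energy_branch_scale (invr_neq0 cn0) h.
  by rewrite (_ : (fun x => c^-1 *: cf x) = f)//; apply/funext => x; rewrite /cf scalerA mulVf// scale1r.
rewrite (menger_energy_arclength p nh) (menger_energy_arclength p nh') /cf.
have l0 := closed_length_gt0 L0 scc.
have l1 : 0 < fine (closed_length L f) by apply: fine_gt0; rewrite l0.
have lfin : closed_length L f \is a fin_num by rewrite ge0_fin_numE// ltW.
rewrite (arclength_param_scale c0 L0 scc lf) -(menger_integral_dilation p (arclength_param L f) c0 l1).
congr (menger_integral _ _ _); rewrite /closed_length curve_lengthZ// -[X in (_ * X)%E](fineK lfin).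
by rewrite -EFinM.
Qed.

End Scaling.

#[local] Transparent co.

(** * Ambient isotopies obtained from Lipschitz fields *)

Section Isotopy.
Context {R : realType}.
Implicit Types (v : 'rV[R]_3 -> 'rV[R]_3) (m : R).

Lemma enorm_near (y : 'rV[R]_3) (e : R) : 0 < e -> \forall z \near y, enorm (z - y) < e.
Proof.
move=> e0; apply/nbhs_ballP; exists (e / 4) => /=; first by rewrite divr_gt0.
move=> z; rewrite -ball_normE/= => h; rewrite (le_lt_trans (enorm_le_normr _))// distrC.
by rewrite (@lt_trans _ _ (3 * (e / 4)))//; [rewrite ltr_pM2l|lra].
Qed.

Definition shear v (w : 'rV[R]_3 * R) : 'rV[R]_3 * R := (w.1 + w.2 *: v w.1, w.2).

(** Continuity of the inverse of [shear v] on its image, phrased for all preimages because the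
    inverse is only chosen later. The lower bound [m] controls points by their images at equal
    times; a time difference below [d] costs at most [m * e / 2]. *)
Lemma shear_proximity v m (w0 : 'rV[R]_3 * R) (U : set ('rV[R]_3 * R)) : 0 < m ->
  (forall (t : R) y z, 0 <= t <= 1 -> m * enorm (y - z) <= enorm (y - z + t *: (v y - v z))) ->
  nbhs w0 U -> nbhs (shear v w0) [set z | forall w : 'rV[R]_3 * R, 0 <= w.2 <= 1 -> shear v w = z -> U w].
Proof.
move=> m0 hm [[U1 U2] /= [nU1 nU2] hU].
move: nU1 => /nbhs_ballP[e /= e0 he].
pose d := m * e / (2 * (1 + enorm (v w0.1))).
have B0 : 0 < 1 + enorm (v w0.1) by rewrite ltr_wpDr ?enorm_ge0.
have d0 : 0 < d by rewrite !divr_gt0 ?mulr_gt0.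
have me : 0 < m * e / 2 by rewrite divr_gt0 ?mulr_gt0.
exists ([set z | enorm (z - (shear v w0).1) < m * e / 2], U2 `&` [set t | `|w0.2 - t| < d]).
  split; first exact: enorm_near.
  by apply: filterI => //=; apply/nbhs_ballP; exists d => //= t; rewrite -ball_normE.
move=> z /= [h1 [h2 h3]] [y t] /= t01 E; apply: hU; split => /=; last by move: h2; rewrite -E.
apply: he; rewrite -ball_normE/= (le_lt_trans (normr_le_enorm _))//.
move: h1 h3; rewrite -E /shear/= => h1 h3.
have h4 := hm t w0.1 y t01.
rewrite -(ltr_pM2l m0); apply: (le_lt_trans h4).
have -> : w0.1 - y + t *: (v w0.1 - v y) = - (y + t *: v y - (w0.1 + w0.2 *: v w0.1)) - (w0.2 - t) *: v w0.1.
  by apply: eq_vec3; rewrite !coE; ring.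
rewrite (le_lt_trans (ler_enormB _ _))// enormN enormZ.
have h5 : `|w0.2 - t| * enorm (v w0.1) <= m * e / 2.
  apply: (@le_trans _ _ (d * (1 + enorm (v w0.1)))).
    by apply: ler_pM => //; [exact: enorm_ge0|exact: ltW|rewrite lerDr].
  by rewrite /d le_eqVlt; apply/orP; left; apply/eqP; field; rewrite gt_eqF.
rewrite (lt_le_trans (ltr_leD h1 h5))//; lra.
Qed.

Lemma continuous_shear v (Lam : R) : (forall y z, enorm (v y - v z) <= Lam * enorm (y - z)) ->
  continuous (shear v).
Proof.
move=> lv w.
have cv : continuous v.
  move=> y; apply/(@enorm_cvgP R _ _ (nbhs_filter y)); apply/(@cvgr0Pnorm_lt R R _ (nbhs y) (nbhs_filter y)) => e e0.
  have L0 : 0 < 1 + `|Lam| by rewrite ltr_wpDr.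
  apply: filterS (enorm_near y (divr_gt0 e0 L0)) => z; rewrite ltr_pdivlMr// => h.
  rewrite ger0_norm ?enorm_ge0// (le_lt_trans (lv z y))// (le_lt_trans _ h)// mulrC.
  by rewrite ler_wpM2l ?enorm_ge0// (le_trans (ler_norm _))// lerDr.
have c1 : {for w, continuous (fun w : 'rV[R]_3 * R => w.1)} by exact: cvg_fst.
have c2 : {for w, continuous (fun w : 'rV[R]_3 * R => w.2)} by exact: cvg_snd.
have c3 : {for w, continuous (fun w : 'rV[R]_3 * R => v w.1)}.
  by apply: (@continuous_comp _ _ _ (fun w : 'rV[R]_3 * R => w.1) v); [exact: c1|exact: cv].
have c4 : {for w, continuous (fun w : 'rV[R]_3 * R => w.2 *: v w.1)}.
  exact: (@cvgZ R 'rV[R]_3 _ _ _ (fun w : 'rV[R]_3 * R => w.2) (fun w : 'rV[R]_3 * R => v w.1) _ _ c2 c3).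
have c5 : {for w, continuous (fun w : 'rV[R]_3 * R => w.1 + w.2 *: v w.1)}.
  exact: (@cvgD _ 'rV[R]_3 _ _ _ (fun w : 'rV[R]_3 * R => w.1) (fun w : 'rV[R]_3 * R => w.2 *: v w.1) _ _ c1 c4).
exact: (cvg_pair c5 c2).
Qed.

(* The isotopy h_t is followed by y |-> y + t v(y), a homeomorphism onto its image for every t. *)
Lemma ambient_isotopic_shear v (Lam : R) m (f0 f : curve R) : 0 < m ->
  (forall y z, enorm (v y - v z) <= Lam * enorm (y - z)) ->
  (forall (t : R) y z, 0 <= t <= 1 -> m * enorm (y - z) <= enorm (y - z + t *: (v y - v z))) ->
  ambient_isotopic f0 f -> ambient_isotopic f0 (fun x => f x + v (f x)).
Proof.
move=> m0 lv hm [h [[cH [G [cG GK]]] h0 ->]].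
pose A := (setT `*` `[0, 1] : set ('rV[R]_3 * R)).
pose H (yt : 'rV[R]_3 * R) := (h yt.2 yt.1, yt.2).
have inj (w w' : 'rV[R]_3 * R) : 0 <= w.2 <= 1 -> shear v w = shear v w' -> w = w'.
  move: w w' => [y t] [y' t'] /= t01 [E tt']; rewrite -tt' in E *; congr pair.
  apply/eqP; rewrite -subr_eq0 -enorm_eq0 eq_le enorm_ge0 andbT -(pmulr_rle0 _ m0).
  apply: (le_trans (hm t y y' t01)).
  have -> : y - y' + t *: (v y - v y') = y + t *: v y - (y' + t *: v y').
    by apply: eq_vec3; rewrite !coE; ring.
  by rewrite E subrr enorm0.
(* A right inverse of the shear on its image, arbitrary elsewhere; injectivity makes it a left
   inverse for times in [[0, 1]]. *)
have /choice[S hS] (z : 'rV[R]_3 * R) : exists w : 'rV[R]_3 * R,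
    (exists2 w' : 'rV[R]_3 * R, 0 <= w'.2 <= 1 & shear v w' = z) -> 0 <= w.2 <= 1 /\ shear v w = z.
  have [[w h1 h2]|nw] := pselect (exists2 w' : 'rV[R]_3 * R, 0 <= w'.2 <= 1 & shear v w' = z).
    by exists w.
  by exists (0, 0) => /nw.
have SK w : 0 <= w.2 <= 1 -> S (shear v w) = w.
  move=> w01; have [|h1 h2] := hS (shear v w); first by exists w.
  exact: inj.
exists (fun t y => h t y + t *: v (h t y)); split.
- have HE : (fun yt : 'rV[R]_3 * R => (h yt.2 yt.1 + yt.2 *: v (h yt.2 yt.1), yt.2)) = shear v \o H by [].
  rewrite HE; have AI w : A w -> 0 <= (H w).2 <= 1 by move=> [_]; rewrite /= in_itv.
  split.
    apply/subspace_continuousP => w Aw.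
    have cw := (subspace_continuousP A H).1 cH w Aw.
    exact: (cvg_comp _ _ cw (continuous_shear lv (x := H w))).
  exists (G \o S); split; last first.
    by move=> w Aw; rewrite /= SK; [exact: GK|exact: AI].
  apply/subspace_continuousP => _ [w Aw <-] /=.
  have E0 : (G \o S) (shear v (H w)) = G (H w) by rewrite /= (SK _ (AI w Aw)).
  move=> V nV'; have {nV'}nV : nbhs (G (H w)) V by rewrite -E0; exact: nV'.
  have := (subspace_continuousP (H @` A) G).1 cG (H w) (ex_intro2 _ _ w Aw erefl) V nV.
  rewrite /= => nU; have := shear_proximity m0 hm nU.
  move=> nZ; rewrite /within/=; apply: filterS nZ => z hz [w' Aw' zE].
  have E1 : S z = H w' by rewrite -zE SK//; exact: AI.
  change (V (G (S z))); rewrite E1; apply: (hz (H w') (AI w' Aw') zE).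
  by exists w'.
- by apply/funext => y; rewrite scale0r addr0 h0.
- by apply/funext => x; rewrite /= scale1r.
Qed.

(** Scaling is the shear with [v y = (c - 1) *: y], whose factor [1 + t * (c - 1)] stays above the
    smaller of 1 and [c]. *)
Lemma ambient_isotopic_scale (c : R) (f0 f : curve R) : 0 < c -> ambient_isotopic f0 f ->
  ambient_isotopic f0 (fun x => c *: f x).
Proof.
move=> c0 iso; pose v (y : 'rV[R]_3) := (c - 1) *: y.
have -> : (fun x => c *: f x) = (fun x => f x + v (f x)).
  by apply/funext => x; rewrite /v; apply: eq_vec3; rewrite !coE; ring.
apply: (@ambient_isotopic_shear v `|c - 1| (Num.min 1 c)) iso.
- by rewrite lt_min ltr01.
- by move=> y z; rewrite /v -scalerBr enormZ.
- move=> t y z /andP[t0 t1].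
  have -> : y - z + t *: (v y - v z) = (1 + t * (c - 1)) *: (y - z).
    by apply: eq_vec3; rewrite /v !coE; ring.
  rewrite enormZ ler_wpM2r ?enorm_ge0// (le_trans _ (ler_norm _))//.
  have [h|h] := leP 1 c.
    by rewrite lerDl mulr_ge0// subr_ge0.
  have : (1 - t) * (1 - c) >= 0 by rewrite mulr_ge0// subr_ge0// ltW.
  by lra.
Qed.

(* McShane extension of [Phi \o f^-1], coordinatewise. *)
Lemma lipschitz_extension (f Phi : curve R) (Lam B : R) : 0 <= Lam -> (forall s, enorm (Phi s) <= B) ->
  (forall s t, enorm (Phi s - Phi t) <= Lam * enorm (f s - f t)) ->
  exists2 v : 'rV[R]_3 -> 'rV[R]_3, forall s, v (f s) = Phi s &
    forall y z, enorm (v y - v z) <= 3 * Lam * enorm (y - z).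
Proof.
move=> Lam0 bP lP.
pose E i y := [set co i (Phi s) + Lam * enorm (y - f s) | s in [set: R]].
have lb i y : (i < 3)%N -> has_inf (E i y).
  move=> i3; split; first by exists (co i (Phi 0) + Lam * enorm (y - f 0)); exists 0.
  exists (- B) => _ [s _ <-]; rewrite -[leLHS]addr0 lerD ?mulr_ge0 ?enorm_ge0//.
  by have := le_trans (ler_norm_co (Phi s) i3) (bP s); rewrite ler_norml => /andP[].
pose v (y : 'rV[R]_3) : 'rV[R]_3 := \row_(j < 3) inf (E j y).
have coV i y : (i < 3)%N -> co i (v y) = inf (E i y).
  by move=> i3; rewrite /co /v mxE inordK.
have vf i s : (i < 3)%N -> inf (E i (f s)) = co i (Phi s).
  move=> i3; apply/eqP; rewrite eq_le; apply/andP; split.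
    apply: ge_inf; first by case: (lb i (f s) i3).
    by exists s => //; rewrite subrr enorm0 mulr0 addr0.
  apply: lb_le_inf; first by case: (lb i (f s) i3).
  move=> _ [t _ <-]; rewrite -lerBlDl (le_trans (ler_norm _))// -coB.
  by rewrite (le_trans (ler_norm_co _ i3)).
have one i y z : (i < 3)%N -> inf (E i y) - inf (E i z) <= Lam * enorm (y - z).
  move=> i3; rewrite lerBlDr -lerBlDl; apply: lb_le_inf; first by case: (lb i z i3).
  move=> _ [t _ <-]; rewrite lerBlDl.
  apply: (@le_trans _ _ (co i (Phi t) + Lam * enorm (y - f t))).
    by apply: ge_inf; [case: (lb i y i3)|exists t].
  rewrite addrCA lerD2l -mulrDr ler_wpM2l//; exact: enorm_triangle.
exists v.
  by move=> s; apply: eq_vec3; rewrite coV// vf.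
move=> y z; rewrite (le_trans (enorm_le_sum _))// !coB !coV//.
have ab i : (i < 3)%N -> `|inf (E i y) - inf (E i z)| <= Lam * enorm (y - z).
  move=> i3; rewrite ler_norml one// andbT lerNl opprB enormBC; exact: one.
rewrite (le_trans (lerD (lerD (ab 0%N isT) (ab 1%N isT)) (ab 2%N isT)))//.
by rewrite le_eqVlt; apply/orP; left; apply/eqP; ring.
Qed.

End Isotopy.

#[local] Opaque co.

(** * Positivity of the energy, length of perturbations, weighted AM-GM *)

Section EnergyOfPerturbations.
Context {R : realType}.
Notation mu := (@lebesgue_measure R).
Implicit Types (f Phi : curve R) (p L : R).

(** The argument of [flat_triple] read as a lower bound: around a triple that is not collinear there
    is a cube of triples whose curvature is bounded below. *)
Lemma menger_integral_gt0_noncollinear p L f s t g : 3 < p -> 0 < L -> by_arclength f ->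
  0 <= s <= L -> 0 <= t <= L -> 0 <= g <= L -> cross (f t - f s) (f g - f s) != 0 ->
  (0 < menger_integral p L f)%E.
Proof.
move=> p3 L0 arc sI tI gI; rewrite -enorm_gt0 => a0; set a := enorm _ in a0.
have lipL u v : 0 <= u <= L -> 0 <= v <= L -> enorm (f u - f v) <= L.
  move=> /andP[u0 uL] /andP[v0 vL]; rewrite (le_trans (by_arclength_lip _ _ arc))//.
  by rewrite ler_norml; apply/andP; split; move: u0 uL v0 vL; lra.
pose e := a / (16 * L).
have e0 : 0 < e by rewrite divr_gt0// mulr_gt0.
have ad : a <= L ^+ 2.
  by rewrite (le_trans (enorm_cross_le _ _))// expr2 ler_pM ?enorm_ge0 ?lipL.
have ed : e <= L / 16.
  by rewrite /e ler_pdivrMr ?mulr_gt0// (_ : L / 16 * (16 * L) = L ^+ 2)//; field.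
have eL : 0 <= e <= L / 2 by rewrite ltW//=; move: ed L0; lra.
have [u1 [u10 u1L u1P]] := itv_near_point sI eL.
have [u2 [u20 u2L u2P]] := itv_near_point tI eL.
have [u3 [u30 u3L u3P]] := itv_near_point gI eL.
have ea : 16 * (e * L) = a by rewrite /e; field; exact: lt0r_neq0.
have key s' t' g' : u1 <= s' <= u1 + e -> u2 <= t' <= u2 + e -> u3 <= g' <= u3 + e ->
    a / (8 * L ^+ 3) <= menger_curvature f s' t' g'.
  move=> /u1P hs /u2P ht /u3P hg.
  have fs : enorm (f s' - f s) <= e by rewrite (le_trans (by_arclength_lip _ _ arc)).
  have ft : enorm (f t' - f t) <= e by rewrite (le_trans (by_arclength_lip _ _ arc)).
  have fg : enorm (f g' - f g) <= e by rewrite (le_trans (by_arclength_lip _ _ arc)).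
  exact: (menger_curvature_ge_perturb e0 L0 ed ea fs ft fg (lipL _ _ tI sI) (lipL _ _ gI sI) (lipL _ _ gI tI)).
have L30 : 0 < L ^+ 3 by rewrite exprn_gt0.
have k0 : 0 < a / (8 * L ^+ 3) by rewrite divr_gt0// mulr_gt0.
have h := menger_integral_ge_box p3 L0 arc u10 u20 u30 (ltW e0) u1L u2L u3L (ltW k0) key.
apply: (lt_le_trans _ h).
by rewrite lte_fin mulr_gt0 ?powR_gt0 ?exprn_gt0.
Qed.

(* If all triples were collinear then f would run on a line, where a closed
   C^1 curve must have a vanishing derivative. *)
Lemma menger_integral_gt0 p L f : 3 < p -> 0 < L -> by_arclength f -> regular_embedding L f ->
  (0 < menger_integral p L f)%E.
Proof.
move=> p3 L0 arc [[_ pf inj] df _ f'0].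
have [[s [sI c0]]|col] := pselect (exists s, 0 <= s <= L /\ cross (f (L / 2) - f 0) (f s - f 0) != 0).
  apply: (@menger_integral_gt0_noncollinear p L f 0 (L / 2) s p3 L0 arc _ _ sI c0).
    by rewrite lexx ltW.
  by apply/andP; split; lra.
exfalso; set w := f (L / 2) - f 0 in col.
have w0 : w != 0.
  rewrite subr_eq0; apply/eqP => E; have := inj _ _ _ _ E; rewrite !in_itv/= lexx L0.
  have h1 : 0 <= L / 2 by lra.
  have h2 : L / 2 < L by lra.
  by rewrite h1 h2 => /(_ isT isT) h; move: h1 h2; rewrite h => _; rewrite -h; lra.
have cr s : cross w (f s - f 0) = 0.
  have [n /andP[n0 nL]] := floor_reduce s L0; rewrite -(periodic_intP n s pf).
  apply/eqP; apply/negPn/negP => c0; apply: col; exists (s + n%:~R * L).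
  by rewrite n0 ltW.
pose phi z (x : R) := dot (f (0 + 1 * x)) z.
have dphi z (x : R) : is_derive x (1 : R) (phi z) (1 * dot (derive1 f (0 + 1 * x)) z).
  exact: (@is_derive_dot_affine R f z 0 1 x df).
(* Rolle's theorem for the component along [w]: at [c] the derivative is orthogonal to [w], whereas
   a curve on a line has its derivative parallel to [w]. *)
have [c _ hc] : exists2 c, c \in `]0, L[ & 0 = 1 * dot (derive1 f (0 + 1 * c)) w.
  have cphi : {within `[0, L], continuous (phi w)}.
    by apply: derivable_within_continuous => x _; have [] := dphi w x.
  have [c cI] := MVT L0 (fun x _ => dphi w x) cphi.
  have -> : phi w L - phi w 0 = 0 by rewrite /phi !mul1r !add0r -{1}[L]add0r pf subrr.
  move=> /esym/eqP; rewrite mulf_eq0 subr0 (gt_eqF L0) orbF => /eqP h.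
  by exists c.
rewrite !mul1r add0r in hc.
have dw : cross (derive1 f c) w = 0.
  apply/eqP; rewrite -enorm_eq0 -sqrf_eq0 sqr_enorm.
  set z := cross (derive1 f c) w.
  have E0 x : phi (cross w z) x = phi (cross w z) 0.
    rewrite /phi !mul1r !add0r; apply/eqP; rewrite -subr_eq0 -dotBl.
    have -> : dot (f x - f 0) (cross w z) = - dot (cross w (f x - f 0)) z by rewrite !coE; ring.
    by rewrite cr (_ : dot 0 z = 0) ?oppr0// !coE; ring.
  have -> : dot z z = dot (derive1 f c) (cross w z) by rewrite {1}/z !coE; ring.
  have [_ ] := dphi (cross w z) c; rewrite !mul1r add0r => <-.
  rewrite (_ : phi (cross w z) = cst (phi (cross w z) 0)); last by apply/funext => x; exact: E0.
  by have [_ ->] := is_derive_cst (phi (cross w z) 0) c (1 : R).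
have := lagrange (derive1 f c) w; rewrite dw -hc enorm0 expr0n /= subr0 => /esym/eqP.
by rewrite mulf_eq0 !sqrf_eq0 !enorm_eq0 (negbTE (f'0 c)) (negbTE w0).
Qed.

Lemma sqr_enorm_axpy (u w : 'rV[R]_3) (tau : R) :
  enorm (u + tau *: w) ^+ 2 = enorm u ^+ 2 + 2 * (tau * dot u w) + tau ^+ 2 * enorm w ^+ 2.
Proof. by rewrite !sqr_enorm !coE; ring. Qed.

(** The perturbed velocity [v] satisfies [|v| <= (1 + |v| ^ 2) / 2], and [|v| ^ 2] is a quadratic
    polynomial in [tau]. The coefficient [h] does not depend on the sign of [tau], so it cancels
    when the bounds for [tau] and [- tau] are added. *)
Lemma perturb_length L f Phi : 0 < L -> (forall x, derivable f x (1 : R)) -> continuous (derive1 f) ->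
  (forall x, enorm (derive1 f x) = 1) -> periodic Phi L -> (forall x, derivable Phi x (1 : R)) ->
  continuous (derive1 Phi) -> exists h B, 0 <= B /\ forall tau,
    (closed_length L (perturb f Phi tau) <= (L + tau * h + tau ^+ 2 * B)%:E)%E.
Proof.
move=> L0 df cf' f1 pP dP cP'.
have [M M0 hM] := periodic_bounded L0 cP' (derive1_periodic pP).
pose k x := dot (derive1 f x) (derive1 Phi x).
have ck : continuous k.
  pose F (i : nat) (x : R) := co i (derive1 f x); pose G (i : nat) (x : R) := co i (derive1 Phi x).
  have cF i : continuous (F i).
    by move=> x; apply: (@continuous_comp _ _ _ (derive1 f) (@co R i)); [exact: cf'|exact: continuous_co].
  have cG i : continuous (G i).
    by move=> x; apply: (@continuous_comp _ _ _ (derive1 Phi) (@co R i)); [exact: cP'|exact: continuous_co].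
  have -> : k = (fun x => F 0%N x * G 0%N x + F 1%N x * G 1%N x + F 2%N x * G 2%N x).
    by apply/funext => x; rewrite /k dotE.
  clearbody F G => x.
  have cM i : {for x, continuous (fun x => F i x * G i x)} by apply: cvgM; [exact: cF|exact: cG].
  by apply: cvgD; [apply: cvgD|]; exact: cM.
have [H dH] := global_primitive ck.
exists (H L - H 0), (M ^+ 2 / 2 * L); split.
  by rewrite mulr_ge0 ?(ltW L0)// divr_ge0// sqr_ge0.
move=> tau; pose G x := x + tau * H x + tau ^+ 2 * (M ^+ 2 / 2) * x.
have dG (x : R) : - 1 < x -> is_derive x (1 : R) G (1 + tau * k x + tau ^+ 2 * (M ^+ 2 / 2)).
  by move=> _; have h := dH x; rewrite /G; apply: is_derive_eq; rewrite /GRing.scale/=; ring.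
have bd x : enorm (derive1 (perturb f Phi tau) x) <= 1 + tau * k x + tau ^+ 2 * (M ^+ 2 / 2).
  rewrite (derive1_perturb tau (df x) (dP x)).
  set v := derive1 f x + tau *: derive1 Phi x.
  have E : enorm v ^+ 2 = enorm (derive1 f x) ^+ 2 + 2 * (tau * k x) + tau ^+ 2 * enorm (derive1 Phi x) ^+ 2.
    exact: sqr_enorm_axpy.
  rewrite f1 expr1n in E.
  have h1 : tau ^+ 2 * enorm (derive1 Phi x) ^+ 2 <= tau ^+ 2 * M ^+ 2.
    by rewrite ler_wpM2l ?sqr_ge0// lerXn2r ?nnegrE ?enorm_ge0// ltW.
  have h2 : 0 <= (enorm v - 1) ^+ 2 by rewrite sqr_ge0.
  rewrite sqrrB1 E mulr2n in h2; move: h1 h2.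
  have -> : tau ^+ 2 * (M ^+ 2 / 2) = tau ^+ 2 * M ^+ 2 / 2 by rewrite mulrA.
  move: (tau ^+ 2 * enorm (derive1 Phi x) ^+ 2) (enorm v) (tau * k x) (tau ^+ 2 * M ^+ 2) => q1 q2 q3 q4.
  by lra.
have N10 : - 1 < 0 :> R by rewrite oppr_lt0.
have dp x : derivable (perturb f Phi tau) x (1 : R) by exact: derivable_perturb.
apply: (le_trans (curve_length_primitive L dp dG bd N10)).
rewrite lee_fin /G le_eqVlt; apply/orP; left; apply/eqP; ring.
Qed.

(** With [y] the left side, [1 + ln t <= t] is applied to [a / y], [b / y] and [1 / y] with the
    weights [al], [be] and [1 - al - be]; the logarithms cancel by the choice of [y]. *)
Lemma weighted_amgm (al be a b : R) : 0 < al -> 0 < be -> al + be <= 1 -> 0 <= a -> 0 <= b ->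
  a `^ al * b `^ be <= al * a + be * b + (1 - al - be).
Proof.
move=> al0 be0 s1 a0 b0.
have r0 : 0 <= al * a + be * b + (1 - al - be).
  apply: addr_ge0; last by lra.
  by apply: addr_ge0; apply: mulr_ge0 => //; exact: ltW.
move: a0 r0; rewrite le_eqVlt => /orP[/eqP <- r0|a0].
  by rewrite powR0 ?gt_eqF// mul0r.
move: b0; rewrite le_eqVlt => /orP[/eqP <- r0|b0 r0].
  by rewrite powR0 ?gt_eqF// mulr0.
set y := a `^ al * b `^ be; have y0 : 0 < y by rewrite mulr_gt0 ?powR_gt0.
have lnle (t : R) : 0 < t -> 1 + ln t <= t.
  by move=> t0; have := expR_ge1Dx (ln t); rewrite lnK ?posrE.
have ly : ln y = al * ln a + be * ln b by rewrite lnM ?posrE ?powR_gt0// !ln_powR.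
have h1 := lnle (a / y) (divr_gt0 a0 y0); have h2 := lnle (b / y) (divr_gt0 b0 y0).
have h3 : 1 + ln y^-1 <= y^-1 by apply: lnle; rewrite invr_gt0.
rewrite !lnM ?posrE ?invr_gt0// in h1 h2; rewrite !lnV ?posrE// in h1 h2 h3.
have g1 := ler_wpM2l (ltW al0) h1; have g2 := ler_wpM2l (ltW be0) h2.
have s0 : 0 <= 1 - al - be by lra.
have g3 := ler_wpM2l s0 h3.
have : 1 <= (al * a + be * b + (1 - al - be)) / y.
  have -> : (al * a + be * b + (1 - al - be)) / y = al * (a / y) + be * (b / y) + (1 - al - be) * y^-1 by ring.
  apply: (le_trans _ (lerD (lerD g1 g2) g3)).
  by rewrite ly le_eqVlt; apply/orP; left; apply/eqP; ring.
by rewrite ler_pdivlMr// mul1r.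
Qed.

Lemma derive_squeeze (E : R -> R) (K t0 : R) : 0 < t0 ->
  (forall tau, `|tau| <= t0 -> `|E tau - E 0| <= K * tau ^+ 2) -> is_derive (0 : R) 1 E 0.
Proof.
move=> t00 hE; have K0 : 0 <= `|K| by [].
have cv : h^-1 *: (E (h + 0) - E 0) @[h --> 0^'] --> (0 : R).
  apply/cvgrPdist_lt => e e0; near=> h.
  have h0 : h != 0 by near: h; exact: nbhs_dnbhs_neq.
  have ht : `|h| < t0 by near: h; apply: dnbhs0_lt.
  have he : `|h| < e / (1 + `|K|) by near: h; apply: dnbhs0_lt; rewrite divr_gt0// ltr_wpDr.
  rewrite sub0r normrN addr0 /GRing.scale/= normrM normfV ltr_pdivrMl ?normr_gt0//.
  apply: (le_lt_trans (hE h (ltW ht))); rewrite -[h ^+ 2]real_normK ?num_real// expr2 mulrA.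
  rewrite mulrC ltr_pM2l ?normr_gt0//; move: he; rewrite ltr_pdivlMr ?ltr_wpDr// => he.
  apply: le_lt_trans he; rewrite mulrC ler_wpM2l// (le_trans (ler_norm K))// lerDr//.
have cv' : h^-1 *: (E (h *: (1 : R) + 0) - E 0) @[h --> 0^'] --> (0 : R).
  rewrite (_ : (fun h => _) = (fun h : R => h^-1 *: (E (h + 0) - E 0)))//.
  by apply/funext => h; rewrite /GRing.scale/= mulr1.
split; first by apply/cvg_ex; exists 0.
exact/cvg_lim.
Unshelve. all: by end_near. Qed.

End EnergyOfPerturbations.

(** * Minimizers among curves of arbitrary length and their perturbations *)

Section Minimizers.
Context {R : realType}.
Notation mu := (@lebesgue_measure R).
Implicit Types (f Phi : curve R) (p L c : R).

(** If the direct formula does not apply, the energy is that of [arclength_param L f], which is [f]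
    itself by uniqueness. *)
Lemma menger_energy_by_arclength p L f : 0 < L -> simple_closed_curve L f -> by_arclength f ->
  menger_energy p L f = menger_integral p L f.
Proof.
move=> L0 scc arc; have [cf pf _] := scc.
have lE : closed_length L f = L%:E by rewrite /closed_length (arc 0 L (ltW L0)) subr0.
have lf : (closed_length L f < +oo)%E by rewrite lE ltry.
have l1 : 0 < fine (closed_length L f) by rewrite lE.
have [h|nh] := pselect (energy_branch L f); first exact: menger_energy_branch.
rewrite (menger_energy_arclength p nh).
have -> : arclength_param L f = f.
  apply: (arclength_param_unique L0 cf lf pf l1); split; first by move=> x; rewrite lE /= pf.
  by move=> t; rewrite in_itv/= => /andP[t0 _]; rewrite (arc 0 t t0) /= subr0.
by rewrite lE.
Qed.

Lemma knot_class_scale L (k : set (curve R)) c f : 0 < c -> knot_class L k -> k f -> k (fun x => c *: f x).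
Proof.
move=> c0 [f0 _ ->] /= [scc iso]; split; first exact: simple_closed_curve_scale (lt0r_neq0 c0) scc.
exact: ambient_isotopic_scale.
Qed.

Lemma CLk_normalize L (k : set (curve R)) f : 0 < L -> knot_class L k -> k f -> (closed_length L f < +oo)%E ->
  let l := fine (closed_length L f) in [/\ 0 < l, closed_length L f = l%:E & CLk L k (fun x => (L / l) *: f x)].
Proof.
move=> L0 hk kf lf l; have [f0 _ kE] := hk.
have [scc _] : simple_closed_curve L f /\ ambient_isotopic f0 f by move: kf; rewrite kE.
have l0 := closed_length_gt0 L0 scc.
have lE : closed_length L f = l%:E by rewrite /l fineK// ge0_fin_numE// ltW.
have lp : 0 < l by rewrite -lte_fin -lE.
have c0 : 0 < L / l by rewrite divr_gt0.
have [cf pf _] := simple_closed_curve_scale (lt0r_neq0 c0) scc.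
split; [exact: lp|exact: lE|split; [exact: cf|exact: pf| |exact: (knot_class_scale c0 hk kf)]].
by rewrite /closed_length curve_lengthZ// -/(closed_length L f) lE -EFinM divfK ?gt_eqF.
Qed.

(** A competitor of length [l] is scaled by [L / l] into [CLk L k]; the factor
    [(L / l) ^ ((3 - p) / p)] that this puts on the root of its energy is exactly offset by the
    length factors. *)
Lemma scaled_energy_minimizer p L (k : set (curve R)) f : 3 < p -> 0 < L -> knot_class L k ->
  closed_length L f = L%:E ->
  (forall g, CLk L k g -> (menger_energy p L f <= menger_energy p L g)%E) ->
  forall g, Ck L k g -> (scaled_energy p L f <= scaled_energy p L g)%E.
Proof.
move=> p3 L0 hk lE hmin g [cg pg lg kg].
have p0 : 0 < p by rewrite (lt_trans _ p3).
have [l0 lgE Cg] := CLk_normalize L0 hk kg lg.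
set l := fine _ in l0 lgE Cg; have c0 : 0 < L / l by rewrite divr_gt0.
have [f0 _ kE] := hk.
have [scc _] : simple_closed_curve L g /\ ambient_isotopic f0 g by move: kg; rewrite kE.
have := hmin _ Cg; rewrite (menger_energy_scale p c0 L0 scc lg) => h.
have E0 h' : (0 <= menger_energy p L h')%E by rewrite /menger_energy; case: ifP => _; exact: menger_integral_ge0.
rewrite /scaled_energy lE lgE !poweR_EFin.
apply: (@le_trans _ _ (poweR (((L / l) `^ (3 - p))%:E * menger_energy p L g) p^-1 * (L `^ ((p - 3) / p))%:E)%E).
  apply: lee_wpmul2r; first by rewrite lee_fin powR_ge0.
  apply: gt0_ler_poweR => //; rewrite ?in_itv/= ?leey ?E0 ?mule_ge0 ?lee_fin ?powR_ge0 ?invr_ge0 ?(ltW p0)//.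
rewrite poweRM ?lee_fin ?powR_ge0// poweR_EFin muleAC muleC -EFinM.
rewrite (_ : (L / l) `^ (3 - p) `^ p^-1 * L `^ ((p - 3) / p) = l `^ ((p - 3) / p))//.
rewrite -powRrM (_ : (3 - p) / p = - ((p - 3) / p)); last by rewrite -mulNr opprB.
have -> : L / l = (l / L)^-1 by rewrite invf_div.
rewrite -powR_inv1 ?divr_ge0 ?(ltW L0) ?(ltW l0)// -powRrM mulN1r opprK.
by rewrite -powRM ?divr_ge0 ?(ltW L0) ?(ltW l0)// divfK// gt_eqF.
Qed.

(** The smooth representative, rescaled to length [L], is an admissible competitor for the
    minimum. *)
Lemma smooth_class_finite p L (k : set (curve R)) f : 3 < p -> 0 < L -> knot_class L k -> k f ->
  smooth_embedding L f -> exists2 g, CLk L k g & (menger_energy p L g < +oo)%E.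
Proof.
move=> p3 L0 hk kf sm; have p1 : 1 < p by rewrite (lt_trans _ p3)// ltr1n.
have [ref slf] := smooth_embedding_regular p1 L0 sm.
have [scc df cf' _] := ref; have [_ pf _] := scc.
have [M M0 hM] := periodic_bounded L0 cf' (derive1_periodic pf).
have lf : (closed_length L f < +oo)%E.
  have lip := C1_lipschitz df hM.
  apply: (@le_lt_trans _ _ (M * L - M * 0)%:E); last exact: ltry.
  apply: (@curve_length_le R 0 L f (fun x => M * x)) => u v _ uv _.
  by rewrite -mulrBr (le_trans (lip v u))// ger0_norm ?subr_ge0.
have [l0 lE Cf] := CLk_normalize L0 hk kf lf.
set l := fine _ in l0 lE Cf; have c0 : 0 < L / l by rewrite divr_gt0.
exists (fun x => (L / l) *: f x) => //.
rewrite (menger_energy_scale p c0 L0 scc lf) (regular_embedding_energy p L0 ref).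
(* Finiteness is read off the estimate for [f] perturbed by itself, at [tau = 0]. *)
have [C C0 [t0 t00 h]] := menger_integral_second_diff p3 L0 ref slf slf.
have [|hC _] := h 0; first by rewrite lexx ltW.
have fin : menger_integral p L f \is a fin_num.
  by rewrite ge0_fin_numE ?(le_lt_trans hC) ?ltry//; exact: menger_integral_ge0.
by rewrite -(fineK fin) -EFinM ltry.
Qed.

(** As a function of the point on the curve, [Phi] has Lipschitz constant [M / m]. For small [tau]
    the extended field [tau *: v] has Lipschitz constant at most 1/2, so the shear contracts
    distances by at most one half. *)
Lemma perturb_isotopic L f Phi : 0 < L -> regular_embedding L f -> periodic Phi L ->
  (forall x, derivable Phi x (1 : R)) -> continuous (derive1 Phi) ->
  exists2 t0, 0 < t0 & forall tau f0, `|tau| <= t0 -> ambient_isotopic f0 f ->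
    ambient_isotopic f0 (perturb f Phi tau).
Proof.
move=> L0 ref pP dP cP'; have [m [M [m0 mM [bil _ lP _ _]]]] := controlled_exists L0 ref pP dP cP'.
have [[_ pf _] _ _ _] := ref.
have M0 : 0 < M := lt_le_trans m0 mM.
have [B B0 hB] := periodic_bounded L0 (derivable_continuous dP) pP.
pose Lam := M / m; have Lam0 : 0 < Lam by rewrite divr_gt0.
have lam s t : enorm (Phi s - Phi t) <= Lam * enorm (f s - f t).
  (* The lower chord bound is available up to distance [2 * L / 3], so [t] is moved by periods to
     within [L / 2] of [s]. *)
  have [n /andP[n0 nL]] := floor_reduce (t - s + L / 2) L0.
  rewrite -(periodic_intP n t pf) -(periodic_intP n t pP); set t' := t + _.
  have st : `|s - t'| <= 2 * L / 3.
    rewrite distrC ler_norml; move: n0 nL; rewrite /t' => n0 nL; move: (n%:~R * L) n0 nL => w n0 nL.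
    by apply/andP; split; lra.
  rewrite (le_trans (lP s t'))// /Lam mulrAC ler_pdivlMr// -mulrA ler_wpM2l ?(ltW M0)// mulrC.
  exact: bil.
have [v vf lv] := lipschitz_extension (ltW Lam0) hB lam.
have L30 : 0 < 3 * Lam by rewrite mulr_gt0.
exists (2^-1 / (3 * Lam)); first by rewrite divr_gt0.
move=> tau f0; rewrite ler_pdivlMr// => tL iso.
have -> : perturb f Phi tau = (fun x => f x + tau *: v (f x)).
  by apply/funext => x; rewrite /perturb vf.
have lv' y z : enorm (tau *: v y - tau *: v z) <= `|tau| * (3 * Lam) * enorm (y - z).
  by rewrite -scalerBr enormZ -mulrA ler_wpM2l.
apply: (@ambient_isotopic_shear R (fun y => tau *: v y) (`|tau| * (3 * Lam)) 2^-1 f0 f _ lv' _ iso) => //.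
move=> t y z /andP[t0 t1].
have h := lerB_enorm (y - z) (- (t *: (tau *: v y - tau *: v z))).
rewrite enormN opprK enormZ (ger0_norm t0) in h.
have h1 : t * enorm (tau *: v y - tau *: v z) <= 2^-1 * enorm (y - z).
  rewrite -[leRHS]mul1r; apply: ler_pM => //; first exact: enorm_ge0.
  by rewrite (le_trans (lv' y z))// ler_wpM2r ?enorm_ge0.
by apply: le_trans h; move: h1; move: (enorm (y - z)) (t * enorm _) => a b; lra.
Qed.

Lemma perturb_Ck L (k : set (curve R)) f Phi : 0 < L -> knot_class L k -> k f -> regular_embedding L f ->
  periodic Phi L -> (forall x, derivable Phi x (1 : R)) -> continuous (derive1 Phi) ->
  exists2 t0, 0 < t0 & forall tau, `|tau| <= t0 ->
    regular_embedding L (perturb f Phi tau) /\ Ck L k (perturb f Phi tau).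
Proof.
move=> L0 [f0 _ kE] kf ref pP dP cP'.
have [scc iso] : simple_closed_curve L f /\ ambient_isotopic f0 f by move: kf; rewrite kE.
have [t1 t10 h1] := perturb_regular_embedding L0 ref pP dP cP'.
have [t2 t20 h2] := perturb_isotopic L0 ref pP dP cP'.
exists (Num.min t1 t2); first by rewrite lt_min t10.
move=> tau; rewrite le_min => /andP[tt1 tt2]; have r := h1 tau tt1; split; first exact: r.
have [[cp pp inj] dp cp' _] := r.
have [M M0 hM] := periodic_bounded L0 cp' (derive1_periodic pp).
have lip := C1_lipschitz dp hM.
split; [exact: cp|exact: pp| |by rewrite kE; split; [split|exact: h2]].
apply: (@le_lt_trans _ _ (M * L - M * 0)%:E); last exact: ltry.
apply: (@curve_length_le R 0 L _ (fun x => M * x)) => u v _ uv _.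
by rewrite -mulrBr (le_trans (lip v u))// ger0_norm ?subr_ge0.
Qed.

End Minimizers.

Lemma positive_min (R : realType) (a b : R) : 0 < a -> 0 < b ->
  exists t : R, [/\ 0 < t, t <= a & t <= b].
Proof.
by move=> a0 b0; exists (Num.min a b); rewrite lt_min a0 b0 !ge_min !lexx orbT.
Qed.

(** The product is at most its value at 0 times a weighted mean of [MM tau / MM 0], [len tau / L]
    and 1. Adding the bounds for [tau] and [- tau] removes the linear term of the length, and
    minimality at [- tau] leaves an upper bound at [tau] alone. *)
Lemma scaled_product_flat (R : realType) (MM len : R -> \bar R) (p L C B hh t0 : R) :
  3 < p -> 0 < L -> 0 < t0 -> 0 <= B ->
  (forall tau, 0%:E <= MM tau)%E -> (0%:E < MM 0%R)%E -> (MM 0%R <= C%:E)%E ->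
  (forall tau, 0 <= tau <= t0 -> (MM tau + MM (- tau)%R <= 2%:E * MM 0%R + (C * tau ^+ 2)%:E)%E) ->
  (forall tau, 0%:E <= len tau)%E -> len 0 = L%:E ->
  (forall tau, len tau <= (L + tau * hh + tau ^+ 2 * B)%:E)%E ->
  (forall tau, `|tau| <= t0 -> (MM 0%R `^ p^-1 * len 0%R `^ ((p - 3) / p) <=
     MM tau `^ p^-1 * len tau `^ ((p - 3) / p))%E) ->
  exists K : R, exists2 e : R -> R,
    forall tau, `|tau| <= t0 -> (MM tau `^ p^-1 * len tau `^ ((p - 3) / p))%E = (e tau)%:E &
    forall tau, `|tau| <= t0 -> `|e tau - e 0| <= K * tau ^+ 2.
Proof.
move=> p3 L0 t00 B0 MM0 M0p hC h2 len_ge0 len0 hB hmin.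
have p0 : 0 < p by rewrite (lt_trans _ p3).
have fin0 : MM 0 \is a fin_num.
  rewrite fin_numElt; apply/andP; split; first exact: (lt_le_trans (ltNyr 0) (MM0 0)).
  exact: (le_lt_trans hC (ltry C)).
have sum tau : `|tau| <= t0 -> (MM tau + MM (- tau)%R <= 2%:E * MM 0%R + (C * tau ^+ 2)%:E)%E.
  move=> ht; have [tp|tn] := leP 0 tau.
    by apply: (h2 tau); rewrite tp; exact: (le_trans (ler_norm tau) ht).
  rewrite addeC -sqrrN -{2}(opprK tau); apply: (h2 (- tau)).
  by rewrite oppr_ge0 (ltW tn) -normrN in ht *; exact: (le_trans (ler_norm _) ht).
have fin tau : `|tau| <= t0 -> MM tau \is a fin_num.
  move=> ht; rewrite fin_numElt; apply/andP; split; first exact: (lt_le_trans (ltNyr 0) (MM0 tau)).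
  apply: (@le_lt_trans _ _ (MM tau + MM (- tau)%R)%E); first exact: (leeDl (MM tau) (MM0 (- tau))).
  by apply: (le_lt_trans (sum tau ht)); rewrite -(fineK fin0) -EFinM -EFinD; exact: ltry.
pose mm tau := fine (MM tau).
have mE tau : `|tau| <= t0 -> MM tau = (mm tau)%:E by move=> ht; rewrite /mm fineK; [|exact: (fin tau ht)].
have z0 : `|0 : R| <= t0 by rewrite normr0 ltW.
have m00 : 0 < mm 0 by rewrite -lte_fin -(mE 0 z0).
have mm_ge0 tau : 0 <= mm tau by exact: fine_ge0.
have msum tau : `|tau| <= t0 -> mm tau + mm (- tau) <= 2 * mm 0 + C * tau ^+ 2.
  move=> ht; have ht' : `|- tau| <= t0 by rewrite normrN.
  have := sum tau ht; rewrite (mE tau ht) (mE (- tau) ht') (mE 0 z0).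
  by rewrite -EFinM -!EFinD lee_fin.
pose ll tau := fine (len tau).
have lE tau : len tau = (ll tau)%:E.
  rewrite /ll fineK; first by [].
  rewrite fin_numElt; apply/andP; split; first exact: (lt_le_trans (ltNyr 0) (len_ge0 tau)).
  exact: (le_lt_trans (hB tau) (ltry _)).
have ll_le tau : ll tau <= L + tau * hh + tau ^+ 2 * B by rewrite -lee_fin -lE.
have ll_ge0 tau : 0 <= ll tau by exact: fine_ge0.
have llz : ll 0 = L by rewrite /ll len0.
pose al := p^-1; pose be := (p - 3) / p.
have al0 : 0 < al by rewrite invr_gt0.
have be0 : 0 < be by rewrite divr_gt0// subr_gt0.
have abE : 1 - al - be = 2 / p by rewrite /al /be; field; rewrite gt_eqF.
have ab1 : al + be <= 1.
  have : 0 <= 1 - al - be by rewrite abE divr_ge0// ltW.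
  lra.
pose e tau := mm tau `^ al * ll tau `^ be.
have eE tau : `|tau| <= t0 -> (MM tau `^ p^-1 * len tau `^ ((p - 3) / p))%E = (e tau)%:E.
  by move=> ht; rewrite (mE tau ht) lE !poweR_EFin -EFinM.
have e_min tau : `|tau| <= t0 -> e 0 <= e tau.
  by move=> ht; rewrite -lee_fin -(eE tau ht) -(eE 0 z0); exact: hmin.
have e0_ge0 : 0 <= e 0 by rewrite mulr_ge0 ?powR_ge0.
(* The ratio [mm tau / mm 0] is where positivity of the energy at 0 is used. *)
have e_amgm tau : e tau <= e 0 * (al * (mm tau / mm 0) + be * (ll tau / L) + (1 - al - be)).
  have a0 : 0 <= mm tau / mm 0 by rewrite divr_ge0.
  have b0 : 0 <= ll tau / L by rewrite divr_ge0// ltW.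
  have -> : e tau = e 0 * ((mm tau / mm 0) `^ al * (ll tau / L) `^ be).
    rewrite /e llz mulrACA -!powRM ?(ltW L0)//.
    by rewrite [mm 0 * _]mulrC [L * _]mulrC !divfK ?gt_eqF.
  by rewrite ler_wpM2l// weighted_amgm.
pose K := e 0 * (al * (C / mm 0) + be * (2 * B / L)).
have main tau : `|tau| <= t0 -> `|e tau - e 0| <= K * tau ^+ 2.
  move=> ht; have ht' : `|- tau| <= t0 by rewrite normrN.
  rewrite ger0_norm ?subr_ge0 ?e_min//.
  have h3 := e_min _ ht'; have h4 := lerD (e_amgm tau) (e_amgm (- tau)).
  have h5 : al * ((mm tau + mm (- tau)) / mm 0) <= al * (2 + C / mm 0 * tau ^+ 2).
    rewrite ler_wpM2l ?(ltW al0)// ler_pdivrMr//.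
    have -> : (2 + C / mm 0 * tau ^+ 2) * mm 0 = 2 * mm 0 + C * tau ^+ 2 by field; rewrite gt_eqF.
    exact: msum.
  have h6 : be * ((ll tau + ll (- tau)) / L) <= be * (2 + 2 * B / L * tau ^+ 2).
    rewrite ler_wpM2l ?(ltW be0)// ler_pdivrMr//.
    have -> : (2 + 2 * B / L * tau ^+ 2) * L = 2 * L + 2 * B * tau ^+ 2 by field; rewrite gt_eqF.
    have := lerD (ll_le tau) (ll_le (- tau)); rewrite sqrrN.
    by move: (tau ^+ 2) => q; rewrite mulNr; lra.
  have h7 : e tau + e (- tau) <= e 0 * (2 + (al * (C / mm 0) + be * (2 * B / L)) * tau ^+ 2).
    apply: (le_trans h4); rewrite -mulrDr ler_wpM2l//.
    have -> : al * (mm tau / mm 0) + be * (ll tau / L) + (1 - al - be) +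
        (al * (mm (- tau) / mm 0) + be * (ll (- tau) / L) + (1 - al - be)) =
        al * ((mm tau + mm (- tau)) / mm 0) + be * ((ll tau + ll (- tau)) / L) + 2 * (1 - al - be) by ring.
    have -> : 2 + (al * (C / mm 0) + be * (2 * B / L)) * tau ^+ 2 =
        al * (2 + C / mm 0 * tau ^+ 2) + be * (2 + 2 * B / L * tau ^+ 2) + 2 * (1 - al - be) by ring.
    by rewrite lerD2r lerD.
  have : e 0 * (2 + (al * (C / mm 0) + be * (2 * B / L)) * tau ^+ 2) = 2 * e 0 + K * tau ^+ 2.
    by rewrite /K; ring.
  by move: h3 h7; move: (K * tau ^+ 2) => q h3 h7 h8; rewrite h8 in h7; lra.
by exists K, e.
Qed.

(** * Vanishing of the first variation *)

Section Stationarity.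
Context {R : realType}.
Notation mu := (@lebesgue_measure R).
Implicit Types (f Phi : curve R) (p L : R).

Lemma minimizer_first_variation p L f Phi : 3 < p -> 0 < L -> by_arclength f -> regular_embedding L f ->
  (forall x, enorm (derive1 f x) = 1) -> C1_slobodeckij p L f -> C1_slobodeckij p L Phi ->
  (exists2 t0 : R, 0 < t0 & forall tau : R, `|tau| <= t0 -> regular_embedding L (perturb f Phi tau) /\
     (scaled_energy p L f <= scaled_energy p L (perturb f Phi tau))%E) ->
  first_variation p L f Phi 0.
Proof.
move=> p3 L0 arc ref f1 slf slP [t1 t10 ht1].
have [C C0 [t2 t20 h2]] := menger_integral_second_diff p3 L0 ref slf slP.
have [_ df cf' _] := slf; have [pP dP cP' _] := slP.
have [hh [B [B0 hB]]] := perturb_length L0 df cf' f1 pP dP cP'.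
have M0p := menger_integral_gt0 p3 L0 arc ref.
have [t0 [t00 t0t1 t0t2]] := positive_min t10 t20.
have len_ge0 tau : (0%:E <= closed_length L (perturb f Phi tau))%E by apply: curve_length_ge0; exact: ltW.
have EE tau : `|tau| <= t0 -> scaled_energy p L (perturb f Phi tau) =
    (menger_integral p L (perturb f Phi tau) `^ p^-1 * closed_length L (perturb f Phi tau) `^ ((p - 3) / p))%E.
  move=> ht; have [r _] := ht1 tau (le_trans ht t0t1).
  by rewrite /scaled_energy (regular_embedding_energy p L0 r).
have z0 : `|0 : R| <= t0 by rewrite normr0 ltW.
have z2 : 0 <= (0 : R) <= t2 by rewrite lexx; exact: ltW.
have hC : (menger_integral p L (perturb f Phi 0%R) <= C%:E)%E.
  by rewrite perturb0; have [h _] := h2 0 z2; exact: h.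
have hS tau : 0 <= tau <= t0 -> (menger_integral p L (perturb f Phi tau) + menger_integral p L (perturb f Phi (- tau)%R)
    <= 2%:E * menger_integral p L (perturb f Phi 0%R) + (C * tau ^+ 2)%:E)%E.
  move=> /andP[h h']; have h'' : 0 <= tau <= t2 by rewrite h; exact: (le_trans h' t0t2).
  by rewrite perturb0; have [_ h3] := h2 tau h''; exact: h3.
have l0 : closed_length L (perturb f Phi 0) = L%:E.
  by rewrite perturb0 /closed_length (arc 0 L (ltW L0)) subr0.
have M0p' : (0%:E < menger_integral p L (perturb f Phi 0%R))%E by rewrite perturb0; exact: M0p.
have hm tau : `|tau| <= t0 -> (menger_integral p L (perturb f Phi 0%R) `^ p^-1 *
     closed_length L (perturb f Phi 0%R) `^ ((p - 3) / p) <= menger_integral p L (perturb f Phi tau) `^ p^-1 *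
     closed_length L (perturb f Phi tau) `^ ((p - 3) / p))%E.
  move=> ht; have [_ h] := ht1 tau (le_trans ht t0t1).
  by move: h; rewrite -{1}(perturb0 f Phi) (EE 0 z0) (EE tau ht).
have M_ge0 tau : (0%:E <= menger_integral p L (perturb f Phi tau))%E by exact: menger_integral_ge0.
have [K [e eE0 main]] := scaled_product_flat p3 L0 t00 B0 M_ge0 M0p' hC hS len_ge0 l0 hB hm.
have eE tau : `|tau| <= t0 -> scaled_energy p L (perturb f Phi tau) = (e tau)%:E.
  by move=> ht; rewrite (EE tau ht); exact: eE0.
split.
  apply/nbhs_ballP; exists t0 => //= tau; rewrite -ball_normE/= sub0r normrN => ht.
  by have -> : (fun x => f x + tau *: Phi x) = perturb f Phi tau by []; rewrite (eE tau (ltW ht)).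
apply: (@derive_squeeze R (fun tau => fine (scaled_energy p L (perturb f Phi tau))) K t0 t00) => tau ht.
by rewrite (eE tau ht) (eE 0 z0); exact: main.
Qed.

End Stationarity.

Theorem mainTheorem6 (R : realType) (p L : R) (k : set (curve R))
    (Gamma : curve R)
    (hp : 3 < p) (hL : 0 < L)
    (hk : knot_class L k)
    (hsmooth : exists2 f : curve R, k f & smooth_embedding L f)
    (hGamma : CLk L k Gamma)
    (harc : by_arclength Gamma)
    (hmin : menger_energy p L Gamma =
            ereal_inf [set menger_energy p L f | f in CLk L k]) :
  [/\ sobolev_slobodeckij p L Gamma,
      minimizer (scaled_energy p L) (Ck L k) Gamma &
      stationary p L Gamma].
Proof.
have p1 : 1 < p by rewrite (lt_trans _ hp)// ltr1n.
have [cG pG lG kG] := hGamma.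
have [f0 _ kE] := hk.
have [scc _] : simple_closed_curve L Gamma /\ ambient_isotopic f0 Gamma by move: kG; rewrite kE.
have [_ _ inj] := scc.
have min g : CLk L k g -> (menger_energy p L Gamma <= menger_energy p L g)%E.
  by move=> Cg; rewrite hmin; apply: ereal_inf_lbound; exists g.
(* Without a competitor of finite energy, [hmin] could hold with both sides infinite and would give
   no regularity. *)
have [f kf sm] := hsmooth.
have [g Cg gfin] := smooth_class_finite hp hL hk kf sm.
have fin : (menger_integral p L Gamma < +oo)%E.
  rewrite -(menger_energy_by_arclength p hL scc harc).
  exact: (le_lt_trans (min g Cg) gfin).
have [dG cG' G1 slG] := finite_energy_regularity hp hL cG pG inj harc fin.
have ref : regular_embedding L Gamma.
  by split => // x; rewrite -enorm_gt0 G1.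
have slobG : C1_slobodeckij p L Gamma := And4 pG dG cG' slG.
have Emin := scaled_energy_minimizer hp hL hk lG min.
split.
- exact: (C1_sobolev p1 hL pG dG cG' slG).
- by split; [split; rewrite ?lG ?ltry|exact: Emin].
- move=> Phi cPhi sPhi; have slP := sobolev_slobodeckij_C1 hp hL cPhi sPhi.
  apply: (minimizer_first_variation hp hL harc ref G1 slobG slP).
  have [pP dP cP' _] := slP.
  have [t0 t00 h] := perturb_Ck hL hk kG ref pP dP cP'.
  exists t0; first exact: t00.
  by move=> tau ht; have [r c] := h tau ht; split; [exact: r|exact: (Emin _ c)].
Qed.
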